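(* Let $L$ be a homogeneous Lévy basis on $\mathbb{R}^2$ with seed $L'$, and let $X$ be the trawl process with trawl function $a$. Let $\Delta_n\downarrow0$ with $n\Delta_n\to+\infty$ as $n\uparrow\infty$. Suppose that there is $p_0>2$ such that $\mathbb{E}(|L'|^{p_0})<\infty$ and $a(s)=\mathrm{O}(s^{-p_0})$ as $s\uparrow+\infty$. Put $$\mathcal G^X=\sigma\Big(\bigcup_{k\ge1}\bigcap_{N\ge k}\sigma(X_0,X_{\Delta_N},\ldots,X_{k\Delta_N})\Big).$$ Then, as $n\uparrow\infty$, $$\sqrt{\frac{\Delta_n}{n}}\,\mathbf S^n\ \overset{\mathcal G^X\text{-}\mathcal D[0,1]}{\Longrightarrow}\ \sigma_aB,$$ where $\sigma_a^2=\int_{\mathbb R}\Gamma_X(s)\,\mathrm{d}s$, with $\Gamma_X(h)=\mathrm{Var}(L')\int_{|h|}^\infty a(u)\,\mathrm{d}u$ the autocovariance function of $X$, and $B$ is a Brownian motion independent of $\mathcal G^X$.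
   Context: $(\Omega,\mathcal F,\mathbb P)$ is a complete probability space; $[\cdot]$ denotes the integer part; $\mathbb{R}^+=[0,\infty)$. Lévy basis. A homogeneous Lévy basis on $\mathbb{R}^2$ with characteristic triplet $(\gamma,b,\nu)$ ($\gamma\in\mathbb R$, $b\ge0$, $\nu$ a Lévy measure on $\mathbb R$) is a family $L=\{L(A)\}$ of real random variables, indexed by Borel sets $A\subset\mathbb{R}^2$ of finite Lebesgue measure, that is a.s. $\sigma$-additive, takes independent values on disjoint sets, and satisfies $\log\mathbb{E}e^{izL(A)}=\mathrm{Leb}(A)\psi(z)$ with $\psi(z)=i\gamma z-\frac12b^2z^2+\int_{\mathbb{R}\setminus\{0\}}(e^{izx}-1-izx\mathbf 1_{|x|\le1})\nu(\mathrm{d}x)$. The seed $L'$ is a random variable with $\log\mathbb{E}e^{izL'}=\psi(z)$. Trawl process. The trawl function $a:\mathbb{R}^+\to\mathbb{R}^+$ is non-increasing, integrable and continuous on $[0,\infty)$; $A=\{(r,y):r\le0,\ 0\le y\le a(-r)\}$, $A_t=A+(t,0)$, and $X_t=L(A_t)$, $t\in\mathbb R$. Write $\mathbf S^n=(\mathbf S^n_t)_{t\ge0}$ with $\mathbf S^n_t=\sum_{k=0}^{[nt]-1}\big(X_{k\Delta_n}-\mathbb{E}(X_{k\Delta_n})\big)$. Stable convergence. For a sub-$\sigma$-field $\mathcal G\subseteq\mathcal F$, $\xi_n\to\xi$ $\mathcal G$-stably in distribution ($\xi$ possibly defined on an extension of the probability space) means that for every $E\in\mathcal G$ with $\mathbb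 P(E)>0$, $\xi_n$ under $\mathbb P(\cdot|E)$ converges in distribution to $\xi$ under $\mathbb P(\cdot|E)$. $X^n\overset{\mathcal G\text{-}\mathcal D[0,T]}{\Longrightarrow}X$ means that $X^n$ converges in law to $X$ in the Skorokhod space $\mathcal D[0,T]$ and that all finite-dimensional distributions converge $\mathcal G$-stably. *)

(* Defs.v *)
From HB Require Import structures.
From mathcomp Require Export all_boot all_order all_algebra.
From mathcomp Require Export complex.
From mathcomp Require Export all_classical all_reals all_analysis.
Set Implicit Arguments.
Unset Strict Implicit.
Unset Printing Implicit Defensive.
Import Order.TTheory GRing.Theory Num.Theory.
Import numFieldTopology.Exports numFieldNormedType.Exports.
Local Open Scope complex_scope.
Local Open Scope classical_set_scope.
Local Open Scope ring_scope.

Definition cexp (R : realType) (u : R[i]) : R[i] :=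
  (expR (complex.Re u) * cos (complex.Im u)) +i*
  (expR (complex.Re u) * sin (complex.Im u)).

Definition cintegral d (T : measurableType d) (R : realType)
    (mu : {measure set T -> \bar R}) (D : set T) (f : T -> R[i]) : R[i] :=
  (\int[mu]_(x in D) complex.Re (f x)) +i* (\int[mu]_(x in D) complex.Im (f x)).

Definition charfun d (T : measurableType d) (R : realType)
    (P : probability T R) (X : T -> R) (z : R) : R[i] :=
  cintegral P setT (fun w => cexp (0 +i* (z * X w))).

(* Taking some of the [B i] equal to [setT] gives the product rule for every
   subfamily. *)
Definition mutually_independent d (T : measurableType d) (R : realType)
    (P : probability T R) (n : nat) (X : 'I_n -> T -> R) : Prop :=
  forall B : 'I_n -> set R, (forall i, measurable (B i)) ->
    (P (\bigcap_(i in [set: 'I_n]) (X i @^-1` B i)) =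
     \prod_(i < n) P (X i @^-1` B i))%E.

Definition sigma_of d (T : measurableType d) (R : realType) (I : Type)
    (D : set I) (Z : I -> T -> R) : set (set T) :=
  <<s \bigcup_(i in D) preimage_set_system [set: T] (Z i) measurable >>.

Definition levy_measure (R : realType) (nu : {measure set R -> \bar R}) : Prop :=
  nu [set 0] = 0%E /\ (\int[nu]_x (Num.min 1 (x ^+ 2))%:E < +oo)%E.

Definition levy_exponent (R : realType) (gamma b : R)
    (nu : {measure set R -> \bar R}) (z : R) : R[i] :=
  (0 +i* (gamma * z)) - ((b ^+ 2 * z ^+ 2 / 2) +i* 0)
  + cintegral nu (~` [set 0]) (fun x =>
      cexp (0 +i* (z * x)) - 1 - (0 +i* (z * x * \1_[set y | `|y| <= 1] x))).

Definition leb2 (R : realType) : set (R * R) -> \bar R :=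
  (@lebesgue_measure R \x @lebesgue_measure R)%E.

Definition finite_borel (R : realType) (A : set (R * R)) : Prop :=
  measurable A /\ (leb2 A < +oo)%E.

(* [L A] is only meaningful for [finite_borel A]. The logarithm of the
   characteristic function is written in exponentiated form. *)
Record levy_basis d (T : measurableType d) (R : realType) (P : probability T R)
    (L : set (R * R) -> T -> R) (gamma b : R)
    (nu : {measure set R -> \bar R}) : Prop := LevyBasis {
  levy_basis_b_ge0 : 0 <= b ;
  levy_basis_nu : levy_measure nu ;
  levy_basis_measurable : forall A, finite_borel A ->
    measurable_fun [set: T] (L A) ;
  levy_basis_sigma_additive : forall A : nat -> set (R * R),
    (forall i, measurable (A i)) -> trivIset [set: nat] A ->
    (leb2 (\bigcup_i A i) < +oo)%E ->
    {ae P, forall w, series (fun i => L (A i) w) n @[n --> \oo]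
                       --> L (\bigcup_i A i) w} ;
  levy_basis_independent : forall (n : nat) (A : 'I_n -> set (R * R)),
    (forall i, finite_borel (A i)) -> trivIset [set: 'I_n] A ->
    mutually_independent P (fun i => L (A i)) ;
  levy_basis_charfun : forall A, finite_borel A -> forall z,
    charfun P (L A) z =
    cexp ((fine (leb2 A))%:C%C * levy_exponent gamma b nu z) }.

Definition levy_seed d (T : measurableType d) (R : realType)
    (P : probability T R) (L' : {RV P >-> R}) (gamma b : R)
    (nu : {measure set R -> \bar R}) : Prop :=
  forall z, charfun P L' z = cexp (levy_exponent gamma b nu z).

(* Only the values of [a] on [0, +oo[ matter. *)
Record trawl_function (R : realType) (a : R -> R) : Prop := TrawlFunction {
  trawl_ge0 : forall s, 0 <= s -> 0 <= a s ;
  trawl_nonincreasing : forall s t, 0 <= s -> s <= t -> a t <= a s ;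
  trawl_integrable :
    (@lebesgue_measure R).-integrable `[0, +oo[ (EFin \o a) ;
  trawl_continuous : {within `[0, +oo[, continuous a} }.

Definition trawl_set (R : realType) (a : R -> R) : set (R * R) :=
  [set p | p.1 <= 0 /\ 0 <= p.2 <= a (- p.1)].

Definition trawl_set_at (R : realType) (a : R -> R) (t : R) : set (R * R) :=
  [set (p.1 + t, p.2) | p in trawl_set a].

Definition trawl_process d (T : measurableType d) (R : realType)
    (L : set (R * R) -> T -> R) (a : R -> R) (t : R) : T -> R :=
  L (trawl_set_at a t).

Definition partial_sum d (T : measurableType d) (R : realType)
    (P : probability T R) (X : R -> T -> R) (Delta : nat -> R)
    (n : nat) (t : R) (w : T) : R :=
  \sum_(0 <= k < Num.truncn (n%:R * t))
    (X (k%:R * Delta n) w - fine 'E_P[X (k%:R * Delta n)%R]%E).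

Definition trawl_acov d (T : measurableType d) (R : realType)
    (P : probability T R) (L' : {RV P >-> R}) (a : R -> R) (h : R) : R :=
  fine ('V_P[L'])%E * \int[@lebesgue_measure R]_(u in `[`|h|, +oo[) a u.

Definition sigma_field_X d (T : measurableType d) (R : realType)
    (X : R -> T -> R) (Delta : nat -> R) : set (set T) :=
  <<s \bigcup_(k in [set k | (1 <= k)%N])
        \bigcap_(N in [set N | (k <= N)%N])
          sigma_of [set j | (j <= k)%N] (fun j : nat => X (j%:R * Delta N)) >>.

(* An event [E] and a random variable [xi] of the base space are lifted to the
   extension as [pi @^-1` E] and [xi \o pi]. *)
Definition prob_extension d (T : measurableType d) d' (T' : measurableType d')
    (R : realType) (P : probability T R) (P' : probability T' R)
    (pi : T' -> T) : Prop :=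
  measurable_fun [set: T'] pi /\
  forall A, measurable A -> P' (pi @^-1` A) = P A.

(* [normal_prob m s] is parametrized by the standard deviation [s]. *)
Record brownian_motion d (T : measurableType d) (R : realType)
    (P : probability T R) (B : R -> T -> R) : Prop := BrownianMotion {
  bm_measurable : forall t, 0 <= t -> measurable_fun [set: T] (B t) ;
  bm_start : {ae P, forall w, B 0 w = 0} ;
  bm_increments : forall (n : nat) (t : nat -> R), 0 <= t 0%N ->
    {homo t : i j / (i < j)%N >-> i < j} ->
    mutually_independent P (fun i : 'I_n => B (t i.+1) \- B (t i)) ;
  bm_normal : forall s t, 0 <= s -> s < t ->
    forall A : set R, measurable A ->
    P ((B t \- B s) @^-1` A) = normal_prob 0 (Num.sqrt (t - s)) A ;
  bm_continuous :
    {ae P, forall w, {within `[0, +oo[, continuous (fun t => B t w)}} }.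

(* B, indexed by the half-line, is independent of (the lift of) [G]. *)
Definition independent_of_field d (T : measurableType d)
    d' (T' : measurableType d') (R : realType) (P' : probability T' R)
    (pi : T' -> T) (G : set (set T)) (B : R -> T' -> R) : Prop :=
  forall C E, sigma_of [set t | 0 <= t] B C -> G E ->
    (P' (C `&` pi @^-1` E) = P' C * P' (pi @^-1` E))%E.

(* Elements of D[0,T] are represented by functions on R of which only the
   restriction to [0,T] matters. *)
Definition cadlag (R : realType) (T : R) (x : R -> R) : Prop :=
  (forall t, 0 <= t < T -> x s @[s --> t^'+] --> x t) /\
  (forall t, 0 < t <= T -> cvg (x s @[s --> t^'-])).

Definition time_change (R : realType) (T : R) (lam : R -> R) : Prop :=
  [/\ {in `[0, T]%R &, {homo lam : s t / s < t}},
      {within `[0, T], continuous lam} & lam @` `[0, T]%classic = `[0, T]%classic].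

(* The J1 distance on D[0,T]. *)
Definition skorokhod_dist (R : realType) (T : R) (x y : R -> R) : R :=
  inf [set e | 0 < e /\ exists lam, time_change T lam /\
    forall t, 0 <= t <= T -> `|lam t - t| <= e /\ `|x t - y (lam t)| <= e].

Definition skorokhod_continuous (R : realType) (T : R) (F : (R -> R) -> R) :
    Prop :=
  forall x, cadlag T x -> forall e, 0 < e -> exists2 delta, 0 < delta &
    forall y, cadlag T y -> skorokhod_dist T x y < delta -> `|F x - F y| < e.

(* [F] is not asked to be measurable: this follows from its continuity, the
   Borel sigma-field of J1 being generated by the coordinates. *)
Definition cvg_law_skorokhod d (Om : measurableType d)
    d' (Om' : measurableType d') (R : realType)
    (P : probability Om R) (P' : probability Om' R) (T : R)
    (Xn : nat -> R -> Om -> R) (X : R -> Om' -> R) : Prop :=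
  forall F : (R -> R) -> R, skorokhod_continuous T F ->
    (exists M, forall x, cadlag T x -> `|F x| <= M) ->
    \int[P]_w F (fun t => Xn n t w) @[n --> \oo]
      --> \int[P']_w F (fun t => X t w).

(* Expectation of [f] under P(. | E), i.e. E[f 1_E] / P(E). *)
Definition cond_expect d (T : measurableType d) (R : realType)
    (P : probability T R) (E : set T) (f : T -> R) : R :=
  (\int[P]_(w in E) f w) / fine (P E).

Definition cvg_stably d (Om : measurableType d)
    d' (Om' : measurableType d') (R : realType)
    (P : probability Om R) (P' : probability Om' R) (pi : Om' -> Om)
    (G : set (set Om)) (V : topologicalType)
    (xin : nat -> Om -> V) (xi : Om' -> V) : Prop :=
  forall E, G E -> (0 < P E)%E ->
  forall g : V -> R, continuous g -> (exists M, forall v, `|g v| <= M) ->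
    cond_expect P E (g \o xin n) @[n --> \oo]
      --> cond_expect P' (pi @^-1` E) (g \o xi).

Definition cvg_stably_skorokhod d (Om : measurableType d)
    d' (Om' : measurableType d') (R : realType)
    (P : probability Om R) (P' : probability Om' R) (pi : Om' -> Om)
    (G : set (set Om)) (T : R)
    (Xn : nat -> R -> Om -> R) (X : R -> Om' -> R) : Prop :=
  cvg_law_skorokhod P P' T Xn X /\
  forall (k : nat) (ts : 'I_k -> R), (forall i, 0 <= ts i <= T) ->
    cvg_stably P P' pi G (V := 'rV[R]_k)
      (fun n w => \row_i Xn n (ts i) w) (fun w => \row_i X (ts i) w).

(* Main.v *)
(** A finite second moment of the seed gives its cumulant function a second-order
    expansion at 0, with a modulus bounded on the half-line. A linear combination of
    values of the normalized sum is the centered integral, against the basis, of a sum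
    of indicators of trawl sets; splitting the latter into atoms, its characteristic
    function is that of a Gaussian variable up to a Lindeberg error, and its variance is
    a double Riemann sum converging to [sigma_a^2] times the covariance of Brownian
    motion. Given an event of [GX], approximated by one that depends on the past of a
    fixed time, the part of the trawl sets lying after that time is independent of it
    and carries asymptotically all the variance: this yields stability. Characteristic
    functions and bounded second moments give weak convergence, since a bounded
    Lipschitz function is approximated by trigonometric polynomials.

    For tightness each trawl set is cut into vertical strips of width [Delta_n]. The
    strips at a given lag are disjoint, so the sum splits into one random walk with
    independent increments per lag, up to a negligible rest. Doob's inequality for the
    submartingale [(|S| - q)_+] bounds the oscillation of each walk by truncated second
    moments, which are read off the characteristic function. The bound at lag [j] is of
    order [Delta_n * sqrt (a (j * Delta_n))], and the decay of [a] with [p0 > 2] makes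
    [sqrt a] integrable, so that the sum over the lags is small.

    A J1-continuous functional is continuous for the uniform distance at each cadlag
    path; its inf-convolutions are Lipschitz for that distance and increase to it, which
    reduces the convergence in law to finitely many times. *)

From HB Require Import structures.
Require Import Defs.
From mathcomp Require Import measurable_realfun ring lra zify.
Import Order.TTheory GRing.Theory Num.Theory.
Import numFieldTopology.Exports numFieldNormedType.Exports.
Set Implicit Arguments.
Unset Strict Implicit.
Unset Printing Implicit Defensive.
Local Open Scope classical_set_scope.
Local Open Scope ring_scope.

(** * Real-valued integrals and independence *)

(** Everything is read off expectations of cosines and sines, down to the integrability of [x ^+ 2]
    under [nu], which comes from the seed. The obstacle to a Lindeberg argument is memory: one point
    of the plane may lie in very many of the [n] trawl sets, so its total coefficient need not be
    small. Cutting each set at a distance [Kc] behind its time leaves coefficients of order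
    [(n * Delta n) ^ (-1/2)], and what is cut off is small in mean square; [Kc] is fixed before [n]
    grows. For tightness no fourth moment is assumed, so the truncated second moment of a block is
    bounded by a second moment minus a cosine at frequency [3 / q], where the leading terms cancel.
    This gains nothing at a lag whose total mass [n * lag_mass] is below a fixed level: such a lag
    only gets a crude bound, which is harmless because early lags have small weight when
    [n * Delta n] is large and late ones are covered by the tail of [sqrt a]. Path functionals come
    without measurability, so each is approached from below by functionals of finitely many
    coordinates; lower bounds for [F] and [- F] then give the limit. *)

Section real_integral.
Context d (T : measurableType d) (R : realType) (mu : {measure set T -> \bar R}).
Implicit Types f g : T -> R.

Definition rintegrable f := mu.-integrable setT (EFin \o f).

Lemma rintegrable_measurable f : rintegrable f -> measurable_fun setT f.
Proof. by move=> /(measurable_int mu)/measurable_EFinP. Qed.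

Lemma eq_rintegrable f g : f =1 g -> rintegrable f -> rintegrable g.
Proof. by move=> /funext ->. Qed.

Lemma rintegrableD f g :
  rintegrable f -> rintegrable g -> rintegrable (fun x => f x + g x).
Proof. by move=> fi gi; have := integrableD measurableT fi gi; exact: eq_integrable. Qed.

Lemma rintegrableN f : rintegrable f -> rintegrable (fun x => - f x).
Proof. by move=> fi; have := integrableN fi; exact: eq_integrable. Qed.

Lemma rintegrableB f g :
  rintegrable f -> rintegrable g -> rintegrable (fun x => f x - g x).
Proof. by move=> fi gi; apply: rintegrableD => //; exact: rintegrableN. Qed.

Lemma rintegrableZ k f : rintegrable f -> rintegrable (fun x => k * f x).
Proof. by move=> fi; have := integrableZl measurableT k fi; exact: eq_integrable. Qed.

Lemma rintegrable0 : rintegrable (fun=> 0).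
Proof. exact: integrable0. Qed.

Lemma rintegrable_sum I (s : seq I) (Q : pred I) (F : I -> T -> R) :
  (forall i, Q i -> rintegrable (F i)) ->
  rintegrable (fun x => \sum_(i <- s | Q i) F i x).
Proof.
move=> Fi; elim: s => [|i s IH].
  by apply: (eq_rintegrable _ rintegrable0) => x; rewrite big_nil.
case Qi : (Q i).
  by apply: (eq_rintegrable _ (rintegrableD (Fi _ Qi) IH)) => x; rewrite big_cons Qi.
by apply: (eq_rintegrable _ IH) => x; rewrite big_cons Qi.
Qed.

Lemma le_rintegrable f g : measurable_fun setT f ->
  (forall x, `|f x| <= g x) -> rintegrable g -> rintegrable f.
Proof.
move=> mf fg gi; apply: (le_integrable measurableT _ _ gi) => //.
  exact/measurable_EFinP.
by move=> x _; rewrite /= lee_fin (le_trans (fg x))// ler_norm.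
Qed.

Lemma rintegrable_norm f : rintegrable f -> rintegrable (fun x => `|f x|).
Proof. by move=> fi; exact: integrable_norm. Qed.

Lemma RintD f g : rintegrable f -> rintegrable g ->
  \int[mu]_x (f x + g x) = \int[mu]_x f x + \int[mu]_x g x.
Proof. exact: RintegralD. Qed.

Lemma RintB f g : rintegrable f -> rintegrable g ->
  \int[mu]_x (f x - g x) = \int[mu]_x f x - \int[mu]_x g x.
Proof. exact: RintegralB. Qed.

Lemma RintZ k f : rintegrable f -> \int[mu]_x (k * f x) = k * \int[mu]_x f x.
Proof. exact: RintegralZl. Qed.

Lemma Rint0 : \int[mu]_x (fun=> 0 : R) x = 0.
Proof. by rewrite /Rintegral integral0. Qed.

Lemma RintN f : rintegrable f -> \int[mu]_x (- f x) = - \int[mu]_x f x.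
Proof.
move=> fi; rewrite -mulN1r -RintZ//; congr Rintegral.
by apply/funext => x; rewrite mulN1r.
Qed.

Lemma Rint_sum I (s : seq I) (Q : pred I) (F : I -> T -> R) :
  (forall i, Q i -> rintegrable (F i)) ->
  \int[mu]_x (\sum_(i <- s | Q i) F i x) = \sum_(i <- s | Q i) \int[mu]_x F i x.
Proof.
move=> Fi; elim: s => [|i s IH].
  by rewrite big_nil -[RHS]Rint0; congr Rintegral; apply/funext => x; rewrite big_nil.
rewrite big_cons; case: ifPn => Qi; last first.
  by rewrite -IH; congr Rintegral; apply/funext => x; rewrite big_cons (negbTE Qi).
rewrite -IH -RintD; [|exact: Fi|exact: rintegrable_sum].
by congr Rintegral; apply/funext => x; rewrite big_cons Qi.
Qed.

Lemma ler_Rint f g : rintegrable f -> rintegrable g ->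
  (forall x, f x <= g x) -> \int[mu]_x f x <= \int[mu]_x g x.
Proof. by move=> fi gi fg; apply: le_Rintegral. Qed.

Lemma ler_norm_Rint f : rintegrable f ->
  `|\int[mu]_x f x| <= \int[mu]_x `|f x|.
Proof. exact: le_normr_Rintegral. Qed.

Lemma ler_norm_RintB f g h : rintegrable f -> rintegrable g -> rintegrable h ->
  (forall x, `|f x - g x| <= h x) ->
  `|\int[mu]_x f x - \int[mu]_x g x| <= \int[mu]_x h x.
Proof.
move=> fi gi hi fgh; rewrite -RintB//.
apply: le_trans (ler_norm_Rint (rintegrableB fi gi)) _.
by apply: ler_Rint => //; apply/rintegrable_norm/rintegrableB.
Qed.

Lemma eq_Rint f g : f =1 g -> \int[mu]_x f x = \int[mu]_x g x.
Proof. by move=> /funext ->. Qed.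

Lemma Rint_fin f : rintegrable f ->
  (\int[mu]_x (f x)%:E)%E = (\int[mu]_x f x)%:E.
Proof. by move=> fi; rewrite fineK//; exact: integrable_fin_num. Qed.

Lemma ge0_rintegrableP f : measurable_fun setT f -> (forall x, 0 <= f x) ->
  (\int[mu]_x (f x)%:E < +oo)%E -> rintegrable f.
Proof.
move=> mf f0 fi; apply/integrableP; split; first exact/measurable_EFinP.
by under eq_integral do rewrite /= ger0_norm//.
Qed.

Lemma cvg_RintD (f_ : (T -> R)^nat) f g : (forall n, measurable_fun setT (f_ n)) ->
  rintegrable g -> (forall n x, `|f_ n x| <= g x) ->
  (forall x, f_ n x @[n --> \oo] --> f x) ->
  rintegrable f /\ \int[mu]_x f_ n x @[n --> \oo] --> \int[mu]_x f x.
Proof.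
move=> mf_ gi fg ff.
have mf : measurable_fun setT f.
  exact: (@measurable_fun_cvg _ _ _ setT f_).
have [] := @dominated_convergence _ _ _ mu setT measurableT
  (fun n => EFin \o f_ n) (EFin \o f) (EFin \o g).
- by move=> n; apply/measurable_EFinP.
- exact/measurable_EFinP.
- by apply: aeW => x _ /=; apply/fine_cvgP; split; [exact: nearW|exact: ff].
- exact: gi.
- by apply: aeW => x n _ /=; rewrite lee_fin.
move=> fi _ cvf; split => //.
have fii n : rintegrable (f_ n) by apply: le_rintegrable gi.
rewrite /Rintegral; apply: fine_cvg; rewrite fineK//.
exact: integrable_fin_num.
Qed.

(** Integrability of the limit is part of the conclusion: this is how [x ^+ 2] is shown to be
    integrable, once under [nu] and once under the law of a variable with a known characteristic
    function. *)
Lemma fatou_cvg (f_ : (T -> R)^nat) f (C : R) :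
  (forall n, rintegrable (f_ n)) -> (forall n x, 0 <= f_ n x) ->
  (forall x, f_ n x @[n --> \oo] --> f x) ->
  (\forall n \near \oo, \int[mu]_x f_ n x <= C) ->
  rintegrable f /\ \int[mu]_x f x <= C.
Proof.
move=> fi f0 ff [N _ fC].
have mf_ n := rintegrable_measurable (fi n).
have mf : measurable_fun setT f by exact: (@measurable_fun_cvg _ _ _ setT f_).
have ff0 x : 0 <= f x.
  by rewrite -(cvg_lim (@Rhausdorff R) (ff x)); apply: limr_ge; [exact: cvgP (ff x)|exact: nearW].
have H : (\int[mu]_x (f x)%:E <= C%:E)%E.
  have := @fatou _ _ _ mu setT measurableT (fun n => EFin \o f_ n)
    (fun n => proj2 (measurable_EFinP _ _) (mf_ n))
    (fun n x _ => f0 n x).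
  have -> : (\int[mu]_x limn_einf (fun n => (EFin \o f_ n) x) =
             \int[mu]_x (f x)%:E)%E.
    apply: eq_integral => x _.
    rewrite /= (_ : (fun n => (f_ n x)%:E) = EFin \o f_ ^~ x)//.
    have cf : (EFin \o f_ ^~ x) n @[n --> \oo] --> (f x)%:E.
      by apply/fine_cvgP; split; [exact: nearW|exact: ff].
    by rewrite is_cvg_limn_einfE; [exact/cvg_lim|exact: cvgP cf].
  move=> /le_trans; apply.
  rewrite limn_einf_lim; apply: lime_le; first exact: is_cvg_einfs.
  exists N => // n Nn /=.
  apply: (@le_trans _ _ (\int[mu]_x (f_ n x)%:E)%E).
    by apply: ereal_inf_lbound; exists n => //=.
  by rewrite Rint_fin// lee_fin fC.
have fi' : rintegrable f.
  by apply: ge0_rintegrableP => //; exact: le_lt_trans H (ltry _).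
by split => //; rewrite -lee_fin -Rint_fin.
Qed.
End real_integral.

Section probability_integral.
Context d (T : measurableType d) (R : realType) (P : probability T R).
Implicit Types f g : T -> R.

Lemma rintegrable_cst c : rintegrable P (fun=> c).
Proof. exact: finite_measure_integrable_cst. Qed.

Lemma Rint_cst (c : R) : \int[P]_x c = c.
Proof. by rewrite Rintegral_cst//= (probability_setT P) mulr1. Qed.

Lemma bounded_rintegrable f M : measurable_fun setT f ->
  (forall x, `|f x| <= M) -> rintegrable P f.
Proof. by move=> mf fM; apply: le_rintegrable fM (rintegrable_cst M). Qed.

Lemma ae_rintegrable f g : measurable_fun setT g -> {ae P, forall x, f x = g x} ->
  rintegrable P f -> rintegrable P g.
Proof.
move=> mg fg fi.
have mf := rintegrable_measurable fi.
apply/integrableP; split; first exact/measurable_EFinP.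
rewrite (ae_eq_integral (fun x => `|(f x)%:E|%E))//.
- by have /integrableP[] := fi.
- by apply: measurableT_comp => //; exact/measurable_EFinP.
- by apply: measurableT_comp => //; exact/measurable_EFinP.
- by move: fg; apply: filterS => x /= -> _.
Qed.

Lemma ae_eq_Rint f g : measurable_fun setT f -> measurable_fun setT g ->
  {ae P, forall x, f x = g x} -> \int[P]_x f x = \int[P]_x g x.
Proof.
move=> mf mg fg; congr fine; apply: ae_eq_integral => //.
- exact/measurable_EFinP.
- exact/measurable_EFinP.
- by move: fg; apply: filterS => x /= -> _.
Qed.

Definition sqintegrable f :=
  measurable_fun setT f /\ rintegrable P (fun x => f x ^+ 2).

Lemma sqintegrableM f g : sqintegrable f -> sqintegrable g ->
  rintegrable P (fun x => f x * g x).
Proof.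
move=> [mf fi] [mg gi].
apply: (le_rintegrable _ _ (rintegrableD fi gi)); first exact: measurable_funM.
move=> x; rewrite ler_norml.
have := sqr_ge0 (f x - g x); have := sqr_ge0 (f x + g x).
have := sqr_ge0 (f x); have := sqr_ge0 (g x).
by rewrite sqrrD sqrrB; lra.
Qed.

Lemma sqintegrable_cst c : sqintegrable (fun=> c).
Proof. by split; [exact: measurable_cst|exact: rintegrable_cst]. Qed.

Lemma sqintegrable_int f : sqintegrable f -> rintegrable P f.
Proof.
move=> fi; have := sqintegrableM fi (sqintegrable_cst 1).
by apply: eq_rintegrable => x; rewrite mulr1.
Qed.

Lemma sqintegrableD f g : sqintegrable f -> sqintegrable g ->
  sqintegrable (fun x => f x + g x).
Proof.
move=> fi gi; split; first by apply: measurable_funD; [case: fi|case: gi].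
have := rintegrableD (rintegrableD fi.2 gi.2) (rintegrableZ 2 (sqintegrableM fi gi)).
by apply: eq_rintegrable => x; ring.
Qed.

Lemma sqintegrableZ k f : sqintegrable f -> sqintegrable (fun x => k * f x).
Proof.
move=> fi; split; first by apply: measurable_funM => //; case: fi.
by have := rintegrableZ (k ^+ 2) fi.2; apply: eq_rintegrable => x; ring.
Qed.

Lemma sqintegrableN f : sqintegrable f -> sqintegrable (fun x => - f x).
Proof. by move/(sqintegrableZ (-1)); under eq_fun do rewrite mulN1r. Qed.

Lemma sqintegrableB f g : sqintegrable f -> sqintegrable g ->
  sqintegrable (fun x => f x - g x).
Proof. by move=> fi gi; apply: sqintegrableD => //; exact: sqintegrableN. Qed.

Lemma sqintegrable_sum I (s : seq I) (Q : pred I) (F : I -> T -> R) :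
  (forall i, Q i -> sqintegrable (F i)) ->
  sqintegrable (fun x => \sum_(i <- s | Q i) F i x).
Proof.
move=> Fi; elim: s => [|i s IH].
  by under eq_fun do rewrite big_nil; exact: sqintegrable_cst.
under eq_fun do rewrite big_cons.
by case Qi : (Q i) => //; apply: sqintegrableD => //; exact: Fi.
Qed.

Lemma le_sqintegrable f g : measurable_fun setT f ->
  (forall x, `|f x| <= `|g x|) -> sqintegrable g -> sqintegrable f.
Proof.
move=> mf fg [mg gi]; split => //; apply: le_rintegrable gi.
  by apply: measurable_funX.
by move=> x; rewrite normrX -[leRHS]real_normK ?num_real// ler_sqr ?nnegrE.
Qed.

Lemma ae_sqintegrable f g : measurable_fun setT g -> {ae P, forall x, f x = g x} ->
  sqintegrable f -> sqintegrable g.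
Proof.
move=> mg fg [mf fi]; split => //; apply: (ae_rintegrable _ _ fi).
  exact: measurable_funX.
by move: fg; apply: filterS => x ->.
Qed.

(** With [m] the mean of [|f|], the integral of [(|f| - m) ^+ 2] is nonnegative; expanding it gives
    [m ^+ 2] at most the second moment. *)
Lemma Rint_norm_sqrt f : sqintegrable f ->
  \int[P]_x `|f x| <= Num.sqrt (\int[P]_x f x ^+ 2).
Proof.
move=> fi; set m := \int[P]_x `|f x|.
have m0 : 0 <= m by apply: Rintegral_ge0.
have fi1 := rintegrable_norm (sqintegrable_int fi).
rewrite -(ger0_norm m0) -sqrtr_sqr ler_wsqrtr//.
have : 0 <= \int[P]_x (f x ^+ 2 - 2 * m * `|f x| + m ^+ 2).
  apply: Rintegral_ge0 => x _.
  have -> : f x ^+ 2 - 2 * m * `|f x| + m ^+ 2 = (`|f x| - m) ^+ 2.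
    by rewrite sqrrB real_normK ?num_real//; ring.
  exact: sqr_ge0.
rewrite (RintD (rintegrableB fi.2 (rintegrableZ _ fi1)) (rintegrable_cst _)).
rewrite (RintB fi.2 (rintegrableZ _ fi1)) RintZ// (Rint_cst (m ^+ 2)) -/m.
by rewrite expr2; lra.
Qed.

End probability_integral.

(** * Independence of sigma-fields, of variables and of blocks of variables *)

Section independence.
Context d (T : measurableType d) (R : realType) (P : probability T R).

Definition indep_sys (G H : set (set T)) :=
  forall A B, G A -> H B -> (P (A `&` B) = P A * P B)%E.

Lemma indep_sysC G H : indep_sys G H -> indep_sys H G.
Proof. by move=> GH A B HA GB; rewrite setIC GH// muleC. Qed.

(** Dynkin's argument: for a fixed [B] in [H], the events that obey the product rule with [B] form a
    Dynkin class, and [G] is a pi-system inside it. *)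
Lemma indep_sys_sigma (G H : set (set T)) : setI_closed G ->
  G `<=` measurable -> H `<=` measurable -> indep_sys G H ->
  indep_sys <<s G >> H.
Proof.
move=> GI mG mH GH A B GA HB.
have mB := mH _ HB.
pose K := [set A | measurable A /\ (P (A `&` B) = P A * P B)%E].
suff : <<s G >> `<=` K by move/(_ _ GA) => [].
rewrite -setI_closed_g_dynkin_g_sigma_algebra//.
apply: smallest_sub; last first.
  by move=> C GC; split; [exact: mG|exact: GH].
split.
- by split => //; rewrite setTI probability_setT mul1e.
- move=> C [mC CB]; split; first exact: measurableC.
  rewrite probability_setC// setIC -setDE measureD//; last by rewrite ltey_eq fin_num_measure.
  transitivity (P B - P C * P B)%E; first by congr (_ - _)%E; rewrite setIC.
  rewrite muleBl ?mul1e//.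
    by rewrite fin_num_measure.
- move=> F tF FK.
  have mF n : measurable (F n) by case: (FK n).
  split; first exact: bigcup_measurable.
  rewrite setI_bigcupl measure_bigcup//; last 2 first.
    by move=> i _; apply: measurableI.
    exact: trivIset_setIr.
  rewrite measure_bigcup//.
  have fB : P B \is a fin_num by rewrite fin_num_measure.
  rewrite -[in RHS](fineK fB) muleC -nneseriesZl//.
  apply: eq_eseriesr => n _.
  by rewrite fineK// muleC; exact: (FK n).2.
Qed.

Definition indep_rv (X Y : T -> R) := forall A B, measurable A -> measurable B ->
  (P (X @^-1` A `&` Y @^-1` B) = P (X @^-1` A) * P (Y @^-1` B))%E.

Lemma indep_rv_comp X Y (f g : R -> R) : measurable_fun setT f ->
  measurable_fun setT g -> indep_rv X Y -> indep_rv (f \o X) (g \o Y).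
Proof.
move=> mf mg XY A B mA mB; apply: (XY (f @^-1` A) (g @^-1` B)).
- by rewrite -[X in measurable X]setTI; exact: mf.
- by rewrite -[X in measurable X]setTI; exact: mg.
Qed.

(** By independence the joint law is the product of the marginal laws, since both agree on
    rectangles. Tonelli on [|x * y|] gives integrability and Fubini the value. *)
Lemma indep_rv_mul X Y : indep_rv X Y -> rintegrable P X -> rintegrable P Y ->
  rintegrable P (fun w => X w * Y w) /\
  \int[P]_w (X w * Y w) = \int[P]_w X w * \int[P]_w Y w.
Proof.
move=> XY iX iY.
have mX := rintegrable_measurable iX; have mY := rintegrable_measurable iY.
pose X' : {RV P >-> R} := HB.pack X (isMeasurableFun.Build _ _ _ _ X mX).
pose Y' : {RV P >-> R} := HB.pack Y (isMeasurableFun.Build _ _ _ _ Y mY).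
have mZ : measurable_fun setT (fun w => (X w, Y w)) by exact: measurable_fun_pair.
pose Z' : {RV P >-> (R * R)%type} :=
  HB.pack (fun w => (X w, Y w)) (isMeasurableFun.Build _ _ _ _ _ mZ).
have ZE S : measurable S ->
    (distribution P X' \x distribution P Y')%E S = distribution P Z' S.
  move=> mS; exact: product_measure_unique.
have ge0E (f : R * R -> \bar R) : measurable_fun setT f -> (forall p, 0 <= f p)%E ->
    (\int[distribution P X' \x distribution P Y']_z f z = \int[P]_w f (X w, Y w))%E.
  move=> mf f0; rewrite (eq_measure_integral (distribution P Z')).
    by rewrite ge0_integral_distribution.
  by move=> A mA _; exact: ZE.
have mabs : measurable_fun [set: R] (fun x : R => `|x|%:E).
  by apply/measurable_EFinP; exact: normr_measurable.
pose f (p : R * R) := (p.1 * p.2)%:E.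
have mf : measurable_fun setT f.
  by apply/measurable_EFinP; apply: measurable_funM.
have fi : (distribution P X' \x distribution P Y')%E.-integrable setT f.
  apply/integrableP; split => //.
  rewrite fubini_tonelli1//; last exact: measurableT_comp.
  rewrite /fubini_F.
  under eq_integral => x _.
    under eq_integral => y _ do rewrite /f /= normrM EFinM.
    rewrite ge0_integralZl//.
    over.
  rewrite ge0_integralZr//; last exact: integral_ge0.
  have h (W : {RV P >-> R}) : rintegrable P W ->
      (\int[distribution P W]_x `|x|%:E)%E = (\int[P]_x `|W x|)%:E.
    move=> iW; rewrite ge0_integral_distribution//.
    by rewrite -Rint_fin//; exact: rintegrable_norm.
  by rewrite !h// -EFinM ltry.
have fi' : rintegrable P (fun w => X w * Y w).
  apply/integrableP; split; first by apply/measurable_EFinP; exact: measurable_funM.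
  have /integrableP[_] := fi.
  by rewrite ge0E//; exact: measurableT_comp.
split => //.
apply: EFin_inj; rewrite -Rint_fin// EFinM -!Rint_fin//.
have -> : (\int[P]_w (X w * Y w)%:E)%E =
    (\int[distribution P X' \x distribution P Y']_z f z)%E.
  rewrite (eq_measure_integral (distribution P Z')); last by move=> A mA _; exact: ZE.
  by rewrite integral_distribution.
rewrite -integral12_prod_meas1//.
have h (W : {RV P >-> R}) : rintegrable P W ->
    (\int[distribution P W]_x x%:E)%E = (\int[P]_x (W x)%:E)%E.
  by move=> iW; rewrite integral_distribution.
have hi (W : {RV P >-> R}) : rintegrable P W ->
    (distribution P W).-integrable setT EFin.
  move=> iW; apply/integrableP; split; first exact/measurable_EFinP.
  rewrite ge0_integral_distribution//.
  by have /integrableP[] := iW.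
transitivity (\int[distribution P X']_x (x%:E * (\int[P]_w Y w)%:E))%E.
  apply: eq_integral => x _; rewrite /fubini_F.
  transitivity (\int[distribution P Y']_y (x%:E * y%:E))%E.
    by apply: eq_integral => y _; rewrite /f EFinM.
  by rewrite (integralZl measurableT (hi _ _))// (h Y')// Rint_fin.
by rewrite (integralZr measurableT (hi _ _))// (h X')// !Rint_fin.
Qed.

End independence.

Section adapted.
Context d (T : measurableType d) (R : realType).
Implicit Types (G : set (set T)) (U V : T -> R).

(** Measurability for the sigma-field generated by [G], kept as a predicate on functions of [T] so
    that several sigma-fields can coexist; [adaptedP] gives access to the closure properties of
    measurable functions. *)
Definition adapted G U := forall B : set R, measurable B -> <<s G >> (U @^-1` B).

Lemma adaptedP G U :
  adapted G U <-> measurable_fun setT (U : g_sigma_algebraType G -> R).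
Proof.
split => [aU _ B mB|mU B mB]; first by rewrite setTI; exact: aU.
by have := mU measurableT B mB; rewrite setTI.
Qed.

Lemma adapted_cst G (c : R) : adapted G (fun=> c).
Proof. exact/adaptedP/measurable_cst. Qed.

Lemma adaptedD G U V : adapted G U -> adapted G V ->
  adapted G (fun x => U x + V x).
Proof. by move=> /adaptedP ? /adaptedP ?; apply/adaptedP; exact: measurable_funD. Qed.

Lemma adaptedM G U V : adapted G U -> adapted G V ->
  adapted G (fun x => U x * V x).
Proof. by move=> /adaptedP ? /adaptedP ?; apply/adaptedP; exact: measurable_funM. Qed.

Lemma adapted_max G U V : adapted G U -> adapted G V ->
  adapted G (fun x => Num.max (U x) (V x)).
Proof. by move=> /adaptedP ? /adaptedP ?; apply/adaptedP; exact: measurable_maxr. Qed.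

Lemma adapted_comp G U (f : R -> R) : measurable_fun setT f -> adapted G U ->
  adapted G (f \o U).
Proof. by move=> mf /adaptedP ?; apply/adaptedP; exact: measurableT_comp. Qed.

Lemma adapted_sum G I (s : seq I) (Q : pred I) (F : I -> T -> R) :
  (forall i, Q i -> adapted G (F i)) ->
  adapted G (fun x => \sum_(i <- s | Q i) F i x).
Proof.
move=> aF; elim: s => [|i s IH].
  by under eq_fun do rewrite big_nil; exact: adapted_cst.
under eq_fun do rewrite big_cons.
by case Qi : (Q i) => //; apply: adaptedD => //; exact: aF.
Qed.

Definition gen_of (I : Type) (D : set I) (Z : I -> T -> R) :=
  \bigcup_(i in D) preimage_set_system [set: T] (Z i) measurable.

Lemma gen_of_measurable (I : Type) (D : set I) (Z : I -> T -> R) :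
  (forall i, measurable_fun setT (Z i)) -> gen_of D Z `<=` measurable.
Proof. by move=> mZ A [i _ [B mB <-]]; exact: mZ. Qed.

Lemma adapted_gen (I : Type) (D : set I) (Z : I -> T -> R) i : D i ->
  adapted (gen_of D Z) (Z i).
Proof.
move=> Di B mB; apply: sub_sigma_algebra; exists i => //.
by exists B => //; rewrite setTI.
Qed.

End adapted.

Section independent_blocks.
Context d (T : measurableType d) (R : realType) (P : probability T R).
Variables (n : nat) (X : 'I_n -> T -> R).
Hypothesis mX : forall i, measurable_fun setT (X i).
Hypothesis indX : mutually_independent P X.

(** Cylinders that constrain only the coordinates in [D]: a pi-system that generates the sigma-field
    of that block and on which mutual independence can be applied directly. *)
Let rect (D : set 'I_n) : set (set T) :=
  [set A | exists B : 'I_n -> set R, [/\ forall i, measurable (B i),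
    forall i, ~ D i -> B i = setT & A = \bigcap_(i in [set: 'I_n]) (X i @^-1` B i)]].

Let rectI D : setI_closed (rect D).
Proof.
move=> _ _ [B [mB BT ->]] [C [mC CT ->]].
exists (fun i => B i `&` C i); split.
- by move=> i; exact: measurableI.
- by move=> i Di; rewrite BT// CT// setTI.
- apply/seteqP; split => w.
    by move=> [h1 h2] i _; split; [exact: h1|exact: h2].
  by move=> h; split => i Di; have [] := h i Di.
Qed.

Let mpre i (B : set R) : measurable B -> measurable (X i @^-1` B).
Proof. by move=> mB; rewrite -[X in measurable X]setTI; exact: mX. Qed.

Let rectm D : rect D `<=` measurable.
Proof.
move=> _ [B [mB _ ->]]; apply: fin_bigcap_measurable => // i _.
exact: mpre.
Qed.

Let gen_rect D : <<s gen_of D X >> `<=` <<s rect D >>.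
Proof.
apply: smallest_sub; first exact: smallest_sigma_algebra.
move=> A [i Di [B mB <-]]; rewrite setTI; apply: sub_sigma_algebra.
exists (fun j => if j == i then B else setT); split.
- by move=> j; case: ifP.
- by move=> j Dj; case: eqP => // ji; rewrite ji in Dj.
- apply/seteqP; split => w.
    by move=> Bw j _ /=; case: eqP => // ->.
  by move=> /(_ i I) /=; rewrite eqxx.
Qed.

(** The product rule holds between cylinders over disjoint index sets; two passes of
    [indep_sys_sigma], one for each side, extend it to the generated sigma-fields. *)
Lemma indep_blocks (D E : set 'I_n) : (forall i, ~ (D i /\ E i)) ->
  indep_sys P <<s gen_of D X >> <<s gen_of E X >>.
Proof.
move=> DE.
have rr : indep_sys P (rect D) (rect E).
  move=> _ _ [B [mB BT ->]] [C [mC CT ->]].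
  have -> : \bigcap_(i in [set: 'I_n]) (X i @^-1` B i) `&`
            \bigcap_(i in [set: 'I_n]) (X i @^-1` C i) =
            \bigcap_(i in [set: 'I_n]) (X i @^-1` (B i `&` C i)).
    apply/seteqP; split => w.
      by move=> [h1 h2] i _; split; [exact: h1|exact: h2].
    by move=> h; split => i Di; have [] := h i Di.
  rewrite (indX mB) (indX mC) indX; last by move=> i; exact: measurableI.
  rewrite -big_split /=; apply: eq_bigr => i _.
  have [Di|Di] := pselect (D i).
    rewrite (CT i) ?setIT; last by move=> Ei; apply: (DE i).
    by rewrite preimage_setT probability_setT mule1.
  by rewrite (BT i) ?setTI// preimage_setT probability_setT mul1e.
have s1 : indep_sys P <<s rect D >> (rect E).
  by apply: indep_sys_sigma => //; exact: rectm.
have s2 : indep_sys P <<s rect E >> <<s rect D >>.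
  apply: indep_sys_sigma => //; last exact: indep_sysC.
  exact: (smallest_sub (@sigma_algebra_measurable _ T) (@rectm D)).
by move=> A B /gen_rect A' /gen_rect B'; exact: (indep_sysC s2).
Qed.

Lemma indep_blocks_rv (D E : set 'I_n) U V : (forall i, ~ (D i /\ E i)) ->
  adapted (gen_of D X) U -> adapted (gen_of E X) V -> indep_rv P U V.
Proof.
move=> DE aU aV A B mA mB; apply: (indep_blocks DE).
- exact: aU.
- exact: aV.
Qed.

End independent_blocks.

(** * Cumulants and moments *)

Section trigonometric_bounds.
Context (R : realType).
Implicit Types (x u : R).

(** Engine of the Taylor bounds that follow: each one is the integrated form of the previous one,
    from [cos <= 1] to [sin], then [cos], [sin] and [cos] again. *)
Lemma derive_ge0_ge0 (f df : R -> R) : (forall x, is_derive x 1 f (df x)) ->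
  f 0 = 0 -> (forall x, 0 <= x -> 0 <= df x) -> forall x, 0 <= x -> 0 <= f x.
Proof.
move=> fdf f0 df0 x x0.
have [|c] := @MVT_segment R f df 0 x x0 (fun y _ => fdf y).
  apply: continuous_subspaceT => y; apply: differentiable_continuous.
  by apply/derivable1_diffP; have [] := fdf y.
rewrite in_itv/= => /andP[c0 _]; rewrite f0 !subr0 => ->.
by rewrite mulr_ge0// df0.
Qed.

Lemma sin_lex u : 0 <= u -> sin u <= u.
Proof.
move=> u0; rewrite -subr_ge0.
apply: (@derive_ge0_ge0 (id - sin) (fun x => 1 - cos x)) => //.
by rewrite !fctE sin0 subr0.
Qed.

Lemma cos_ge_quad u : 1 - u ^+ 2 / 2 <= cos u.
Proof.
wlog u0 : u / 0 <= u.
  move=> h; have [/h//|/ltW u0] := leP 0 u.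
  by have := h (- u); rewrite oppr_ge0 sqrrN cosN; exact.
pose f : R -> R := cos - cst 1 + 2^-1 \*: (id ^+ 2).
have fE x : f x = cos x - (1 - x ^+ 2 / 2).
  by rewrite /f !fctE /=; rewrite /GRing.scale /=; lra.
rewrite -subr_ge0 -fE; apply: (@derive_ge0_ge0 f (fun x => x - sin x) _ _ _ u u0).
- by move=> x; apply: is_derive_eq; rewrite /GRing.scale /= expr1; lra.
- by rewrite fE cos0 expr0n /=; lra.
- by move=> x x0; rewrite subr_ge0 sin_lex.
Qed.

Lemma sin_ge_cubic u : 0 <= u -> u - u ^+ 3 / 6 <= sin u.
Proof.
move=> u0; pose f : R -> R := sin - id + 6^-1 \*: (id ^+ 3).
have fE x : f x = sin x - (x - x ^+ 3 / 6).
  by rewrite /f !fctE /=; rewrite /GRing.scale /=; lra.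
rewrite -subr_ge0 -fE.
apply: (@derive_ge0_ge0 f (fun x => cos x - (1 - x ^+ 2 / 2)) _ _ _ u u0).
- by move=> x; apply: is_derive_eq; rewrite /GRing.scale /=; lra.
- by rewrite fE sin0 expr0n /=; lra.
- by move=> x x0; rewrite subr_ge0 cos_ge_quad.
Qed.

Lemma cos_le_quartic u : cos u <= 1 - u ^+ 2 / 2 + u ^+ 4 / 24.
Proof.
wlog u0 : u / 0 <= u.
  move=> h; have [/h//|/ltW u0] := leP 0 u.
  by have := h (- u); rewrite oppr_ge0 cosN !(exprM (- u) 2 2) (exprM u 2 2) sqrrN; exact.
pose f : R -> R := cst 1 - 2^-1 \*: (id ^+ 2) + 24^-1 \*: (id ^+ 4) - cos.
have fE x : f x = 1 - x ^+ 2 / 2 + x ^+ 4 / 24 - cos x.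
  by rewrite /f !fctE /=; rewrite /GRing.scale /=; lra.
rewrite -subr_ge0 -fE.
apply: (@derive_ge0_ge0 f (fun x => sin x - (x - x ^+ 3 / 6)) _ _ _ u u0).
- by move=> x; apply: is_derive_eq; rewrite /GRing.scale /= expr1; lra.
- by rewrite fE cos0 !expr0n /=; lra.
- by move=> x x0; rewrite subr_ge0 sin_ge_cubic.
Qed.

(** The factor [min 1 |u|] makes the remainder dominated by [u ^+ 2] everywhere and negligible
    against it near 0. With only a second moment at hand, this is the form to which dominated
    convergence applies. *)
Lemma cos_quad_bound u : `|cos u - 1 + u ^+ 2 / 2| <= u ^+ 2 * Num.min 1 `|u|.
Proof.
have h1 := cos_ge_quad u; have h2 := cos_le_quartic u; have h3 := cos_le1 u.
have u2 := sqr_ge0 u.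
rewrite ger0_norm; last lra.
rewrite minr_pMr ?sqr_ge0// mulr1 le_min; apply/andP; split; first lra.
have [u1|u1] := leP `|u| 1.
  have : u ^+ 4 <= u ^+ 2 * `|u|.
    have -> : u ^+ 4 = u ^+ 2 * `|u| ^+ 2 by rewrite real_normK ?num_real//; ring.
    by rewrite ler_wpM2l// expr2 ler_piMl.
  have : 0 <= u ^+ 2 * `|u| by rewrite mulr_ge0.
  lra.
have : u ^+ 2 <= u ^+ 2 * `|u| by rewrite ler_peMr// ltW.
lra.
Qed.

Lemma sin_bound u : `|sin u - u| <= u ^+ 2 * Num.min 1 `|u|.
Proof.
wlog u0 : u / 0 <= u.
  move=> h; have [/h//|/ltW u0] := leP 0 u.
  have := h (- u); rewrite oppr_ge0 sqrrN sinN normrN => /(_ u0).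
  by rewrite -opprD normrN.
have h1 := sin_lex u0; have h2 := sin_ge_cubic u0; have h3 := sin_geN1 u.
have u2 := sqr_ge0 u.
rewrite distrC ger0_norm ?subr_ge0// ger0_norm//.
have u3 : 0 <= u ^+ 3 by rewrite exprn_ge0.
have e3 : u ^+ 2 * u = u ^+ 3 by rewrite -exprSr.
rewrite minr_pMr ?sqr_ge0// mulr1 le_min; apply/andP; split; last lra.
have [u6|u6] := leP u 2.
  have : u ^+ 3 <= 2 * u ^+ 2 by rewrite -e3 mulrC ler_wpM2r.
  lra.
have : 2 * u <= u ^+ 2 by rewrite expr2 ler_wpM2r// ltW.
lra.
Qed.

Lemma sin_le_norm u : `|sin u| <= `|u|.
Proof.
wlog u0 : u / 0 <= u.
  move=> h; have [/h//|/ltW u0] := leP 0 u.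
  by have := h (- u); rewrite oppr_ge0 sinN !normrN; exact.
rewrite (ger0_norm u0) ler_norml sin_lex// andbT.
have [u1|u1] := leP u 1; last by have := sin_geN1 u; lra.
have := sin_ge_cubic u0.
have : u ^+ 3 <= u by rewrite exprS ler_piMr// expr2 mulr_ile1.
lra.
Qed.

Lemma measurable_cos (D : set R) : measurable_fun D (@cos R).
Proof.
apply: measurable_funTS; apply: continuous_measurable_fun.
exact: continuous_cos.
Qed.

Lemma measurable_sin (D : set R) : measurable_fun D (@sin R).
Proof.
apply: measurable_funTS; apply: continuous_measurable_fun.
exact: continuous_sin.
Qed.

(** The rescaled second difference of the cosine at 0, which turns values of a characteristic
    function into a second moment. *)
Lemma cvg_cos_quad (x : R) :
  n.+1%:R ^+ 2 * 2 * - (cos (n.+1%:R^-1 * x) - 1) @[n --> \oo] --> x ^+ 2.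
Proof.
apply/cvgrPdist_le => e e0.
  near=> n.
  have nN : e^-1 * (x ^+ 2 * 2 * `|x|) <= n.+1%:R.
    near: n; rewrite mulrC.
    apply: filterS (nbhs_infty_ger (x ^+ 2 * 2 * `|x| / e)) => n /le_trans; apply.
    by rewrite ler_nat.
  set N := n.+1%:R.
  have N0 : 0 < N by rewrite /N ltr0n.
  have := cos_quad_bound (N^-1 * x).
  rewrite ler_norml => /andP[h1 h2].
  set c := cos _ in h1 h2 *.
  have hx : x ^+ 2 = N ^+ 2 * 2 * ((N^-1 * x) ^+ 2 / 2) by field; rewrite gt_eqF.
  rewrite hx.
  have -> : N ^+ 2 * 2 * ((N^-1 * x) ^+ 2 / 2) - N ^+ 2 * 2 * - (c - 1) =
    N ^+ 2 * 2 * (c - 1 + (N^-1 * x) ^+ 2 / 2) by ring.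
  rewrite normrM ger0_norm ?mulr_ge0 ?sqr_ge0//.
  have : `|c - 1 + (N^-1 * x) ^+ 2 / 2| <= (N^-1 * x) ^+ 2 * `|N^-1 * x|.
    rewrite ler_norml; apply/andP; split.
      apply: le_trans h1; rewrite lerN2 ler_wpM2l ?sqr_ge0// ge_min lexx orbT//.
    by apply: (le_trans h2); rewrite ler_wpM2l ?sqr_ge0// ge_min lexx orbT.
  move=> /(ler_wpM2l (_ : 0 <= N ^+ 2 * 2)) h.
  apply: (le_trans (h _)); first by rewrite mulr_ge0 ?sqr_ge0.
  have -> : N ^+ 2 * 2 * ((N^-1 * x) ^+ 2 * `|N^-1 * x|) = (x ^+ 2 * 2) * `|x| / N.
    rewrite normrM (ger0_norm (x := N^-1)) ?invr_ge0 ?ltW//; field; exact: lt0r_neq0.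
  by rewrite ler_pdivrMr// mulrC -ler_pdivrMl// mulrC.
Unshelve. all: by end_near.
Qed.

Lemma cvg_sin_lin (x : R) :
  n.+1%:R * sin (n.+1%:R^-1 * x) @[n --> \oo] --> x.
Proof.
rewrite -[X in _ --> X]addr0.
have -> : (fun n => n.+1%:R * sin (n.+1%:R^-1 * x)) =
    (fun n => x + n.+1%:R * (sin (n.+1%:R^-1 * x) - n.+1%:R^-1 * x)).
  by apply/funext => n; rewrite mulrBr mulrA divff ?gt_eqF ?ltr0n// mul1r; ring.
apply: cvgD; first exact: cvg_cst.
apply/norm_cvg0P; apply: (@squeeze_cvgr _ _ _ _ (fun=> 0) (fun n => n.+1%:R^-1 * x ^+ 2)).
- apply: nearW => n; rewrite normr_ge0/=.
  set N := n.+1%:R; have N0 : 0 < N by rewrite /N ltr0n.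
  rewrite normrM (ger0_norm (ltW N0)).
  have : `|sin (N^-1 * x) - N^-1 * x| <= (N^-1 * x) ^+ 2.
    apply: le_trans (sin_bound _) _; by rewrite ler_piMr ?sqr_ge0// ?ge_min ?lexx.
  move=> /(ler_wpM2l (ltW N0)) /le_trans; apply.
  rewrite le_eqVlt; apply/orP; left; apply/eqP; field; exact: lt0r_neq0.
- exact: cvg_cst.
- by rewrite -[X in _ --> X](mul0r (x ^+ 2)); apply: cvgM; [exact: cvg_harmonic|exact: cvg_cst].
Qed.

Lemma cvg_expR_lin (A : R^nat) (al : R) : (forall n, A n <= 0) ->
  n.+1%:R ^+ 2 * A n @[n --> \oo] --> al ->
  n.+1%:R ^+ 2 * (expR (A n) - 1) @[n --> \oo] --> al.
Proof.
move=> A0 cA.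
rewrite -[X in _ --> X]addr0.
have -> : (fun n => n.+1%:R ^+ 2 * (expR (A n) - 1)) =
    (fun n => n.+1%:R ^+ 2 * A n + n.+1%:R ^+ 2 * (expR (A n) - 1 - A n)).
  by apply/funext => n; ring.
apply: cvgD => //.
apply/norm_cvg0P; apply: (@squeeze_cvgr _ _ _ _ (fun=> 0)
  (fun n => (n.+1%:R ^+ 2 * A n) ^+ 2 * n.+1%:R^-1 ^+ 2)).
- apply: nearW => n; rewrite normr_ge0/=.
  set N := n.+1%:R; have N0 : 0 < N by rewrite /N ltr0n.
  have -> : (N ^+ 2 * A n) ^+ 2 * N^-1 ^+ 2 = N ^+ 2 * A n ^+ 2.
    by field; exact: lt0r_neq0.
  rewrite normrM ger0_norm ?sqr_ge0// ler_wpM2l ?sqr_ge0//.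
  (* For [a = A n <= 0], the bounds [1 + a <= expR a] and [(1 - a) * expR a <= 1] give
     [0 <= expR a - 1 - a <= a ^+ 2]. *)
  have h1 := expR_ge1Dx (A n); have h2 := expR_ge1Dx (- A n).
  rewrite ger0_norm; last lra.
  move: h2; rewrite expRN => h2.
  have e0 := expR_gt0 (A n).
  have : (1 - A n) * expR (A n) <= 1 by rewrite -ler_pdivlMr// div1r.
  have := A0 n; move: h1; set E := expR _; set a := A n => h1 a0 h3.
  by nra.
- exact: cvg_cst.
- rewrite -[X in _ --> X](mulr0 (al ^+ 2)); apply: cvgM.
    by rewrite expr2; under eq_fun do rewrite expr2; exact: cvgM.
  by rewrite -(mulr0 0); under eq_fun do rewrite expr2; apply: cvgM; exact: cvg_harmonic.
Qed.

Lemma cvg_cos_lin (B : R^nat) (be : R) :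
  n.+1%:R * B n @[n --> \oo] --> be ->
  n.+1%:R ^+ 2 * 2 * (1 - cos (B n)) @[n --> \oo] --> be ^+ 2.
Proof.
move=> cB.
rewrite -[X in _ --> X]subr0.
have -> : (fun n => n.+1%:R ^+ 2 * 2 * (1 - cos (B n))) =
    (fun n => (n.+1%:R * B n) ^+ 2 - n.+1%:R ^+ 2 * 2 * (cos (B n) - 1 + B n ^+ 2 / 2)).
  by apply/funext => n; field.
apply: cvgB; first by rewrite expr2; under eq_fun do rewrite expr2; exact: cvgM.
apply/norm_cvg0P; apply: (@squeeze_cvgr _ _ _ _ (fun=> 0)
  (fun n => 2 * `|n.+1%:R * B n| ^+ 3 * n.+1%:R^-1)).
- apply: nearW => n; rewrite normr_ge0/=.
  set N := n.+1%:R; have N0 : 0 < N by rewrite /N ltr0n.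
  have -> : 2 * `|N * B n| ^+ 3 * N^-1 = N ^+ 2 * 2 * (`|B n| ^+ 2 * `|B n|).
    by rewrite normrM (ger0_norm (ltW N0)); field; exact: lt0r_neq0.
  rewrite normrM ger0_norm ?mulr_ge0 ?sqr_ge0// ler_wpM2l ?mulr_ge0 ?sqr_ge0//.
  apply: le_trans (cos_quad_bound _) _.
  by rewrite real_normK ?num_real// ler_wpM2l ?sqr_ge0// ge_min lexx orbT.
- exact: cvg_cst.
- rewrite -[X in _ --> X](mulr0 (2 * `|be| ^+ 3)); apply: cvgM; last exact: cvg_harmonic.
  apply: cvgM; first exact: cvg_cst.
  have cn : `|n.+1%:R * B n| @[n --> \oo] --> `|be| by exact: cvg_norm.
  rewrite !exprS expr0 mulr1; under eq_fun do rewrite !exprS expr0 mulr1.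
  by apply: cvgM => //; exact: cvgM.
Qed.

Lemma cvg_sin_lin_seq (B : R^nat) (be : R) :
  n.+1%:R * B n @[n --> \oo] --> be ->
  n.+1%:R * sin (B n) @[n --> \oo] --> be.
Proof.
move=> cB; rewrite -[X in _ --> X]addr0.
have -> : (fun n => n.+1%:R * sin (B n)) =
    (fun n => n.+1%:R * B n + n.+1%:R * (sin (B n) - B n)).
  by apply/funext => n; ring.
apply: cvgD => //.
apply/norm_cvg0P; apply: (@squeeze_cvgr _ _ _ _ (fun=> 0)
  (fun n => (n.+1%:R * B n) ^+ 2 * n.+1%:R^-1)).
- apply: nearW => n; rewrite normr_ge0/=.
  set N := n.+1%:R; have N0 : 0 < N by rewrite /N ltr0n.
  have -> : (N * B n) ^+ 2 * N^-1 = N * B n ^+ 2 by field; exact: lt0r_neq0.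
  rewrite normrM (ger0_norm (ltW N0)) (ler_wpM2l (ltW N0))//.
  apply: le_trans (sin_bound _) _; by rewrite ler_piMr ?sqr_ge0// ?ge_min ?lexx.
- exact: cvg_cst.
- rewrite -[X in _ --> X](mulr0 (be ^+ 2)); apply: cvgM; last exact: cvg_harmonic.
  by rewrite expr2; under eq_fun do rewrite expr2; exact: cvgM.
Qed.

End trigonometric_bounds.

Section characteristic_functions.
Context d (T : measurableType d) (R : realType) (P : probability T R).

Lemma charfunE (X : T -> R) z : charfun P X z =
  Complex (\int[P]_w cos (z * X w)) (\int[P]_w sin (z * X w)).
Proof.
rewrite /charfun /cintegral /cexp /=; congr Complex; apply: eq_Rintegral => w _.
  by rewrite expR0 mul1r.
by rewrite expR0 mul1r.
Qed.

Lemma rintegrable_cos (X : T -> R) : measurable_fun setT X ->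
  rintegrable P (fun w => cos (X w)).
Proof.
move=> mX; apply: (@bounded_rintegrable _ _ _ _ _ 1).
  by apply: (measurableT_comp _ mX); exact: measurable_cos.
by move=> w; exact: cos_max.
Qed.

Lemma rintegrable_sin (X : T -> R) : measurable_fun setT X ->
  rintegrable P (fun w => sin (X w)).
Proof.
move=> mX; apply: (@bounded_rintegrable _ _ _ _ _ 1).
  by apply: (measurableT_comp _ mX); exact: measurable_sin.
by move=> w; rewrite ler_norml sin_geN1 sin_le1.
Qed.

End characteristic_functions.

(** Real part of the Lévy exponent. Its integrand, like that of [log_cf_im], vanishes at 0, so that
    integrating over the whole line gives the same value as removing the origin. *)
Definition log_cf_re (R : realType) (b : R) (nu : {measure set R -> \bar R}) z :=
  - (b ^+ 2 * z ^+ 2 / 2) + \int[nu]_x (cos (z * x) - 1).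

Definition log_cf_im (R : realType) (gamma : R) (nu : {measure set R -> \bar R}) z :=
  gamma * z + \int[nu]_x (sin (z * x) - z * x * \1_[set y | `|y| <= 1] x).

Lemma levy_exponentE (R : realType) (gamma b : R) (nu : {measure set R -> \bar R}) z :
  levy_exponent gamma b nu z = Complex (log_cf_re b nu z) (log_cf_im gamma nu z).
Proof.
rewrite /levy_exponent /cintegral /cexp /log_cf_re /log_cf_im.
rewrite [in RHS](_ : \int[nu]_x (cos (z * x) - 1) = \int[nu]_(x in ~` [set 0])
   (cos (z * x) - 1)); last first.
  rewrite [RHS]Rintegral_mkcond; apply: eq_Rintegral => x _; rewrite patchE.
  by case: ifPn => // /negP; rewrite inE/= => /contrapT ->; rewrite mulr0 cos0 subrr.
rewrite [in RHS](_ : \int[nu]_x (sin (z * x) - z * x * \1_[set y | `|y| <= 1] x) =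
   \int[nu]_(x in ~` [set 0]) (sin (z * x) - z * x * \1_[set y | `|y| <= 1] x)); last first.
  rewrite [RHS]Rintegral_mkcond; apply: eq_Rintegral => x _; rewrite patchE.
  by case: ifPn => // /negP; rewrite inE/= => /contrapT ->; rewrite mulr0 sin0 mul0r subrr.
apply/eqP; rewrite eq_complex /=; apply/andP; split; apply/eqP.
- rewrite !add0r oppr0 /=. congr (_ + _). apply: eq_Rintegral => x _.
  by rewrite expR0 mul1r addr0.
- rewrite subr0; congr (_ + _); apply: eq_Rintegral => x _.
  by rewrite expR0 mul1r subr0.
Qed.

Lemma cexp_scale (R : realType) (v : R) (a c : R) :
  cexp ((v%:C)%C * Complex a c) = Complex (expR (v * a) * cos (v * c)) (expR (v * a) * sin (v * c)).
Proof.
by rewrite /cexp /= !mul0r subr0 addr0.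
Qed.

Section cumulant.
Context (R : realType).

(* [eps] is a common modulus for the second-order Taylor remainders at 0 of the
   real and imaginary parts of the cumulant. *)
Record cumulant_expansion (pre pim : R -> R) (m s2 : R) (eps : R -> R) : Prop :=
  CumulantExpansion {
  ce_s2_ge0 : 0 <= s2 ;
  ce_re_le0 : forall z, pre z <= 0 ;
  ce_re : forall z, `|pre z + s2 * z ^+ 2 / 2| <= z ^+ 2 * eps `|z| ;
  ce_im : forall z, `|pim z - m * z| <= z ^+ 2 * eps `|z| ;
  ce_eps_ge0 : forall x, 0 <= x -> 0 <= eps x ;
  ce_eps_mono : forall x y, 0 <= x -> x <= y -> eps x <= eps y ;
  ce_eps_bound : exists2 C, 0 <= C & forall x, 0 <= x -> eps x <= C ;
  ce_eps_0 : forall e, 0 < e -> exists2 x, 0 < x & eps x < e }.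

Variables (nu : {measure set R -> \bar R}) (gamma b : R).
Hypothesis nu_levy : levy_measure nu.

Let mcos z : measurable_fun setT (fun x : R => cos (z * x)).
Proof.
have mz : measurable_fun setT (fun x : R => z * x) by apply: measurable_funM.
by apply: (measurableT_comp _ mz); exact: measurable_cos.
Qed.

Let msin z : measurable_fun setT (fun x : R => sin (z * x)).
Proof.
have mz : measurable_fun setT (fun x : R => z * x) by apply: measurable_funM.
by apply: (measurableT_comp _ mz); exact: measurable_sin.
Qed.

Let min_int : rintegrable nu (fun x : R => Num.min 1 (x ^+ 2)).
Proof.
apply: ge0_rintegrableP.
- by apply: measurable_minr => //; exact: measurable_funX.
- by move=> x; rewrite le_min ler01 sqr_ge0.
- exact: nu_levy.2.
Qed.

Let cos1_int z : rintegrable nu (fun x => cos (z * x) - 1).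
Proof.
apply: (le_rintegrable _ _ (rintegrableZ (2 + z ^+ 2) min_int)).
  exact: measurable_funB.
move=> x; have := cos_ge_quad (z * x); have := cos_le1 (z * x).
have := cos_geN1 (z * x) => c1 c2 c3.
have z2 := sqr_ge0 z; have x2 := sqr_ge0 x.
rewrite ler0_norm ?subr_le0// opprB.
have [x1|x1] := leP 1 (x ^+ 2); first by rewrite mulr1; lra.
rewrite mulrDl; move: c3; rewrite exprMn.
have : 0 <= z ^+ 2 * x ^+ 2 by rewrite mulr_ge0.
lra.
Qed.

Lemma sqr_integrable_of_cumulant (M : R) :
  (\forall n \near \oo, - log_cf_re b nu n.+1%:R^-1 <= n.+1%:R^-1 ^+ 2 * M) ->
  rintegrable nu (fun x => x ^+ 2).
Proof.
move=> hM.
pose f n (x : R) := (n.+1%:R ^+ 2 * 2) * - (cos (n.+1%:R^-1 * x) - 1).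
have [] // := @fatou_cvg _ _ _ nu f (fun x => x ^+ 2) (2 * M).
- by move=> n; apply/rintegrableZ/rintegrableN/cos1_int.
- by move=> n x; rewrite /f mulr_ge0// ?mulr_ge0 ?exprn_ge0.
- exact: cvg_cos_quad.
- move: hM; apply: filterS => n.
  rewrite /f RintZ; last by apply/rintegrableN/cos1_int.
  rewrite RintN; last exact: cos1_int.
  rewrite /log_cf_re; set I := \int[nu]_x _; set N := n.+1%:R => h.
  have N0 : 0 < N by rewrite /N ltr0n.
  have b0 : 0 <= b ^+ 2 * N^-1 ^+ 2 / 2 by rewrite divr_ge0// mulr_ge0 ?sqr_ge0.
  have {h}h : - I <= N^-1 ^+ 2 * M by apply: le_trans h; rewrite opprD opprK lerDr.
  have : N ^+ 2 * - I <= N ^+ 2 * (N^-1 ^+ 2 * M) by rewrite ler_wpM2l ?sqr_ge0.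
  by rewrite mulrA -exprMn divff ?gt_eqF// expr1n mul1r; lra.
Qed.

Hypothesis x2_int : rintegrable nu (fun x => x ^+ 2).

(** The pointwise trigonometric remainders integrated against [nu]: nondecreasing on the half-line,
    bounded by twice the integral of [x ^+ 2], and small near 0 by dominated convergence. The factor
    2 is a margin; any constant at least 1 would do. *)
Let eps (z : R) := 2 * \int[nu]_x (x ^+ 2 * Num.min 1 `|z * x|).

Let eps_meas z : measurable_fun setT (fun x : R => x ^+ 2 * Num.min 1 `|z * x|).
Proof.
apply: measurable_funM; first exact: measurable_funX.
apply: measurable_minr => //.
by apply: measurableT_comp => //; apply: measurable_funM.
Qed.

Let eps_int z : rintegrable nu (fun x => x ^+ 2 * Num.min 1 `|z * x|).
Proof.
apply: (le_rintegrable (eps_meas z) _ x2_int) => x.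
rewrite normrM ger0_norm ?sqr_ge0// ler_piMr ?sqr_ge0//.
by rewrite ger0_norm ?le_min ?ler01//= ge_min lexx.
Qed.

Let x1_int : rintegrable nu (fun x : R => x * (1 - \1_[set y | `|y| <= 1] x)).
Proof.
apply: le_rintegrable x2_int.
  apply: measurable_funM => //; apply: measurable_funB => //.
  apply: measurable_indic.
  rewrite (_ : [set y | _] = `[-1, 1]%classic)//.
  by apply/seteqP; split => x /=; rewrite in_itv/= ler_norml.
move=> x; rewrite indicE; have [x1|x1] := leP `|x| 1.
  by rewrite mem_set// subrr mulr0 normr0 sqr_ge0.
rewrite memNset/=; last by rewrite leNgt x1.
rewrite subr0 mulr1 -[leRHS]real_normK ?num_real// expr2.
by rewrite ler_peMl// ltW.
Qed.

Let sin1_int z : rintegrable nu (fun x => sin (z * x) - z * x).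
Proof.
apply: (le_rintegrable _ _ (rintegrableZ (z ^+ 2) (eps_int z))).
  by apply: measurable_funB => //; apply: measurable_funM.
move=> x; have := sin_bound (z * x).
by rewrite exprMn mulrA.
Qed.

Lemma levy_cumulant_expansion : exists m s2 eps,
  cumulant_expansion (log_cf_re b nu) (log_cf_im gamma nu) m s2 eps.
Proof.
(* Compensating all jumps instead of those of size at most 1 moves the mean of the large jumps into
   the drift; it is finite because [|x| <= x ^+ 2] there. The variance adds the Gaussian part and
   the second moment of the jumps. *)
exists (gamma + \int[nu]_x (x * (1 - \1_[set y | `|y| <= 1] x))).
exists (b ^+ 2 + \int[nu]_x (x ^+ 2)), eps.
have int_ge0 z : 0 <= \int[nu]_x (x ^+ 2 * Num.min 1 `|z * x|).
  apply: Rintegral_ge0 => x _.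
  by rewrite mulr_ge0 ?sqr_ge0// le_min ler01 normr_ge0.
split.
- rewrite addr_ge0 ?sqr_ge0//; apply: Rintegral_ge0 => x _; exact: sqr_ge0.
- move=> z; rewrite /log_cf_re.
  have : \int[nu]_x (cos (z * x) - 1) <= \int[nu]_x 0.
    by apply: ler_Rint => //; exact: rintegrable0.
  rewrite (Rint0 nu) => h.
  have : 0 <= b ^+ 2 * z ^+ 2 / 2 by rewrite divr_ge0// mulr_ge0 ?sqr_ge0.
  lra.
- move=> z.
  have -> : log_cf_re b nu z + (b ^+ 2 + \int[nu]_x (x ^+ 2)) * z ^+ 2 / 2 =
    \int[nu]_x (cos (z * x) - 1 + z ^+ 2 / 2 * x ^+ 2).
    rewrite RintD//; last exact: rintegrableZ.
    by rewrite RintZ// /log_cf_re; lra.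
  apply: (le_trans (ler_norm_Rint _)).
    by apply: rintegrableD => //; exact: rintegrableZ.
  have : \int[nu]_x `|cos (z * x) - 1 + z ^+ 2 / 2 * x ^+ 2| <= \int[nu]_x (z ^+ 2 * (x ^+ 2 * Num.min 1 `|z * x|)).
    { apply: ler_Rint => //.
    + by apply/rintegrable_norm/rintegrableD => //; exact: rintegrableZ.
    + exact: rintegrableZ.
    + move=> x; have := cos_quad_bound (z * x).
      by rewrite [in X in _ <= X]exprMn mulrA; apply: le_trans; rewrite exprMn mulrAC.
    }
  move=> /le_trans; apply; rewrite RintZ// ler_wpM2l ?sqr_ge0// /eps.
  under [in leRHS]eq_Rint do rewrite normrM normr_id -normrM.
  by rewrite ler_peMl// ler1n.
- move=> z.
  have -> : log_cf_im gamma nu z -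
      (gamma + \int[nu]_x (x * (1 - \1_[set y | `|y| <= 1] x))) * z =
      \int[nu]_x (sin (z * x) - z * x).
    rewrite /log_cf_im.
    rewrite (_ : \int[nu]_x (sin (z * x) - z * x * \1_[set y | `|y| <= 1] x) =
       \int[nu]_x ((sin (z * x) - z * x) +
                   z * (x * (1 - \1_[set y | `|y| <= 1] x)))); last first.
      by apply: eq_Rint => x; ring.
    rewrite RintD//; last exact: rintegrableZ.
    by rewrite RintZ//; ring.
  apply: (le_trans (ler_norm_Rint _)) => //.
  have : \int[nu]_x `|sin (z * x) - z * x| <= \int[nu]_x (z ^+ 2 * (x ^+ 2 * Num.min 1 `|z * x|)).
    { apply: ler_Rint => //.
    + exact: rintegrable_norm.
    + exact: rintegrableZ.
    + by move=> x; have := sin_bound (z * x); rewrite exprMn mulrA.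
    }
  move=> /le_trans; apply; rewrite RintZ// ler_wpM2l ?sqr_ge0// /eps.
  under [in leRHS]eq_Rint do rewrite normrM normr_id -normrM.
  by rewrite ler_peMl// ler1n.
- by move=> x x0; rewrite /eps mulr_ge0.
- move=> x y x0 xy; rewrite /eps ler_wpM2l//.
  apply: ler_Rint => // t; rewrite ler_wpM2l ?sqr_ge0// le_min !ge_min lexx/=.
  apply/orP; right; rewrite !normrM ler_wpM2r// !ger0_norm//.
  exact: le_trans xy.
- exists (2 * \int[nu]_x (x ^+ 2)).
    by rewrite mulr_ge0//; apply: Rintegral_ge0 => x _; exact: sqr_ge0.
  move=> x x0; rewrite /eps ler_wpM2l//; apply: ler_Rint => // t.
  by rewrite ler_piMr ?sqr_ge0// ge_min lexx.
- move=> e e0.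
  have [_ cv] : rintegrable nu (fun=> 0) /\
      \int[nu]_x (x ^+ 2 * Num.min 1 `|n.+1%:R^-1 * x|) @[n --> \oo] --> \int[nu]_x 0.
    { apply: (@cvg_RintD _ _ _ nu (fun n x => x ^+ 2 * Num.min 1 `|n.+1%:R^-1 * x|)
      (fun=> 0) (fun x => x ^+ 2)) => //.
      move=> n x.
      rewrite normrM ger0_norm ?sqr_ge0// ler_piMr ?sqr_ge0//.
      by rewrite ger0_norm ?le_min ?ler01//= ge_min lexx.
    move=> x; apply: (@squeeze_cvgr _ _ _ _ (fun=> 0) (fun n => x ^+ 2 * `|n.+1%:R^-1 * x|)).
    + apply: nearW => n; rewrite mulr_ge0 ?sqr_ge0 ?le_min ?ler01//=.
      by rewrite ler_wpM2l ?sqr_ge0// ge_min lexx orbT.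
    + exact: cvg_cst.
    + rewrite -[X in _ --> X](mulr0 (x ^+ 2)); apply: cvgM; first exact: cvg_cst.
      rewrite -(normr0 R); apply: cvg_norm; rewrite -[X in _ --> X](mul0r x).
      by apply: cvgM; [exact: cvg_harmonic|exact: cvg_cst].
    }
  move/cvgrPdist_lt : cv => /(_ (e / 2)) []; first by rewrite divr_gt0.
  rewrite (Rint0 nu) => N _ /(_ N (leqnn N)) /=; rewrite sub0r normrN ger0_norm// => h.
  exists N.+1%:R^-1; first by rewrite invr_gt0 ltr0n.
  by rewrite /eps; lra.
Qed.

End cumulant.

Section moments.
Context d (T : measurableType d) (R : realType) (P : probability T R).
Variables (pre pim : R -> R) (m s2 : R) (eps : R -> R).
Hypothesis ce : cumulant_expansion pre pim m s2 eps.

(** Polar form of the exponential of [v] times the cumulant: [expR (v * pre z)] is the modulus and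
    [v * pim z] the argument. The number [v] is the area of the set on which the basis is evaluated,
    and 1 for the seed. *)
Definition has_cf (X : T -> R) (v : R) := forall z,
  \int[P]_w cos (z * X w) = expR (v * pre z) * cos (v * pim z) /\
  \int[P]_w sin (z * X w) = expR (v * pre z) * sin (v * pim z).

Lemma cvg_cumulant_re : n.+1%:R ^+ 2 * pre n.+1%:R^-1 @[n --> \oo] --> - s2 / 2.
Proof.
have -> : (fun n => n.+1%:R ^+ 2 * pre n.+1%:R^-1) =
    (fun n => - s2 / 2 + n.+1%:R ^+ 2 * (pre n.+1%:R^-1 + s2 * n.+1%:R^-1 ^+ 2 / 2)).
  apply/funext => n; have N0 : (n.+1%:R : R) != 0 by rewrite pnatr_eq0.
  by move: (n.+1%:R) N0 => N N0; field.
rewrite -[X in _ --> X]addr0; apply: cvgD; first exact: cvg_cst.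
apply/norm_cvg0P; apply/cvgrPdist_lt => e e0.
have [x x0 xe] := ce_eps_0 ce e0.
near=> n.
have Nx : n.+1%:R^-1 <= x.
  near: n; have := @cvg_harmonic R; move/cvgrPdist_le => /(_ x x0).
  apply: filterS => n; rewrite sub0r normrN ger0_norm ?invr_ge0//.
rewrite sub0r normrN normr_id normrM ger0_norm ?sqr_ge0//.
move: Nx; set N := n.+1%:R => Nx.
have N0 : 0 < N by rewrite /N ltr0n.
have N1 : 0 <= N^-1 by rewrite invr_ge0 ltW.
have := ce_re ce N^-1; rewrite (ger0_norm N1) => h.
have {}h := ler_wpM2l (sqr_ge0 N) h.
apply: le_lt_trans h _; rewrite mulrA -exprMn divff ?gt_eqF// expr1n mul1r.
by apply: le_lt_trans xe; apply: (ce_eps_mono ce) => //; rewrite invr_ge0 ltW.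
Unshelve. all: by end_near.
Qed.

Lemma cvg_cumulant_im : n.+1%:R * pim n.+1%:R^-1 @[n --> \oo] --> m.
Proof.
have -> : (fun n => n.+1%:R * pim n.+1%:R^-1) =
    (fun n => m + n.+1%:R * (pim n.+1%:R^-1 - m * n.+1%:R^-1)).
  apply/funext => n; have N0 : (n.+1%:R : R) != 0 by rewrite pnatr_eq0.
  by move: (n.+1%:R) N0 => N N0; field.
rewrite -[X in _ --> X]addr0; apply: cvgD; first exact: cvg_cst.
have [C C0 hC] := ce_eps_bound ce.
apply/norm_cvg0P; apply: (@squeeze_cvgr _ _ _ _ (fun=> 0) (fun n => C * n.+1%:R^-1)).
- apply: nearW => n; rewrite normr_ge0/=.
  set N := n.+1%:R; have N0 : 0 < N by rewrite /N ltr0n.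
  rewrite normrM (ger0_norm (ltW N0)).
  have N1 : 0 <= N^-1 by rewrite invr_ge0 ltW.
  have := ce_im ce N^-1; rewrite (ger0_norm N1) => h.
  have {}h := le_trans h (ler_wpM2l (sqr_ge0 N^-1) (hC _ N1)).
  have {}h := ler_wpM2l (ltW N0) h.
  apply: le_trans h _; rewrite le_eqVlt; apply/orP; left; apply/eqP; field.
  exact: lt0r_neq0.
- exact: cvg_cst.
- by rewrite -[X in _ --> X](mulr0 C); apply: cvgM; [exact: cvg_cst|exact: cvg_harmonic].
Qed.

(** Along [z = 1 / (n + 1)] the rescaled second difference of the characteristic function converges,
    and Fatou makes [X] square integrable. Dominated convergence, by [X ^+ 2] for cosines and [|X|]
    for sines, then identifies both moments. *)
Lemma moments_of_cf X v : 0 <= v -> measurable_fun setT X -> has_cf X v ->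
  [/\ sqintegrable P X, \int[P]_w X w = v * m &
      \int[P]_w X w ^+ 2 = v * s2 + (v * m) ^+ 2].
Proof.
move=> v0 mX cfX.
pose A n := v * pre n.+1%:R^-1; pose B n := v * pim n.+1%:R^-1.
have mcX z : measurable_fun setT (fun w => z * X w) by apply: measurable_funM.
have icX z : rintegrable P (fun w => cos (z * X w)) by apply: rintegrable_cos.
have isX z : rintegrable P (fun w => sin (z * X w)) by apply: rintegrable_sin.
have A0 n : A n <= 0 by rewrite /A mulr_ge0_le0// (ce_re_le0 ce).
have cA : n.+1%:R ^+ 2 * A n @[n --> \oo] --> v * (- s2 / 2).
  under eq_fun do rewrite /A mulrCA.
  by apply: cvgM; [exact: cvg_cst|exact: cvg_cumulant_re].
have cB : n.+1%:R * B n @[n --> \oo] --> v * m.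
  under eq_fun do rewrite /B mulrCA.
  by apply: cvgM; [exact: cvg_cst|exact: cvg_cumulant_im].
have cE : expR (A n) @[n --> \oo] --> (1 : R).
  have -> : (fun n => expR (A n)) =
      (fun n => 1 + n.+1%:R ^+ 2 * (expR (A n) - 1) * (n.+1%:R^-1 * n.+1%:R^-1)).
    apply/funext => n; have N0 : (n.+1%:R : R) != 0 by rewrite pnatr_eq0.
  by move: (n.+1%:R) N0 => N N0; field.
  rewrite -[X in _ --> X]addr0; apply: cvgD; first exact: cvg_cst.
  rewrite -(mulr0 (v * (- s2 / 2))); apply: cvgM; first exact: cvg_expR_lin.
  by rewrite -(mulr0 0); apply: cvgM; exact: cvg_harmonic.
pose f n w := n.+1%:R ^+ 2 * 2 * - (cos (n.+1%:R^-1 * X w) - 1).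
have fi n : rintegrable P (f n).
  by apply/rintegrableZ/rintegrableN/rintegrableB => //; exact: rintegrable_cst.
have Ef n : \int[P]_w f n w = n.+1%:R ^+ 2 * 2 * (1 - expR (A n) * cos (B n)).
  rewrite /f RintZ; last by apply/rintegrableN/rintegrableB => //; exact: rintegrable_cst.
  rewrite RintN; last by apply: rintegrableB => //; exact: rintegrable_cst.
  by rewrite RintB ?Rint_cst ?(cfX _).1 ?opprB//; exact: rintegrable_cst.
have cEf : \int[P]_w f n w @[n --> \oo] --> v * s2 + (v * m) ^+ 2.
  under eq_fun do rewrite Ef.
  have -> : (fun n => n.+1%:R ^+ 2 * 2 * (1 - expR (A n) * cos (B n))) =
    (fun n => -2 * (n.+1%:R ^+ 2 * (expR (A n) - 1)) +
              expR (A n) * (n.+1%:R ^+ 2 * 2 * (1 - cos (B n)))).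
    by apply/funext => n; ring.
  apply: cvgD.
    have -> : v * s2 = -2 * (v * (- s2 / 2)) by field.
    by apply: cvgM; [exact: cvg_cst|exact: cvg_expR_lin].
  rewrite -[X in _ --> X]mul1r; apply: cvgM => //.
  exact: cvg_cos_lin.
have [X2i _] : rintegrable P (fun w => X w ^+ 2) /\
    \int[P]_w X w ^+ 2 <= v * s2 + (v * m) ^+ 2 + 1.
  { apply: (@fatou_cvg _ _ _ P f) => //.
  - move=> n w; by rewrite /f mulr_ge0 ?mulr_ge0 ?sqr_ge0// oppr_ge0 subr_le0 cos_le1.
  - by move=> w; exact: cvg_cos_quad.
  - move/cvgrPdist_le : cEf => /(_ 1 ltr01); apply: filterS => n.
    rewrite ler_distlC => /andP[_]; by rewrite addrC. }
have sX : sqintegrable P X by split.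
split => //.
- have [_ c1] : rintegrable P X /\
    \int[P]_w (n.+1%:R * sin (n.+1%:R^-1 * X w)) @[n --> \oo] --> \int[P]_w X w.
    { apply: (@cvg_RintD _ _ _ P (fun n w => n.+1%:R * sin (n.+1%:R^-1 * X w)) X (fun w => `|X w|)).
    + by move=> n; apply: measurable_funM => //; apply: rintegrable_measurable (isX _).
    + exact/rintegrable_norm/sqintegrable_int.
    + move=> n w; set N := n.+1%:R; have N0 : 0 < N by rewrite /N ltr0n.
      rewrite normrM (ger0_norm (ltW N0)) -ler_pdivlMl//.
      apply: le_trans (sin_le_norm _) _.
      by rewrite normrM ger0_norm// invr_ge0 ltW.
    + by move=> w; exact: cvg_sin_lin. }
  apply: (cvg_unique _ c1) => //.
  have -> : (fun n => \int[P]_w (n.+1%:R * sin (n.+1%:R^-1 * X w))) =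
      (fun n => expR (A n) * (n.+1%:R * sin (B n))).
    by apply/funext => n; rewrite RintZ// (cfX _).2 mulrCA.
  rewrite -[v * m]mul1r; apply: cvgM => //.
  exact: cvg_sin_lin_seq.
- have [_ c2] : rintegrable P (fun w => X w ^+ 2) /\
    \int[P]_w f n w @[n --> \oo] --> \int[P]_w X w ^+ 2.
    { apply: (@cvg_RintD _ _ _ P f (fun w => X w ^+ 2) (fun w => X w ^+ 2)) => //.
    + by move=> n; apply: rintegrable_measurable (fi n).
    + move=> n w; rewrite /f; set N := n.+1%:R; have N0 : 0 < N by rewrite /N ltr0n.
      have c1 := cos_le1 (N^-1 * X w); have c2 := cos_ge_quad (N^-1 * X w).
      rewrite normrM ger0_norm ?mulr_ge0 ?sqr_ge0//.
      rewrite ger0_norm; last by lra.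
      have -> : X w ^+ 2 = N ^+ 2 * 2 * ((N^-1 * X w) ^+ 2 / 2).
        by field; exact: lt0r_neq0.
      rewrite ler_wpM2l ?mulr_ge0 ?sqr_ge0//.
      by move: c1 c2; set u := _ * X w; lra.
    + by move=> w; exact: cvg_cos_quad. }
  exact: (cvg_unique _ c2 cEf).
Qed.

End moments.

Section covariance_real.
Context d (T : measurableType d) (R : realType) (P : probability T R).

Lemma expectation_Rint (X : T -> R) : rintegrable P X ->
  'E_P[X]%E = (\int[P]_w X w)%:E.
Proof. by move=> iX; rewrite unlock Rint_fin. Qed.

Lemma covariance_Rint (X Y : T -> R) : sqintegrable P X -> sqintegrable P Y ->
  covariance P X Y = (\int[P]_w (X w * Y w) - \int[P]_w X w * \int[P]_w Y w)%:E.
Proof.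
move=> sX sY; have iX := sqintegrable_int sX; have iY := sqintegrable_int sY.
rewrite unlock (expectation_Rint iX) (expectation_Rint iY) /=.
set x := \int[P]_w X w; set y := \int[P]_w Y w.
have iXY := sqintegrableM sX sY.
have ic : rintegrable P (fun=> x * y) by exact: rintegrable_cst.
have i3 : rintegrable P (fun w => y * X w) by exact: rintegrableZ.
have i4 : rintegrable P (fun w => x * Y w) by exact: rintegrableZ.
have i5 := rintegrableD i3 i4; have i2 := rintegrableB i5 ic.
rewrite (_ : (_ * _)%R = (fun w => X w * Y w - (y * X w + x * Y w - x * y))); last first.
  by apply/funext => w; rewrite !fctE /=; ring.
rewrite expectation_Rint; last exact: rintegrableB.
congr (_%:E); rewrite (RintB iXY i2) (RintB i5 ic) (RintD i3 i4) (RintZ _ iX) (RintZ _ iY).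
by rewrite (Rint_cst P) -/x -/y; ring.
Qed.

End covariance_real.

Section seed.
Context d (T : measurableType d) (R : realType) (P : probability T R).
Variables (gamma b : R) (nu : {measure set R -> \bar R}) (L' : {RV P >-> R}).
Hypothesis nu_levy : levy_measure nu.
Hypothesis HL' : levy_seed L' gamma b nu.

Lemma seed_cf : has_cf P (log_cf_re b nu) (log_cf_im gamma nu) L' 1.
Proof.
move=> z; have := HL' z.
rewrite charfunE levy_exponentE /cexp /= => -[-> ->].
by rewrite !mul1r.
Qed.

Lemma seed_sqintegrable p0 : 2 < p0 ->
  ('E_P[fun w => (`|L' w| `^ p0)%R] < +oo)%E -> sqintegrable P L'.
Proof.
move=> p02 Ei; have mL : measurable_fun setT L' by [].
have p00 : 0 < p0 by apply: lt_trans p02.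
split => //.
have mp : measurable_fun setT (fun w => `|L' w| `^ p0).
  have mn : measurable_fun setT (fun w => `|L' w|) by exact: measurableT_comp.
  exact: (measurableT_comp (measurable_powR p0) mn).
have pi' : rintegrable P (fun w => `|L' w| `^ p0).
  apply: ge0_rintegrableP => //.
  by move: Ei; rewrite unlock.
apply: (le_rintegrable _ _ (rintegrableD (rintegrable_cst P 1) pi')).
  exact: measurable_funX.
move=> w; rewrite ger0_norm ?sqr_ge0// -real_normK ?num_real//.
have [h|h] := leP `|L' w| 1.
  by rewrite ler_wpDr ?powR_ge0// expr_le1.
rewrite ler_wpDl// -powR_mulrn ?normr_ge0// ler_powR//; last exact: ltW.
by rewrite ltW.
Qed.

(** A finite second moment of the seed forces [x ^+ 2] to be integrable under [nu]:
    [cos u >= 1 - u ^+ 2 / 2] bounds the modulus of the characteristic function from below near 0,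
    hence minus the real cumulant from above by a multiple of [h ^+ 2]. *)
Lemma seed_expansion : sqintegrable P L' -> exists m s2 eps,
  cumulant_expansion (log_cf_re b nu) (log_cf_im gamma nu) m s2 eps /\
  fine ('V_P[L'])%E = s2.
Proof.
move=> sL; set M := \int[P]_w L' w ^+ 2.
have M0 : 0 <= M by apply: Rintegral_ge0 => w _; exact: sqr_ge0.
have x2 : rintegrable nu (fun x => x ^+ 2).
  apply: (@sqr_integrable_of_cumulant R nu b nu_levy M).
  apply: filterS (nbhs_infty_ger M) => n nM.
  set N := n.+1%:R; set h := N^-1; set re := log_cf_re _ _ _.
  have N0 : 0 < N by rewrite /N ltr0n.
  have h0 : 0 <= h by rewrite /h invr_ge0 ltW.
  set t := h ^+ 2 * M / 2.
  have t0 : 0 <= t by rewrite /t divr_ge0// mulr_ge0 ?sqr_ge0.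
  have t1 : t <= 2^-1.
    rewrite /t -[leRHS]mul1r ler_wpM2r// /h expr2 -mulrA.
    have N1 : 1 <= N by rewrite /N ler1n.
    rewrite ler_pdivrMl// mulr1 ler_pdivrMl//.
    have MN : M <= N by apply: le_trans nM _; rewrite /N ler_nat.
    by apply: le_trans MN _; rewrite ler_peMr// ltW.
  have mL : measurable_fun setT (fun w => h * L' w) by apply: measurable_funM.
  have : 1 - t <= \int[P]_w cos (h * L' w).
    have i1 : rintegrable P (fun=> 1 : R) by exact: rintegrable_cst.
    have i2 : rintegrable P (fun w => (h ^+ 2 / 2) * L' w ^+ 2).
      exact: (rintegrableZ _ sL.2).
    have -> : 1 - t = \int[P]_w (1 - (h ^+ 2 / 2) * L' w ^+ 2).
      rewrite (RintB i1 i2) (Rint_cst P) (RintZ _ sL.2).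
      by rewrite /t /M; ring.
    apply: ler_Rint; [exact: rintegrableB|exact: rintegrable_cos|move=> w].
    by have := cos_ge_quad (h * L' w); rewrite exprMn mulrAC.
  rewrite (seed_cf _).1 mul1r -/re => h1.
  have h2 : 1 - t <= expR re.
    apply: le_trans h1 _; rewrite ler_piMr ?expR_ge0 ?cos_le1//.
  have -> : h ^+ 2 * M = 2 * t by rewrite /t; field.
  (* If [- re > 2 * t], then [1 - t <= expR re < expR (- (2 * t)) <= (1 + 2 * t)^-1]. This
     contradicts [(1 - t) * (1 + 2 * t) >= 1], valid for [0 <= t <= 1 / 2]; that range of [t] is the
     reason for asking [M <= n]. *)
  rewrite leNgt; apply/negP => ht.
  have h3 : expR re < expR (- (2 * t)) by rewrite ltr_expR ltrNr.
  have h4 : expR (- (2 * t)) * (1 + 2 * t) <= 1.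
    rewrite expRN -ler_pdivlMr ?invr_gt0 ?expR_gt0//; last by lra.
    rewrite div1r lef_pV2 ?posrE ?expR_gt0//; last by lra.
    exact: expR_ge1Dx.
  have : (1 - t) * (1 + 2 * t) < 1.
    apply: lt_le_trans h4; rewrite ltr_pM2r; last by lra.
    exact: le_lt_trans h2 h3.
  nra.
have [m [s2 [eps ce]]] := levy_cumulant_expansion gamma b nu_levy x2.
exists m, s2, eps; split => //.
have mL : measurable_fun setT L' by [].
have [_ E1 E2] := moments_of_cf ce ler01 mL seed_cf.
have Li := sqintegrable_int sL.
rewrite /variance (covariance_Rint sL sL) E1 !mul1r.
by rewrite /= (_ : \int[P]_w (L' w * L' w) = \int[P]_w L' w ^+ 2)// E2; ring.
Qed.

End seed.

(** * Levy bases and a Lindeberg bound *)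

Section levy_basis_theory.
Context d (T : measurableType d) (R : realType) (P : probability T R).
Variables (L : set (R * R) -> T -> R) (gamma b : R) (nu : {measure set R -> \bar R}).
Hypothesis HL : levy_basis P L gamma b nu.
Let pre := log_cf_re b nu.
Let pim := log_cf_im gamma nu.
Variables (m s2 : R) (eps : R -> R).
Hypothesis ce : cumulant_expansion pre pim m s2 eps.

Definition lam (A : set (R * R)) : R := fine (leb2 A).

Lemma lam_ge0 A : 0 <= lam A.
Proof. by rewrite /lam fine_ge0// /leb2 measure_ge0. Qed.

Lemma finite_borelI (A B : set (R * R)) : finite_borel A -> measurable B -> finite_borel (A `&` B).
Proof.
move=> [mA fA] mB; split; first exact: measurableI.
apply: le_lt_trans fA; apply: le_measure; rewrite ?inE//; exact: measurableI.
Qed.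

Lemma finite_borel0 : finite_borel (set0 : set (R * R)).
Proof. by split => //; rewrite /leb2 measure0. Qed.

Lemma finite_borelU (A B : set (R * R)) : finite_borel A -> finite_borel B -> finite_borel (A `|` B).
Proof.
move=> [mA fA] [mB fB]; split; first exact: measurableU.
apply: (@le_lt_trans _ _ (leb2 A + leb2 B)%E); last exact: lte_add_pinfty.
exact: measureU2.
Qed.

Lemma lamU A B : finite_borel A -> finite_borel B -> A `&` B = set0 ->
  lam (A `|` B) = lam A + lam B.
Proof.
move=> [mA fA] [mB fB] AB0; rewrite /lam /leb2 measureU// fineD//.
- by rewrite ge0_fin_numE.
- by rewrite ge0_fin_numE.
Qed.

Lemma levy_cf A : finite_borel A -> has_cf P pre pim (L A) (lam A).
Proof.
move=> fA z; have := levy_basis_charfun HL fA z.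
by rewrite charfunE levy_exponentE cexp_scale => -[-> ->].
Qed.

Lemma levy_measurable A : finite_borel A -> measurable_fun setT (L A).
Proof. exact: (levy_basis_measurable HL). Qed.

Lemma levy_moments A : finite_borel A ->
  [/\ sqintegrable P (L A), \int[P]_w L A w = lam A * m &
      \int[P]_w L A w ^+ 2 = lam A * s2 + (lam A * m) ^+ 2].
Proof.
move=> fA; apply: (moments_of_cf ce (lam_ge0 A)).
  exact: levy_measurable.
exact: levy_cf.
Qed.

(** Countable additivity on the constant family [set0] makes the series with constant term
    [L set0 w] converge, and its increments then tend to 0. *)
Lemma levy_set0 : {ae P, forall w, L set0 w = 0}.
Proof.
have := levy_basis_sigma_additive HL (A := fun=> set0) (fun=> measurable0).
have -> : \bigcup_(i in [set: nat]) (set0 : set (R * R)) = set0 by rewrite bigcup0.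
move=> /(_ (@trivIset_set0 _ _ _)); rewrite /leb2 measure0 => /(_ (ltry 0)).
apply: filterS => w cw.
have c1 : (series (fun=> L set0 w) n.+1) @[n --> \oo] --> L set0 w.
  by rewrite (cvg_shiftS (series _)).
have c2 : (series (fun=> L set0 w) n.+1 - series (fun=> L set0 w) n) @[n --> \oo]
   --> L set0 w - L set0 w by apply: cvgB.
move: c2; rewrite subrr.
under eq_fun do rewrite seriesSB.
by move=> /(cvg_unique _ (cvg_cst _)); exact.
Qed.

(** Finite additivity follows from countable additivity after padding the family with [set0], where
    [L] vanishes almost surely. *)
Lemma levy_additive n (A : 'I_n -> set (R * R)) : (forall i, finite_borel (A i)) ->
  trivIset setT A ->
  {ae P, forall w, L (\bigcup_(i in setT) A i) w = \sum_(i < n) L (A i) w}.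
Proof.
move=> fA tA.
pose F k := if insub k is Some i then A i else set0.
have FE (i : 'I_n) : F i = A i by rewrite /F insubT// => h; congr A; exact: val_inj.
have Fn k : (n <= k)%N -> F k = set0 by move=> nk; rewrite /F insubF// ltnNge nk.
have UE : \bigcup_(i in setT) A i = \bigcup_k F k.
  apply/seteqP; split => [p [i _ Ap]|p [k _]]; first by exists i => //; rewrite FE.
  by rewrite /F; case: insubP => // i _ _ Ap; exists i.
have fF k : finite_borel (F k).
  by rewrite /F; case: insubP => // _; exact: finite_borel0.
have tF : trivIset setT F.
  apply/trivIsetP => i j _ _ ij; rewrite /F.
  case: insubP => [i' _ ii'|_]; last by rewrite set0I.
  case: insubP => [j' _ jj'|_]; last by rewrite setI0.
  move/trivIsetP : tA; apply => //.
  by apply: contra_neq ij => ij'; rewrite -ii' -jj' ij'.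
have fU : (leb2 (\bigcup_k F k) < +oo)%E.
  have -> : \bigcup_k F k = \big[setU/set0]_(k < n) F k.
    rewrite -bigcup_mkord; apply/seteqP; split => p [k] //=.
      move=> _ Fp; exists k => //=; rewrite ltnNge; apply/negP => nk.
      by move: Fp; rewrite Fn.
    by move=> _ Fp; exists k.
  suff : finite_borel (\big[setU/set0]_(k < n) F k) by case.
  apply: (big_ind (@finite_borel R)); [exact: finite_borel0|exact: finite_borelU|].
  by move=> i _; exact: fF.
have := levy_basis_sigma_additive HL (fun i => (fF i).1) tF fU.
rewrite UE; move: levy_set0; apply: filterS2 => w L0.
have : (series (fun i => L (F i) w)) k @[k --> \oo] --> \sum_(i < n) L (A i) w.
  apply: cvg_near_cst; exists n => // k /= nk.
  rewrite /series /= (big_cat_nat (n := n))//= big_mkord [X in _ + X]big_nat_cond.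
  rewrite [X in _ + X]big1 ?addr0.
    by apply: eq_bigr => i _; rewrite FE.
  by move=> i /andP[/andP[ni _] _]; rewrite Fn.
move=> c1 c2; exact: (cvg_unique _ c2 c1).
Qed.

End levy_basis_theory.

Lemma bigcup_ord_cond (T : Type) n (Q : pred 'I_n) (F : 'I_n -> set T) :
  \bigcup_(k in [set k | Q k]) F k = \big[setU/set0]_(k < n | Q k) F k.
Proof.
rewrite -bigcup_seq_cond; apply/seteqP; split => p [k /= kQ Fp]; exists k => //=.
  by rewrite mem_index_enum.
by case/andP: kQ.
Qed.

Lemma lam_sum (R : realType) n (Q : pred 'I_n) (A : 'I_n -> set (R * R)) :
  (forall i, finite_borel (A i)) -> trivIset setT A ->
  lam (\bigcup_(i in [set i | Q i]) A i) = \sum_(i < n | Q i) lam (A i).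
Proof.
move=> fA tA; rewrite bigcup_ord_cond /lam /leb2 measure_bigsetU_ord//; last first.
  by move=> i; case: (fA i).
transitivity (fine (\sum_(i < n | Q i) (lam (A i))%:E)%E); last by rewrite sumEFin.
congr fine; apply: eq_bigr => i _; by rewrite /lam fineK// ge0_fin_numE ?(fA i).2.
Qed.

Lemma measurable_bigsum d (T : measurableType d) (R : realType) (I : Type)
    (s : seq I) (Q : pred I) (F : I -> T -> R) :
  (forall i, Q i -> measurable_fun setT (F i)) ->
  measurable_fun setT (fun x => \sum_(i <- s | Q i) F i x).
Proof.
move=> mF; elim: s => [|i s IH].
  by under eq_fun do rewrite big_nil; exact: measurable_cst.
under eq_fun do rewrite big_cons.
by case Qi : (Q i) => //; apply: measurable_funD => //; exact: mF.
Qed.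

(** * Atoms of a finite family of sets and sums of independent variables *)

Section atoms.
Context (R : realType) (K : finType) (A : K -> set (R * R)).
Hypothesis fA : forall i, finite_borel (A i).

Definition atom_index (k : 'I_#|{: {set K}}|) : {set K} := enum_val k.

(** Atoms of the algebra generated by the [A i], one for each subset of [K]: the points that lie in
    exactly the sets of that subset. The empty subset is given the empty atom, because the common
    complement of the [A i] may have infinite area. *)
Definition atom (k : 'I_#|{: {set K}}|) : set (R * R) :=
  [set p | atom_index k != finset.set0 /\
           (forall i, A i p <-> i \in atom_index k)].

Lemma atomP k p : atom k p -> forall i, A i p <-> i \in atom_index k.
Proof. by case. Qed.

Lemma atom_trivIset : trivIset setT atom.
Proof.
apply/trivIsetP => k l _ _ kl; rewrite -subset0 => p [[_ pk] [_ pl]].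
move/eqP: kl; apply; apply: enum_val_inj; apply/setP => i.
by apply/idP/idP => [/pk/pl|/pl/pk].
Qed.

Lemma atom_cover i : A i = \bigcup_(k in [set k | i \in atom_index k]) atom k.
Proof.
apply/seteqP; split => [p Ap|p [k /= ik kp]]; last by apply/(atomP kp).
pose s : {set K} := finset (fun i => `[< A i p >]).
have sP j : A j p <-> j \in s by rewrite inE; split => [/asboolP|/asboolP].
exists (enum_rank s); first by rewrite /= /atom_index enum_rankK; apply/sP.
rewrite /atom /= /atom_index enum_rankK; split => //.
by apply/set0Pn; exists i; apply/sP.
Qed.

Lemma atom_finite_borel k : finite_borel (atom k).
Proof.
have [k0|k0] := eqVneq (atom_index k) finset.set0.
  rewrite (_ : atom k = set0); first exact: finite_borel0.
  by rewrite -subset0 => p []; rewrite k0 eqxx.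
have /set0Pn[i ik] := k0.
have -> : atom k = A i `&` \bigcap_(j in [set: K])
    (if j \in atom_index k then A j else ~` A j).
  apply/seteqP; split => p.
    move=> kp; split; first by apply/(atomP kp).
    move=> j _; case: ifPn => jk; first by apply/(atomP kp).
    by move=> /(atomP kp); apply/negP.
  move=> [_ h]; split => // j.
  by have := h j Logic.I; case: ifPn => jk Aj; split.
apply: finite_borelI => //; apply: fin_bigcap_measurable => // j _.
by case: ifP => _; [exact: (fA j).1|apply: measurableC; exact: (fA j).1].
Qed.

Lemma lam_atoms i j : lam (A i `&` A j) =
  \sum_(k | (i \in atom_index k) && (j \in atom_index k)) lam (atom k).
Proof.
rewrite -lam_sum; [|exact: atom_finite_borel|exact: atom_trivIset].
congr lam; apply/seteqP; split => p.
  move=> [Ai Aj]; have := Ai; rewrite (atom_cover i) => -[k /= ik kp].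
  by exists k => //=; rewrite ik/=; apply/(atomP kp).
by move=> [k /= /andP[ik jk] kp]; split; apply/(atomP kp).
Qed.

(** Both sides are the integral of the square of [\sum_i th i * \1_(A i)], a function that is
    constant on each atom; the atoms diagonalize the quadratic form. *)
Lemma sum_lam_atoms (th : K -> R) :
  \sum_i \sum_j th i * th j * lam (A i `&` A j) =
  \sum_k lam (atom k) * (\sum_(i in atom_index k) th i) ^+ 2.
Proof.
under eq_bigr do under eq_bigr do rewrite lam_atoms mulr_sumr big_mkcond/=.
under eq_bigr do rewrite exchange_big/=.
rewrite exchange_big/=; apply: eq_bigr => k _.
rewrite expr2 [in RHS]mulr_suml [RHS]mulr_sumr [RHS]big_mkcond/=; apply: eq_bigr => i _.
case: ifPn => ik /=; last by rewrite big1// => j _.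
rewrite [in RHS]mulr_sumr [RHS]mulr_sumr [RHS]big_mkcond/=; apply: eq_bigr => j _.
by case: ifPn => // _; ring.
Qed.

End atoms.

Section independent_sums.
Context d (T : measurableType d) (R : realType) (P : probability T R).
Variables (n : nat) (X : 'I_n -> T -> R).
Hypothesis mX : forall i, measurable_fun setT (X i).
Hypothesis indX : mutually_independent P X.

Lemma indep_pair i j : i != j -> indep_rv P (X i) (X j).
Proof.
move=> ij; apply: (indep_blocks_rv mX indX (D := [set i]) (E := [set j])).
- by move=> k [/= -> ij']; rewrite ij' eqxx in ij.
- exact: adapted_gen.
- exact: adapted_gen.
Qed.

Lemma cf_add (U V : T -> R) (a b c e : R) :
  measurable_fun setT U -> measurable_fun setT V -> indep_rv P U V ->
  \int[P]_w cos (U w) = expR a * cos b -> \int[P]_w sin (U w) = expR a * sin b ->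
  \int[P]_w cos (V w) = expR c * cos e -> \int[P]_w sin (V w) = expR c * sin e ->
  \int[P]_w cos (U w + V w) = expR (a + c) * cos (b + e) /\
  \int[P]_w sin (U w + V w) = expR (a + c) * sin (b + e).
Proof.
move=> mU mV UV cU sU cV sV.
have icU := rintegrable_cos P mU; have icV := rintegrable_cos P mV.
have isU := rintegrable_sin P mU; have isV := rintegrable_sin P mV.
have mc := @measurable_cos R setT; have ms := @measurable_sin R setT.
have [i1 e1] := indep_rv_mul (indep_rv_comp mc mc UV) icU icV.
have [i2 e2] := indep_rv_mul (indep_rv_comp ms ms UV) isU isV.
have [i3 e3] := indep_rv_mul (indep_rv_comp ms mc UV) isU icV.
have [i4 e4] := indep_rv_mul (indep_rv_comp mc ms UV) icU isV.
split.
- under eq_Rint do rewrite cosD.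
  rewrite (RintB i1 i2) e1 e2 /= cU cV sU sV expRD cosD; ring.
- under eq_Rint do rewrite sinD.
  rewrite (RintD i3 i4) e3 e4 /= cU cV sU sV expRD sinD; ring.
Qed.

(** Moduli multiply and arguments add: [cf_add] is the addition formula for angles, applied by
    induction to initial segments, the next variable being independent of the block before it. *)
Lemma cf_indep_sum (th a b : 'I_n -> R) :
  (forall k, \int[P]_w cos (th k * X k w) = expR (a k) * cos (b k)) ->
  (forall k, \int[P]_w sin (th k * X k w) = expR (a k) * sin (b k)) ->
  \int[P]_w cos (\sum_k th k * X k w) = expR (\sum_k a k) * cos (\sum_k b k) /\
  \int[P]_w sin (\sum_k th k * X k w) = expR (\sum_k a k) * sin (\sum_k b k).
Proof.
move=> hc hs.
have mth k : measurable_fun setT (fun w => th k * X k w) by apply: measurable_funM.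
suff H l : (l <= n)%N ->
    \int[P]_w cos (\sum_(k < n | (k < l)%N) th k * X k w) =
      expR (\sum_(k < n | (k < l)%N) a k) * cos (\sum_(k < n | (k < l)%N) b k) /\
    \int[P]_w sin (\sum_(k < n | (k < l)%N) th k * X k w) =
      expR (\sum_(k < n | (k < l)%N) a k) * sin (\sum_(k < n | (k < l)%N) b k).
  have E (F : 'I_n -> R) : \sum_(k < n | (k < n)%N) F k = \sum_k F k.
    by apply: eq_bigl => k; rewrite ltn_ord.
  have := H n (leqnn n).
  by under eq_Rint do rewrite E; under [in X in _ /\ X]eq_Rint do rewrite E; rewrite !E.
elim: l => [_|l IH ln].
  have E0 (F : 'I_n -> R) : \sum_(k < n | (k < 0)%N) F k = 0 by rewrite big_pred0.
  rewrite !E0; under eq_Rint do rewrite E0; under [in X in _ /\ X]eq_Rint do rewrite E0.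
  by rewrite cos0 sin0 !Rint_cst expR0 !mul1r.
have [IH1 IH2] := IH (ltnW ln).
pose k : 'I_n := Ordinal ln.
have S (F : 'I_n -> R) : \sum_(i < n | (i < l.+1)%N) F i =
    \sum_(i < n | (i < l)%N) F i + F k.
  rewrite (bigD1 k)//= addrC; congr (_ + _); apply: eq_bigl => i.
  by rewrite ltnS leq_eqVlt -val_eqE/=; case: ltngtP.
rewrite !S; under eq_Rint do rewrite S; under [in X in _ /\ X]eq_Rint do rewrite S.
apply: cf_add => //.
- by apply: measurable_bigsum => i _; exact: mth.
- apply: (indep_blocks_rv mX indX (D := [set i | (i < l)%N]) (E := [set k])).
  + by move=> i [/= il ik]; move: il; rewrite ik ltnn.
  + apply: adapted_sum => i il; apply: adaptedM; first exact: adapted_cst.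
    exact: adapted_gen.
  + by apply: adaptedM; [exact: adapted_cst|exact: adapted_gen].
Qed.

Lemma variance_indep_sum (th : 'I_n -> R) : (forall k, sqintegrable P (X k)) ->
  (forall k, \int[P]_w X k w = 0) ->
  \int[P]_w (\sum_k th k * X k w) ^+ 2 = \sum_k th k ^+ 2 * \int[P]_w X k w ^+ 2.
Proof.
move=> sX X0.
have iXX i j := sqintegrableM (sX i) (sX j).
have E w : (\sum_k th k * X k w) ^+ 2 =
    \sum_i \sum_j (th i * th j) * (X i w * X j w).
  rewrite expr2 mulr_suml; apply: eq_bigr => i _; rewrite mulr_sumr.
  by apply: eq_bigr => j _; ring.
under eq_Rint do rewrite E.
rewrite Rint_sum; last first.
  by move=> i _; apply: rintegrable_sum => j _; exact: rintegrableZ.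
apply: eq_bigr => i _; rewrite Rint_sum; last by move=> j _; exact: rintegrableZ.
rewrite (bigD1 i)//= big1 ?addr0; first by rewrite RintZ// expr2.
move=> j ji; rewrite RintZ//.
rewrite (indep_rv_mul (indep_pair _) _ _).2 ?X0 ?mul0r ?mulr0//.
- by rewrite eq_sym.
- exact: sqintegrable_int.
- exact: sqintegrable_int.
Qed.

End independent_sums.

(** * Gaussian approximation of the characteristic function of a centered sum *)

Section clt_bound.
Context d (T : measurableType d) (R : realType) (P : probability T R).
Variables (L : set (R * R) -> T -> R) (gamma b : R) (nu : {measure set R -> \bar R}).
Hypothesis HL : levy_basis P L gamma b nu.
Let pre := log_cf_re b nu.
Let pim := log_cf_im gamma nu.
Variables (m s2 : R) (eps : R -> R).
Hypothesis ce : cumulant_expansion pre pim m s2 eps.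

Section family.
Context (K : finType) (A : K -> set (R * R)).
Hypothesis fA : forall i, finite_borel (A i).

(** The squared norm of [\sum_i th i * \1_(A i)] in the plane; times [s2] it is the variance of
    [centered_sum]. *)
Definition quad (th : K -> R) := \sum_i \sum_j th i * th j * lam (A i `&` A j).

Definition centered_sum (th : K -> R) w := \sum_i th i * (L (A i) w - m * lam (A i)).

Let D := @atom R K A.
Let fD := atom_finite_borel fA.
Let tD := @atom_trivIset R K A.

Let S (th : K -> R) k := \sum_(i in @atom_index K k) th i.

Let indD : mutually_independent P (fun k => L (D k)).
Proof. exact: (levy_basis_independent HL). Qed.

Let mD k : measurable_fun setT (L (D k)).
Proof. exact: (levy_measurable HL). Qed.

Lemma quad_ge0 th : 0 <= quad th.
Proof.
rewrite /quad sum_lam_atoms//; apply: sumr_ge0 => k _.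
by rewrite mulr_ge0 ?lam_ge0 ?sqr_ge0.
Qed.

Lemma levy_atoms : {ae P, forall w i,
  L (A i) w = \sum_(k | i \in @atom_index K k) L (D k) w}.
Proof.
have H i : {ae P, forall w, L (A i) w = \sum_(k | i \in @atom_index K k) L (D k) w}.
  pose F k := if i \in @atom_index K k then D k else set0.
  have fF k : finite_borel (F k).
    by rewrite /F; case: ifP => _; [exact: fD|exact: finite_borel0].
  have tF : trivIset setT F.
    apply/trivIsetP => k l _ _ kl; rewrite /F.
    case: ifP => _; last by rewrite set0I.
    case: ifP => _; last by rewrite setI0.
    by move/trivIsetP : tD; apply.
  have FE : \bigcup_(k in setT) F k = A i.
    rewrite (atom_cover A i); apply/seteqP; split => p [k /= ik].
      by rewrite /F in ik *; case: ifPn => // iK Dp; exists k.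
    by move=> Dp; exists k => //; rewrite /F ik.
  have := levy_additive HL fF tF; rewrite FE.
  have := levy_set0 HL; apply: filterS2 => w L0 ->.
  rewrite [RHS]big_mkcond/=; apply: eq_bigr => k _; rewrite /F.
  by case: ifP.
have : {ae P, forall w, forall i, i \in index_enum K ->
    L (A i) w = \sum_(k | i \in @atom_index K k) L (D k) w}.
  elim: (index_enum K) => [|i s IH]; first by apply: nearW.
  move: (H i) IH; apply: filterS2 => w h1 h2 j; rewrite inE => /predU1P[->//|js].
  exact: h2.
by apply: filterS => w h i; apply: h; rewrite mem_index_enum.
Qed.

Let lamA i : lam (A i) = \sum_(k | i \in @atom_index K k) lam (D k).
Proof.
rewrite -[in LHS](setIid (A i)) lam_atoms//.
by apply: eq_bigl => k; rewrite andbb.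
Qed.

Let exch (th : K -> R) (g : 'I_#|{: {set K}}| -> R) :
  \sum_i th i * (\sum_(k | i \in @atom_index K k) g k) = \sum_k S th k * g k.
Proof.
under eq_bigr do rewrite mulr_sumr big_mkcond/=.
rewrite exchange_big/=; apply: eq_bigr => k _.
by rewrite /S mulr_suml [RHS]big_mkcond/=; apply: eq_bigr => i _.
Qed.

Lemma centered_sum_atoms th : {ae P, forall w,
  centered_sum th w = \sum_k S th k * (L (D k) w - m * lam (D k))}.
Proof.
move: levy_atoms; apply: filterS => w h.
rewrite /centered_sum.
transitivity (\sum_i th i * (\sum_(k | i \in @atom_index K k) (L (D k) w - m * lam (D k)))).
  by apply: eq_bigr => i _; rewrite h lamA mulr_sumr -sumrB.
exact: exch.
Qed.

Lemma measurable_centered_sum th : measurable_fun setT (centered_sum th).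
Proof.
apply: measurable_bigsum => i _; apply: measurable_funM => //.
exact: (measurable_funB (levy_measurable HL (fA i)) (measurable_cst _)).
Qed.

Let mS th : measurable_fun setT (fun w => \sum_k S th k * (L (D k) w - m * lam (D k))).
Proof.
apply: measurable_bigsum => k _; apply: measurable_funM => //.
exact: (measurable_funB (mD k) (measurable_cst _)).
Qed.

Lemma centered_moments B : finite_borel B ->
  [/\ sqintegrable P (fun w => L B w - m * lam B),
      \int[P]_w (L B w - m * lam B) = 0 &
      \int[P]_w (L B w - m * lam B) ^+ 2 = lam B * s2].
Proof.
move=> fB; have [sB E1 E2] := levy_moments HL ce fB.
have iB := sqintegrable_int sB.
have ic c : rintegrable P (fun=> c : R) by exact: rintegrable_cst.
split.
- by apply: sqintegrableB => //; exact: sqintegrable_cst.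
- by rewrite (RintB iB (ic _)) E1 Rint_cst mulrC subrr.
- have E w : (L B w - m * lam B) ^+ 2 =
      L B w ^+ 2 - (2 * (m * lam B)) * L B w + (m * lam B) ^+ 2 by ring.
  under eq_Rint do rewrite E.
  have i1 := rintegrableZ (2 * (m * lam B)) iB.
  rewrite (RintD (rintegrableB sB.2 i1) (ic _)) (RintB sB.2 i1) RintZ// Rint_cst E1 E2.
  by ring.
Qed.

Lemma centered_sum_moments th :
  [/\ sqintegrable P (centered_sum th), \int[P]_w centered_sum th w = 0 &
      \int[P]_w centered_sum th w ^+ 2 = s2 * quad th].
Proof.
pose Y k w := L (D k) w - m * lam (D k).
have sY k : sqintegrable P (Y k) by have [] := centered_moments (fD k).
have Y0 k : \int[P]_w Y k w = 0 by have [] := centered_moments (fD k).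
have Y2 k : \int[P]_w Y k w ^+ 2 = lam (D k) * s2 by have [] := centered_moments (fD k).
split.
- apply: sqintegrable_sum => i _; apply: sqintegrableZ.
  by have [] := centered_moments (fA i).
- rewrite /centered_sum Rint_sum; last first.
    move=> i _; apply: rintegrableZ; apply: sqintegrable_int.
    by have [] := centered_moments (fA i).
  rewrite big1// => i _; have [si i0 _] := centered_moments (fA i).
  by rewrite (RintZ _ (sqintegrable_int si)) i0 mulr0.
- rewrite (_ : \int[P]_w _ = \int[P]_w (\sum_k S th k * Y k w) ^+ 2); last first.
  { apply: ae_eq_Rint.
    + by apply: measurable_funX; exact: measurable_centered_sum.
    + by apply: measurable_funX; exact: mS.
    + by move: (centered_sum_atoms th); apply: filterS => w ->. }
  have mY k : measurable_fun setT (Y k) by exact: (measurable_funB (mD k) (measurable_cst _)).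
  have indY : mutually_independent P Y.
    move=> B mB; have /= := @indD (fun k => [set x | B k (x - m * lam (D k))]).
    apply => k.
    have mk : measurable_fun setT (fun x : R => x - m * lam (D k)) by exact: measurable_funB.
    by have := mk measurableT _ (mB k); rewrite setTI.
  rewrite (variance_indep_sum mY indY)// /quad sum_lam_atoms// mulr_sumr.
  by apply: eq_bigr => k _; rewrite Y2 -/(S th k); ring.
Qed.

Let err th := \sum_k lam (D k) * (S th k ^+ 2 * eps `|S th k|).

(** Over the independent atoms the cumulants add up. Centering cancels the first-order terms, the
    second-order ones add up to the variance, and [err] collects the remainders, each weighted by
    the area of its atom. *)
Let centered_sum_cf th : exists a c, [/\ a <= 0, `|a + s2 * quad th / 2| <= err th,
   `|c| <= err th, \int[P]_w cos (centered_sum th w) = expR a * cos c &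
   \int[P]_w sin (centered_sum th w) = expR a * sin c].
Proof.
pose al := \sum_k lam (D k) * pre (S th k).
pose be := \sum_k lam (D k) * pim (S th k).
pose mc := m * \sum_k lam (D k) * S th k.
pose W w := \sum_k S th k * L (D k) w.
have [cW sW] : \int[P]_w cos (W w) = expR al * cos be /\
               \int[P]_w sin (W w) = expR al * sin be.
  apply: (cf_indep_sum mD indD) => k.
    by rewrite (levy_cf HL (fD k) _).1.
  by rewrite (levy_cf HL (fD k) _).2.
have mW : measurable_fun setT W.
  by apply: measurable_bigsum => k _; apply: measurable_funM.
have aeW : {ae P, forall w, centered_sum th w = W w - mc}.
  move: (centered_sum_atoms th); apply: filterS => w ->.
  rewrite /W /mc mulr_sumr -sumrB; apply: eq_bigr => k _; ring.
have mWc : measurable_fun setT (fun w => W w - mc).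
  exact: (measurable_funB mW (measurable_cst _)).
have icW := rintegrable_cos P mW; have isW := rintegrable_sin P mW.
have mcs := measurable_centered_sum th.
exists al, (be - mc); split.
- apply: sumr_le0 => k _; rewrite mulr_ge0_le0 ?lam_ge0// (ce_re_le0 ce) //.
- rewrite /quad sum_lam_atoms// -mulrA mulr_suml mulr_sumr -big_split/=.
  apply: le_trans (ler_norm_sum _ _ _) _; apply: ler_sum => k _.
  rewrite -/(S th k) -/(D k) (_ : _ + _ = lam (D k) * (pre (S th k) + s2 * S th k ^+ 2 / 2)); last by ring.
  rewrite normrM ger0_norm ?lam_ge0// ler_wpM2l ?lam_ge0//.
  exact: (ce_re ce).
- rewrite /be /mc mulr_sumr -sumrB.
  apply: le_trans (ler_norm_sum _ _ _) _; apply: ler_sum => k _.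
  rewrite (_ : _ - _ = lam (D k) * (pim (S th k) - m * S th k)); last by ring.
  rewrite normrM ger0_norm ?lam_ge0// ler_wpM2l ?lam_ge0//.
  exact: (ce_im ce).
- rewrite (@ae_eq_Rint _ _ _ P _ (fun w => cos (W w - mc))); last first.
  { by move: aeW; apply: filterS => w ->. }
  { exact: (measurableT_comp (@measurable_cos R setT) mWc). }
  { exact: (measurableT_comp (@measurable_cos R setT) mcs). }
  under eq_Rint do rewrite cosB mulrC [X in _ + X]mulrC.
  rewrite (RintD (rintegrableZ _ icW) (rintegrableZ _ isW)) !RintZ// cW sW cosB; ring.
- rewrite (@ae_eq_Rint _ _ _ P _ (fun w => sin (W w - mc))); last first.
  { by move: aeW; apply: filterS => w ->. }
  { exact: (measurableT_comp (@measurable_sin R setT) mWc). }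
  { exact: (measurableT_comp (@measurable_sin R setT) mcs). }
  under eq_Rint do rewrite sinB mulrC [X in _ - X]mulrC.
  rewrite (RintB (rintegrableZ _ isW) (rintegrableZ _ icW)) !RintZ// cW sW sinB; ring.
Qed.

Lemma expR_lip (x y : R) : x <= 0 -> y <= 0 -> `|expR x - expR y| <= `|x - y|.
Proof.
wlog xy : x y / x <= y.
  move=> h x0 y0; have [/h|/ltW/h] := leP x y; first exact.
  by rewrite distrC (distrC x); exact.
move=> x0 y0; rewrite distrC [leRHS]distrC !ger0_norm ?subr_ge0 ?ler_expR//.
have -> : expR y - expR x = expR y * (1 - expR (x - y)).
  by rewrite mulrBr mulr1 -expRD [y + _]addrC subrK.
apply: (@le_trans _ _ (1 - expR (x - y))).
  rewrite ler_piMl ?expR_le1// subr_ge0 expR_le1 subr_le0//.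
have := expR_ge1Dx (x - y); lra.
Qed.

(* Lindeberg: only the part of the field outside [J] may be locally large, and
   its contribution is controlled in mean square. *)
Lemma clt_bound (th : K -> R) (J : pred K) (rho C : R) : 0 <= rho ->
  (forall x, 0 <= x -> eps x <= C) ->
  (forall p, `|\sum_(i | J i) th i * \1_(A i) p| <= rho) ->
  let e := eps (2 * rho) * quad th + 4 * C * quad (fun i => if J i then 0 else th i) in
  `|\int[P]_w cos (centered_sum th w) - expR (- (s2 * quad th / 2))| <= 2 * e /\
  `|\int[P]_w sin (centered_sum th w)| <= 2 * e.
Proof.
move=> rho0 hC hrho e.
have He : err th <= e.
  rewrite /e /quad !sum_lam_atoms// !mulr_sumr -big_split/=; apply: ler_sum => k _.
  rewrite -/(S th k) -/(S (fun i => if J i then 0 else th i) k) -/(D k).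
  set t := S th k; set t2 := S _ k.
  (* An empty atom has no mass. A nonempty one provides a point [p] at which the bound [hrho] is a
     bound on [t - t2], the contribution of the indices in [J] to the coefficient of the atom. *)
  have [->|/set0P[p Dp]] := eqVneq (D k) set0.
    by rewrite /lam /leb2 measure0 !mul0r !mulr0 addr0.
  have t1r : `|t - t2| <= rho.
    have -> : t - t2 = \sum_(i | J i) th i * \1_(A i) p.
      rewrite /t /t2 /S -sumrB [LHS]big_mkcond [RHS]big_mkcond/=; apply: eq_bigr => i _.
      rewrite indicE; have [iK|iK] := boolP (i \in atom_index k).
        rewrite mem_set; last by apply/(atomP Dp).
        by case: (J i); rewrite ?subr0 ?subrr ?mulr1.
      rewrite memNset ?mulr0; last by move=> /(atomP Dp); apply/negP.
      by case: (J i).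
    exact: hrho.
  have eps0 := ce_eps_ge0 ce (normr_ge0 t).
  have C0 : 0 <= C by apply: le_trans eps0 (hC _ (normr_ge0 t)).
  have e2 : 0 <= eps (2 * rho) by apply: (ce_eps_ge0 ce); rewrite mulr_ge0.
  (* If [|t| > 2 * rho], then [|t - t2| <= rho] forces [|t| <= 2 * |t2|], so the whole of [t ^+ 2]
     is charged to the far part. This explains both [2 * rho] and [4 * C]. *)
  have key : t ^+ 2 * eps `|t| <= eps (2 * rho) * t ^+ 2 + 4 * C * t2 ^+ 2.
    have [tr|tr] := leP `|t| (2 * rho).
      apply: (@le_trans _ _ (eps (2 * rho) * t ^+ 2)).
        by rewrite mulrC ler_wpM2r ?sqr_ge0// (ce_eps_mono ce).
      by rewrite lerDl mulr_ge0 ?sqr_ge0// mulr_ge0.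
    apply: (@le_trans _ _ (t ^+ 2 * C)).
      by rewrite ler_wpM2l ?sqr_ge0// hC.
    have : t ^+ 2 <= 4 * t2 ^+ 2.
      rewrite -[t ^+ 2]real_normK ?num_real// -[t2 ^+ 2]real_normK ?num_real//.
      have : `|t| <= 2 * `|t2|.
        by have := ler_normD (t - t2) t2; rewrite subrK; lra.
      have := normr_ge0 t; have := normr_ge0 t2.
      move: (`|t|) (`|t2|) => x y y0 x0 xy.
      have : x ^+ 2 <= (2 * y) ^+ 2 by rewrite ler_sqr ?nnegrE ?mulr_ge0.
      by rewrite exprMn; lra.
    move=> /(ler_wpM2r C0).
    have : 0 <= eps (2 * rho) * t ^+ 2 by rewrite mulr_ge0 ?sqr_ge0.
    lra.
  rewrite (_ : _ + _ = lam (D k) * (eps (2 * rho) * t ^+ 2 + 4 * C * t2 ^+ 2)); last by ring.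
  by rewrite ler_wpM2l ?lam_ge0.
have [a [c [a0 ha hc -> ->]]] := centered_sum_cf th.
have q0 : - (s2 * quad th / 2) <= 0.
  by rewrite oppr_le0 divr_ge0// mulr_ge0 ?quad_ge0 ?(ce_s2_ge0 ce).
have h1 : `|expR a - expR (- (s2 * quad th / 2))| <= e.
  apply: le_trans (expR_lip a0 q0) _; rewrite opprK; exact: le_trans ha He.
have hc' : `|c| <= e by exact: le_trans hc He.
have e0 : 0 <= e := le_trans (normr_ge0 c) hc'.
have ea : expR a <= 1 by rewrite expR_le1.
split.
- have -> : expR a * cos c - expR (- (s2 * quad th / 2)) =
    (expR a - expR (- (s2 * quad th / 2))) + expR a * (cos c - 1) by ring.
  apply: le_trans (ler_normD _ _) _.
  have : `|expR a * (cos c - 1)| <= e.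
    rewrite normrM ger0_norm ?expR_ge0//.
    apply: (@le_trans _ _ `|cos c - 1|); first by rewrite ler_piMl.
    apply: le_trans hc'; have c1 := cos_le1 c; have c2 := cos_ge_quad c.
    have c3 := cos_geN1 c; rewrite distrC ger0_norm ?subr_ge0//.
    have [h|h] := leP `|c| 2; last by lra.
    have : c ^+ 2 <= 2 * `|c|.
      by rewrite -real_normK ?num_real// expr2 ler_wpM2r.
    lra.
  by move: h1; lra.
- rewrite normrM ger0_norm ?expR_ge0//.
  apply: (@le_trans _ _ `|sin c|); first by rewrite ler_piMl.
  apply: le_trans (sin_le_norm _) _; apply: le_trans hc' _.
  by move: e0; lra.
Qed.

End family.
End clt_bound.

(** * Geometry of the trawl sets *)

Section power_tail.
Context (R : realType).
Local Notation mu := (@lebesgue_measure R).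

Lemma powR_tail_cvg (q : R) : 0 < q -> x `^ (- q) @[x --> +oo] --> (0 : R).
Proof.
move=> q0; apply/cvgrPdist_lt => e e0.
near=> x.
have x0 : 0 < x by near: x; exact: nbhs_pinfty_gt.
rewrite sub0r normrN ger0_norm ?powR_ge0// powRN.
have e1 : 0 < e^-1 by rewrite invr_gt0.
rewrite -[ltRHS]invrK ltf_pV2 ?posrE ?powR_gt0//.
have -> : e^-1 = (e^-1 `^ q^-1) `^ q by rewrite -powRrM mulVf ?gt_eqF// powRr1// ltW.
apply: gt0_ltr_powR; rewrite ?in_itv/= ?nnegrE ?powR_ge0 ?(ltW x0)//.
Unshelve. all: by end_near.
Qed.

Lemma powR_tail_integral (q h : R) : 1 < q -> 0 < h ->
  (\int[mu]_(x in `[h, +oo[) (x `^ (- q))%:E = (h `^ (1 - q) / (q - 1))%:E)%E.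
Proof.
move=> q1 h0; have q10 : 0 < q - 1 by rewrite subr_gt0.
pose F (x : R) := - (q - 1)^-1 * x `^ (1 - q).
have dF (x : R) : 0 < x -> is_derive x 1 F (x `^ (- q)).
  move=> x0; have := is_deriveZ (- (q - 1)^-1) (is_derive1_powR (1 - q) x0).
  move=> [d1 d2]; split => //.
  rewrite d2 /GRing.scale /=.
  rewrite (_ : 1 - q - 1 = - q); last by ring.
  by field; rewrite gt_eqF.
rewrite (@ge0_continuous_FTC2y R (fun x => x `^ (- q)) F h 0).
- by rewrite /F sub0e -EFinN; congr EFin; field; rewrite gt_eqF.
- by move=> x _; exact: powR_ge0.
- apply: continuous_in_subspaceT => x; rewrite inE/= in_itv/= andbT => hx.
  have x0 : 0 < x by exact: lt_le_trans hx.
  apply: differentiable_continuous; apply/derivable1_diffP.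
  by apply: derivable_powR; rewrite in_itv/= andbT.
- rewrite -(mulr0 (- (q - 1)^-1)); apply: cvgM; first exact: cvg_cst.
  by rewrite -opprB; exact: powR_tail_cvg.
- by move=> x hx; have [] := dF x (lt_trans h0 hx).
- have [d1 _] := dF h h0.
  apply: cvg_at_right_filter; apply: differentiable_continuous.
  exact/derivable1_diffP.
- by move=> x; rewrite in_itv/= andbT => hx; have [_ <-] := dF x (lt_trans h0 hx); rewrite derive1E.
Qed.

Lemma powR_tail_integrable (C q h : R) : 1 < q -> 0 < h ->
  mu.-integrable `[h, +oo[ (EFin \o (fun x => C * x `^ (- q))).
Proof.
move=> q1 h0.
have : mu.-integrable `[h, +oo[ (EFin \o (fun x => x `^ (- q))).
  apply/integrableP; split.
    by apply/measurable_EFinP; apply: measurable_funTS; exact: measurable_powR.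
  under eq_integral do rewrite /= ger0_norm ?powR_ge0//.
  by rewrite powR_tail_integral// ltry.
move=> /(integrableZl _ C) => /(_ (measurable_itv _)).
by apply: eq_integrable => // x _ /=.
Qed.

End power_tail.

Section decreasing.
Context (R : realType) (f : R -> R).
Local Notation mu := (@lebesgue_measure R).

(** The class shared by the trawl function, its tail integral and its square root, so that one set
    of estimates on grid sums serves all three. *)
Record tail_fun : Prop := TailFun {
  dec_ge0 : forall s, 0 <= s -> 0 <= f s ;
  dec_noninc : forall s t, 0 <= s -> s <= t -> f t <= f s ;
  dec_int : mu.-integrable `[0, +oo[ (EFin \o f) }.

Definition tail_int (x : R) := \int[mu]_(u in `[x, +oo[) f u.

Lemma decreasing_measurable (D : set R) : measurable D ->
  (forall s t, 0 <= s -> s <= t -> f t <= f s) ->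
  measurable_fun (D `&` `[0, +oo[) f.
Proof.
move=> mD fni.
(* Freezing [f] at [f 0] on the negative half-line makes it monotone everywhere, hence
   measurable. *)
have H : measurable_fun (D `&` `[0, +oo[%classic) (fun u : R => f (Num.max u 0)).
  apply: nonincreasing_measurable; first exact: measurableI.
  move=> x y xy; apply: fni; first by rewrite le_max lexx orbT.
  by rewrite ge_max !le_max xy lexx !orbT.
apply: eq_measurable_fun H => x.
by rewrite inE => -[_ /=]; rewrite in_itv/= andbT => x0; rewrite max_l.
Qed.

Lemma integrable_of_power (C q : R) : 1 < q ->
  (forall s, 0 <= s -> 0 <= f s) -> (forall s t, 0 <= s -> s <= t -> f t <= f s) ->
  (\forall s \near +oo, f s <= C * s `^ (- q)) ->
  tail_fun.
Proof.
move=> q1 f0 fni [A [_ hA]]; split => //.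
pose h := Num.max A 0 + 1.
have h0 : 0 < h by rewrite ltr_wpDl// le_max lexx orbT.
have -> : `[0, +oo[%classic = `[0, h[%classic `|` `[h, +oo[%classic :> set R.
  apply/seteqP; split => x /=; rewrite !in_itv/= !andbT.
    by move=> x0; have [xh|hx] := ltP x h; [left; rewrite x0|right].
  by move=> [/andP[]//|]; apply: le_trans; exact: ltW.
have sub0 : `[h, +oo[ `<=` [set` `[0, +oo[].
  by move=> x /=; rewrite !in_itv/= !andbT; apply: le_trans; exact: ltW.
have mf : measurable_fun (`[0, +oo[%classic : set R) f.
  by rewrite -[X in measurable_fun X](setTI); exact: decreasing_measurable.
have i1 : mu.-integrable `[0, h[ (EFin \o f).
  { apply: measurable_bounded_integrable => //.
  - by rewrite /= lebesgue_measure_itv/= lte_fin h0 ltry.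
  - apply: measurable_funS mf => // x /=; rewrite !in_itv/= andbT => /andP[]//.
  - exists (f 0); split; first exact: num_real.
    move=> M hM x /=; rewrite in_itv/= => /andP[x0 _].
    by rewrite ger0_norm ?f0//; apply: le_trans (ltW hM); exact: fni. }
have i2 : mu.-integrable `[h, +oo[ (EFin \o f).
  { have i3 := powR_tail_integrable C q1 h0.
    apply: (le_integrable _ _ _ i3) => //.
    - by apply/measurable_EFinP; apply: measurable_funS mf.
    - move=> x /=; rewrite in_itv/= andbT => hx; rewrite lee_fin.
      rewrite ger0_norm; last by apply: f0; apply: le_trans hx; exact: ltW.
      apply: le_trans (ler_norm _); apply: hA.
      by apply: lt_le_trans hx; rewrite /h ltr_pwDr// le_max lexx. }
apply/integrableP; split.
  { apply/measurable_EFinP; apply/measurable_funU => //; split.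
    - by move/(measurable_int mu)/measurable_EFinP : i1.
    - by move/(measurable_int mu)/measurable_EFinP : i2. }
rewrite ge0_integral_setU//=.
- by apply: lte_add_pinfty; [have /integrableP[] := i1|have /integrableP[] := i2].
- apply/measurable_EFinP; apply: measurableT_comp => //; apply/measurable_funU => //; split.
  + by move/(measurable_int mu)/measurable_EFinP : i1.
  + by move/(measurable_int mu)/measurable_EFinP : i2.
- apply/disj_setPS => u /= []; rewrite !in_itv/= andbT => /andP[_ uy] yu.
  by move: uy; rewrite ltNge yu.
Qed.

Hypothesis fdec : tail_fun.

Lemma tail_integrable x : 0 <= x -> mu.-integrable `[x, +oo[ (EFin \o f).
Proof.
move=> x0; apply: integrableS (dec_int fdec) => //.
by move=> y /=; rewrite !in_itv/= !andbT; apply: le_trans.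
Qed.

Lemma tail_int_ge0 x : 0 <= x -> 0 <= tail_int x.
Proof.
move=> x0; apply: Rintegral_ge0 => u /=; rewrite in_itv/= andbT => xu.
by apply: (dec_ge0 fdec); exact: le_trans xu.
Qed.

Lemma tail_intB x y : 0 <= x -> x <= y ->
  tail_int x - tail_int y = \int[mu]_(u in `[x, y[) f u.
Proof.
move=> x0 xy; rewrite /tail_int.
have E : `[x, +oo[%classic = `[x, y[%classic `|` `[y, +oo[%classic :> set R.
  apply/seteqP; split => u /=; rewrite !in_itv/= !andbT.
    by move=> xu; have [uy|yu] := ltP u y; [left; rewrite xu|right].
  by move=> [/andP[]//|]; apply: le_trans.
rewrite [in X in X - _]E Rintegral_setU//.
- by rewrite addrK.
- by rewrite -E; exact: tail_integrable.
- apply/disj_setPS => u /= []; rewrite !in_itv/= andbT => /andP[_ uy] yu.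
  by move: uy; rewrite ltNge yu.
Qed.

Let itv_int x y : 0 <= x -> mu.-integrable `[x, y[ (EFin \o f).
Proof.
move=> x0; apply: integrableS (tail_integrable x0) => //.
by move=> u /=; rewrite !in_itv/= andbT => /andP[].
Qed.

Let cst_int x y c : mu.-integrable `[x, y[ (EFin \o (fun=> c : R)).
Proof.
apply: measurable_bounded_integrable => //.
- by rewrite /= lebesgue_measure_itv/=; case: ifP => _; rewrite ?ltry// -EFinB ltry.
- exists `|c|; split; first exact: num_real.
  by move=> M hM z _ /=; exact: ltW.
Qed.

Let Rint_cst_itv x y (c : R) : x <= y -> \int[mu]_(u in `[x, y[) c = (y - x) * c.
Proof.
move=> xy; rewrite Rintegral_cst//= lebesgue_measure_itv/= lte_fin.
case: ltgtP xy => //= [xy _|-> _]; first by rewrite mulrC.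
by rewrite subrr mul0r mulr0.
Qed.

Lemma tail_int_lb x y : 0 <= x -> x <= y -> (y - x) * f y <= tail_int x - tail_int y.
Proof.
move=> x0 xy; rewrite tail_intB// -Rint_cst_itv//; apply: le_Rintegral => //.
- exact: itv_int.
- move=> u /=; rewrite in_itv/= => /andP[xu uy].
  by apply: (dec_noninc fdec); [exact: le_trans xu|exact: ltW].
Qed.

Lemma tail_int_ub x y : 0 <= x -> x <= y -> tail_int x - tail_int y <= (y - x) * f x.
Proof.
move=> x0 xy; rewrite tail_intB// -Rint_cst_itv//; apply: le_Rintegral => //.
- exact: itv_int.
- move=> u /=; rewrite in_itv/= => /andP[xu uy].
  exact: (dec_noninc fdec).
Qed.

Lemma tail_int_noninc x y : 0 <= x -> x <= y -> tail_int y <= tail_int x.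
Proof.
move=> x0 xy; rewrite -subr_ge0; apply: le_trans (tail_int_lb x0 xy).
by rewrite mulr_ge0 ?subr_ge0// (dec_ge0 fdec)//; exact: le_trans xy.
Qed.

Lemma tail_int_cvg0 (e : R) : 0 < e -> exists2 x, 0 <= x & tail_int x < e.
Proof.
move=> e0.
pose g (x : R) := if x < 0 then 0 else f x.
have gf x : `[0, +oo[%classic x -> g x = f x.
  by rewrite /= in_itv/= andbT /g ltNge => ->.
have g0 x : 0 <= g x.
  by rewrite /g; case: ltP => // x0; exact: (dec_ge0 fdec).
have mg : measurable_fun setT g.
  apply: measurable_fun_if => //.
    by apply: measurable_fun_ltr => //; exact: measurable_id.
  rewrite setTI.
  rewrite [X in measurable_fun X](_ : _ = setT `&` `[0, +oo[%classic); last first.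
    rewrite setTI; apply/seteqP; split => x /=; rewrite in_itv/= andbT ltNge.
      by move/negbFE.
    by move=> ->.
  exact: (decreasing_measurable measurableT (dec_noninc fdec)).
have := @ge0_cvgn_integral R mu g g0 mg.
have -> : (\int[mu]_(x in `[0%R, +oo[) (g x)%:E = (tail_int 0)%:E)%E.
  rewrite /tail_int /Rintegral fineK; last exact: integrable_fin_num (dec_int fdec).
  by apply: eq_integral => x; rewrite inE => /gf ->.
move=> /fine_cvgP[_] /cvgrPdist_lt /(_ e e0) [N _ /(_ N (leqnn N))] /= h.
exists N%:R => //; apply: le_lt_trans h.
have -> : fine (\int[mu]_(x in `[0%R, N%:R]) (g x)%:E)%E = tail_int 0 - tail_int N%:R.
  rewrite tail_intB// Rintegral_itv_bndo_bndc; last exact: itv_int.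
  by congr fine; apply: eq_integral => x; rewrite inE/= in_itv/= => /andP[x0 _]; rewrite gf//= in_itv/= x0.
rewrite opprB addrC subrK; exact: ler_norm.
Qed.

End decreasing.

Section trawl_geometry.
Context (R : realType) (a : R -> R).
Hypothesis Ha : trawl_function a.
Local Notation mu := (@lebesgue_measure R).

Lemma trawl_tail_fun : tail_fun a.
Proof. by case: Ha => ? ? ? _; split. Qed.

(** Extension of [a] by the constant [a 0] to negative arguments, which keeps it nonnegative,
    nonincreasing and continuous on the whole line. *)
Let a0 (u : R) := a (Num.max u 0).

Let a0E u : 0 <= u -> a0 u = a u.
Proof. by move=> u0; rewrite /a0 max_l. Qed.

Let a0_ge0 u : 0 <= a0 u.
Proof. by apply: (trawl_ge0 Ha); rewrite le_max lexx orbT. Qed.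

Let a0_noninc x y : x <= y -> a0 y <= a0 x.
Proof.
move=> xy; apply: (trawl_nonincreasing Ha); first by rewrite le_max lexx orbT.
by rewrite ge_max !le_max xy lexx !orbT.
Qed.

Let ma0 (D : set R) : measurable D -> measurable_fun D a0.
Proof. by move=> mD; apply: nonincreasing_measurable => // x y; exact: a0_noninc. Qed.

Let ca0 : continuous a0.
Proof.
have := trawl_continuous Ha => /subspace_continuousP ca.
move=> x; apply/cvgrPdist_lt => e e0.
have x0 : `[0, +oo[%classic (Num.max x 0) by rewrite /= in_itv/= andbT le_max lexx orbT.
have := ca _ x0 => /cvgrPdist_lt /(_ e e0).
rewrite /within/= => /nbhs_ballP[dl /= dl0 h].
near=> y; rewrite /a0; apply: (h (Num.max y 0)); last first.
  by rewrite /= in_itv/= andbT le_max lexx orbT.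
rewrite /ball/=.
have xy : `|x - y| < dl by near: y; apply/nbhs_ballP; exists dl.
apply: le_lt_trans xy.
have [hx|hx] := leP 0 x; have [hy|hy] := leP 0 y; rewrite ?subr0 ?sub0r ?subrr ?normr0//.
- by rewrite !ger0_norm ?lerD2l; lra.
- rewrite normrN ger0_norm//; apply: le_trans (_ : y - x <= _); first lra.
  by rewrite distrC ler_norm.
Unshelve. all: by end_near.
Qed.

(** The part of the trawl set at time [M] that lies at or before time [x]. Unlike trawl sets, these
    sets are stable under intersection ([trawl_boxI]), and their area is a tail integral of [a]. *)
Definition trawl_box (M x : R) : set (R * R) :=
  [set p | p.1 <= x /\ 0 <= p.2 <= a (M - p.1)].

Lemma trawl_set_atE t : trawl_set_at a t = trawl_box t t.
Proof.
apply/seteqP; split => [p [[r y] /= [r0 ry] <-]|[r y] /= [rt ry]].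
  move: r0 ry => /= r0 ry; rewrite /trawl_box /=; split; first lra.
  by rewrite (_ : t - (r + t) = - r); last ring.
move: rt ry => /= rt ry; exists (r - t, y) => /=; last by rewrite subrK.
by rewrite /trawl_set /= opprB; split => //; lra.
Qed.

Lemma trawl_boxI s t x y : x <= s -> y <= t ->
  trawl_box s x `&` trawl_box t y = trawl_box (Num.max s t) (Num.min x y).
Proof.
move=> xs yt; apply/seteqP; split => -[r v] /=.
  move=> [[rx /andP[v0 va]] [ry /andP[_ vb]]]; split; first by rewrite /= le_min rx ry.
  by rewrite /= v0/=; case: (leP s t).
rewrite /trawl_box /= le_min => -[/andP[rx ry] /andP[v0 va]].
have h1 : 0 <= s - r by rewrite subr_ge0; exact: le_trans xs.
have h2 : 0 <= t - r by rewrite subr_ge0; exact: le_trans yt.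
split; split => //=; rewrite v0/=; apply: le_trans va _;
  apply: (trawl_nonincreasing Ha) => //; rewrite lerB// le_max lexx ?orbT//.
Qed.

Lemma trawl_box_measurable M x : x <= M -> measurable (trawl_box M x).
Proof.
move=> xM.
pose D : set (R * R) := [set p | p.1 <= x] `&` [set p | 0 <= p.2].
have -> : trawl_box M x = [set p | p.1 <= x] `&` ([set p | 0 <= p.2] `&`
    [set p | p.2 <= a0 (M - p.1)]).
  apply/seteqP; split => -[r v]; rewrite /trawl_box /=.
    by move=> [rx /andP[v0 va]]; rewrite a0E// subr_ge0; exact: le_trans xM.
  by move=> [rx [v0]]; rewrite v0 a0E// subr_ge0; exact: le_trans xM.
have mle (f g : R * R -> R) : measurable_fun setT f -> measurable_fun setT g ->
    measurable [set p | f p <= g p].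
  by move=> mf mg; have := measurable_fun_ler mf mg measurableT (I : measurable [set true]); rewrite setTI; congr measurable; apply/seteqP; split => p /=.
apply: measurableI; first by apply: mle => //; exact: measurable_fst.
apply: measurableI; first by apply: mle => //; exact: measurable_snd.
apply: mle; first exact: measurable_snd.
apply: (measurableT_comp (ma0 measurableT)).
by apply: measurable_funB => //; exact: measurable_fst.
Qed.

(** The vertical section at [r] is an interval of length [a (M - r)] when [r <= x] and empty
    otherwise. A reflection and a translation turn the integral of these lengths into a tail
    integral. *)
Lemma leb2_trawl_box M x : x <= M ->
  leb2 (trawl_box M x) = (\int[mu]_(u in `[(M - x)%R, +oo[) (a u)%:E)%E.
Proof.
move=> xM; rewrite /leb2 /product_measure1.
transitivity (\int[mu]_(r in `]-oo, x]) (a0 (M - r))%:E)%E.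
  rewrite [RHS]integral_mkcond; apply: eq_integral => r _ /=.
  rewrite patchE; case: ifPn => [/set_mem|/negP rx'] /=.
    rewrite in_itv/= => rx.
    have -> : xsection (trawl_box M x) r = `[0, a0 (M - r)]%classic.
      apply/seteqP; split => v; rewrite /xsection/= inE /trawl_box /= in_itv/=.
        by move=> [_]; rewrite a0E// subr_ge0; exact: le_trans xM.
      by rewrite a0E// subr_ge0; exact: le_trans xM.
    rewrite lebesgue_measure_itv/= lte_fin; case: ltP => h.
      by rewrite sube0.
    by congr EFin; apply/eqP; rewrite eq_le h a0_ge0.
  have -> : xsection (trawl_box M x) r = set0.
    rewrite -subset0 => v; rewrite /xsection/= inE => -[/= rx _].
    by apply: rx'; rewrite inE/= in_itv.
  by rewrite measure0.
have c1 : continuous (fun r : R => a0 (M - r)).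
  move=> r; apply: (@continuous_comp _ _ _ (fun r => M - r) a0); last exact: ca0.
  by apply: cvgB; [exact: cvg_cst|exact: cvg_id].
have := @ge0_integration_by_substitutionNy R (fun r => a0 (M - r)) (- x).
rewrite opprK => ->; last 2 first.
{ exact: continuous_subspaceT. }
{ by move=> r _; exact: a0_ge0. }
have cF : (fun v : R => M + v)^`()%classic = cst 1.
  by apply/funext => v; rewrite derive1E deriveD// derive_cst derive_id add0r.
rewrite (_ : M - x = (fun v : R => M + v) (- x))//.
transitivity (\int[mu]_(u in `[(M - x)%R, +oo[) (a0 u)%:E)%E; last first.
  apply: eq_integral => u; rewrite inE/= in_itv/= andbT => ux.
  by rewrite a0E//; apply: le_trans ux; rewrite subr_ge0.
rewrite (@increasing_ge0_integration_by_substitutiony R (fun v => M + v) a0 (- x)).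
- by apply: eq_integral => v _; rewrite cF /= mulr1 opprK.
- by move=> u v _ _; rewrite ltrD2l.
- by rewrite cF => u _; exact: cvg_cst.
- by rewrite cF; exact: is_cvg_cst.
- by rewrite cF; exact: is_cvg_cst.
- split.
  + by move=> u _; apply: derivableD.
  + apply: cvg_at_right_filter; apply: cvgD; [exact: cvg_cst|exact: cvg_id].
- exact: cvg_addrl.
- exact: continuous_subspaceT.
- by move=> u _; exact: a0_ge0.
Qed.

Local Notation G := (tail_int a).

Lemma trawl_box_finite M x : x <= M -> finite_borel (trawl_box M x).
Proof.
move=> xM; split; first exact: trawl_box_measurable.
rewrite leb2_trawl_box//.
apply: integrable_lty => //.
by apply: tail_integrable; [exact: trawl_tail_fun|rewrite subr_ge0].
Qed.

Lemma lam_trawl_box M x : x <= M -> lam (trawl_box M x) = G (M - x).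
Proof. by move=> xM; rewrite /lam leb2_trawl_box. Qed.

Definition trawl_strip (M x y : R) : set (R * R) :=
  trawl_box M y `&` [set p | x < p.1].

Lemma trawl_strip_finite M x y : y <= M -> finite_borel (trawl_strip M x y).
Proof.
move=> yM; apply: finite_borelI; first exact: trawl_box_finite.
have mf : measurable_fun setT (fst : R * R -> R) by exact: measurable_fst.
have := measurable_fun_ltr (measurable_cst x) mf measurableT (I : measurable [set true]).
by rewrite setTI; congr measurable; apply/seteqP; split => p /=.
Qed.

Lemma trawl_strip_split M x y : x <= y ->
  trawl_box M y = trawl_strip M x y `|` trawl_box M x /\
  trawl_strip M x y `&` trawl_box M x = set0.
Proof.
move=> xy; split.
- apply/seteqP; split => -[r v]; rewrite /trawl_strip /trawl_box /=.
    by move=> [ry h]; have [rx|xr] := leP r x; [right|left].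
  by move=> [[]//|[rx ?]]; split => //; exact: le_trans xy.
- rewrite -subset0 => -[r v]; rewrite /trawl_strip /trawl_box /= => -[[_ xr] [rx _]].
  by move: xr; rewrite ltNge rx.
Qed.

Lemma lam_trawl_strip M x y : x <= y -> y <= M ->
  lam (trawl_strip M x y) = G (M - y) - G (M - x).
Proof.
move=> xy yM; have [E1 E2] := trawl_strip_split M xy.
have xM := le_trans xy yM.
have := lamU (trawl_strip_finite x yM) (trawl_box_finite xM) E2.
by rewrite -E1 !lam_trawl_box// => ->; rewrite addrK.
Qed.

End trawl_geometry.

Section tail_functions.
Context (R : realType) (a : R -> R).
Hypothesis Ha : trawl_function a.
Local Notation mu := (@lebesgue_measure R).
Local Notation G := (tail_int a).
Let ta := trawl_tail_fun Ha.

(** A decay of order [s ^ (- p)] becomes [s ^ (1 - p)] after one tail integration, and [p - 1 > 1]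
    allows a second one: the autocovariance is integrable. *)
Lemma tail_int_tail_fun (p C : R) : 2 < p ->
  (\forall s \near +oo_R, `|a s| <= C * s `^ (- p)) -> tail_fun G.
Proof.
move=> p2 [A [_ hA]].
have p1 : 1 < p by lra.
apply: (@integrable_of_power _ _ (C / (p - 1)) (p - 1)); first lra.
{ exact: tail_int_ge0. }
{ exact: tail_int_noninc. }
exists (Num.max A 0); split; first exact: num_real.
move=> h; rewrite gt_max => /andP[Ah h0].
have i2 := powR_tail_integrable C p1 h0.
have -> : C / (p - 1) * h `^ (- (p - 1)) =
    \int[mu]_(x in `[h, +oo[) (C * x `^ (- p)).
  have i1 := powR_tail_integrable 1 p1 h0.
  rewrite RintegralZl//; last by apply: eq_integrable i1 => // x _ /=; rewrite mul1r.
  rewrite /Rintegral powR_tail_integral//= opprB mulrAC mulrA; ring.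
apply: le_Rintegral => //; first exact: (tail_integrable ta (ltW h0)).
move=> x /=; rewrite in_itv/= andbT => hx.
by apply: le_trans (ler_norm _) _; apply: hA; exact: lt_le_trans hx.
Qed.

(** The square root decays like [s ^ (- p / 2)] and [p / 2 > 1]. This makes the sum over lags
    converge in the proof of tightness. *)
Lemma sqrt_tail_fun (p C : R) : 2 < p ->
  (\forall s \near +oo_R, `|a s| <= C * s `^ (- p)) ->
  tail_fun (fun s => Num.sqrt (a s)).
Proof.
move=> p2 [A [_ hA]].
apply: (@integrable_of_power _ _ (Num.sqrt `|C|) (p / 2)); first lra.
{ by move=> s _; exact: sqrtr_ge0. }
{ by move=> s t s0 st; rewrite ler_wsqrtr//; exact: (trawl_nonincreasing Ha). }
exists (Num.max A 0); split; first exact: num_real.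
move=> h; rewrite gt_max => /andP[Ah h0].
have -> : h `^ (- (p / 2)) = Num.sqrt (h `^ (- p)).
  by rewrite -powR12_sqrt ?powR_ge0// -powRrM; congr (_ `^ _); lra.
rewrite -sqrtrM// ler_wsqrtr//.
apply: le_trans (ler_norm _) _; apply: le_trans (hA h Ah) _.
by rewrite ler_wpM2r ?powR_ge0// ler_norm.
Qed.

Lemma tail_int_lip x y : 0 <= x -> 0 <= y -> `|G x - G y| <= a 0 * `|x - y|.
Proof.
wlog xy : x y / x <= y => [h|].
  have [xy|/ltW yx] := leP x y; first exact: h.
  by move=> x0 y0; rewrite distrC [`|x - y|]distrC; exact: h.
move=> x0 y0; rewrite ger0_norm ?subr_ge0; last exact: tail_int_noninc.
apply: le_trans (tail_int_ub ta x0 xy) _.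
rewrite distrC ger0_norm ?subr_ge0// mulrC.
by rewrite ler_wpM2r ?subr_ge0//; exact: (trawl_nonincreasing Ha).
Qed.

Lemma continuous_tail_int_norm : continuous (fun x : R => G `|x|).
Proof.
move=> x; apply/cvgrPdist_le => e e0.
have a00 : 0 <= a 0 by exact: (trawl_ge0 Ha).
have k0 : 0 < a 0 + 1 by rewrite ltr_wpDl.
near=> y.
apply: le_trans (tail_int_lip _ _) _ => //.
have : `|x - y| <= e / (a 0 + 1).
  by near: y; apply: cvgr_dist_le; [exact: cvg_id|exact: divr_gt0].
rewrite ler_pdivlMr// => h; apply: le_trans h; rewrite mulrC.
apply: ler_pM => //; first exact: ler_dist_dist.
by rewrite lerDl.
Unshelve. all: by end_near.
Qed.

Lemma integral_acov (s2 : R) : tail_fun G ->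
  \int[mu]_s (s2 * G `|s|) = s2 * (2 * tail_int G 0).
Proof.
move=> tG.
have G0 (x : R) : 0 <= G `|x| by exact: tail_int_ge0.
have E : (\int[mu]_s (G `|s|)%:E = (2 * tail_int G 0)%:E)%E.
  rewrite ge0_symfun_integralT//; last 2 first.
  { exact: continuous_tail_int_norm. }
  { by move=> x /=; rewrite normrN. }
  rewrite EFinM /tail_int [in RHS]/Rintegral fineK; last first.
    exact: integrable_fin_num (dec_int tG).
  rewrite -set_itvcy; apply: (f_equal (mule 2%:E)).
  by apply: eq_integral => x; rewrite inE/= in_itv/= andbT => x0; rewrite ger0_norm.
have iG : rintegrable mu (fun s => G `|s|).
  apply: ge0_rintegrableP => //; last by rewrite E ltry.
  exact: continuous_measurable_fun continuous_tail_int_norm.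
by rewrite (RintZ s2 iG) /Rintegral E.
Qed.

End tail_functions.

Section trawl_covariance.
Context d (T : measurableType d) (R : realType) (P : probability T R).
Variables (L : set (R * R) -> T -> R) (gamma b : R) (nu : {measure set R -> \bar R}).
Hypothesis HL : levy_basis P L gamma b nu.
Variables (m s2 : R) (eps : R -> R).
Hypothesis ce : cumulant_expansion (log_cf_re b nu) (log_cf_im gamma nu) m s2 eps.

(** Polarization: [centered_sum_moments] for the family of the two sets gives the variance of the
    sum of the centered values, and subtracting the two variances leaves twice the covariance. *)
Lemma levy_covariance A B : finite_borel A -> finite_borel B ->
  covariance P (L A) (L B) = (s2 * lam (A `&` B))%:E.
Proof.
move=> fA fB.
have [iA EA _] := levy_moments HL ce fA.
have [iB EB _] := levy_moments HL ce fB.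
rewrite covariance_Rint// EA EB.
pose F (i : bool) := if i then A else B.
have fF i : finite_borel (F i) by case: i.
have [i1 _ V] := centered_sum_moments HL ce fF (fun=> 1).
have [jA EA1 VA] := centered_moments HL ce fA.
have [jB EB1 VB] := centered_moments HL ce fB.
set x := (fun w => L A w - m * lam A) in jA EA1 VA.
set y := (fun w => L B w - m * lam B) in jB EB1 VB.
have sE w : centered_sum L m F (fun=> 1) w = x w + y w.
  by rewrite /centered_sum /index_enum; rewrite !unlock /= /F; rewrite !mul1r addr0.
have qE : quad F (fun=> 1) = lam A + lam B + 2 * lam (A `&` B).
  rewrite /quad /index_enum; rewrite !unlock /= /F !setIid (setIC B A); ring.
have ixy := sqintegrableM jA jB.
have E1 : \int[P]_w (x w * y w) = s2 * lam (A `&` B).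
  have E2 : \int[P]_w (x w + y w) ^+ 2 = \int[P]_w x w ^+ 2 + \int[P]_w y w ^+ 2 + 2 * \int[P]_w (x w * y w).
    rewrite -(RintZ 2 ixy) -(RintD jA.2 jB.2).
    rewrite -(RintD (rintegrableD jA.2 jB.2) (rintegrableZ 2 ixy)).
    by apply: eq_Rint => w; ring.
  have E3 : \int[P]_w (x w + y w) ^+ 2 = s2 * quad F (fun=> 1).
    by rewrite -V; apply: eq_Rint => w; rewrite sE.
  have : 2 * \int[P]_w (x w * y w) = 2 * (s2 * lam (A `&` B)).
    have -> : 2 * \int[P]_w (x w * y w) = s2 * quad F (fun=> 1) - \int[P]_w x w ^+ 2 - \int[P]_w y w ^+ 2.
      rewrite -E3 E2.
      move: (\int[P]_w (x w * y w)) (\int[P]_w x w ^+ 2) (\int[P]_w y w ^+ 2) => u1 u2 u3; ring.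
    rewrite VA VB qE; move: (lam A) (lam B) (lam _) => u1 u2 u3; ring.
  by move/mulfI; apply; rewrite pnatr_eq0.
congr EFin.
have -> : \int[P]_w (L A w * L B w) =
    \int[P]_w (x w * y w) + (m * lam B) * \int[P]_w x w + (m * lam A) * \int[P]_w y w + m * lam A * (m * lam B).
  have ix := sqintegrable_int jA; have iy := sqintegrable_int jB.
  rewrite -(RintZ _ ix) -(RintZ _ iy) -[X in _ + X](Rint_cst P).
  have i1' := rintegrableD ixy (rintegrableZ (m * lam B) ix).
  have i2' := rintegrableD i1' (rintegrableZ (m * lam A) iy).
  rewrite -(RintD ixy (rintegrableZ _ ix)) -(RintD i1' (rintegrableZ _ iy)).
  rewrite -(RintD i2' (rintegrable_cst _ _)).
  by apply: eq_Rint => w; rewrite /x /y; ring.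
rewrite E1 EA1 EB1; move: (lam A) (lam B) (lam _) => u1 u2 u3; ring.
Qed.

Lemma trawl_covariance (a : R -> R) (Ha : trawl_function a) t h :
  covariance P (trawl_process L a t) (trawl_process L a (t + h)) =
  (s2 * tail_int a `|h|)%:E.
Proof.
rewrite /trawl_process !trawl_set_atE (levy_covariance (trawl_box_finite Ha _) (trawl_box_finite Ha _))//.
rewrite trawl_boxI// lam_trawl_box//; last by rewrite le_max !ge_min lexx.
congr (_ * tail_int a _)%:E; have [h0|h0] := leP 0 h.
  by rewrite max_r ?min_l ?lerDl// addrAC subrr add0r ger0_norm.
by rewrite max_l ?min_r ?gerDl ?(ltW h0)// opprD addNKr ltr0_norm.
Qed.

End trawl_covariance.

(** * Independence of the past and the future of the basis *)

Section past_future.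
Context d (T : measurableType d) (R : realType) (P : probability T R).

Lemma Rint_indic (E : set T) : measurable E -> \int[P]_w (\1_E w) = fine (P E).
Proof. by move=> mE; rewrite /Rintegral integral_indic// setIT. Qed.

(** Modifying the generators on null sets changes each event by a null set only: events with such a
    counterpart form a sigma-field. This is needed because the values of [L] split over atoms only
    almost surely. *)
Lemma ae_sigma_gen (I : Type) (D : set I) (Z Z' : I -> T -> R) :
  (forall i, D i -> {ae P, forall w, Z i w = Z' i w}) ->
  forall E, <<s gen_of D Z>> E ->
  exists2 E', <<s gen_of D Z'>> E' & {ae P, forall w, E w <-> E' w}.
Proof.
move=> ZZ'.
pose C := [set E | exists2 E', <<s gen_of D Z'>> E' & {ae P, forall w, E w <-> E' w}].
have sC : <<s gen_of D Z>> `<=` C; last by move=> E /sC.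
apply: smallest_sub.
- split => [|A [A' sA' hA]|F FC].
  + by exists set0; [exact: sigma_algebra0|exact: nearW].
  + exists (setT `\` A'); first exact: sigma_algebraCD.
    by move: hA; apply: filterS => w h; split=> -[_ nA]; split => // ?; apply: nA; apply/h.
  + have /choice[F' hF] n : exists E', <<s gen_of D Z'>> E' /\ {ae P, forall w, F n w <-> E' w}.
      by have [E' ? ?] := FC n; exists E'.
    exists (\bigcup_n F' n).
      by apply: sigma_algebra_bigcup => n; exact: (hF n).1.
    have : {ae P, forall w n, F n w <-> F' n w}.
      by apply/ae_foralln => n; exact: (hF n).2.
    apply: filterS => w h; split => -[n _ Fn]; exists n => //; exact/h.
- move=> _ [i Di [B mB <-]]; exists (setT `&` Z' i @^-1` B).
    by apply: sub_sigma_algebra; exists i => //; exists B.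
  move: (ZZ' i Di); apply: filterS => w h; split=> -[_ /=]; [rewrite h|rewrite -h] => ?; by split.
Qed.

Lemma indic_indep_mul (E : set T) (W : T -> R) (f : R -> R) (M : R) :
  measurable E -> measurable_fun setT W -> measurable_fun setT f ->
  (forall x, `|f x| <= M) ->
  indep_rv P (\1_E : T -> R) W ->
  \int[P]_w (\1_E w * f (W w)) = fine (P E) * \int[P]_w f (W w).
Proof.
move=> mE mW mf fM ind.
have mf' : measurable_fun setT (f \o W) by exact: measurableT_comp.
have i1 : rintegrable P (id \o \1_E : T -> R).
  apply: (@bounded_rintegrable _ _ _ P _ 1); first exact: measurable_indic.
  by move=> x; rewrite /= indicE ger0_norm// lern1 leq_b1.
have i2 : rintegrable P (f \o W).
  by apply: (bounded_rintegrable P mf') => x; exact: fM.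
have [_ ->] := indep_rv_mul (indep_rv_comp (@measurable_id _ R setT) mf ind) i1 i2.
by congr (_ * _); rewrite /= Rint_indic//.
Qed.

Lemma indep_rv_indic (E : set T) (W : T -> R) : measurable E -> measurable_fun setT W ->
  (forall B, measurable B -> P (E `&` W @^-1` B) = (P E * P (W @^-1` B))%E) ->
  indep_rv P (\1_E : T -> R) W.
Proof.
move=> mE mW h A B mA mB.
have mWB : measurable (W @^-1` B) by rewrite -[X in measurable X]setTI; exact: mW.
rewrite preimage_indic; case: ifP => _; case: ifP => _.
- by rewrite setTI probability_setT mul1e.
- exact: h.
- have mD : P (W @^-1` B `\` E) = (P (W @^-1` B) - P (E `&` W @^-1` B))%E.
    by rewrite setIC measureD// ltey_eq fin_num_measure.
  rewrite setIC -setDE mD (h B mB) probability_setC// muleBl ?mul1e//.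
  by rewrite fin_num_measure.
- by rewrite set0I measure0 mul0e.
Qed.

Variables (L : set (R * R) -> T -> R) (gamma b : R) (nu : {measure set R -> \bar R}).
Hypothesis HL : levy_basis P L gamma b nu.

(** The atoms of the joint family [U], [V] fall into two disjoint blocks: those inside some [V j]
    and the others. As each [U k] is disjoint from each [V j], an atom inside both is empty, so up
    to null sets [E] depends on the second block and the centered sum on the first. *)
Lemma levy_indep_families (K J : finType) (U : K -> set (R * R)) (V : J -> set (R * R)) :
  (forall k, finite_borel (U k)) -> (forall j, finite_borel (V j)) ->
  (forall k j, U k `&` V j = set0) ->
  forall (E : set T) (m : R) (th : J -> R) (f : R -> R) (M : R),
  <<s gen_of setT (fun k => L (U k)) >> E ->
  measurable_fun setT f -> (forall x, `|f x| <= M) ->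
  \int[P]_w (\1_E w * f (centered_sum L m V th w)) =
  fine (P E) * \int[P]_w f (centered_sum L m V th w).
Proof.
move=> fU fV UV E m th f M sE mf fM.
pose A (i : (K + J)%type) := match i with inl k => U k | inr j => V j end.
have fA i : finite_borel (A i) by case: i.
pose D := @atom R _ A; have fD := atom_finite_borel fA.
have tD := @atom_trivIset R _ A.
have mD k : measurable_fun setT (L (D k)) by exact: (levy_measurable HL (fD k)).
have indD : mutually_independent P (fun k => L (D k)) by exact: (levy_basis_independent HL).
pose future k := [exists j, inr j \in @atom_index (K + J)%type k].
pose Z k w := \sum_(i | (inl k \in @atom_index (K + J)%type i) && ~~ future i) L (D i) w.
pose W w := \sum_j th j * (\sum_(i | inr j \in @atom_index (K + J)%type i) L (D i) w - m * lam (V j)).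
have hZ k : {ae P, forall w, L (U k) w = Z k w}.
  have := levy_set0 HL; have := levy_atoms HL fA; apply: filterS2 => w h L0.
  rewrite (h (inl k)) (bigID future)/= big1 ?add0r// => i /andP[ki /existsP[j ji]].
  suff -> : atom A i = set0 by [].
  rewrite -subset0 => p Dp; rewrite -(UV k j); split.
    exact: (atomP Dp (inl k)).2.
  exact: (atomP Dp (inr j)).2.
have hW : {ae P, forall w, centered_sum L m V th w = W w}.
  have := levy_atoms HL fA; apply: filterS => w h.
  by apply: eq_bigr => j _; rewrite (h (inr j)).
pose Dp := [set i | ~~ future i]; pose De := [set i | future i].
have [E' sE' EE'] := ae_sigma_gen (fun k _ => hZ k) sE.
have sub : <<s gen_of setT Z >> `<=` <<s gen_of Dp (fun i => L (D i)) >>.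
  apply: smallest_sub; first exact: smallest_sigma_algebra.
  move=> _ [k _ [B mB <-]]; rewrite setTI.
  suff : adapted (gen_of Dp (fun i => L (D i))) (Z k) by exact.
  by apply: adapted_sum => i /andP[_ fi]; exact: adapted_gen.
have mDp : gen_of Dp (fun i => L (D i)) `<=` measurable by exact: gen_of_measurable.
have smD : <<s gen_of Dp (fun i => L (D i)) >> `<=` measurable.
  by apply: smallest_sub => //; exact: sigma_algebra_measurable.
have mE' : measurable E' by apply: smD; exact: sub.
have mE : measurable E.
  have : <<s gen_of setT (fun k => L (U k)) >> `<=` measurable.
    apply: smallest_sub; first exact: sigma_algebra_measurable.
    by apply: gen_of_measurable => k; exact: (levy_measurable HL (fU k)).
  exact.
have mW : measurable_fun setT W.
  apply: measurable_bigsum => j _; apply: measurable_funM => //.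
  by apply: measurable_funB => //; exact: measurable_bigsum.
have mW0 := measurable_centered_sum HL m fV th.
have indic_le (F : set T) w : `|\1_F w : R| <= 1.
  by rewrite indicE ger0_norm// lern1 leq_b1.
transitivity (\int[P]_w (\1_E' w * f (W w))).
  apply: ae_eq_Rint.
  { by apply: measurable_funM; [exact: measurable_indic|exact: measurableT_comp]. }
  { by apply: measurable_funM; [exact: measurable_indic|exact: measurableT_comp]. }
    move: EE' hW; apply: filterS2 => w h1 ->; congr (_ * _).
    rewrite !indicE; congr (_%:R); congr nat_of_bool.
    by apply/idP/idP; rewrite !inE => /h1.
have -> : P E = P E'.
  have : \int[P]_w (\1_E w) = \int[P]_w (\1_E' w) :> R.
    apply: ae_eq_Rint; [exact: measurable_indic|exact: measurable_indic|].
    move: EE'; apply: filterS => w h1; rewrite !indicE; congr (_%:R); congr nat_of_bool.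
    by apply/idP/idP; rewrite !inE => /h1.
  rewrite !Rint_indic// => h.
  by rewrite -[LHS]fineK ?fin_num_measure// -[RHS]fineK ?fin_num_measure// h.
have -> : \int[P]_w f (centered_sum L m V th w) = \int[P]_w f (W w).
  apply: ae_eq_Rint; [exact: measurableT_comp|exact: measurableT_comp|].
  by move: hW; apply: filterS => w ->.
apply: (indic_indep_mul (M := M)) => //.
apply: (@indep_blocks_rv _ _ _ P _ (fun i => L (D i)) mD indD Dp De).
- by move=> i [] /=; rewrite /Dp /De /= => /negP.
- by apply/adaptedP; apply: measurable_indic; exact: sub.
- apply: adapted_sum => j _; apply: adaptedM; first exact: adapted_cst.
  apply: adaptedD; last exact: adapted_cst.
  apply: adapted_sum => i ji; apply: adapted_gen.
  by rewrite /De /= /future; apply/existsP; exists j.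
Qed.

(** The events with the announced limit form a lambda-system. For an increasing union, the bound
    [|f n w| <= 1] makes the error of replacing the union by [F N] at most the gap in probability,
    uniformly in [n]. *)
Lemma dynkin_cvg_indic (Pi : set (set T)) (f : nat -> T -> R) (c : R) :
  setI_closed Pi -> Pi `<=` measurable ->
  (forall n, measurable_fun setT (f n)) -> (forall n w, `|f n w| <= 1) ->
  \int[P]_w f n w @[n --> \oo] --> c ->
  (forall E, Pi E -> \int[P]_w (\1_E w * f n w) @[n --> \oo] --> fine (P E) * c) ->
  forall E, <<s Pi >> E -> \int[P]_w (\1_E w * f n w) @[n --> \oo] --> fine (P E) * c.
Proof.
move=> PiI mPi mf f1 fT fPi.
pose C := [set E | measurable E /\ \int[P]_w (\1_E w * f n w) @[n --> \oo] --> fine (P E) * c].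
have smPi : <<s Pi >> `<=` measurable.
  by apply: smallest_sub => //; exact: sigma_algebra_measurable.
have iE E n : measurable E -> rintegrable P (fun w => \1_E w * f n w).
  move=> mE; apply: (@bounded_rintegrable _ _ _ P _ 1).
    by apply: measurable_funM => //; exact: measurable_indic.
  move=> w; rewrite normrM -[leRHS]mulr1 ler_pM//.
  by rewrite indicE ger0_norm// lern1 leq_b1.
suff : <<s Pi >> `<=` C by move=> h E /h[].
apply: (lambda_system_subset PiI) => //; last by move=> E PE; split; [exact: mPi|exact: fPi].
split => //.
- split => //; rewrite probability_setT/= mul1r.
  by under eq_fun do under eq_Rint do rewrite indicT mul1r.
- move=> A B BA [mA cA] [mB cB]; have mAB : measurable (A `\` B) by exact: measurableD.
  split => //.
  have -> : fine (P (A `\` B)) = fine (P A) - fine (P B).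
    rewrite measureD//; last by rewrite ltey_eq fin_num_measure.
    by rewrite (setIidr BA) fineB// fin_num_measure.
  rewrite mulrBl.
  rewrite (_ : (fun n => _) = (fun n => \int[P]_w (\1_A w * f n w) - \int[P]_w (\1_B w * f n w))).
    exact: cvgB.
  apply/funext => n; rewrite -(RintB (iE _ n mA) (iE _ n mB)).
  apply: eq_Rint => w; rewrite -mulrBl; congr (_ * _).
  have [Bw|Bw] := pselect (B w).
    by rewrite !indicE (mem_set Bw) (mem_set (BA _ Bw)) subrr memNset// => -[].
  have [Aw|Aw] := pselect (A w).
    by rewrite !indicE (mem_set Aw) (memNset Bw) subr0 mem_set.
  by rewrite !indicE (memNset Aw) (memNset Bw) subr0 memNset// => -[].
- move=> F ndF FC; have mF n : measurable (F n) by case: (FC n).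
  have mU : measurable (\bigcup_n F n) by exact: bigcup_measurable.
  split => //.
  have cP : fine (P (F n)) @[n --> \oo] --> fine (P (\bigcup_n F n)).
    apply: fine_cvg; rewrite fineK ?fin_num_measure//.
    exact: nondecreasing_cvg_mu.
  apply/cvgrPdist_le => e e0.
  have e4 : 0 < e / 4 by lra.
  have k0 : 0 < `|c| + 1 by rewrite ltr_wpDl.
  have e5 : 0 < e / 4 / (`|c| + 1) by exact: divr_gt0.
  have /cvgrPdist_le /(_ _ e4) h1 := cP.
  have /cvgrPdist_le /(_ _ e5) h2 := cP.
  have [N [hN1 hN2]] : exists N, `|fine (P (\bigcup_n F n)) - fine (P (F N))| <= e / 4 /\
      `|fine (P (\bigcup_n F n)) - fine (P (F N))| <= e / 4 / (`|c| + 1).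
    have [N _ hN] : \forall N \near \oo, `|fine (P (\bigcup_n F n)) - fine (P (F N))| <= e / 4 /\
      `|fine (P (\bigcup_n F n)) - fine (P (F N))| <= e / 4 / (`|c| + 1).
      by near=> N; split; near: N.
    by exists N; apply: hN => /=.
  have [_ /cvgrPdist_le /(_ _ e4)] := FC N; apply: filterS => n hn.
  have d1 : `|\int[P]_w (\1_(\bigcup_n F n) w * f n w) - \int[P]_w (\1_(F N) w * f n w)| <= e / 4.
    apply: le_trans hN1.
    have -> : fine (P (\bigcup_n F n)) = \int[P]_w (\1_(\bigcup_n F n) w) by rewrite Rint_indic//.
    have -> : fine (P (F N)) = \int[P]_w (\1_(F N) w) by rewrite Rint_indic//.
    have ii E : measurable E -> rintegrable P (\1_E : T -> R).
      move=> mE; apply: (@bounded_rintegrable _ _ _ P _ 1); first exact: measurable_indic.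
      by move=> w; rewrite indicE ger0_norm// lern1 leq_b1.
    rewrite -(RintB (ii _ mU) (ii _ (mF N))); apply: le_trans (ler_norm _).
    apply: ler_norm_RintB; [exact: iE|exact: iE|exact: (rintegrableB (ii _ mU) (ii _ (mF N)))|].
    move=> w; rewrite -mulrBl normrM -[leRHS]mulr1 ler_pM//.
    rewrite !indicE; have [Fw|Fw] := pselect (F N w).
      by rewrite (mem_set Fw) mem_set ?subrr ?normr0//; exists N.
    by rewrite (memNset Fw) subr0 ger0_norm.
  have d2 : `|fine (P (\bigcup_n F n)) * c - fine (P (F N)) * c| <= e / 4.
    rewrite -mulrBl normrM; move: hN2; rewrite ler_pdivlMr// => h.
    by apply: le_trans h; rewrite ler_wpM2l// lerDl.
  rewrite -(subrKA (fine (P (F N)) * c)); apply: le_trans (ler_normD _ _) _.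
  rewrite -(subrKA (\int[P]_w (\1_(F N) w * f n w)) (fine (P (F N)) * c)).
  have := ler_normD (fine (P (F N)) * c - \int[P]_w (\1_(F N) w * f n w))
     (\int[P]_w (\1_(F N) w * f n w) - \int[P]_w (\1_(\bigcup_n F n) w * f n w)).
  rewrite [X in _ <= _ + X -> _]distrC; lra.
Unshelve. all: by end_near.
Qed.

End past_future.

(** Distance of two indices: one of the two truncated differences is always 0. *)
Definition dn (k l : nat) := (k - l + (l - k))%N.

Lemma dnC k l : dn k l = dn l k.
Proof. by rewrite /dn addnC. Qed.

(** * Limit of the characteristic functions *)

Section grid_sums.
Context (R : realType) (H : R -> R).
Hypothesis tH : tail_fun H.
Local Notation I := (tail_int H).

(** A window of length [K] contains at most [K / D + 1] points of a grid of mesh [D]. The grid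
    clamped to a window of length [K + D] telescopes, and each counted point contributes a full step
    [D]. *)
Lemma count_window (D : R) (D0 : 0 < D) (n : nat) (r K : R) : 0 <= K ->
  \sum_(k < n) (if r <= k%:R * D < r + K then 1 else 0) <= K / D + 1 :> R.
Proof.
move=> K0; rewrite -(ler_pM2r D0) mulrDl divfK ?gt_eqF// mul1r.
pose psi k := Num.max r (Num.min (k%:R * D) (r + K + D)).
have : \sum_(0 <= k < n) (psi k.+1 - psi k) <= K + D.
  rewrite telescope_sumr// lerBlDr; apply: le_trans (_ : r + K + D <= _); last first.
    have : r <= psi 0%N by rewrite le_max lexx.
    lra.
  rewrite ge_max ge_min lexx orbT andbT -addrA lerDl addr_ge0//; exact: ltW.
apply: le_trans; rewrite big_mkord mulr_suml; apply: ler_sum => k _.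
rewrite /psi -natr1 mulrDl mul1r.
case: ifPn => [/andP[h1 h2]|_].
  have -> : Num.min (k%:R * D + D) (r + K + D) = k%:R * D + D by rewrite min_l//; lra.
  have -> : Num.min (k%:R * D) (r + K + D) = k%:R * D.
    by rewrite min_l// ler_wpDr ?(ltW D0) ?(ltW h2).
  by rewrite mul1r !max_r; lra.
rewrite mul0r subr_ge0 ge_max le_max lexx/= le_max; apply/orP; right.
by rewrite le_min !ge_min lexx orbT andbT lerDl (ltW D0).
Qed.

Lemma grid_sum_ub (D : R) (D0 : 0 < D) x N : 0 <= x ->
  \sum_(j < N) D * H (x + j.+1%:R * D) <= I x - I (x + N%:R * D).
Proof.
move=> x0; elim: N => [|N IH]; first by rewrite big_ord0 mul0r addr0 subrr.
rewrite big_ord_recr/=.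
have h : 0 <= x + N%:R * D by rewrite addr_ge0// mulr_ge0// ltW.
have := @tail_int_lb _ _ tH (x + N%:R * D) (x + N.+1%:R * D) h.
rewrite -natr1 mulrDl mul1r addrA lerDl (ltW D0) => /(_ isT).
rewrite [x + _ + D - _]addrAC subrr add0r; move: IH; lra.
Qed.

Lemma grid_sum_lb (D : R) (D0 : 0 < D) x N : 0 <= x ->
  I x - I (x + N%:R * D) <= \sum_(j < N) D * H (x + j%:R * D).
Proof.
move=> x0; elim: N => [|N IH]; first by rewrite big_ord0 mul0r addr0 subrr.
rewrite big_ord_recr/=.
have h : 0 <= x + N%:R * D by rewrite addr_ge0// mulr_ge0// ltW.
have := @tail_int_ub _ _ tH (x + N%:R * D) (x + N.+1%:R * D) h.
rewrite -natr1 mulrDl mul1r addrA lerDl (ltW D0) => /(_ isT).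
rewrite [x + _ + D - _]addrAC subrr add0r; move: IH; lra.
Qed.

Lemma grid_sum_le (D : R) (D0 : 0 < D) x N : 0 <= x ->
  \sum_(j < N) D * H (x + j.+1%:R * D) <= I x.
Proof.
move=> x0; apply: le_trans (grid_sum_ub D0 N x0) _.
rewrite gerBl; apply: (tail_int_ge0 tH).
by rewrite addr_ge0// mulr_ge0// ltW.
Qed.

Lemma row_split (F : nat -> R) k q : (k < q)%N ->
  \sum_(l < q) F (dn k l) = \sum_(j < k.+1) F j + \sum_(j < q - k.+1) F j.+1.
Proof.
move=> kq; rewrite -(big_mkord xpredT (fun l => F (dn k l))).
rewrite (@big_cat_nat _ _ _ k.+1)//=; congr (_ + _).
  rewrite big_mkord (reindex_inj rev_ord_inj)/=; apply: eq_bigr => j _.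
  by congr F; rewrite /dn; have := ltn_ord j; lia.
rewrite -{1}[k.+1]add0n big_addn big_mkord; apply: eq_bigr => j _.
by congr F; rewrite /dn; lia.
Qed.

Lemma row_ub (D : R) (D0 : 0 < D) k q x : (k < q)%N -> 0 <= x ->
  \sum_(l < q) D * H (x + (dn k l)%:R * D) <= 2 * I x + D * H x.
Proof.
move=> kq x0; rewrite (row_split (fun j => D * H (x + j%:R * D)) kq).
rewrite big_ord_recl/= mul0r addr0.
have := grid_sum_le D0 k x0; have := grid_sum_le D0 (q - k.+1) x0.
have -> : \sum_(i < k) D * H (x + (bump 0 i)%:R * D) = \sum_(j < k) D * H (x + j.+1%:R * D) by [].
lra.
Qed.

Lemma row_lb (D : R) (D0 : 0 < D) k q : (k < q)%N ->
  2 * I 0 - D * H 0 - I (k.+1%:R * D) - I ((q - k)%:R * D) <=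
  \sum_(l < q) D * H ((dn k l)%:R * D).
Proof.
move=> kq; rewrite (row_split (fun j => D * H (j%:R * D)) kq).
have := grid_sum_lb D0 k.+1 (lexx 0); have := grid_sum_lb D0 (q - k) (lexx 0).
rewrite !add0r; under eq_bigr do rewrite add0r.
under [X in _ -> _ <= X -> _]eq_bigr do rewrite add0r.
have -> : (q - k)%N = (q - k.+1).+1 by lia.
rewrite [X in _ <= X -> _]big_ord_recl/= mul0r.
have -> : \sum_(i < q - k.+1) D * H ((bump 0 i)%:R * D) = \sum_(j < q - k.+1) D * H (j.+1%:R * D) by [].
lra.
Qed.

(** Each row is a Riemann sum for the two-sided integral [2 * I 0]. Its error is one mesh term plus
    the tails lost at the two ends of the row, and the average of these tails over the rows is a
    Cesàro mean. *)
Lemma double_sum (D : R) (D0 : 0 < D) p q n : (p <= q)%N -> (q <= n)%N -> (0 < n)%N ->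
  `|D / n%:R * (\sum_(k < p) \sum_(l < q) H ((dn k l)%:R * D)) - p%:R / n%:R * (2 * I 0)|
  <= D * H 0 + 2 * (n%:R^-1 * \sum_(j < n) I (j.+1%:R * D)).
Proof.
move=> pq qn n0.
have N0 : (0 : R) < n%:R by rewrite ltr0n.
have I_ge0 j : 0 <= I (j%:R * D) by apply: (tail_int_ge0 tH); rewrite mulr_ge0// ltW.
have H0 : 0 <= H 0 by exact: (dec_ge0 tH).
have -> : D / n%:R * (\sum_(k < p) \sum_(l < q) H ((dn k l)%:R * D)) - p%:R / n%:R * (2 * I 0)
   = n%:R^-1 * \sum_(k < p) (\sum_(l < q) D * H ((dn k l)%:R * D) - 2 * I 0).
  rewrite sumrB sumr_const card_ord mulrBr -[2 * I 0 *+ p]mulr_natl.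
  congr (_ - _); last by rewrite !mulrA; congr (_ * _ * _); rewrite mulrC.
  rewrite [D / _]mulrC -mulrA; congr (_ * _); rewrite mulr_sumr.
  by apply: eq_bigr => k _; rewrite mulr_sumr.
rewrite normrM gtr0_norm ?invr_gt0//.
have key : `|\sum_(k < p) (\sum_(l < q) D * H ((dn k l)%:R * D) - 2 * I 0)| <=
    n%:R * (D * H 0) + 2 * \sum_(j < n) I (j.+1%:R * D).
  apply: le_trans (ler_norm_sum _ _ _) _.
  apply: (@le_trans _ _ (\sum_(k < p) (D * H 0 + I (k.+1%:R * D) + I ((p - k)%:R * D)))).
    apply: ler_sum => k _.
    have kq : (k < q)%N by exact: leq_trans pq.
    have := row_lb D0 kq; have := row_ub D0 kq (lexx 0).
    under [X in X <= _ -> _]eq_bigr do rewrite add0r.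
    have : I ((q - k)%:R * D) <= I ((p - k)%:R * D).
      apply: (tail_int_noninc tH); first by rewrite mulr_ge0// ltW.
      by rewrite ler_wpM2r ?(ltW D0)// ler_nat leq_sub2r.
    have := I_ge0 k.+1; have := I_ge0 (p - k)%N; rewrite ler_norml.
    move=> h1 h2 h3 h4 h5; apply/andP; split; lra.
  rewrite !big_split/= sumr_const card_ord -mulr_natl.
  have E : \sum_(k < p) I ((p - k)%:R * D) = \sum_(j < p) I (j.+1%:R * D).
    rewrite (reindex_inj rev_ord_inj)/=; apply: eq_bigr => j _.
    by rewrite subKn.
  have le_n : \sum_(j < p) I (j.+1%:R * D) <= \sum_(j < n) I (j.+1%:R * D).
    rewrite -!(big_mkord xpredT (fun j => I (j.+1%:R * D))).
    rewrite [leRHS](@big_cat_nat _ _ _ p)//=; last exact: leq_trans qn.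
    by rewrite lerDl sumr_ge0.
  have : p%:R * (D * H 0) <= n%:R * (D * H 0).
    by rewrite ler_wpM2r ?mulr_ge0 ?(ltW D0)// ler_nat (leq_trans pq).
  rewrite E; move: le_n; lra.
rewrite -(ler_pM2l N0) mulrA divff ?gt_eqF// mul1r.
by apply: le_trans key _; rewrite mulrDr lerD2l mulrCA mulVKf ?gt_eqF.
Qed.

(* Pairs of indices both below the window are counted; the other ones are
   charged to the larger of the two. *)
Lemma past_sum (D : R) (D0 : 0 < D) n s0 M : 0 <= s0 -> D <= M -> (0 < n)%N ->
  D / n%:R * (\sum_(k < n) \sum_(l < n) H (Num.max ((maxn k l)%:R * D - s0) 0)) <=
  H 0 * (s0 + M + 2 * D) ^+ 2 / (n%:R * D) + 2 * I (M - D).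
Proof.
move=> s00 DM n0.
have N0 : (0 : R) < n%:R by rewrite ltr0n.
have H0 : 0 <= H 0 by exact: (dec_ge0 tH).
pose g j : R := H (Num.max (j%:R * D - s0) 0).
have g0 j : 0 <= g j by apply: (dec_ge0 tH); rewrite le_max lexx orbT.
have gH j : g j <= H 0 by apply: (dec_noninc tH) => //; rewrite le_max lexx orbT.
pose one j : R := if 0 <= j%:R * D < 0 + (s0 + M + D) then 1 else 0.
have one0 j : 0 <= one j by rewrite /one; case: ifP.
pose phi j : R := if j%:R * D - s0 > M then g j else 0.
have phi0 j : 0 <= phi j by rewrite /phi; case: ifP.
have D00 := ltW D0.
have pt k l : g (maxn k l) <= H 0 * (one k * one l) + (phi k + phi l).
  wlog kl : k l / (k <= l)%N => [hw|].
    have /orP[/hw//|lk] := leq_total k l.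
    by rewrite maxnC [one k * _]mulrC [phi k + _]addrC; exact: hw.
  rewrite (maxn_idPr kl).
  have [h|h] := ltP M (l%:R * D - s0).
    have -> : phi l = g l by rewrite /phi h.
    by rewrite addrA lerDr addr_ge0// mulr_ge0// mulr_ge0.
  have kl' : k%:R * D <= l%:R * D by rewrite ler_wpM2r// ler_nat.
  have k0 : 0 <= k%:R * D by rewrite mulr_ge0.
  have h3 : s0 + M < s0 + M + D by rewrite ltrDl.
  have -> : one l = 1 by rewrite /one ifT//; apply/andP; split; lra.
  have -> : one k = 1 by rewrite /one ifT//; apply/andP; split; lra.
  by rewrite !mulr1 ler_wpDr// addr_ge0.
have sone : \sum_(k < n) one k <= (s0 + M + D) / D + 1.
  by apply: count_window => //; lra.
have sphi : D * \sum_(k < n) phi k <= I (M - D).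
  (* The tail integral at the preceding grid point, clamped at [M - D]: by monotonicity of [H], each
     nonzero [D * phi k] is at most the decrement of [psi], and the decrements telescope. *)
  pose psi j := I (Num.max (M - D) ((j%:R - 1) * D - s0)).
  have psi_ge0 j : 0 <= psi j.
    by apply: (tail_int_ge0 tH); rewrite le_max subr_ge0 DM.
  apply: (@le_trans _ _ (psi 0%N)); last first.
    by apply: (tail_int_noninc tH); [rewrite subr_ge0|rewrite le_max lexx].
  have : \sum_(0 <= k < n) (psi k - psi k.+1) <= psi 0%N.
    under eq_bigr do rewrite -opprB.
    by rewrite sumrN telescope_sumr// opprB gerBl.
  apply: le_trans; rewrite big_mkord mulr_sumr; apply: ler_sum => k _.
  rewrite /phi; case: ifPn => [h|_]; last first.
    rewrite mulr0 subr_ge0; apply: (tail_int_noninc tH).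
      by rewrite le_max subr_ge0 DM.
    by rewrite ge_max !le_max lexx /= lerD2r ler_wpM2r ?orbT// lerD2r ler_nat.
  rewrite /psi /g -[k.+1%:R]natr1 addrK.
  have -> : Num.max (k%:R * D - s0) 0 = k%:R * D - s0 by rewrite max_l//; lra.
  have -> : Num.max (M - D) ((k%:R - 1) * D - s0) = (k%:R - 1) * D - s0 by rewrite max_r//; lra.
  have -> : Num.max (M - D) (k%:R * D - s0) = k%:R * D - s0 by rewrite max_r//; lra.
  have h1 : 0 <= (k%:R - 1) * D - s0 by lra.
  have := @tail_int_lb _ _ tH _ (k%:R * D - s0) h1.
  rewrite lerD2r mulrBl mul1r gerBl => /(_ D00).
  by rewrite (_ : k%:R * D - s0 - (k%:R * D - D - s0) = D)//; ring.
apply: (@le_trans _ _ (D / n%:R * (H 0 * (\sum_(k < n) one k) ^+ 2 + 2 * n%:R * \sum_(k < n) phi k))).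
  rewrite ler_wpM2l ?divr_ge0//.
  apply: (@le_trans _ _ (\sum_(k < n) \sum_(l < n) (H 0 * (one k * one l) + (phi k + phi l)))).
    by apply: ler_sum => k _; apply: ler_sum => l _; exact: pt.
  rewrite le_eqVlt; apply/orP; left; apply/eqP.
  under eq_bigr => k _.
    rewrite big_split/= big_split/= sumr_const card_ord -mulr_sumr -mulr_sumr -[_ *+ n]mulr_natl.
  over.
  rewrite !big_split/= sumr_const card_ord -!mulr_sumr -mulr_suml -[_ *+ n]mulr_natl.
  ring.
rewrite mulrDr; apply: lerD; last first.
  rewrite (_ : _ * _ = 2 * (D * \sum_(k < n) phi k)); first by rewrite ler_pM2l.
  by move: (\sum_(k < n) phi k) => s; field; rewrite gt_eqF.
have -> : H 0 * (s0 + M + 2 * D) ^+ 2 / (n%:R * D) =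
    D / n%:R * (H 0 * ((s0 + M + D) / D + 1) ^+ 2).
  by field; rewrite !gt_eqF.
rewrite ler_wpM2l ?divr_ge0// ler_wpM2l// lerXn2r// nnegrE ?sumr_ge0//.
by rewrite addr_ge0// divr_ge0//; lra.
Qed.

End grid_sums.

Section grid_limits.
Context (R : realType) (Delta : nat -> R).
Hypothesis D0 : forall n, 0 < Delta n.
Hypothesis Dcvg : Delta n @[n --> \oo] --> (0 : R).
Hypothesis nD : n%:R * Delta n @[n --> \oo] --> +oo.

Lemma natr_gt0_near : \forall n \near \oo, (0 : R) < n%:R.
Proof. by exists 1%N => // n; rewrite /= ltr0n. Qed.

Lemma cvg_invn : (n%:R : R)^-1 @[n --> \oo] --> (0 : R).
Proof. by apply/gtr0_cvgV0; [exact: natr_gt0_near|exact: cvgr_idn]. Qed.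

Lemma cvg_invnD : (n%:R * Delta n)^-1 @[n --> \oo] --> (0 : R).
Proof.
apply/gtr0_cvgV0; last exact: nD.
by near=> n; rewrite mulr_gt0//; near: n; exact: natr_gt0_near.
Unshelve. all: by end_near.
Qed.

Lemma cvg_count (K : R) : n%:R^-1 * (K / Delta n + 1) @[n --> \oo] --> (0 : R).
Proof.
rewrite (_ : (fun n => _) = (fun n => K * (n%:R * Delta n)^-1 + n%:R^-1)).
  rewrite -[X in _ --> X]addr0; apply: cvgD; last exact: cvg_invn.
  by rewrite -[X in _ --> X](mulr0 K); apply: cvgM; [exact: cvg_cst|exact: cvg_invnD].
by apply/funext => n; rewrite invfM mulrDr mulr1 mulrCA.
Qed.

(** Beyond some [x] the function is small, and the grid points below [x] are a fraction of order
    [x / (n * Delta n)] of the total. *)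
Lemma cesaro_grid (h : R -> R) : (forall x, 0 <= x -> 0 <= h x) ->
  (forall x y, 0 <= x -> x <= y -> h y <= h x) ->
  (forall e, 0 < e -> exists2 x, 0 <= x & h x < e) ->
  n%:R^-1 * \sum_(j < n) h (j.+1%:R * Delta n) @[n --> \oo] --> (0 : R).
Proof.
move=> h0 hni hv; apply/cvgrPdist_le => e e0.
have e2 : 0 < e / 2 by lra.
have [x x0 hx] := hv _ e2.
have hc : h 0 * (n%:R^-1 * (x / Delta n + 1)) @[n --> \oo] --> (0 : R).
  by rewrite -[X in _ --> X](mulr0 (h 0)); apply: cvgM; [exact: cvg_cst|exact: cvg_count].
move/cvgrPdist_le : hc => /(_ _ e2) hc.
near=> n.
have N0 : (0 : R) < n%:R by near: n; exact: natr_gt0_near.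
have s0 : 0 <= n%:R^-1 * \sum_(j < n) h (j.+1%:R * Delta n).
  rewrite mulr_ge0 ?invr_ge0 ?ler0n// sumr_ge0// => j _.
  by rewrite h0// mulr_ge0// ltW.
rewrite sub0r normrN ger0_norm//.
(* The summand is taken at [j + 1], so the window for [j] is shifted by one mesh. *)
pose r := - Delta n.
apply: (@le_trans _ _ (n%:R^-1 * \sum_(j < n) (e / 2 + h 0 * (if r <= j%:R * Delta n < r + x then 1 else 0)))).
  rewrite ler_wpM2l ?invr_ge0 ?ler0n//; apply: ler_sum => j _.
  have j0 : 0 <= j%:R * Delta n by rewrite mulr_ge0// ltW.
  have Dn := D0 n.
  have j1 : 0 <= j.+1%:R * Delta n by rewrite mulr_ge0// ltW.
  case: ifPn => [_|]; first by rewrite mulr1 ler_wpDl ?(ltW e2)// hni.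
  rewrite negb_and -!ltNge -leNgt mulr0 addr0 => /orP[|hr]; first by rewrite /r; lra.
  apply: le_trans (ltW hx); apply: hni => //.
  by rewrite -natr1 mulrDl mul1r; move: hr; rewrite /r; lra.
rewrite big_split/= sumr_const card_ord -[e / 2 *+ n]mulr_natl -mulr_sumr mulrDr mulKf ?gt_eqF//.
have c1 : \sum_(i < n) (if r <= i%:R * Delta n < r + x then 1 else 0) <= x / Delta n + 1 by exact: count_window.
have c2 : `|0 - h 0 * (n%:R^-1 * (x / Delta n + 1))| <= e / 2 by near: n.
have c3 : n%:R^-1 * (h 0 * \sum_(i < n) (if r <= i%:R * Delta n < r + x then 1 else 0)) <=
   h 0 * (n%:R^-1 * (x / Delta n + 1)).
  by rewrite mulrCA; apply: ler_wpM2l; [exact: h0|rewrite ler_wpM2l ?invr_ge0 ?ler0n].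
move: c2; rewrite sub0r normrN => /(le_trans (ler_norm _)); move: c3; lra.
Unshelve. all: by end_near.
Qed.

Lemma truncn_ratio (s : R) : 0 <= s -> (Num.truncn (n%:R * s))%:R / n%:R @[n --> \oo] --> s.
Proof.
move=> s0; apply/cvgrPdist_le => e e0.
have /cvgrPdist_le /(_ _ e0) hn := cvg_invn.
near=> n.
have N0 : (0 : R) < n%:R by near: n; exact: natr_gt0_near.
have /andP[h1 h2] := truncn_itv (mulr_ge0 (ltW N0) s0).
have : `|0 - (n%:R : R)^-1| <= e by near: n.
rewrite sub0r normrN gtr0_norm ?invr_gt0// => h3.
have {1}-> : s = (n%:R * s) / n%:R by rewrite mulrAC divff ?mul1r// gt_eqF.
rewrite -mulrBl normrM [X in _ * X]gtr0_norm ?invr_gt0//.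
apply: le_trans h3; rewrite ler_piMl ?invr_ge0 ?(ltW N0)//.
rewrite ger0_norm ?subr_ge0// lerBlDr addrC natr1; exact: ltW.
Unshelve. all: by end_near.
Qed.

Lemma double_sum_cvg (H : R -> R) (s t : R) : tail_fun H ->
  0 <= s <= 1 -> 0 <= t <= 1 ->
  Delta n / n%:R * (\sum_(k < Num.truncn (n%:R * s)) \sum_(l < Num.truncn (n%:R * t))
     H ((dn k l)%:R * Delta n)) @[n --> \oo] --> Num.min s t * (2 * tail_int H 0).
Proof.
move=> tH; wlog st : s t / s <= t => [hw|].
  move=> h1 h2; have [st|/ltW ts] := leP s t.
    by have := hw _ _ st h1 h2; rewrite min_l.
  have := hw _ _ ts h2 h1; rewrite min_l//.
  under eq_fun do rewrite exchange_big/=.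
  by under eq_fun do under eq_bigr do under eq_bigr do rewrite dnC.
move=> /andP[s0 _] /andP[t0 t1]; rewrite min_l//.
have c1 : (Num.truncn (n%:R * s))%:R / n%:R * (2 * tail_int H 0) @[n --> \oo] --> s * (2 * tail_int H 0).
  by apply: cvgM; [exact: truncn_ratio|exact: cvg_cst].
have c2 : Delta n * H 0 + 2 * (n%:R^-1 * \sum_(j < n) tail_int H (j.+1%:R * Delta n)) @[n --> \oo] --> (0 : R).
  rewrite -[X in _ --> X]addr0 -[X in _ --> X + _](mul0r (H 0)) -[X in _ --> _ + X](mulr0 2).
  apply: cvgD; first by apply: cvgM => //; exact: cvg_cst.
  apply: cvgM; first exact: cvg_cst.
  apply: cesaro_grid; [exact: tail_int_ge0|exact: tail_int_noninc|exact: tail_int_cvg0].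
rewrite (_ : (fun n => _) = (fun n => (Num.truncn (n%:R * s))%:R / n%:R * (2 * tail_int H 0) +
  (Delta n / n%:R * (\sum_(k < Num.truncn (n%:R * s)) \sum_(l < Num.truncn (n%:R * t))
     H ((dn k l)%:R * Delta n)) - (Num.truncn (n%:R * s))%:R / n%:R * (2 * tail_int H 0)))); last first.
  by apply/funext => n; rewrite addrC subrK.
rewrite -[X in _ --> X]addr0; apply: cvgD => //.
apply/norm_cvg0P; apply: (squeeze_cvgr _ (cvg_cst 0) c2).
near=> n; rewrite normr_ge0/=.
have n0 : (0 < n)%N by near: n; exists 1%N.
apply: double_sum => //.
  by apply: le_truncn; rewrite ler_wpM2l.
by rewrite -[leqRHS](@natrK R n); apply: le_truncn; rewrite ler_piMr.
Unshelve. all: by end_near.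
Qed.

End grid_limits.

Section trig_lipschitz.
Context (R : realType).
Implicit Types x y : R.

Let half_sum x y : x = (x + y) / 2 + (x - y) / 2.
Proof. by field. Qed.

Let half_diff x y : y = (x + y) / 2 - (x - y) / 2.
Proof. by field. Qed.

Lemma cos_lip x y : `|cos x - cos y| <= `|x - y|.
Proof.
pose u := (x + y) / 2; pose v := (x - y) / 2.
have -> : cos x = cos u * cos v - sin u * sin v by rewrite -cosD -half_sum.
have -> : cos y = cos u * cos v + sin u * sin v by rewrite -cosB -half_diff.
have -> : cos u * cos v - sin u * sin v - (cos u * cos v + sin u * sin v) = - (2 * sin u * sin v) by ring.
have -> : x - y = 2 * v by rewrite /v mulrC divfK.
move: u v => u v.
rewrite normrN !normrM; apply: ler_pM; rewrite ?mulr_ge0 ?sin_le_norm//.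
by rewrite -[leRHS]mulr1 ler_pM// ler_norml sin_geN1 sin_le1.
Qed.

Lemma sin_lip x y : `|sin x - sin y| <= `|x - y|.
Proof.
pose u := (x + y) / 2; pose v := (x - y) / 2.
have -> : sin x = sin u * cos v + cos u * sin v by rewrite -sinD -half_sum.
have -> : sin y = sin u * cos v - cos u * sin v by rewrite -sinB -half_diff.
have -> : sin u * cos v + cos u * sin v - (sin u * cos v - cos u * sin v) = 2 * cos u * sin v by ring.
have -> : x - y = 2 * v by rewrite /v mulrC divfK.
move: u v => u v.
rewrite !normrM; apply: ler_pM; rewrite ?mulr_ge0 ?sin_le_norm//.
by rewrite -[leRHS]mulr1 ler_pM// ler_norml cos_geN1 cos_le1.
Qed.

Lemma norm_cos_le1 x : `|cos x| <= 1.
Proof. by rewrite ler_norml cos_geN1 cos_le1. Qed.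

Lemma norm_sin_le1 x : `|sin x| <= 1.
Proof. by rewrite ler_norml sin_geN1 sin_le1. Qed.

End trig_lipschitz.

(** * Gaussian approximation on an event of the past *)

Section clt_mixing.
Context d (T : measurableType d) (R : realType) (P : probability T R).
Variables (L : set (R * R) -> T -> R) (gamma b : R) (nu : {measure set R -> \bar R}).
Hypothesis HL : levy_basis P L gamma b nu.
Variables (m s2 : R) (eps : R -> R).
Hypothesis ce : cumulant_expansion (log_cf_re b nu) (log_cf_im gamma nu) m s2 eps.

Lemma lam_splitI (A S : set (R * R)) : finite_borel A -> measurable S ->
  lam A = lam (A `&` S) + lam (A `&` ~` S).
Proof.
move=> fA mS; have fS := finite_borelI fA mS.
have fC := finite_borelI fA (measurableC mS).
have E : (A `&` S) `&` (A `&` ~` S) = set0 by rewrite setIACA setICr setI0.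
by rewrite -(lamU fS fC E) -setIUr setUCr setIT.
Qed.

Lemma le_lam (A B : set (R * R)) : finite_borel B -> measurable A -> A `<=` B -> lam A <= lam B.
Proof.
by move=> fB mA AB; rewrite (lam_splitI fB mA) (setIidr AB) lerDl lam_ge0.
Qed.

Lemma levy_splitI (A S : set (R * R)) : finite_borel A -> measurable S ->
  {ae P, forall w, L A w = L (A `&` S) w + L (A `&` ~` S) w}.
Proof.
move=> fA mS.
pose F (i : 'I_2) := if i == ord0 then A `&` S else A `&` ~` S.
have fF i : finite_borel (F i).
  by rewrite /F; case: ifP => _; apply: finite_borelI => //; exact: measurableC.
have tF : trivIset setT F.
  apply/trivIsetP => i j _ _; case: i => -[|[|//]] hi; case: j => -[|[|//]] hj //= _;
    by rewrite /F/= setIACA ?setICr ?setICl setI0.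
have E : \bigcup_(i in setT) F i = A.
  apply/seteqP; split => [p [i _]|p Ap]; first by rewrite /F; case: ifP => _ [].
  have [Sp|Sp] := pselect (S p); first by exists ord0.
  by exists ord_max.
have := levy_additive HL fF tF; rewrite E; apply: filterS => w ->.
by rewrite big_ord_recl big_ord1.
Qed.

Section family.
Variables (K : finType).
Implicit Types (A : K -> set (R * R)) (th : K -> R).

Lemma quad_bound A th (t : R) (g : K -> K -> R) : (forall i, `|th i| <= t) ->
  (forall i j, lam (A i `&` A j) <= g i j) ->
  quad A th <= t ^+ 2 * \sum_i \sum_j g i j.
Proof.
move=> tht lg; rewrite /quad mulr_sumr; apply: ler_sum => i _.
rewrite mulr_sumr; apply: ler_sum => j _.
apply: le_trans (ler_norm _) _; rewrite normrM (ger0_norm (lam_ge0 _)).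
by apply: ler_pM => //; [exact: lam_ge0|rewrite normrM expr2 ler_pM].
Qed.

Lemma quad_split A th (S : set (R * R)) : (forall i, finite_borel (A i)) -> measurable S ->
  quad A th = quad (fun i => A i `&` S) th + quad (fun i => A i `&` ~` S) th.
Proof.
move=> fA mS; rewrite /quad -big_split; apply: eq_bigr => i _ /=.
rewrite -big_split; apply: eq_bigr => j _ /=; rewrite -mulrDr; congr (_ * _).
rewrite (lam_splitI _ mS); last by apply: finite_borelI => //; case: (fA j).
by congr (lam _ + lam _); rewrite setIACA setIid.
Qed.

(** Each [A i] is cut by its own [S i], which doubles the family without changing the centered sum
    almost surely or the quadratic form. The boolean then serves as the predicate [J] of
    [clt_bound]. *)
Definition halves A (S : K -> set (R * R)) (i : K * bool) :=
  if i.2 then A i.1 `&` S i.1 else A i.1 `&` ~` S i.1.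

Lemma halves_finite A S i : (forall i, finite_borel (A i)) -> (forall i, measurable (S i)) ->
  finite_borel (halves A S i).
Proof.
move=> fA mS; rewrite /halves; case: ifP => _; apply: finite_borelI => //.
exact: measurableC.
Qed.

Lemma quad_halves A S th : (forall i, finite_borel (A i)) -> (forall i, measurable (S i)) ->
  quad (halves A S) (fun i => th i.1) = quad A th.
Proof.
move=> fA mS; rewrite /quad.
rewrite -(pair_bigA _ (fun k c => \sum_j th k * th j.1 * lam (halves A S (k, c) `&` halves A S j)))/=.
apply: eq_bigr => k _; rewrite big_bool/=.
rewrite -2!(pair_bigA _ (fun l c => th k * th l * lam (halves A S (k, _) `&` halves A S (l, c))))/=.
rewrite -big_split; apply: eq_bigr => l _ /=; rewrite !big_bool/= /halves/= -!mulrDr; congr (_ * _).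
have fI : finite_borel (A k `&` A l) by apply: finite_borelI => //; case: (fA l).
rewrite (lam_splitI fI (mS k)).
have f1 : finite_borel (A k `&` A l `&` S k) by exact: finite_borelI.
have f2 : finite_borel (A k `&` A l `&` ~` S k) by apply: finite_borelI => //; exact: measurableC.
rewrite (lam_splitI f1 (mS l)) (lam_splitI f2 (mS l)).
have E (X Y Z V : set (R * R)) : X `&` Z `&` Y `&` V = X `&` Y `&` (Z `&` V).
  by rewrite -setIA setIACA.
by rewrite !E.
Qed.

Lemma quad_halves_snd A S th :
  quad (halves A S) (fun i => if i.2 then 0 else th i.1) = quad (fun i => A i `&` ~` S i) th.
Proof.
rewrite /quad.
rewrite -(pair_bigA _ (fun k c => \sum_j (if c then 0 else th k) * (if j.2 then 0 else th j.1) *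
   lam (halves A S (k, c) `&` halves A S j)))/=.
apply: eq_bigr => k _; rewrite big_bool/= [X in X + _]big1 ?add0r; last by move=> j _; rewrite !mul0r.
rewrite -(pair_bigA _ (fun l c => th k * (if c then 0 else th l) * lam (halves A S (k, false) `&` halves A S (l, c))))/=.
by apply: eq_bigr => l _; rewrite big_bool/= mulr0 mul0r add0r.
Qed.

Lemma centered_sum_split A th (S : K -> set (R * R)) : (forall i, finite_borel (A i)) ->
  (forall i, measurable (S i)) ->
  {ae P, forall w, centered_sum L m A th w =
    centered_sum L m (fun i => A i `&` S i) th w + centered_sum L m (fun i => A i `&` ~` S i) th w}.
Proof.
move=> fA mS.
have : {ae P, forall w, forall i, i \in index_enum K ->
    L (A i) w = L (A i `&` S i) w + L (A i `&` ~` S i) w}.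
  elim: (index_enum K) => [|i s IH]; first by apply: nearW.
  move: (levy_splitI (fA i) (mS i)) IH; apply: filterS2 => w h1 h2 j.
  by rewrite inE => /predU1P[->//|js]; exact: h2.
apply: filterS => w h; rewrite /centered_sum -big_split; apply: eq_bigr => i _ /=.
by rewrite h ?mem_index_enum// (lam_splitI (fA i) (mS i)); ring.
Qed.

Lemma centered_sum_halves A S th w :
  centered_sum L m (halves A S) (fun i => th i.1) w =
  centered_sum L m (fun i => A i `&` S i) th w + centered_sum L m (fun i => A i `&` ~` S i) th w.
Proof.
rewrite /centered_sum -(pair_bigA _ (fun k c => th k * (L (halves A S (k, c)) w - m * lam (halves A S (k, c)))))/=.
by rewrite -big_split; apply: eq_bigr => k _; rewrite big_bool.
Qed.

End family.

(* [W] is split into a future part, independent of [E], and a past part, small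
   in mean square. *)
Lemma clt_mixing_bound (K J : finType) (A : K -> set (R * R)) (U : J -> set (R * R))
    (S0 : set (R * R)) (S : K -> set (R * R)) (th : K -> R) (rho C : R) (E : set T) :
  (forall i, finite_borel (A i)) -> (forall j, finite_borel (U j)) ->
  measurable S0 -> (forall i, measurable (S i)) -> (forall j, U j `<=` ~` S0) ->
  0 <= rho -> (forall x, 0 <= x -> eps x <= C) ->
  (forall p, `|\sum_i th i * \1_(A i `&` S0 `&` S i) p| <= rho) ->
  <<s gen_of setT (fun j => L (U j)) >> E ->
  let qp := quad (fun i => A i `&` ~` S0) th in
  let e := Num.sqrt (s2 * qp) + s2 * qp / 2 + 2 * (eps (2 * rho) * quad A th +
     4 * C * quad (fun i => A i `&` S0 `&` ~` S i) th) in
  `|\int[P]_w (\1_E w * cos (centered_sum L m A th w)) -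
     fine (P E) * expR (- (s2 * quad A th / 2))| <= e /\
  `|\int[P]_w (\1_E w * sin (centered_sum L m A th w))| <= e.
Proof.
move=> fA fU mS0 mS US0 rho0 hC hrho sE qp e.
have s20 := ce_s2_ge0 ce.
have fA0 i : finite_borel (A i `&` S0) by exact: finite_borelI.
have fA1 i : finite_borel (A i `&` ~` S0) by apply: finite_borelI => //; exact: measurableC.
pose B := halves (fun i => A i `&` S0) S.
have fB i : finite_borel (B i) by exact: halves_finite.
pose W := centered_sum L m A th.
pose Wf := centered_sum L m B (fun i => th i.1).
pose Wp := centered_sum L m (fun i => A i `&` ~` S0) th.
have WE : {ae P, forall w, W w = Wf w + Wp w}.
  move: (centered_sum_split th fA (fun=> mS0)) (centered_sum_split th fA0 mS).
  by apply: filterS2 => w h1 h2; rewrite /W h1 h2 /Wf /B centered_sum_halves.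
have [sWp _ VWp] := centered_sum_moments HL ce fA1 th.
have mW := measurable_centered_sum HL m fA th.
have mWf := measurable_centered_sum HL m fB (fun i => th i.1).
have mWp := measurable_centered_sum HL m fA1 th.
have mE : measurable E.
  have : <<s gen_of setT (fun k => L (U k)) >> `<=` measurable.
    apply: smallest_sub; first exact: sigma_algebra_measurable.
    by apply: gen_of_measurable => k; exact: (levy_measurable HL (fU k)).
  exact.
have PE1 : 0 <= fine (P E) <= 1.
  by rewrite fine_ge0//= -lee_fin fineK ?fin_num_measure// probability_le1.
(* The quadratic form is additive over a common cut by [S0], so the future part carries all the
   variance except [qp]. *)
have qA : quad A th = quad B (fun i => th i.1) + qp.
  by rewrite (quad_split th fA mS0) /B quad_halves.
have qp0 : 0 <= qp by exact: quad_ge0.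
have qB0 : 0 <= quad B (fun i => th i.1) by exact: quad_ge0.
have indic_le (F : set T) w : `|\1_F w : R| <= 1.
  by rewrite indicE ger0_norm// lern1 leq_b1.
(* Dropping the past part costs its mean absolute value because [f] is 1-Lipschitz; what is left is
   independent of [E] and factorizes. *)
have trans (f : R -> R) : measurable_fun setT f -> (forall x, `|f x| <= 1) ->
   (forall x y, `|f x - f y| <= `|x - y|) ->
   `|\int[P]_w (\1_E w * f (W w)) - fine (P E) * \int[P]_w f (Wf w)| <= Num.sqrt (s2 * qp).
  move=> mf f1 flip.
  rewrite -(levy_indep_families HL fU fB _ m _ sE mf f1); last first.
    move=> j i; rewrite -subset0 => p [/US0 /= nS]; rewrite /B /halves.
    by case: ifP => _ [[_ ?]].
  have m1 : measurable_fun setT (fun w => \1_E w * f (Wf w + Wp w)).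
    apply: measurable_funM; first exact: measurable_indic.
    by apply: measurableT_comp => //; exact: measurable_funD.
  have m2 : measurable_fun setT (fun w => \1_E w * f (Wf w)).
    by apply: measurable_funM; [exact: measurable_indic|exact: measurableT_comp].
  have m3 : measurable_fun setT (fun w => \1_E w * f (W w)).
    by apply: measurable_funM; [exact: measurable_indic|exact: measurableT_comp].
  have -> : \int[P]_w (\1_E w * f (W w)) = \int[P]_w (\1_E w * f (Wf w + Wp w)).
    by apply: ae_eq_Rint => //; move: WE; apply: filterS => w ->.
  apply: (@le_trans _ _ (\int[P]_w `|Wp w|)); last first.
    by apply: le_trans (Rint_norm_sqrt sWp) _; rewrite VWp.
  apply: ler_norm_RintB.
  { apply: (bounded_rintegrable P (M := 1) m1).
    by move=> w; rewrite normrM -[leRHS]mulr1 ler_pM. }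
  { apply: (bounded_rintegrable P (M := 1) m2).
    by move=> w; rewrite normrM -[leRHS]mulr1 ler_pM. }
  { exact: rintegrable_norm (sqintegrable_int sWp). }
  { move=> w; rewrite -mulrBr normrM -[leRHS]mul1r ler_pM//.
    by apply: le_trans (flip _ _) _; rewrite addrAC subrr add0r. }
have hrho' p : `|\sum_(i | i.2) th i.1 * \1_(B i) p| <= rho.
  have -> : \sum_(i | i.2) th i.1 * \1_(B i) p = \sum_i th i * \1_(A i `&` S0 `&` S i) p.
    rewrite big_mkcond/= -(pair_bigA _ (fun k c => if c then th k * \1_(B (k, c)) p else 0))/=.
    by apply: eq_bigr => k _; rewrite big_bool/= addr0.
  exact: hrho.
have [hc hs] := clt_bound HL ce fB rho0 hC hrho'.
have eps0 : 0 <= eps (2 * rho) by apply: (ce_eps_ge0 ce); rewrite mulr_ge0.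
have Ee : quad B (fun i => if i.2 then 0 else th i.1) = quad (fun i => A i `&` S0 `&` ~` S i) th.
  exact: quad_halves_snd.
rewrite /= Ee in hc hs.
pose qf := quad (fun i => A i `&` S0 `&` ~` S i) th.
rewrite -/qf in hc hs e *.
have C0 : 0 <= C by apply: le_trans (hC _ (lexx 0)); exact: (ce_eps_ge0 ce).
have qf0 : 0 <= qf.
  by apply: quad_ge0 => i; apply: finite_borelI => //; exact: measurableC.
have eq1 : 2 * (eps (2 * rho) * quad B (fun i => th i.1) + 4 * C * qf) <=
    2 * (eps (2 * rho) * quad A th + 4 * C * qf).
  by rewrite ler_pM2l// lerD2r ler_wpM2l// qA lerDl.
have ePE x y (z : R) : `|x - y| <= z -> `|fine (P E) * x - fine (P E) * y| <= z.
  move=> h; rewrite -mulrBr normrM; apply: le_trans h.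
  by case/andP: PE1 => h0 h1; rewrite ler_piMl// ger0_norm.
have tc := trans _ (@measurable_cos R setT) (@norm_cos_le1 R) (@cos_lip R).
have ts := trans _ (@measurable_sin R setT) (@norm_sin_le1 R) (@sin_lip R).
have sq0 : 0 <= s2 * qp / 2 by rewrite divr_ge0 ?mulr_ge0.
have ex : `|expR (- (s2 * quad B (fun i => th i.1) / 2)) - expR (- (s2 * quad A th / 2))| <= s2 * qp / 2.
  apply: le_trans (expR_lip _ _) _; rewrite ?oppr_le0 ?divr_ge0 ?mulr_ge0 ?quad_ge0//.
  rewrite opprK addrC qA (_ : _ - _ = s2 * qp / 2); last by ring.
  by rewrite ger0_norm.
split.
- have h1 := ePE _ _ _ hc; have h2 := ePE _ _ _ ex.
  by move: tc h1 h2 eq1; rewrite /e !ler_norml; lra.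
- have h1 : `|fine (P E) * \int[P]_w sin (Wf w) - fine (P E) * 0| <=
     2 * (eps (2 * rho) * quad B (fun i => th i.1) + 4 * C * qf).
    by apply: ePE; rewrite subr0.
  by move: ts h1 eq1 sq0; rewrite mulr0 subr0 /e !ler_norml; lra.
Qed.

End clt_mixing.

Lemma cvg_sumr (R : realType) (I : Type) (s : seq I) (f : I -> nat -> R) (l : I -> R) :
  (forall i, f i n @[n --> \oo] --> l i) ->
  \sum_(i <- s) f i n @[n --> \oo] --> \sum_(i <- s) l i.
Proof.
move=> fl; elim: s => [|i s IH].
  by rewrite big_nil; under eq_fun do rewrite big_nil; exact: cvg_cst.
by rewrite big_cons; under eq_fun do rewrite big_cons; exact: cvgD.
Qed.

Lemma big_ord_wid (R : realType) (p n : nat) (F : nat -> R) : (p <= n)%N ->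
  \sum_(k < p) F k = \sum_(k < n) (if (k < p)%N then 1 else 0) * F k.
Proof.
move=> pn; rewrite (big_ord_widen n F pn) big_mkcond; apply: eq_bigr => k _.
by case: ifP; rewrite ?mul1r ?mul0r.
Qed.

Lemma exchange_big4 (R : realType) (I J : finType) (f : I -> I -> J -> J -> R) :
  \sum_i \sum_j \sum_k \sum_l f i j k l = \sum_k \sum_l \sum_i \sum_j f i j k l.
Proof.
under eq_bigr do rewrite exchange_big/=.
rewrite exchange_big; apply: eq_bigr => k _.
by under eq_bigr do rewrite exchange_big/=; rewrite exchange_big.
Qed.

Lemma measurable_half (R : realType) (x : R) : measurable [set p : R * R | x < p.1].
Proof.
have mf : measurable_fun setT (fst : R * R -> R) by exact: measurable_fst.
have := measurable_fun_ltr (measurable_cst x) mf measurableT (I : measurable [set true]).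
by rewrite setTI; congr measurable; apply/seteqP; split => p /=.
Qed.

Section trawl_limit.
Context d (T : measurableType d) (R : realType) (P : probability T R).
Variables (L : set (R * R) -> T -> R) (gamma b : R) (nu : {measure set R -> \bar R}).
Hypothesis HL : levy_basis P L gamma b nu.
Variables (m s2 : R) (eps : R -> R).
Hypothesis ce : cumulant_expansion (log_cf_re b nu) (log_cf_im gamma nu) m s2 eps.
Variable a : R -> R.
Hypothesis Ha : trawl_function a.
Local Notation G := (tail_int a).
Hypothesis tG : tail_fun G.
Variable Delta : nat -> R.
Hypothesis D0 : forall n, 0 < Delta n.
Hypothesis Dcvg : Delta n @[n --> \oo] --> (0 : R).
Hypothesis nD : n%:R * Delta n @[n --> \oo] --> +oo.
Let ta := trawl_tail_fun Ha.
Let X := trawl_process L a.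
Local Notation I0 := (tail_int G 0).

Section linear_combination.
Variables (N : nat) (t th : 'I_N -> R).
Hypothesis t01 : forall i, 0 <= t i <= 1.

Let c n := Num.sqrt (Delta n / n%:R).
Let A n (k : 'I_n) := trawl_set_at a (k%:R * Delta n).
Let p n i := Num.truncn (n%:R * t i).
Let chi n i (k : nat) : R := if (k < p n i)%N then 1 else 0.
Let co n (k : 'I_n) := c n * \sum_i th i * chi n i k.
Let Tt := \sum_i `|th i|.

Definition linear_comb n w :=
  \sum_i th i * (c n * partial_sum P X Delta n (t i) w).

Let fA n (k : 'I_n) : finite_borel (A k).
Proof. by rewrite /A trawl_set_atE; exact: trawl_box_finite. Qed.

Let pn n i : (p n i <= n)%N.
Proof.
rewrite -[leqRHS](@natrK R n); apply: le_truncn.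
by have /andP[? ?] := t01 i; rewrite ler_piMr.
Qed.

Lemma trawl_mean t0 : fine 'E_P[X t0]%E = m * lam (trawl_set_at a t0).
Proof.
have fX : finite_borel (trawl_set_at a t0) by rewrite trawl_set_atE; exact: trawl_box_finite.
have [sX EX _] := levy_moments HL ce fX.
by rewrite expectation_Rint ?EX 1?mulrC//; exact: sqintegrable_int.
Qed.

Lemma linear_combE n w : linear_comb n w = centered_sum L m (@A n) (@co n) w.
Proof.
rewrite /linear_comb /centered_sum /co.
have E i : th i * (c n * partial_sum P X Delta n (t i) w) =
   \sum_(k < n) c n * (th i * chi n i k) * (L (A k) w - m * lam (A k)).
  rewrite /partial_sum big_mkord.
  rewrite -/(p n i) (@big_ord_wid _ _ n (fun k => X (k%:R * Delta n) w - fine 'E_P[X (k%:R * Delta n)]%E) (pn n i)).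
  rewrite !mulr_sumr; apply: eq_bigr => k _; rewrite trawl_mean /X /trawl_process /A.
  by rewrite -/(chi n i k); ring.
under eq_bigr do rewrite E.
rewrite exchange_big; apply: eq_bigr => k _ /=.
by rewrite mulr_sumr mulr_suml.
Qed.

Let c2 n : c n ^+ 2 = Delta n / n%:R.
Proof. by rewrite sqr_sqrtr// divr_ge0 ?ler0n// ltW. Qed.

Lemma minmax_dn n k l : Num.max (k%:R * Delta n) (l%:R * Delta n) - Num.min (k%:R * Delta n) (l%:R * Delta n) =
  (dn k l)%:R * Delta n.
Proof.
rewrite /dn; have /orP[h|h] := leq_total k l.
  have h' : k%:R * Delta n <= l%:R * Delta n by rewrite ler_wpM2r ?(ltW (D0 n))// ler_nat.
  by rewrite max_r// min_l// (eqP h) add0n natrB// mulrBl.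
have h' : l%:R * Delta n <= k%:R * Delta n by rewrite ler_wpM2r ?(ltW (D0 n))// ler_nat.
by rewrite max_l// min_r// (eqP h) addn0 natrB// mulrBl.
Qed.

Let lamA n (k l : 'I_n) : lam (A k `&` A l) = G ((dn k l)%:R * Delta n).
Proof.
rewrite /A !trawl_set_atE trawl_boxI// lam_trawl_box ?minmax_dn//.
by rewrite le_max !ge_min lexx.
Qed.

Lemma quad_linear_comb n : quad (@A n) (@co n) = \sum_i \sum_j th i * th j *
  (Delta n / n%:R * (\sum_(k < p n i) \sum_(l < p n j) G ((dn k l)%:R * Delta n))).
Proof.
transitivity (\sum_(i < N) \sum_(j < N) \sum_(k < n) \sum_(l < n)
  (th i * th j * (Delta n / n%:R) * (chi n i k * (chi n j l * G ((dn k l)%:R * Delta n))))); last first.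
  apply: eq_bigr => i _; apply: eq_bigr => j _.
  rewrite (@big_ord_wid _ _ n (fun k => \sum_(l < p n j) G ((dn k l)%:R * Delta n)) (pn n i)).
  rewrite [RHS]mulrA mulr_sumr; apply: eq_bigr => k _.
  rewrite (@big_ord_wid _ _ n (fun l => G ((dn k l)%:R * Delta n)) (pn n j)) !mulr_sumr.
  by apply: eq_bigr => l _.
rewrite exchange_big4; apply: eq_bigr => k _; apply: eq_bigr => l _.
rewrite lamA /co -c2.
transitivity (c n ^+ 2 * G ((dn k l)%:R * Delta n) * ((\sum_i th i * chi n i k) * (\sum_j th j * chi n j l))); first by ring.
rewrite mulr_suml mulr_sumr; apply: eq_bigr => i _.
by rewrite mulr_sumr mulr_sumr; apply: eq_bigr => j _; ring.
Qed.

(** As [2 * I0] is the integral of [G |s|] over the line, [s2 * limit_var] is the variance of the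
    matching linear combination of values of [sigma_a B]. *)
Definition limit_var := \sum_i \sum_j th i * th j * (Num.min (t i) (t j) * (2 * I0)).

Lemma quad_cvg : quad (@A n) (@co n) @[n --> \oo] --> limit_var.
Proof.
under eq_fun do rewrite quad_linear_comb.
apply: cvg_sumr => i; apply: cvg_sumr => j.
apply: cvgM; first exact: cvg_cst.
exact: (double_sum_cvg D0 Dcvg nD tG (t01 i) (t01 j)).
Qed.

Let c0 n : 0 <= c n. Proof. exact: sqrtr_ge0. Qed.

Let Tt0 : 0 <= Tt. Proof. by rewrite sumr_ge0. Qed.

Let co_le n (k : 'I_n) : `|co k| <= c n * Tt.
Proof.
rewrite normrM (ger0_norm (c0 n)); apply: ler_wpM2l => //.
apply: le_trans (ler_norm_sum _ _ _) _; apply: ler_sum => i _.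
by rewrite normrM ler_piMr// /chi; case: ifP; rewrite ?normr1 ?normr0.
Qed.

Section cutoff.
Variables (s0 Kc : R).
Hypothesis s00 : 0 <= s0.
Hypothesis Kc0 : 0 <= Kc.
Let S0 := [set q : R * R | s0 < q.1].
(** The near part of the trawl set at [k * Delta n]. A point lies in the near parts of at most
    [Kc / Delta n + 1] of these sets, whereas it may lie in a number of full ones that no cutoff
    bounds. *)
Let S n (k : 'I_n) := [set q : R * R | k%:R * Delta n - Kc < q.1].

Let inA n (k : 'I_n) q : A k q -> q.1 <= k%:R * Delta n /\ 0 <= q.2 <= a (k%:R * Delta n - q.1).
Proof. by rewrite /A trawl_set_atE => -[]. Qed.

(** Before [s0], two trawl sets meet inside a box whose area is [G] at the distance from [s0] to the
    later of the two times, so [past_sum] applies. The bound vanishes when first [n] and then [M]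
    tends to infinity. *)
Lemma past_quad n (M : R) : (0 < n)%N -> Delta n <= M ->
  quad (fun k => @A n k `&` ~` S0) (@co n) <=
  Tt ^+ 2 * (G 0 * (s0 + M + 2 * Delta n) ^+ 2 / (n%:R * Delta n) + 2 * tail_int G (M - Delta n)).
Proof.
move=> n0 DM.
apply: le_trans (quad_bound (@co_le n) (g := fun k l : 'I_n => G (Num.max ((maxn k l)%:R * Delta n - s0) 0)) _) _.
  move=> k l; pose M' := (maxn k l)%:R * Delta n.
  have h : Num.min s0 M' <= M' by rewrite ge_min lexx orbT.
  have -> : Num.max (M' - s0) 0 = M' - Num.min s0 M'.
    by have [h1|h1] := leP s0 M'; [rewrite max_l ?subr_ge0|rewrite max_r ?subrr// subr_le0 ltW].
  rewrite -(lam_trawl_box Ha h); apply: le_lam; first exact: trawl_box_finite.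
    have mB (i : 'I_n) : measurable (A i `&` ~` S0).
      apply: measurableI; first exact: (fA i).1.
      by apply: measurableC; exact: measurable_half.
    exact: measurableI.
  move=> q [[/inA[q1 q2] /= /negP q3] [/inA[q4 q5] _]].
  rewrite -leNgt in q3; split.
    by rewrite le_min q3/= /M'; case: (leqP k l).
  by rewrite /M'; case: (leqP k l).
rewrite exprMn (mulrC (c n ^+ 2)) -[_ * c n ^+ 2 * _]mulrA ler_wpM2l ?sqr_ge0// c2.
exact: (past_sum tG).
Qed.

(** Two far parts meet inside a box of area [G (Kc + |k - l| * Delta n)]. Each row sum is then a
    Riemann sum beyond [Kc], small uniformly in [n] once [Kc] is large. *)
Lemma far_quad n : (0 < n)%N ->
  quad (fun k => @A n k `&` S0 `&` ~` S k) (@co n) <= Tt ^+ 2 * (2 * tail_int G Kc + Delta n * G Kc).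
Proof.
move=> n0.
apply: le_trans (quad_bound (@co_le n) (g := fun k l : 'I_n => G (Kc + (dn k l)%:R * Delta n)) _) _.
  move=> k l; pose M' := Num.max (k%:R * Delta n) (l%:R * Delta n).
  pose x := Num.min (k%:R * Delta n) (l%:R * Delta n) - Kc.
  have h : x <= M' by rewrite lerBlDr ler_wpDr// le_max !ge_min lexx.
  have -> : Kc + (dn k l)%:R * Delta n = M' - x by rewrite /x opprB addrCA minmax_dn.
  rewrite -(lam_trawl_box Ha h); apply: le_lam; first exact: trawl_box_finite.
    have mB (i : 'I_n) : measurable (A i `&` S0 `&` ~` S i).
      apply: measurableI; last by apply: measurableC; exact: measurable_half.
      by apply: measurableI; [exact: (fA i).1|exact: measurable_half].
    exact: measurableI.
  move=> q [[[/inA[q1 q2] _] /= /negP q3] [[/inA[q4 q5] _] /= /negP q6]].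
  rewrite -leNgt in q3; rewrite -leNgt in q6; split.
    by rewrite /x; case: (leP (k%:R * Delta n) (l%:R * Delta n)).
  by rewrite /M'; case: (leP (k%:R * Delta n) (l%:R * Delta n)).
rewrite exprMn (mulrC (c n ^+ 2)) -[_ * c n ^+ 2 * _]mulrA ler_wpM2l ?sqr_ge0// c2.
have N0 : (0 : R) < n%:R by rewrite ltr0n.
rewrite mulrAC ler_pdivrMr// mulr_sumr.
apply: le_trans (_ : \sum_(k < n) (2 * tail_int G Kc + Delta n * G Kc) <= _); last first.
  by rewrite sumr_const card_ord mulr_natr.
apply: ler_sum => k _; rewrite mulr_sumr; exact: (row_ub tG).
Qed.

(** Since [c n / Delta n] is the inverse square root of [n * Delta n], this bound on the local
    coefficient tends to 0 for fixed [Kc]. *)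
Let rho n := c n * Tt * (Kc / Delta n + 1).

Lemma local_sup n q : `|\sum_k @co n k * \1_(A k `&` S0 `&` S k) q| <= rho n.
Proof.
apply: le_trans (ler_norm_sum _ _ _) _.
apply: le_trans (_ : \sum_(k < n) c n * Tt * (if q.1 <= k%:R * Delta n < q.1 + Kc then 1 else 0) <= _).
  apply: ler_sum => k _; rewrite normrM; apply: ler_pM => //.
  rewrite indicE; have [/set_mem[[/inA[q1 _] _] /= q2]|_] := boolP (q \in _).
    by rewrite normr1 ifT// q1/= -ltrBlDr.
  by rewrite normr0; case: ifP.
rewrite -mulr_sumr; apply: ler_wpM2l; first exact: mulr_ge0.
exact: count_window.
Qed.

Lemma local_sup_cvg (y : R) : 0 < y -> \forall n \near \oo, rho n <= y.
Proof.
move=> y0.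
have h : Tt ^+ 2 * (n%:R^-1 * (Kc / Delta n + 1) * (Kc + Delta n)) @[n --> \oo] --> (0 : R).
  rewrite -[X in _ --> X](mulr0 (Tt ^+ 2)); apply: cvgM; first exact: cvg_cst.
  rewrite -[X in _ --> X](mul0r (Kc + 0)); apply: cvgM; first exact: cvg_count.
  by apply: cvgD => //; exact: cvg_cst.
have y2 : 0 < y ^+ 2 by rewrite exprn_gt0.
move/cvgrPdist_le : h => /(_ _ y2); apply: filterS2 (natr_gt0_near R) => n N0.
rewrite sub0r normrN => /(le_trans (ler_norm _)) h.
have r0 : 0 <= rho n by rewrite !mulr_ge0// addr_ge0// divr_ge0// ltW.
rewrite -ler_sqr ?nnegrE ?(ltW y0)//; apply: le_trans h.
rewrite /rho !exprMn c2 le_eqVlt; apply/orP; left; apply/eqP.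
by have := D0 n; move: (n%:R : R) N0 (Delta n) => x x0 D D1; field; rewrite !gt_eqF.
Qed.

End cutoff.

Variables (J : finType) (u : J -> R) (E : set T).
Hypothesis sE : <<s gen_of setT (fun j => X (u j)) >> E.

(** The cutoff [Kc] is chosen first, to make the far part small; then [n] grows, which disposes of
    the past part, of the local coefficients and of the error in the variance. *)
Lemma linear_comb_cf :
  \int[P]_w (\1_E w * cos (linear_comb n w)) @[n --> \oo]
     --> fine (P E) * expR (- (s2 * limit_var / 2)) /\
  \int[P]_w (\1_E w * sin (linear_comb n w)) @[n --> \oo] --> fine (P E) * 0.
Proof.
(* The event depends on the basis only to the left of the last of its times; the default 0 ensures
   [0 <= s0]. *)
pose s0 := \big[Num.max/0]_j u j.
have us0 j : u j <= s0 by exact: le_bigmax.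
have s00 : 0 <= s0 by apply: bigmax_ge_id.
pose S0 := [set q : R * R | s0 < q.1].
have mS0 : measurable S0 by exact: measurable_half.
pose U j := trawl_set_at a (u j).
have fU j : finite_borel (U j) by rewrite /U trawl_set_atE; exact: trawl_box_finite.
have US0 j : U j `<=` ~` S0.
  rewrite /U trawl_set_atE => q [q1 _] /=; apply/negP; rewrite -leNgt.
  exact: le_trans (us0 j).
have s20 := ce_s2_ge0 ce.
have [C C0 hC] := ce_eps_bound ce.
pose qA n := quad (@A n) (@co n).
pose qp n := quad (fun k => @A n k `&` ~` S0) (@co n).
pose qf Kc n := quad (fun k => @A n k `&` S0 `&` ~` [set q : R * R | k%:R * Delta n - Kc < q.1]) (@co n).
have qp0 n : 0 <= qp n.
  by apply: quad_ge0 => i; apply: finite_borelI => //; exact: measurableC.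
have qA0 n : 0 <= qA n by exact: quad_ge0.
pose rho Kc n := c n * Tt * (Kc / Delta n + 1).
have rho0 Kc n : 0 <= Kc -> 0 <= rho Kc n.
  by move=> Kc0; rewrite !mulr_ge0// addr_ge0// divr_ge0// ltW.
pose err Kc n := Num.sqrt (s2 * qp n) + s2 * qp n / 2 +
  2 * (eps (2 * rho Kc n) * qA n + 4 * C * qf Kc n).
have bnd Kc n : 0 <= Kc ->
  `|\int[P]_w (\1_E w * cos (linear_comb n w)) - fine (P E) * expR (- (s2 * qA n / 2))| <= err Kc n /\
  `|\int[P]_w (\1_E w * sin (linear_comb n w))| <= err Kc n.
  move=> Kc0.
  have mS (k : 'I_n) : measurable [set q : R * R | k%:R * Delta n - Kc < q.1].
    exact: measurable_half.
  have [h1 h2] := clt_mixing_bound HL ce (@fA n) fU mS0 mS US0 (rho0 Kc n Kc0) hC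
    (fun q => @local_sup s0 Kc Kc0 n q) sE.
  split.
    by under eq_Rint do rewrite linear_combE; exact: h1.
  by under eq_Rint do rewrite linear_combE; exact: h2.
have qp_small e : 0 < e -> \forall n \near \oo, qp n <= e.
  move=> e0.
  have k0 : 0 < Tt ^+ 2 + 1 by rewrite ltr_wpDl ?sqr_ge0.
  have e1 : 0 < e / (Tt ^+ 2 + 1) / 4 by rewrite !divr_gt0.
  have [M M0 hM] := tail_int_cvg0 tG e1.
  have cv : G 0 * (s0 + (M + 1) + 2 * Delta n) ^+ 2 / (n%:R * Delta n) @[n --> \oo] --> (0 : R).
    rewrite -[X in _ --> X](mulr0 (G 0 * (s0 + (M + 1) + 2 * 0) ^+ 2)).
    apply: cvgM; last exact: cvg_invnD.
    apply: cvgM; first exact: cvg_cst.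
    apply: (@cvg_comp _ _ _ _ (fun x : R => x ^+ 2)); last exact: exprn_continuous.
    by apply: cvgD; [exact: cvg_cst|apply: cvgM => //; exact: cvg_cst].
  have e2 : 0 < e / (Tt ^+ 2 + 1) / 2 by rewrite !divr_gt0.
  move/cvgrPdist_le : cv => /(_ _ e2) cv.
  move/cvgrPdist_le : Dcvg => /(_ _ ltr01) D1.
  have n1 : \forall n \near \oo, (0 < n)%N by exists 1%N.
  near=> n.
  have n0 : (0 < n)%N by near: n.
  have Dn : Delta n <= 1.
    have : `|0 - Delta n| <= 1 by near: n.
    by rewrite sub0r normrN => /(le_trans (ler_norm _)).
  have DM : Delta n <= M + 1 by lra.
  apply: le_trans (past_quad s00 n0 DM) _.
  have h1 : tail_int G (M + 1 - Delta n) <= e / (Tt ^+ 2 + 1) / 4.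
    apply: le_trans (ltW hM); apply: (tail_int_noninc tG) => //.
    by lra.
  have h2 : G 0 * (s0 + (M + 1) + 2 * Delta n) ^+ 2 / (n%:R * Delta n) <= e / (Tt ^+ 2 + 1) / 2.
    have : `|0 - G 0 * (s0 + (M + 1) + 2 * Delta n) ^+ 2 / (n%:R * Delta n)| <= e / (Tt ^+ 2 + 1) / 2 by near: n.
    by rewrite sub0r normrN => /(le_trans (ler_norm _)).
  apply: (@le_trans _ _ (Tt ^+ 2 * (e / (Tt ^+ 2 + 1)))).
    by rewrite ler_wpM2l ?sqr_ge0//; lra.
  rewrite mulrCA ler_piMr ?(ltW e0)// ler_pdivrMr// mul1r lerDl//.
have err_small e : 0 < e -> exists2 Kc, 0 <= Kc & \forall n \near \oo, err Kc n <= e.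
  move=> e0.
  (* [err] has four terms, each made at most [e1]. *)
  pose e1 := e / 5.
  have e10 : 0 < e1 by rewrite divr_gt0.
  pose V := `|limit_var| + 1.
  have V0 : 0 < V by rewrite ltr_wpDl.
  (* The far term is at most [8 * C * Tt ^+ 2] times [2 * tail_int G Kc + Delta n * G Kc], and each
     of the three summands there is made at most [e2]. The [+ 1] avoids a division by 0. *)
  have k0 : 0 < 8 * C * Tt ^+ 2 * 3 + 1.
    by rewrite ltr_wpDl// !mulr_ge0// sqr_ge0.
  have e2 : 0 < e1 / (8 * C * Tt ^+ 2 * 3 + 1) by rewrite divr_gt0.
  have [Kc Kc0 hK] := tail_int_cvg0 tG e2.
  exists Kc => //.
  have e3 : 0 < e1 / (2 * V) by rewrite divr_gt0// mulr_gt0.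
  have [y y0 hy] := ce_eps_0 ce e3.
  have y20 : 0 < y / 2 by lra.
  have r1 := local_sup_cvg Kc0 y20.
  have k1 : 0 < s2 + 1 by rewrite ltr_wpDl.
  have q1 := qp_small (e1 ^+ 2 / (s2 + 1)) (divr_gt0 (exprn_gt0 2 e10) k1).
  have q2 := qp_small (e1 / (s2 + 1)) (divr_gt0 e10 k1).
  have D1 : \forall n \near \oo, Delta n * G Kc <= e1 / (8 * C * Tt ^+ 2 * 3 + 1).
    have : Delta n * G Kc @[n --> \oo] --> 0 * G Kc by apply: cvgM => //; exact: cvg_cst.
    rewrite mul0r => /cvgrPdist_le /(_ _ e2); apply: filterS => n.
    by rewrite sub0r normrN => /(le_trans (ler_norm _)).
  have V1 : \forall n \near \oo, qA n <= V.
    have /cvgrPdist_le /(_ _ ltr01) := quad_cvg; apply: filterS => n.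
    rewrite distrC => /(le_trans (ler_norm _)); rewrite lerBlDr => h.
    by apply: le_trans h _; rewrite addrC lerD2r ler_norm.
  have n1 : \forall n \near \oo, (0 < n)%N by exists 1%N.
  near=> n.
  have n0 : (0 < n)%N by near: n.
  have a1 : Num.sqrt (s2 * qp n) <= e1.
    have h : qp n <= e1 ^+ 2 / (s2 + 1) by near: n.
    rewrite -[leRHS](ger0_norm (ltW e10)) -sqrtr_sqr ler_wsqrtr//.
    apply: le_trans (_ : (s2 + 1) * qp n <= _); first by rewrite ler_wpM2r// lerDl.
    by move: h; rewrite ler_pdivlMr// mulrC.
  have a2 : s2 * qp n / 2 <= e1.
    have h : qp n <= e1 / (s2 + 1) by near: n.
    move: h; rewrite ler_pdivlMr// mulrDr mulr1 mulrC => h.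
    have := qp0 n; have : 0 <= s2 * qp n by exact: mulr_ge0.
    lra.
  have a3 : 2 * (eps (2 * rho Kc n) * qA n) <= e1.
    have hr : rho Kc n <= y / 2 by near: n.
    have h : eps (2 * rho Kc n) <= e1 / (2 * V).
      apply: le_trans (ltW hy); apply: (ce_eps_mono ce).
        by rewrite mulr_ge0// rho0.
      by move: hr; lra.
    have hV : qA n <= V by near: n.
    apply: (@le_trans _ _ (2 * (e1 / (2 * V) * V))).
      rewrite ler_pM2l// ler_pM//.
      by apply: (ce_eps_ge0 ce); rewrite mulr_ge0// rho0.
    by rewrite le_eqVlt; apply/orP; left; apply/eqP; field; rewrite gt_eqF.
  have a4 : 2 * (4 * C * qf Kc n) <= e1.
    have h1 := far_quad s0 Kc0 n0.
    have h2 : Delta n * G Kc <= e1 / (8 * C * Tt ^+ 2 * 3 + 1) by near: n.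
    apply: (@le_trans _ _ (8 * C * Tt ^+ 2 * 3 * (e1 / (8 * C * Tt ^+ 2 * 3 + 1)))).
      rewrite mulrA (_ : 2 * (4 * C) = 8 * C); last by ring.
      rewrite -2![in leRHS]mulrA -[in leRHS]mulrA mulrA; apply: ler_wpM2l; first by rewrite mulr_ge0.
      apply: le_trans h1 _; apply: ler_wpM2l; first exact: sqr_ge0.
      by move: (ltW hK) h2; lra.
    by rewrite mulrCA ler_piMr ?(ltW e10)// ler_pdivrMr// mul1r lerDl.
  by rewrite /err mulrDr; move: a1 a2 a3 a4; rewrite /e1; lra.
have cvexp : fine (P E) * expR (- (s2 * qA n / 2)) @[n --> \oo] --> fine (P E) * expR (- (s2 * limit_var / 2)).
  apply: cvgM; first exact: cvg_cst.
  apply: (@cvg_comp _ _ _ _ expR); last exact: continuous_expR.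
  apply: cvgN; apply: cvgM; last exact: cvg_cst.
  by apply: cvgM; [exact: cvg_cst|exact: quad_cvg].
split.
- apply/cvgrPdist_le => e e0.
  have e2 : 0 < e / 2 by lra.
  have [Kc Kc0 h1] := err_small _ e2.
  move/cvgrPdist_le : cvexp => /(_ _ e2); apply: filterS2 h1 => n h1 h2.
  have [h3 _] := bnd Kc n Kc0.
  by move: h1 h2 h3; rewrite !ler_norml; lra.
- rewrite mulr0; apply/cvgrPdist_le => e e0.
  have [Kc Kc0] := err_small _ e0.
  apply: filterS => n h1; rewrite sub0r normrN.
  by apply: le_trans h1; have [_] := bnd Kc n Kc0.
Unshelve. all: by end_near.
Qed.

End linear_combination.
End trawl_limit.

Section field_of_X.
Context d (T : measurableType d) (R : realType) (P : probability T R).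
Variables (L : set (R * R) -> T -> R) (gamma b : R) (nu : {measure set R -> \bar R}).
Hypothesis HL : levy_basis P L gamma b nu.
Variables (m s2 : R) (eps : R -> R).
Hypothesis ce : cumulant_expansion (log_cf_re b nu) (log_cf_im gamma nu) m s2 eps.
Variable a : R -> R.
Hypothesis Ha : trawl_function a.
Hypothesis tG : tail_fun (tail_int a).
Variable Delta : nat -> R.
Hypothesis D0 : forall n, 0 < Delta n.
Hypothesis Dcvg : Delta n @[n --> \oo] --> (0 : R).
Hypothesis nD : n%:R * Delta n @[n --> \oo] --> +oo.
Let X := trawl_process L a.

Let mX t : measurable_fun setT (X t).
Proof.
by apply: (levy_measurable HL); rewrite trawl_set_atE; exact: trawl_box_finite.
Qed.

Let Pi := \bigcup_(k in [set k | (1 <= k)%N])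
        \bigcap_(N in [set N | (k <= N)%N])
          sigma_of [set j | (j <= k)%N] (fun j : nat => X (j%:R * Delta N)).

(** Two generating events with indices [k] and [l] both belong to the member of index [maxn k l]:
    for [N] beyond it, the fields on the same grid are nested. *)
Let PiI : setI_closed Pi.
Proof.
move=> A B [k /= k1 kA] [l /= l1 lB]; exists (maxn k l); first by rewrite /= leq_max k1.
move=> N /=; rewrite geq_max => /andP[kN lN].
have sub j : (j <= maxn k l)%N -> sigma_of [set i | (i <= j)%N] (fun j : nat => X (j%:R * Delta N)) `<=`
    sigma_of [set i | (i <= maxn k l)%N] (fun j : nat => X (j%:R * Delta N)).
  move=> jm; apply: sub_sigma_algebra2 => S [i /= ij Si]; exists i => //=.
  exact: leq_trans jm.
have hA := sub k (leq_maxl _ _) _ (kA N kN).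
have hB := sub l (leq_maxr _ _) _ (lB N lN).
exact: (@measurableI _ (g_sigma_algebraType _) A B).
Qed.

Let sigma_ord k N E : sigma_of [set j | (j <= k)%N] (fun j : nat => X (j%:R * Delta N)) E ->
  <<s gen_of setT (fun j : 'I_k.+1 => X (j%:R * Delta N)) >> E.
Proof.
apply: sub_sigma_algebra2 => S [i /= ik Si].
by have ik' : (i < k.+1)%N := ik; exists (Ordinal ik').
Qed.

Let Pi_measurable : Pi `<=` measurable.
Proof.
move=> E [k /= k1 /(_ k (leqnn k)) /sigma_ord].
suff : <<s gen_of setT (fun j : 'I_k.+1 => X (j%:R * Delta k)) >> `<=` measurable by exact.
apply: smallest_sub; first exact: sigma_algebra_measurable.
exact: gen_of_measurable.
Qed.

Lemma sigma_field_X_measurable : sigma_field_X X Delta `<=` measurable.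
Proof. by apply: smallest_sub; [exact: sigma_algebra_measurable|exact: Pi_measurable]. Qed.

Lemma linear_comb_stable N (t th : 'I_N -> R) : (forall i, 0 <= t i <= 1) ->
  forall E, sigma_field_X X Delta E ->
  \int[P]_w (\1_E w * cos (linear_comb P L a Delta t th n w)) @[n --> \oo]
     --> fine (P E) * expR (- (s2 * limit_var a t th / 2)) /\
  \int[P]_w (\1_E w * sin (linear_comb P L a Delta t th n w)) @[n --> \oo] --> fine (P E) * 0.
Proof.
move=> t01.
have mW n : measurable_fun setT (linear_comb P L a Delta t th n).
  have := fun w => linear_combE HL ce Ha Delta th t01 n w.
  move=> /= /funext ->.
  by apply: (measurable_centered_sum HL) => k; rewrite trawl_set_atE; exact: trawl_box_finite.
(* Taking [N := k] in the intersection shows that such an event is determined by finitely many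
   values of [X] at times that do not move with [n]. *)
have cv E : Pi E -> _ := fun h => let: ex_intro2 k k1 hk := h in
  linear_comb_cf HL ce Ha tG D0 Dcvg nD th t01 (sigma_ord (hk k (leqnn k))).
(* The sure event gives the unconditional limit, required by the passage to the generated
   sigma-field. *)
have cvT : sigma_of [set j | (j <= 0)%N] (fun j : nat => X (j%:R * Delta 0%N)) setT.
  exact: (@measurableT _ (g_sigma_algebraType _)).
have [cT sT] := linear_comb_cf HL ce Ha tG D0 Dcvg nD th t01 (sigma_ord cvT).
have rT (f : T -> R) : \int[P]_w (\1_setT w * f w) = \int[P]_w f w.
  by apply: eq_Rint => w; rewrite indicT mul1r.
move=> E sE; split; apply: (dynkin_cvg_indic PiI Pi_measurable) => //.
- by move=> n; apply: measurableT_comp => //; exact: measurable_cos.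
- by move=> n w; exact: norm_cos_le1.
- by move: cT; rewrite probability_setT mul1r; under eq_fun do rewrite rT.
- by move=> E' /cv[].
- by move=> n; apply: measurableT_comp => //; exact: measurable_sin.
- by move=> n w; exact: norm_sin_le1.
- by move: sT; rewrite probability_setT mul1r; under eq_fun do rewrite rT.
- by move=> E' /cv[].
Qed.

End field_of_X.

(** * From characteristic functions to weak convergence *)

Section trig.
Context (R : realType) (k : nat).
Implicit Types (x th : 'rV[R]_k) (f g : 'rV[R]_k -> R).

Definition dotv th x := \sum_i th 0 i * x 0 i.

(** The span of the functions whose expectations are read off characteristic functions;
    measurability, boundedness and convergence all follow by induction. Products stay inside by the
    product-to-sum formulas ([trig_mul]). *)
Inductive trig_poly : ('rV[R]_k -> R) -> Prop :=
| TrigCos c th : trig_poly (fun x => c * cos (dotv th x))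
| TrigSin c th : trig_poly (fun x => c * sin (dotv th x))
| TrigAdd f g : trig_poly f -> trig_poly g -> trig_poly (fun x => f x + g x).

Lemma dotvD th1 th2 x : dotv (th1 + th2) x = dotv th1 x + dotv th2 x.
Proof. by rewrite -big_split; apply: eq_bigr => i _; rewrite mxE mulrDl. Qed.

Lemma dotvB th1 th2 x : dotv (th1 - th2) x = dotv th1 x - dotv th2 x.
Proof. by rewrite -sumrB; apply: eq_bigr => i _; rewrite !mxE mulrBl. Qed.

Lemma eq_trig f g : f =1 g -> trig_poly f -> trig_poly g.
Proof. by move=> /funext ->. Qed.

Lemma trig_cst c : trig_poly (fun=> c).
Proof.
apply: eq_trig (TrigCos c 0) => x.
by rewrite /dotv big1 ?cos0 ?mulr1// => i _; rewrite mxE mul0r.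
Qed.

Let trig_mul_cos f c th : trig_poly f -> trig_poly (fun x => f x * (c * cos (dotv th x))).
Proof.
elim=> [c' th'|c' th'|f' g' _ hf _ hg].
- apply: eq_trig (TrigAdd (TrigCos (c * c' / 2) (th' + th)) (TrigCos (c * c' / 2) (th' - th))) => x.
  by rewrite dotvD dotvB cosD cosB; field.
- apply: eq_trig (TrigAdd (TrigSin (c * c' / 2) (th' + th)) (TrigSin (c * c' / 2) (th' - th))) => x.
  by rewrite dotvD dotvB sinD sinB; field.
- by apply: eq_trig (TrigAdd hf hg) => x; rewrite mulrDl.
Qed.

Let trig_mul_sin f c th : trig_poly f -> trig_poly (fun x => f x * (c * sin (dotv th x))).
Proof.
elim=> [c' th'|c' th'|f' g' _ hf _ hg].
- apply: eq_trig (TrigAdd (TrigSin (c * c' / 2) (th' + th)) (TrigSin (- (c * c' / 2)) (th' - th))) => x.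
  by rewrite dotvD dotvB sinD sinB; field.
- apply: eq_trig (TrigAdd (TrigCos (c * c' / 2) (th' - th)) (TrigCos (- (c * c' / 2)) (th' + th))) => x.
  by rewrite dotvB dotvD cosB cosD; field.
- by apply: eq_trig (TrigAdd hf hg) => x; rewrite mulrDl.
Qed.

Lemma trig_mul f g : trig_poly f -> trig_poly g -> trig_poly (fun x => f x * g x).
Proof.
move=> hf; elim=> [c th|c th|f' g' _ h1 _ h2]; [exact: trig_mul_cos|exact: trig_mul_sin|].
by apply: eq_trig (TrigAdd h1 h2) => x; rewrite mulrDr.
Qed.

(* [walk s f z x] is the expectation of [f] at the end of a random walk from
   [z] whose steps are [+/- h e_i], [i] running through [s], the sign [+] having
   probability [(1 + sin (x_i / Lc)) / 2]. *)
Section walk.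
Variables (Lc h : R).

Definition up (i : 'I_k) x := (1 + sin (x 0 i / Lc)) / 2.

Fixpoint walk (s : seq 'I_k) f (z x : 'rV[R]_k) : R :=
  if s is i :: s' then up i x * walk s' f (z + h *: delta_mx 0 i) x +
                       (1 - up i x) * walk s' f (z - h *: delta_mx 0 i) x
  else f z.

Lemma up_ge0 i x : 0 <= up i x /\ 0 <= 1 - up i x.
Proof.
rewrite /up; have := sin_geN1 (x 0 i / Lc); have := sin_le1 (x 0 i / Lc).
by move=> h1 h2; split; lra.
Qed.

Lemma walk_trig s f z : trig_poly (walk s f z).
Proof.
elim: s z => [|i s IH] z /=; first exact: trig_cst.
have tu : trig_poly (up i).
  apply: eq_trig (TrigAdd (trig_cst (1 / 2)) (TrigSin (1 / 2) (Lc^-1 *: delta_mx 0 i))) => x.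
  rewrite /up /dotv (bigD1 i)//= big1 ?addr0; last first.
    by move=> j ji; rewrite !mxE eqxx (negbTE ji)/= mulr0 mul0r.
  by rewrite !mxE !eqxx mulr1 [Lc^-1 * _]mulrC; field.
have tu' : trig_poly (fun x => 1 - up i x).
  apply: eq_trig (TrigAdd (trig_cst 1) (trig_mul (trig_cst (-1)) tu)) => x.
  by rewrite mulN1r.
by apply: TrigAdd; exact: trig_mul.
Qed.

Lemma walk_le s f g z x : (forall y, f y <= g y) -> walk s f z x <= walk s g z x.
Proof.
move=> fg; elim: s z => [|i s IH] z /=; first exact: fg.
have [u0 u1] := up_ge0 i x.
by apply: lerD; apply: ler_wpM2l.
Qed.

Lemma walk_add s f g z x : walk s (fun y => f y + g y) z x = walk s f z x + walk s g z x.
Proof. by elim: s z => [|i s IH] z //=; rewrite !IH; ring. Qed.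

Lemma walk_scale s c f z x : walk s (fun y => c * f y) z x = c * walk s f z x.
Proof. by elim: s z => [|i s IH] z //=; rewrite !IH; ring. Qed.

Lemma walk_cst s c z x : walk s (fun=> c) z x = c.
Proof. by elim: s z => [|i s IH] z //=; rewrite !IH; ring. Qed.

Lemma walk_sum s (I : Type) (r : seq I) (F : I -> 'rV[R]_k -> R) z x :
  walk s (fun y => \sum_(i <- r) F i y) z x = \sum_(i <- r) walk s (F i) z x.
Proof.
elim: r => [|i r IH].
  rewrite big_nil (_ : (fun y => _) = fun=> 0) ?walk_cst//.
  by apply/funext => y; rewrite big_nil.
rewrite big_cons -IH -walk_add; congr (walk s _ z x).
by apply/funext => y; rewrite big_cons.
Qed.

(** Squared bias plus variance: a step in direction [l] has mean [h * sin (x_l / Lc)] and variance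
    [h ^+ 2] times one minus the squared sine, and only the steps of [s] equal to [l] move that
    coordinate. *)
Lemma walk_sqr s l t z x :
  walk s (fun y => (y 0 l - t) ^+ 2) z x =
  (z 0 l + (count_mem l s)%:R * (h * sin (x 0 l / Lc)) - t) ^+ 2 +
  (count_mem l s)%:R * (h ^+ 2 * (1 - sin (x 0 l / Lc) ^+ 2)).
Proof.
elim: s z => [|i s IH] z /=; first by rewrite !mul0r !addr0.
rewrite !IH !mxE eqxx/= natrD /up.
have [->|li] := eqVneq i l.
  by rewrite -[true%:R]/(1 : R); set u := sin _; set n := (count _ _)%:R; field.
by rewrite -[false%:R]/(0 : R) !mulr0 subr0 !addr0 add0r; ring.
Qed.

End walk.

Definition lip_sum (Lam : R) f := forall x y, `|f x - f y| <= Lam * \sum_i `|x 0 i - y 0 i|.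

(** A Bernstein-type approximation: averaging [f] over the end of a walk that is likely to finish
    near [x] keeps the bound [M], and is a trigonometric polynomial in [x] because the step
    probabilities are. The error grows like [x ^+ 2], which second moments can absorb. *)
Lemma trig_approx f (Lam M : R) : 0 <= Lam -> lip_sum Lam f -> (forall x, `|f x| <= M) ->
  exists F : nat -> 'rV[R]_k -> R, [/\ forall q, trig_poly (F q),
    forall q x, `|F q x| <= M &
    forall q x, `|F q x - f x| <= Lam * (q.+1%:R^-1 * \sum_i (1 + x 0 i ^+ 2))].
Proof.
move=> Lam0 fl fM.
pose s N := flatten [seq nseq N i | i <- enum 'I_k].
have cs N l : count_mem l (s N) = N.
  rewrite /s count_flatten -map_comp (eq_map (g := fun i => if i == l then N else 0%N)); last first.
    by move=> i /=; rewrite count_nseq /=; case: eqP => _; rewrite ?mul1n.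
  rewrite sumnE big_map big_enum/= -big_mkcond/= big_pred1_eq//.
(* With [h = Lc / N] and [N = Lc ^ 4], each coordinate of the walk ends with mean
   [Lc * sin (x_i / Lc)], within [x_i ^+ 2 / Lc] of [x_i], and variance at most
   [N * h ^+ 2 = Lc ^ (-2)]. *)
pose N q := (q.+1 ^ 4)%N.
pose Lc q : R := q.+1%:R.
pose h q : R := Lc q / (N q)%:R.
pose F q := walk (Lc q) (h q) (s (N q)) f 0.
exists F; split.
{ by move=> q; exact: walk_trig. }
{ move=> q x; rewrite ler_norml; apply/andP; split.
    rewrite -(walk_cst (Lc q) (h q) (s (N q)) (- M) 0 x); apply: walk_le => y.
    by have := fM y; rewrite ler_norml => /andP[].
  rewrite -(walk_cst (Lc q) (h q) (s (N q)) M 0 x); apply: walk_le => y.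
  by have := fM y; rewrite ler_norml => /andP[]. }
move=> q x.
have L0 : 0 < Lc q by rewrite ltr0n.
pose u i := sin (x 0 i / Lc q).
pose W g := walk (Lc q) (h q) (s (N q)) g 0 x.
pose dist (y : 'rV[R]_k) := Lam * \sum_i `|y 0 i - x 0 i|.
have Wle : W dist <= Lam * (q.+1%:R^-1 * \sum_i (1 + x 0 i ^+ 2)).
  rewrite /W /dist walk_scale; apply: ler_wpM2l => //.
  rewrite walk_sum mulr_sumr; apply: ler_sum => i _.
  pose e : R := (Lc q)^-1.
  have e0 : 0 < e by rewrite invr_gt0.
  (* The arithmetic-geometric inequality replaces the absolute deviation from the mean by its
     square, whose expectation [walk_sqr] gives exactly. *)
  have pt (y : 'rV[R]_k) : `|y 0 i - x 0 i| <= (e / 2 + x 0 i ^+ 2 * e) + (Lc q / 2) * (y 0 i - Lc q * u i) ^+ 2.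
    have h1 : `|Lc q * u i - x 0 i| <= x 0 i ^+ 2 * e.
      have -> : Lc q * u i - x 0 i = Lc q * (u i - x 0 i / Lc q) by field; rewrite gt_eqF.
      rewrite normrM (gtr0_norm L0).
      apply: (@le_trans _ _ (Lc q * ((x 0 i / Lc q) ^+ 2 * 1))).
        rewrite ler_pM2l//; apply: le_trans (sin_bound _) _.
        by rewrite ler_wpM2l ?sqr_ge0// ge_min lexx.
      by rewrite le_eqVlt; apply/orP; left; apply/eqP; rewrite /e; field; rewrite gt_eqF.
    have h2 : `|y 0 i - Lc q * u i| <= e / 2 + (Lc q / 2) * (y 0 i - Lc q * u i) ^+ 2.
      set v := y 0 i - _; rewrite -(real_normK (num_real v)).
      have := sqr_ge0 (`|v| - e); rewrite sqrrB => h3.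
      have h4 : 0 <= Lc q / 2 * (`|v| ^+ 2 - `|v| * e *+ 2 + e ^+ 2) by rewrite mulr_ge0// divr_ge0// ltW.
      suff -> : e / 2 + Lc q / 2 * `|v| ^+ 2 = Lc q / 2 * (`|v| ^+ 2 - `|v| * e *+ 2 + e ^+ 2) + `|v| by lra.
      by rewrite /e mulr2n; field; rewrite gt_eqF.
    by have := ler_normD (y 0 i - Lc q * u i) (Lc q * u i - x 0 i); rewrite addrA subrK; lra.
  apply: le_trans (walk_le _ _ _ _ _ pt) _.
  rewrite walk_add walk_cst walk_scale walk_sqr cs mxE add0r.
  have -> : (N q)%:R * (h q * u i) - Lc q * u i = 0.
    by rewrite /h; field; rewrite pnatr_eq0 -lt0n expn_gt0.
  rewrite expr0n add0r.
  have hv : (N q)%:R * (h q ^+ 2 * (1 - u i ^+ 2)) <= e ^+ 2.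
    apply: (@le_trans _ _ ((N q)%:R * (h q ^+ 2 * 1))).
      by rewrite ler_wpM2l// ler_wpM2l ?sqr_ge0// gerBl sqr_ge0.
    rewrite le_eqVlt; apply/orP; left; apply/eqP.
    rewrite /h /N /e natrX -/(Lc q); by field; rewrite gt_eqF.
  have -> : q.+1%:R^-1 * (1 + x 0 i ^+ 2) = (e / 2 + x 0 i ^+ 2 * e) + Lc q / 2 * e ^+ 2.
    by rewrite -/(Lc q) /e; field; rewrite gt_eqF.
  by rewrite lerD2l ler_wpM2l// divr_ge0// ltW.
apply: le_trans Wle; rewrite ler_norml -/(W f).
have -> : f x = W (fun=> f x) by rewrite /W walk_cst.
have fB (g1 g2 : 'rV[R]_k -> R) : (forall y, g1 y <= g2 y + dist y) -> W g1 - W g2 <= W dist.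
  by move=> hh; rewrite lerBlDl /W -walk_add; exact: walk_le.
apply/andP; split; last first.
  apply: fB => y; have := fl y x; rewrite /dist; move/(le_trans (ler_norm _)); lra.
rewrite lerNl opprB; apply: fB => y; have := fl y x; rewrite distrC /dist.
by move/(le_trans (ler_norm _)); lra.
Qed.

End trig.

(* [D x y e] is meant to say that [y] is admissible and within [e] of [x]. *)
Section inf_convolution.
Context (R : realType) (T : Type) (D : T -> T -> R -> Prop) (F : T -> R) (M : R).
Hypothesis D_ge0 : forall x y e, D x y e -> 0 <= e.
Hypothesis D_ex : forall x, exists y e, D x y e.
Hypothesis FM : forall x y e, D x y e -> `|F y| <= M.

Let vals (j : R) x : set R := [set z | exists y e, D x y e /\ z = F y + j * e].

(** The Lipschitz envelope of [F] with slope [j], capped at [M] so that the bound on [F] passes to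
    it. *)
Definition inf_conv (j : R) (x : T) : R := Num.min M (inf (vals j x)).

Let vals_lb j x : 0 <= j -> lbound (vals j x) (- M).
Proof.
move=> j0 _ [y [e [De ->]]]; have := FM De; rewrite ler_norml => /andP[h _].
by apply: le_trans h _; rewrite lerDl mulr_ge0// (D_ge0 De).
Qed.

Let vals_ex j x : vals j x !=set0.
Proof. by have [y [e De]] := D_ex x; exists (F y + j * e), y, e. Qed.

Let M0 (x : T) : 0 <= M.
Proof. by have [y [e /FM]] := D_ex x; apply: le_trans. Qed.

Lemma inf_conv_le j x y e : 0 <= j -> D x y e -> inf_conv j x <= F y + j * e.
Proof.
move=> j0 De; rewrite ge_min; apply/orP; right; apply: ge_inf.
  by exists (- M); exact: vals_lb.
by exists y, e.
Qed.

Lemma inf_conv_bound j x : 0 <= j -> `|inf_conv j x| <= M.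
Proof.
move=> j0; rewrite ler_norml ge_min lexx andbT le_min; apply/andP; split.
  by have := M0 x; lra.
by apply: lb_le_inf => //; exact: vals_lb.
Qed.

Lemma inf_conv_lip j x x' c : 0 <= j -> 0 <= c ->
  (forall y e, D x' y e -> D x y (e + c)) -> inf_conv j x <= inf_conv j x' + j * c.
Proof.
move=> j0 c0 h; rewrite /inf_conv -lerBlDr le_min lerBlDr; apply/andP; split.
  by apply: (@le_trans _ _ M); [rewrite ge_min lexx|rewrite lerDl mulr_ge0].
apply: lb_le_inf => // _ [y [e [De ->]]]; rewrite lerBlDr.
apply: le_trans (inf_conv_le j0 (h _ _ De)) _.
by rewrite mulrDr addrA.
Qed.

(** Points within [del] of [x] give values at least [F x - e] by lower semicontinuity. For the
    others the penalty [j * del] exceeds [2 * M], the largest possible gain. *)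
Lemma inf_conv_cvg x : D x x 0 ->
  (forall e, 0 < e -> exists2 del, 0 < del & forall y c, D x y c -> c < del -> F x - e <= F y) ->
  inf_conv j%:R x @[j --> \oo] --> F x.
Proof.
move=> Dxx hc; apply/cvgrPdist_le => e e0.
have [del del0 hd] := hc _ e0.
have M0' := M0 x.
near=> j.
have j0 : (0 : R) <= j%:R by [].
have up := inf_conv_le j0 Dxx; rewrite mulr0 addr0 in up.
rewrite ger0_norm ?subr_ge0// lerBlDr -lerBlDl.
have FxM := FM Dxx; rewrite ler_norml in FxM; case/andP: FxM => h1 h2.
rewrite le_min; apply/andP; split; first by lra.
apply: lb_le_inf => // _ [y [c [Dc ->]]].
have [cd|dc] := ltP c del.
  by apply: le_trans (hd _ _ Dc cd) _; rewrite lerDl mulr_ge0// (D_ge0 Dc).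
have hj : 2 * M / del <= j%:R by near: j; exact: nbhs_infty_ger.
have : 2 * M <= j%:R * c.
  by move: hj; rewrite ler_pdivrMr// => /le_trans; apply; rewrite ler_wpM2l.
have := FM Dc; rewrite ler_norml => /andP[]; lra.
Unshelve. all: by end_near.
Qed.

End inf_convolution.

Section trig_measurable.
Context d (T : measurableType d) (R : realType) (k : nat) (xi : T -> 'rV[R]_k).
Hypothesis mxi : forall i, measurable_fun setT (fun w => xi w 0 i).

Lemma measurable_dotv th : measurable_fun setT (fun w => dotv th (xi w)).
Proof. by apply: measurable_bigsum => i _; exact: measurable_funM. Qed.

Lemma trig_measurable f : trig_poly f -> measurable_fun setT (fun w => f (xi w)).
Proof.
elim=> [c th|c th|f' g' _ h1 _ h2]; last exact: measurable_funD.
- apply: measurable_funM => //; apply: (measurableT_comp (@measurable_cos R setT)).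
  exact: measurable_dotv.
- apply: measurable_funM => //; apply: (measurableT_comp (@measurable_sin R setT)).
  exact: measurable_dotv.
Qed.

(** Such a function of [xi] is a pointwise limit of trigonometric polynomials, which are measurable
    as soon as the coordinates are. *)
Lemma lip_measurable f (Lam M : R) : 0 <= Lam -> lip_sum Lam f -> (forall x, `|f x| <= M) ->
  measurable_fun setT (fun w => f (xi w)).
Proof.
move=> Lam0 fl fM; have [F [tF _ Ff]] := trig_approx Lam0 fl fM.
apply: (@measurable_fun_cvg _ _ _ _ (fun q w => F q (xi w))).
  by move=> q; exact: trig_measurable.
move=> w _; apply/cvgrPdist_le => e e0.
have h : Lam * (q.+1%:R^-1 * \sum_i (1 + xi w 0 i ^+ 2)) @[q --> \oo] --> (0 : R).
  rewrite -[X in _ --> X](mulr0 Lam); apply: cvgM; first exact: cvg_cst.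
  rewrite -[X in _ --> X](mul0r (\sum_i (1 + xi w 0 i ^+ 2))).
  by apply: cvgM; [exact: cvg_harmonic|exact: cvg_cst].
move/cvgrPdist_le : h => /(_ _ e0); apply: filterS => q.
rewrite sub0r normrN => /(le_trans (ler_norm _)); apply: le_trans.
by rewrite distrC.
Qed.

End trig_measurable.

Lemma trig_bounded (R : realType) k (f : 'rV[R]_k -> R) : trig_poly f ->
  exists M, forall x, `|f x| <= M.
Proof.
elim=> [c th|c th|f' g' _ [M1 h1] _ [M2 h2]].
- by exists `|c| => x; rewrite normrM ler_piMr// norm_cos_le1.
- by exists `|c| => x; rewrite normrM ler_piMr// norm_sin_le1.
- by exists (M1 + M2) => x; apply: le_trans (ler_normD _ _) _; exact: lerD.
Qed.

Section indic_mul.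
Context d (T : measurableType d) (R : realType) (Q : probability T R) (A : set T).
Hypothesis mA : measurable A.

Lemma indic_mul_le (x : R) w : `|\1_A w * x| <= `|x|.
Proof. by rewrite normrM ler_piMl// indicE ger0_norm// lern1 leq_b1. Qed.

Lemma indic_mul_int (f : T -> R) (M : R) : measurable_fun setT f ->
  (forall w, `|f w| <= M) -> rintegrable Q (fun w => \1_A w * f w).
Proof.
move=> mf fM; apply: (bounded_rintegrable Q (M := M)).
  by apply: measurable_funM => //; exact: measurable_indic.
by move=> w; apply: le_trans (fM w); exact: indic_mul_le.
Qed.

Lemma indic_mulZ (c : R) (f : T -> R) (M : R) : measurable_fun setT f ->
  (forall w, `|f w| <= M) ->
  \int[Q]_w (\1_A w * (c * f w)) = c * \int[Q]_w (\1_A w * f w).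
Proof.
move=> mf fM; rewrite -(RintZ _ (indic_mul_int mf fM)).
by apply: eq_Rint => w; ring.
Qed.

Lemma indic_mulD (f g : T -> R) (M N : R) : measurable_fun setT f ->
  (forall w, `|f w| <= M) -> measurable_fun setT g -> (forall w, `|g w| <= N) ->
  \int[Q]_w (\1_A w * (f w + g w)) = \int[Q]_w (\1_A w * f w) + \int[Q]_w (\1_A w * g w).
Proof.
move=> mf fM mg gN; rewrite -(RintD (indic_mul_int mf fM) (indic_mul_int mg gN)).
by apply: eq_Rint => w; rewrite mulrDr.
Qed.

End indic_mul.

Definition dist1 (R : realType) k (x y : 'rV[R]_k) (e : R) := \sum_i `|x 0 i - y 0 i| <= e.

Section weak_convergence.
Context d (Om : measurableType d) d' (Om' : measurableType d') (R : realType).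
Variables (P : probability Om R) (P' : probability Om' R) (k : nat).
Variables (xi : nat -> Om -> 'rV[R]_k) (xi' : Om' -> 'rV[R]_k) (E : set Om) (E' : set Om') (V : R).
Hypothesis mE : measurable E.
Hypothesis mE' : measurable E'.
Hypothesis sxi : forall n i, sqintegrable P (fun w => xi n w 0 i).
Hypothesis Vxi : \forall n \near \oo, forall i, \int[P]_w xi n w 0 i ^+ 2 <= V.
Hypothesis sxi' : forall i, sqintegrable P' (fun w => xi' w 0 i).
Hypothesis Vxi' : forall i, \int[P']_w xi' w 0 i ^+ 2 <= V.
Hypothesis hcos : forall th,
  \int[P]_w (\1_E w * cos (dotv th (xi n w))) @[n --> \oo] --> \int[P']_w (\1_E' w * cos (dotv th (xi' w))).
Hypothesis hsin : forall th,
  \int[P]_w (\1_E w * sin (dotv th (xi n w))) @[n --> \oo] --> \int[P']_w (\1_E' w * sin (dotv th (xi' w))).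

Let mxi n i : measurable_fun setT (fun w => xi n w 0 i).
Proof. by have [] := sxi n i. Qed.

Let mxi' i : measurable_fun setT (fun w => xi' w 0 i).
Proof. by have [] := sxi' i. Qed.

Lemma trig_cvg f : trig_poly f ->
  \int[P]_w (\1_E w * f (xi n w)) @[n --> \oo] --> \int[P']_w (\1_E' w * f (xi' w)).
Proof.
have mc d0 (T : measurableType d0) (z : T -> 'rV[R]_k) th :
    (forall i, measurable_fun setT (fun w => z w 0 i)) ->
    measurable_fun setT (fun w => cos (dotv th (z w))).
  by move=> mz; apply: (measurableT_comp (@measurable_cos R setT)); exact: measurable_dotv.
have ms d0 (T : measurableType d0) (z : T -> 'rV[R]_k) th :
    (forall i, measurable_fun setT (fun w => z w 0 i)) ->
    measurable_fun setT (fun w => sin (dotv th (z w))).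
  by move=> mz; apply: (measurableT_comp (@measurable_sin R setT)); exact: measurable_dotv.
elim=> [c th|c th|f' g' tf h1 tg h2].
- rewrite (indic_mulZ P' mE' c (mc _ _ _ th mxi') (fun w => norm_cos_le1 _)).
  under eq_fun do rewrite (indic_mulZ P mE c (mc _ _ _ th (mxi _)) (fun w => norm_cos_le1 _)).
  by apply: cvgM; [exact: cvg_cst|exact: hcos].
- rewrite (indic_mulZ P' mE' c (ms _ _ _ th mxi') (fun w => norm_sin_le1 _)).
  under eq_fun do rewrite (indic_mulZ P mE c (ms _ _ _ th (mxi _)) (fun w => norm_sin_le1 _)).
  by apply: cvgM; [exact: cvg_cst|exact: hsin].
- have [M1 b1] := trig_bounded tf; have [M2 b2] := trig_bounded tg.
  rewrite (indic_mulD P' mE' (trig_measurable mxi' tf) (fun w => b1 _) (trig_measurable mxi' tg) (fun w => b2 _)).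
  under eq_fun do rewrite (indic_mulD P mE (trig_measurable (mxi _) tf) (fun w => b1 _) (trig_measurable (mxi _) tg) (fun w => b2 _)).
  exact: cvgD.
Qed.

Lemma approx_indic d0 (T : measurableType d0) (Q : probability T R) (A : set T) (zeta : T -> 'rV[R]_k)
    (f F : 'rV[R]_k -> R) (M Lam q : R) :
  measurable A -> (forall i, sqintegrable Q (fun w => zeta w 0 i)) ->
  (forall i, \int[Q]_w zeta w 0 i ^+ 2 <= V) -> 0 <= Lam -> 0 <= q ->
  measurable_fun setT (fun w => f (zeta w)) -> measurable_fun setT (fun w => F (zeta w)) ->
  (forall x, `|f x| <= M) -> (forall x, `|F x| <= M) ->
  (forall x, `|F x - f x| <= Lam * (q * \sum_i (1 + x 0 i ^+ 2))) ->
  `|\int[Q]_w (\1_A w * F (zeta w)) - \int[Q]_w (\1_A w * f (zeta w))| <= Lam * (q * (k%:R * (1 + V))).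
Proof.
move=> mA sz Vz Lam0 q0 mf mF fM FM Ff.
have ii i : rintegrable Q (fun w => 1 + zeta w 0 i ^+ 2).
  by apply: rintegrableD; [exact: rintegrable_cst|case: (sz i)].
have iS : rintegrable Q (fun w => \sum_i (1 + zeta w 0 i ^+ 2)) by exact: rintegrable_sum.
apply: (@le_trans _ _ (\int[Q]_w (Lam * (q * \sum_i (1 + zeta w 0 i ^+ 2))))).
  apply: ler_norm_RintB.
  { exact: (indic_mul_int Q mA mF (fun w => FM _)). }
  { exact: (indic_mul_int Q mA mf (fun w => fM _)). }
  { by apply: rintegrableZ; exact: rintegrableZ. }
  by move=> w; rewrite -mulrBr; apply: le_trans (Ff _); exact: indic_mul_le.
rewrite RintZ; last exact: rintegrableZ.
rewrite (RintZ _ iS); do 2 apply: ler_wpM2l => //.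
rewrite Rint_sum//; apply: (@le_trans _ _ (\sum_(i < k) (1 + V))).
  apply: ler_sum => i _; rewrite RintD; [|exact: rintegrable_cst|by case: (sz i)].
  by rewrite Rint_cst lerD2l.
by rewrite sumr_const card_ord mulr_natl.
Qed.

(** Uniform second moments act as tightness: the trigonometric approximation is not uniform in
    space, but its error has small expectation for all large [n] at once. *)
Lemma weak_lip f (Lam M : R) : 0 <= Lam -> lip_sum Lam f -> (forall x, `|f x| <= M) ->
  \int[P]_w (\1_E w * f (xi n w)) @[n --> \oo] --> \int[P']_w (\1_E' w * f (xi' w)).
Proof.
move=> Lam0 fl fM; have [F [tF FM Ff]] := trig_approx Lam0 fl fM.
apply/cvgrPdist_le => e e0.
have e3 : 0 < e / 3 by lra.
have h : Lam * (q.+1%:R^-1 * (k%:R * (1 + V))) @[q --> \oo] --> (0 : R).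
  rewrite -[X in _ --> X](mulr0 Lam); apply: cvgM; first exact: cvg_cst.
  rewrite -[X in _ --> X](mul0r (k%:R * (1 + V))).
  by apply: cvgM; [exact: cvg_harmonic|exact: cvg_cst].
move/cvgrPdist_le : h => /(_ _ e3) [q _ /(_ q (leqnn q))].
rewrite /= sub0r normrN => /(le_trans (ler_norm _)) hq.
have q0 : 0 <= q.+1%:R^-1 :> R by rewrite invr_ge0.
have a1 := approx_indic mE' sxi' Vxi' Lam0 q0 (lip_measurable mxi' Lam0 fl fM)
  (trig_measurable mxi' (tF q)) fM (FM q) (Ff q).
have /cvgrPdist_le /(_ _ e3) := trig_cvg (tF q).
apply: filterS2 Vxi => n Vn hn.
have a2 := approx_indic mE (sxi n) Vn Lam0 q0 (lip_measurable (mxi n) Lam0 fl fM)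
  (trig_measurable (mxi n) (tF q)) fM (FM q) (Ff q).
by move: hn (le_trans a1 hq) (le_trans a2 hq); rewrite !ler_norml; lra.
Qed.

Section continuous_function.
Variables (g : 'rV[R]_k -> R) (M : R).
Hypothesis cg : continuous g.
Hypothesis gM : forall v, `|g v| <= M.

Let D_ge0 (x y : 'rV[R]_k) (e : R) : dist1 x y e -> 0 <= e.
Proof. by apply: le_trans; rewrite sumr_ge0. Qed.

Let D_refl (x : 'rV[R]_k) : dist1 x x 0.
Proof. by rewrite /dist1 big1// => i _; rewrite subrr normr0. Qed.

Let D_ex (x : 'rV[R]_k) : exists y (e : R), dist1 x y e.
Proof. by exists x, 0. Qed.

Let gM' (x y : 'rV[R]_k) (e : R) : dist1 x y e -> `|g y| <= M.
Proof. by []. Qed.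

Let gj (j : nat) := inf_conv (@dist1 R k) g M j%:R.

Let gjM j x : `|gj j x| <= M.
Proof. exact: inf_conv_bound. Qed.

Let gj_lip j : lip_sum j%:R (gj j).
Proof.
have H (x y : 'rV[R]_k) : gj j x <= gj j y + j%:R * \sum_i `|x 0 i - y 0 i|.
  apply: (inf_conv_lip D_ge0 D_ex gM') => //; first by rewrite sumr_ge0.
  move=> z e; rewrite /dist1 => h; rewrite addrC; apply: le_trans (_ : _ <= \sum_i `|x 0 i - y 0 i| + \sum_i `|y 0 i - z 0 i|) _.
    rewrite -big_split; apply: ler_sum => i _ /=.
    by rewrite -(subrKA (y 0 i)); exact: ler_normD.
  by rewrite lerD2l.
move=> x y; rewrite ler_norml; have := H x y; have := H y x.
under [X in _ <= _ + _ * X -> _]eq_bigr do rewrite distrC.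
by move=> h1 h2; apply/andP; split; lra.
Qed.

Let gj_cvg x : gj j x @[j --> \oo] --> g x.
Proof.
apply: (inf_conv_cvg D_ge0 D_ex gM') => // e e0.
have /cvgrPdist_le /(_ _ e0) : g y @[y --> x] --> g x by exact: cg.
move=> /nbhs_ballP[del /= del0 hd]; exists del => // y c Dc cd.
have : `|g x - g y| <= e.
  apply: hd; split => // i j; rewrite ord1 /ball/= {i}.
  apply: le_lt_trans cd; apply: le_trans Dc.
  by rewrite (bigD1 j)//= lerDl sumr_ge0.
by move/(le_trans (ler_norm _)); lra.
Qed.

Lemma continuous_measurable_comp d0 (T : measurableType d0) (zeta : T -> 'rV[R]_k) :
  (forall i, measurable_fun setT (fun w => zeta w 0 i)) ->
  measurable_fun setT (fun w => g (zeta w)).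
Proof.
move=> mz; apply: (@measurable_fun_cvg _ _ _ _ (fun j w => gj j (zeta w))).
  by move=> j; apply: (lip_measurable mz (ler0n _ j) (@gj_lip j) (@gjM j)).
by move=> w _; exact: gj_cvg.
Qed.

(** The envelopes [gj j] lie below [g] and tend to it, so convergence for Lipschitz functions yields
    a lower bound for [g]; the same bound for [- g] gives the limit. *)
Lemma weak_lower e : 0 < e -> \forall n \near \oo,
  \int[P']_w (\1_E' w * g (xi' w)) - e <= \int[P]_w (\1_E w * g (xi n w)).
Proof.
move=> e0; have e2 : 0 < e / 2 by lra.
have mgj' j : measurable_fun setT (fun w => gj j (xi' w)).
  exact: (lip_measurable mxi' (ler0n _ j) (@gj_lip j) (@gjM j)).
have h : \int[P']_w (\1_E' w * gj j (xi' w)) @[j --> \oo] --> \int[P']_w (\1_E' w * g (xi' w)).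
  { apply: (@cvg_RintD _ _ _ P' (fun j w => \1_E' w * gj j (xi' w)) (fun w => \1_E' w * g (xi' w)) (fun=> M) _ _ _ _).2.
    - by move=> j; apply: measurable_funM => //; exact: measurable_indic.
    - exact: rintegrable_cst.
    - by move=> j w; apply: le_trans (gjM j (xi' w)); exact: indic_mul_le.
    - by move=> w; apply: cvgM; [exact: cvg_cst|exact: gj_cvg]. }
move/cvgrPdist_le : h => /(_ _ e2) [j _ /(_ j (leqnn j))] /= hj.
have /cvgrPdist_le /(_ _ e2) := weak_lip (ler0n _ j) (@gj_lip j) (@gjM j).
apply: filterS => n hn.
have : \int[P]_w (\1_E w * gj j (xi n w)) <= \int[P]_w (\1_E w * g (xi n w)).
{ apply: ler_Rint.
  - apply: (indic_mul_int P mE _ (fun w => gjM j (xi n w))).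
    exact: (lip_measurable (mxi n) (ler0n _ j) (@gj_lip j) (@gjM j)).
  - apply: (indic_mul_int P mE _ (fun w => gM (xi n w))).
    exact: continuous_measurable_comp.
  - move=> w; rewrite ler_wpM2l//.
    by have := inf_conv_le D_ge0 gM' (ler0n _ j) (D_refl (xi n w)); rewrite mulr0 addr0. }
by move: hn hj; rewrite !ler_norml; lra.
Qed.

End continuous_function.

Lemma weak_continuous (g : 'rV[R]_k -> R) (M : R) : continuous g -> (forall v, `|g v| <= M) ->
  \int[P]_w (\1_E w * g (xi n w)) @[n --> \oo] --> \int[P']_w (\1_E' w * g (xi' w)).
Proof.
move=> cg gM; apply/cvgrPdist_le => e e0.
have cg' : continuous (fun v => - g v) by move=> v; have h : g y @[y --> v] --> g v by [exact: cg]; exact: (cvgN h).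
have gM2 v : `|- g v| <= M by rewrite normrN.
have mg d0 (T : measurableType d0) (zeta : T -> 'rV[R]_k) := @continuous_measurable_comp g M cg gM d0 T zeta.
apply: filterS2 (weak_lower cg gM e0) (weak_lower cg' gM2 e0) => n.
have E1 := indic_mulZ P' mE' (-1) (mg _ _ _ mxi') (fun w => gM _).
have E2 := indic_mulZ P mE (-1) (mg _ _ _ (mxi n)) (fun w => gM _).
under [X in _ -> X - _ <= _ -> _]eq_Rint do rewrite -mulN1r.
under [X in _ -> _ <= X -> _]eq_Rint do rewrite -mulN1r.
rewrite E1 E2 !mulN1r.
by rewrite ler_norml => h1 h2; apply/andP; split; lra.
Qed.

End weak_convergence.

(** * Characteristic functions of Brownian motion *)

Section density.
Context d (T : measurableType d) (R : realType).
Variables (mu nu : {measure set T -> \bar R}) (p : T -> R).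
Hypothesis mp : measurable_fun setT p.
Hypothesis p0 : forall x, 0 <= p x.
Hypothesis nup : forall A, measurable A -> nu A = (\int[mu]_(x in A) (p x)%:E)%E.

Let density_indic E : measurable E ->
  (\int[nu]_x (\1_E x)%:E = \int[mu]_x (\1_E x * p x)%:E)%E.
Proof.
move=> mE; rewrite integral_indic// setIT nup// [LHS]integral_mkcond.
apply: eq_integral => x _; rewrite patchE indicE; case: ifP => _; by rewrite ?mul1r ?mul0r.
Qed.

Import HBNNSimple.

Let density_nnsfun (f : {nnsfun T >-> R}) :
  (\int[nu]_x (f x)%:E = \int[mu]_x (f x * p x)%:E)%E.
Proof.
under [LHS]eq_integral do rewrite fimfunE -fsumEFin//.
rewrite [LHS]ge0_integral_fsum//; last 2 first.
  { by move=> r; exact/measurable_EFinP/measurableT_comp. }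
  { by move=> n x _; rewrite EFinM nnfun_muleindic_ge0. }
under [RHS]eq_integral.
  move=> x xD; rewrite EFinM fimfunE -fsumEFin// muleC ge0_mule_fsumr; last first.
    by move=> r; rewrite EFinM nnfun_muleindic_ge0.
  over.
rewrite [RHS]ge0_integral_fsum//; last 2 first.
  { move=> r; apply: emeasurable_funM; apply/measurable_EFinP => //.
    by apply: measurable_funM => //; exact: measurable_indic. }
  { by move=> n x _; rewrite mule_ge0 ?lee_fin ?p0// -lee_fin EFinM nnfun_muleindic_ge0. }
apply: eq_fsbigr => r _.
have [r0|r0] := leP 0 r; last first.
  rewrite preimage_nnfun0//.
  by rewrite !integral0_eq// => x _; rewrite indic0 mulr0 ?mule0.
have mr : measurable (f @^-1` [set r]) by [].
under [LHS]eq_integral do rewrite EFinM.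
rewrite ge0_integralZl//; last by apply/measurable_EFinP; exact: measurable_indic.
rewrite density_indic// -ge0_integralZl//; last 2 first.
{ by apply/measurable_EFinP; apply: measurable_funM => //; exact: measurable_indic. }
{ by move=> x _; rewrite lee_fin mulr_ge0. }
by apply: eq_integral => x _; rewrite -!EFinM; congr EFin; ring.
Qed.

(** From indicators to simple functions by linearity, then to nonnegative functions by monotone
    convergence on both sides. *)
Lemma integral_density (f : T -> R) : measurable_fun setT f -> (forall x, 0 <= f x) ->
  (\int[nu]_x (f x)%:E = \int[mu]_x (f x * p x)%:E)%E.
Proof.
move=> mf f0.
have mf' : measurable_fun setT (EFin \o f) by exact/measurable_EFinP.
have f0' x : setT x -> (0 <= (EFin \o f) x)%E by rewrite lee_fin.
pose f_ := nnsfun_approx measurableT mf'.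
transitivity (lim (\int[nu]_x (f_ n x)%:E @[n --> \oo])%E).
{ rewrite -monotone_convergence//=.
  - apply: eq_integral => x _; apply/esym/cvg_lim => //=.
    exact: (cvg_nnsfun_approx measurableT mf' f0').
  - by move=> n; exact/measurable_EFinP/measurable_funTS.
  - by move=> n ? _; rewrite lee_fin.
  - by move=> ? _ ? ? mn; rewrite lee_fin; exact/lefP/nd_nnsfun_approx. }
transitivity (lim (\int[mu]_x (f_ n x * p x)%:E @[n --> \oo])%E); last first.
{ rewrite -monotone_convergence//=.
  - apply: eq_integral => x _; apply/cvg_lim => //.
    have := cvg_nnsfun_approx measurableT mf' f0' (I : setT x).
    move=> /fine_cvgP[_] h; apply: cvg_EFin; first by apply: nearW.
    by apply: cvgM => //; exact: cvg_cst.
  - by move=> n; apply/measurable_EFinP; exact: measurable_funM.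
  - by move=> n ? _; rewrite lee_fin mulr_ge0.
  - move=> x _ ? ? mn; rewrite lee_fin ler_wpM2r//; exact/lefP/nd_nnsfun_approx. }
by apply: congr_lim; apply/funext => n /=; exact: density_nnsfun.
Qed.

End density.

(** * Moments and symmetry of the standard normal law *)

Section standard_normal.
Context (R : realType).
Local Notation mu := (@lebesgue_measure R).
Local Notation p := (@normal_pdf R 0).

Let pdf1E x : p 1 x = normal_peak 1 * expR (- x ^+ 2 / 2).
Proof.
rewrite (normal_pdfE 0 (oner_neq0 R)) /normal_fun subr0 expr1n.
by rewrite -[1 *+ 2]/(2%:R).
Qed.

Lemma integral_normal (s : R) (h : R -> R) : measurable_fun setT h -> (forall x, 0 <= h x) ->
  (\int[normal_prob 0 s]_x (h x)%:E = \int[mu]_x (h x * p s x)%:E)%E.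
Proof.
move=> mh h0; apply: integral_density => //; first exact: measurable_normal_pdf.
by move=> x; exact: normal_pdf_ge0.
Qed.

Lemma normal_scale (s : R) (h : R -> R) : 0 < s -> continuous h -> (forall x, 0 <= h x) ->
  (\int[normal_prob 0 s]_x (h x)%:E = \int[normal_prob 0 1]_x (h (s * x))%:E)%E.
Proof.
move=> s0 ch h0.
have mh := continuous_measurable_fun ch.
have cs : continuous (fun x => s * x) by move=> x; apply: cvgM; [exact: cvg_cst|exact: cvg_id].
have chs : continuous (fun x => h (s * x)).
  by move=> x; apply: (@continuous_comp _ _ _ (fun x => s * x) h); [exact: cs|exact: ch].
rewrite (integral_normal s mh h0) (integral_normal 1 (continuous_measurable_fun chs) (fun x => h0 _)).
have dF : (fun x : R => s * x)^`()%classic = cst s.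
  by apply/funext => x; rewrite derive1E deriveZ// derive_id /GRing.scale /= mulr1.
have sn0 : s != 0 by rewrite gt_eqF.
rewrite (@increasing_ge0_integration_by_substitutionT R (fun x => s * x) (fun x => h x * p s x)).
- apply: eq_integral => x _; rewrite dF /=; congr EFin; rewrite -mulrA; congr (_ * _).
  change (p s (s * x) * s = p 1 x).
  rewrite pdf1E (normal_pdfE 0 sn0) /normal_fun subr0 mulrAC; congr (_ * expR _); last first.
    by rewrite -mulr_natr; field.
  rewrite /normal_peak expr1n -mulrnAr sqrtrM ?sqr_ge0// sqrtr_sqr gtr0_norm//.
  by rewrite mul1r invfM mulrAC mulVf// mul1r.
- by move=> x y xy; rewrite ltr_pM2l.
- by rewrite dF => x; exact: cvg_cst.
- by rewrite dF; exact: is_cvg_cst.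
- by rewrite dF; exact: is_cvg_cst.
- by move=> x; apply: derivableZ.
- by apply/gt0_cvgMrNy; [exact: s0|exact: cvg_id].
- by apply/gt0_cvgMry; [exact: s0|exact: cvg_id].
- by move=> x; apply: cvgM; [exact: ch|exact: continuous_normal_pdf].
- by move=> x; rewrite mulr_ge0// normal_pdf_ge0.
Qed.

Let half_line (h : R -> R) : continuous h -> (forall x, 0 <= h x) -> (forall x, h (- x) = h x) ->
  (\int[normal_prob 0 1]_x (h x)%:E = 2%:E * \int[mu]_(x in `[0%R, +oo[) (h x * p 1 x)%:E)%E.
Proof.
move=> ch h0 hN.
rewrite integral_normal//; last exact: continuous_measurable_fun.
rewrite ge0_symfun_integralT ?set_itvcy//.
- by move=> x; rewrite mulr_ge0// normal_pdf_ge0.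
- by move=> x; apply: cvgM; [exact: ch|apply: continuous_normal_pdf; exact: oner_neq0].
- by move=> x /=; rewrite hN !pdf1E sqrrN.
Qed.

Let pdf_half : (\int[mu]_(x in `[0%R, +oo[) (p 1 x)%:E = (1 / 2)%:E)%E.
Proof.
have c1 : continuous (cst 1 : R -> R) by exact: cst_continuous.
have e1 : (\int[normal_prob (0 : R) 1]_x (1 : R)%:E = 1)%E.
  by rewrite integral_cst//= probability_setT mul1e.
have := half_line c1 (fun=> ler01) (fun=> erefl).
rewrite /cst e1; under eq_integral do rewrite mul1r.
have : (0 <= \int[mu]_(x in `[0%R, +oo[) (p 1 x)%:E)%E.
  by apply: integral_ge0 => x _; rewrite lee_fin normal_pdf_ge0.
case: (\int[mu]_(x in _) _)%E => [r|//|//] _; last by rewrite mulry gtr0_sg// mul1e.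
by rewrite -EFinM => -[h]; congr EFin; lra.
Qed.

Let g (x : R) := expR (- x ^+ 2 / 2).

Let dg (x : R) : is_derive x 1 g (- x * g x).
Proof.
pose u (y : R) := - (2^-1) * y ^+ 2.
have du : is_derive x 1 u (- x).
  have dx := is_derive_id x (1 : R).
  have [d1 d2] := is_deriveZ (- 2^-1) (is_deriveM dx dx).
  by split => //; rewrite d2 /GRing.scale /=; field.
have -> : g = expR \o u by apply/funext => y; rewrite /g /u /=; congr expR; field.
have [d1 d2] := is_derive1_comp (is_derive_expR (u x)) du.
by split => //; rewrite d2 mulrC.
Qed.

Let de (x : R) : is_derive x 1 (fun y : R => expR (- y)) (- expR (- x)).
Proof.
have dN : is_derive x 1 (fun y : R => - y) (-1) by have [d1 d2] := is_deriveN (is_derive_id x (1 : R)); split.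
have [d1 d2] := is_derive1_comp (is_derive_expR (- x)) dN.
by split => //; rewrite d2 mulrN1.
Qed.

Let xg_cvg : x * g x @[x --> +oo] --> (0 : R).
Proof.
apply/cvgrPdist_le => e e0; near=> x.
have x0 : 0 < x by near: x; exact: nbhs_pinfty_gt.
rewrite sub0r normrN ger0_norm ?mulr_ge0 ?expR_ge0 ?ltW//.
have h : x * g x <= 2 / x.
  rewrite /g mulNr expRN.
  have h1 : x ^+ 2 / 2 <= expR (x ^+ 2 / 2) by apply: le_trans (expR_ge1Dx _); lra.
  have x2 : 0 < x ^+ 2 / 2 by rewrite divr_gt0// exprn_gt0.
  apply: (@le_trans _ _ (x * (x ^+ 2 / 2)^-1)).
    by rewrite ler_pM2l// lef_pV2 ?posrE ?expR_gt0.
  by rewrite le_eqVlt; apply/orP; left; apply/eqP; field; rewrite gt_eqF.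
apply: le_lt_trans h _; rewrite ltr_pdivrMr// mulrC -ltr_pdivrMr//.
by near: x; apply: nbhs_pinfty_gt; exact: num_real.
Unshelve. all: by end_near.
Qed.

Let e_cvg : expR (- x) @[x --> +oo] --> (0 : R).
Proof. exact: cvgr_expR. Qed.

Let int_exp : (\int[mu]_(x in `[0%R, +oo[) (2 * expR (- x))%:E = 2%:E)%E.
Proof.
pose F (x : R) := (-2) * expR (- x).
have dF (x : R) : is_derive x 1 F (2 * expR (- x)).
  have [d1 d2] := is_deriveZ (-2) (de x).
  by split => //; rewrite d2 /GRing.scale /=; ring.
rewrite (@ge0_continuous_FTC2y R (fun x => 2 * expR (- x)) F 0 0).
- by rewrite /F oppr0 expR0 mulr1 -EFinB sub0r opprK.
- by move=> x _; rewrite mulr_ge0// expR_ge0.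
- apply: continuous_subspaceT => x; apply: differentiable_continuous; apply/derivable1_diffP.
  by apply: derivableM => //; have [] := de x.
- by rewrite -(mulr0 (-2)); apply: cvgM; [exact: cvg_cst|exact: e_cvg].
- by move=> x _; have [] := dF x.
- apply: cvg_at_right_filter; apply: differentiable_continuous; apply/derivable1_diffP.
  by have [] := dF 0.
- by move=> x _; have [_ <-] := dF x; rewrite derive1E.
Qed.

(** The derivative of [- (x * g x)] is [(x ^+ 2 - 1) * g x], which changes sign. Adding
    [2 * expR (- x)] makes the integrand nonnegative, because [(1 - x ^+ 2) * g x <= 2 * (1 - x) <=
    2 * expR (- x)] on [[0, 1]], so the antiderivative can be evaluated on the half-line. *)
Let int_f : (\int[mu]_(x in `[0%R, +oo[) ((x ^+ 2 - 1) * g x + 2 * expR (- x))%:E = 2%:E)%E.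
Proof.
pose F (x : R) := - (x * g x) + (-2) * expR (- x).
have dF (x : R) : is_derive x 1 F ((x ^+ 2 - 1) * g x + 2 * expR (- x)).
  have dx := is_derive_id x (1 : R).
  have h1 := is_deriveN (is_deriveM dx (dg x)).
  have [d1 d2] := is_deriveD h1 (is_deriveZ (-2) (de x)).
  by split => //; rewrite d2 /GRing.scale /=; ring.
rewrite (@ge0_continuous_FTC2y R (fun x => (x ^+ 2 - 1) * g x + 2 * expR (- x)) F 0 0).
- have -> : F 0 = - 2 by rewrite /F mul0r !oppr0 expR0; ring.
  by rewrite -EFinB sub0r opprK.
- move=> x x0; have g1 : g x <= 1.
    by rewrite /g -expR0 ler_expR mulNr oppr_le0 divr_ge0// sqr_ge0.
  have [x1|x1] := leP 1 x.
    by rewrite addr_ge0 ?mulr_ge0 ?expR_ge0// subr_ge0 expr_ge1.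
  have h : (1 - x ^+ 2) * g x <= (1 - x) * 2.
    apply: (@le_trans _ _ ((1 - x ^+ 2) * 1)).
      by rewrite ler_wpM2l// subr_ge0 expr_le1// ltW.
    rewrite mulr1 -[X in X - _](expr1n _ 2) subr_sqr ler_wpM2l ?subr_ge0//; lra.
  have := expR_ge1Dx (- x).
  by rewrite -[x ^+ 2 - 1]opprB mulNr; lra.
- apply: continuous_subspaceT => x; apply: cvgD; apply: cvgM.
  + by apply: cvgB; [exact: exprn_continuous|exact: cvg_cst].
  + by apply: differentiable_continuous; apply/derivable1_diffP; have [] := dg x.
  + exact: cvg_cst.
  + apply: (@continuous_comp _ _ _ (fun y : R => - y) expR); last exact: continuous_expR.
    exact: continuousN.
- rewrite -[X in _ --> X]addr0 -[X in _ --> X + _]oppr0 -[X in _ --> _ + X](mulr0 (-2)).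
  apply: cvgD; first by apply: cvgN; exact: xg_cvg.
  by apply: cvgM; [exact: cvg_cst|exact: e_cvg].
- by move=> x _; have [] := dF x.
- apply: cvg_at_right_filter; apply: differentiable_continuous; apply/derivable1_diffP.
  by have [] := dF 0.
- by move=> x _; have [_ <-] := dF x; rewrite derive1E.
Qed.

Let mg : measurable_fun setT g.
Proof.
apply: continuous_measurable_fun => x; apply: differentiable_continuous; apply/derivable1_diffP.
by have [] := dg x.
Qed.

(** Integration by parts in disguise: [int_f] and [int_exp] have the same value 2, so the added
    exponential cancels without subtracting infinite quantities. *)
Let second_half : (\int[mu]_(x in `[0%R, +oo[) (x ^+ 2 * g x)%:E = \int[mu]_(x in `[0%R, +oo[) (g x)%:E)%E.
Proof.
have mx2 : measurable_fun setT (fun x : R => x ^+ 2 * g x).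
  by apply: measurable_funM => //; exact: measurable_funX.
have me : measurable_fun setT (fun x : R => 2 * expR (- x)).
  apply: measurable_funM => //; apply: measurableT_comp => //; exact: measurableT_comp.
have mf : measurable_fun setT (fun x : R => (x ^+ 2 - 1) * g x + 2 * expR (- x)).
  apply: measurable_funD => //; apply: measurable_funM => //; exact: measurable_funB.
have f0 x : `[0%R, +oo[%classic x -> 0 <= (x ^+ 2 - 1) * g x + 2 * expR (- x).
  rewrite /= in_itv/= andbT => x0; have g1 : g x <= 1.
    by rewrite /g -expR0 ler_expR mulNr oppr_le0 divr_ge0// sqr_ge0.
  have [x1|x1] := leP 1 x.
    by rewrite addr_ge0 ?mulr_ge0 ?expR_ge0// subr_ge0 expr_ge1.
  have h : (1 - x ^+ 2) * g x <= (1 - x) * 2.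
    apply: (@le_trans _ _ ((1 - x ^+ 2) * 1)).
      by rewrite ler_wpM2l// subr_ge0 expr_le1// ltW.
    rewrite mulr1 -[X in X - _](expr1n _ 2) subr_sqr ler_wpM2l ?subr_ge0//; lra.
  have := expR_ge1Dx (- x).
  by rewrite -[x ^+ 2 - 1]opprB mulNr; lra.
have x2g (x : R) : 0 <= x ^+ 2 * g x by rewrite mulr_ge0 ?sqr_ge0 ?expR_ge0.
have E : (\int[mu]_(x in `[0%R, +oo[) (x ^+ 2 * g x)%:E + 2%:E =
          \int[mu]_(x in `[0%R, +oo[) (g x)%:E + 2%:E)%E.
{ rewrite -[in LHS]int_exp -[in RHS]int_f -!ge0_integralD//=.
  { by apply: eq_integral => x _; rewrite -!EFinD; congr EFin; ring. }
  all: try by apply/measurable_EFinP; exact: measurable_funTS.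
  all: try by move=> x _; rewrite lee_fin /g ?mulr_ge0 ?sqr_ge0 ?expR_ge0.
  all: try by move=> x _; rewrite lee_fin; exact: x2g.
  all: by move=> x /f0; rewrite lee_fin. }
by have := congr1 (fun z => z - 2%:E)%E E; rewrite /= !addeK.
Qed.

Lemma normal_second_moment : (\int[normal_prob (0 : R) 1]_x (x ^+ 2)%:E = 1)%E.
Proof.
have c2 : continuous (fun x : R => x ^+ 2) by exact: exprn_continuous.
rewrite (half_line c2 (fun x => sqr_ge0 x) (fun x => sqrrN x)).
have np0 : 0 <= normal_peak (1 : R) by exact: normal_peak_ge0.
have E1 : (\int[mu]_(x in `[0%R, +oo[) (x ^+ 2 * p 1 x)%:E =
   (normal_peak 1)%:E * \int[mu]_(x in `[0%R, +oo[) (x ^+ 2 * g x)%:E)%E.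
  rewrite -ge0_integralZl//=.
  { by apply: eq_integral => x _; rewrite pdf1E -EFinM mulrCA. }
  { by apply/measurable_EFinP; apply: measurable_funTS; apply: measurable_funM. }
  by move=> x _; rewrite lee_fin mulr_ge0 ?sqr_ge0 ?expR_ge0.
have E2 : (\int[mu]_(x in `[0%R, +oo[) (p 1 x)%:E =
   (normal_peak 1)%:E * \int[mu]_(x in `[0%R, +oo[) (g x)%:E)%E.
  rewrite -ge0_integralZl//=.
  { by apply: eq_integral => x _; rewrite pdf1E -EFinM. }
  { by apply/measurable_EFinP; exact: measurable_funTS. }
  by move=> x _; rewrite lee_fin expR_ge0.
by rewrite E1 second_half -E2 pdf_half -EFinM; congr EFin; lra.
Qed.

Lemma normal_reflect (h : R -> R) : continuous h -> (forall x, 0 <= h x) ->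
  (\int[normal_prob 0 1]_x (h (- x))%:E = \int[normal_prob 0 1]_x (h x)%:E)%E.
Proof.
move=> ch h0.
have chN : continuous (fun x => h (- x)).
  by move=> x; apply: (@continuous_comp _ _ _ (fun x => - x) h); [exact: continuousN|exact: ch].
have cp : continuous (p 1) by apply: continuous_normal_pdf; exact: oner_neq0.
have split (k : R -> R) : continuous k -> (forall x, 0 <= k x) ->
    (\int[normal_prob 0 1]_x (k x)%:E =
    \int[mu]_(x in `[0%R, +oo[) (k (- x) * p 1 x)%:E + \int[mu]_(x in `[0%R, +oo[) (k x * p 1 x)%:E)%E.
  move=> ck k0; have mk := continuous_measurable_fun ck.
  have ckp : continuous (fun x => k x * p 1 x) by move=> x; apply: cvgM; [exact: ck|exact: cp].
  rewrite integral_normal// -(setUv `]-oo, 0%R]%classic) ge0_integral_setU//=; last 4 first.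
  { by apply: measurableC. }
  { by apply/measurable_EFinP; apply: measurable_funTS; exact: continuous_measurable_fun. }
  { by move=> x _; rewrite lee_fin mulr_ge0// normal_pdf_ge0. }
  { by apply/disj_setPCl. }
  congr (_ + _)%E.
  { have := @ge0_integration_by_substitutionNy R (fun x => k x * p 1 x) 0.
    rewrite oppr0 => ->.
    - by apply: eq_integral => x _ /=; rewrite !pdf1E sqrrN.
    - exact: continuous_subspaceT.
    - by move=> x _; rewrite mulr_ge0// normal_pdf_ge0. }
  rewrite setCitvl -integral_itv_obnd_cbnd//.
  by apply/measurable_EFinP; apply: measurable_funTS; exact: continuous_measurable_fun.
rewrite (split _ chN (fun x => h0 _)) (split _ ch h0) addeC.
by under [X in (_ + X)%E = _]eq_integral do rewrite opprK.
Qed.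

End standard_normal.

Section normal_cf.
Context (R : realType).
Local Notation N1 := (normal_prob (0 : R) 1).

Let mx2 : measurable_fun setT (fun x : R => x ^+ 2).
Proof. exact: measurable_funX. Qed.

Let x2_int : rintegrable N1 (fun x : R => x ^+ 2).
Proof.
apply: ge0_rintegrableP => //; first by move=> x; exact: sqr_ge0.
by rewrite normal_second_moment ltry.
Qed.

Let x2E : \int[N1]_x (x ^+ 2) = 1.
Proof. by rewrite /Rintegral normal_second_moment. Qed.

Definition normal_cf (u : R) : R := \int[N1]_x cos (u * x).

Let cmul (u : R) : continuous (fun x : R => u * x).
Proof. by move=> x; apply: cvgM; [exact: cvg_cst|exact: cvg_id]. Qed.

Let ccos (u : R) : continuous (fun x : R => 1 + cos (u * x)).
Proof.
move=> x; apply: cvgD; first exact: cvg_cst.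
by apply: (@continuous_comp _ _ _ (fun x => u * x) (@cos R)); [exact: cmul|exact: continuous_cos].
Qed.

Let csin (u : R) : continuous (fun x : R => 1 + sin (u * x)).
Proof.
move=> x; apply: cvgD; first exact: cvg_cst.
by apply: (@continuous_comp _ _ _ (fun x => u * x) (@sin R)); [exact: cmul|exact: continuous_sin].
Qed.

Let mcos (u : R) : measurable_fun setT (fun x : R => cos (u * x)).
Proof. by apply: (measurableT_comp (@measurable_cos R setT)); exact: measurable_funM. Qed.

Let msin (u : R) : measurable_fun setT (fun x : R => sin (u * x)).
Proof. by apply: (measurableT_comp (@measurable_sin R setT)); exact: measurable_funM. Qed.

Let icos (u : R) : rintegrable N1 (fun x : R => cos (u * x)).
Proof. by apply: (bounded_rintegrable N1 (mcos u)) => x; exact: norm_cos_le1. Qed.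

Let isin (u : R) : rintegrable N1 (fun x : R => sin (u * x)).
Proof. by apply: (bounded_rintegrable N1 (msin u)) => x; exact: norm_sin_le1. Qed.

Let cos1_ge0 (y : R) : 0 <= 1 + cos y.
Proof. by have := cos_geN1 y; lra. Qed.

Let sin1_ge0 (y : R) : 0 <= 1 + sin y.
Proof. by have := sin_geN1 y; lra. Qed.

(** By symmetry of the law. The reflection is available for nonnegative functions, hence the shift
    by 1. *)
Lemma normal_sin0 (u : R) : \int[N1]_x sin (u * x) = 0.
Proof.
have := normal_reflect (@csin u) (fun x => sin1_ge0 _).
move=> /(congr1 fine); rewrite -/(Rintegral _ _ _) -/(Rintegral N1 setT (fun x => 1 + sin (u * x))).
rewrite (_ : (fun x => 1 + sin (u * - x)) = (fun x => 1 - sin (u * x))); last first.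
  by apply/funext => x; rewrite mulrN sinN.
rewrite (RintB (rintegrable_cst N1 1) (isin u)) (RintD (rintegrable_cst N1 1) (isin u)); lra.
Qed.

Section law.
Context d (T : measurableType d) (P : probability T R) (X : T -> R) (s : R).
Hypothesis mX : measurable_fun setT X.
Hypothesis s0 : 0 < s.
Hypothesis lawX : forall A, measurable A -> P (X @^-1` A) = normal_prob 0 s A.

Lemma normal_law_integral (h : R -> R) : continuous h -> (forall x, 0 <= h x) ->
  (\int[P]_w (h (X w))%:E = \int[N1]_x (h (s * x))%:E)%E.
Proof.
move=> ch h0; rewrite -(normal_scale s0 ch h0).
have mh : measurable_fun setT (EFin \o h) by apply/measurable_EFinP; exact: continuous_measurable_fun.
pose TR : measurableType _ := measurableTypeR R.
have := @ge0_integral_pushforward _ _ T TR R X mX P setT (EFin \o h) measurableT mh.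
rewrite preimage_setT /= => <-; last by move=> x _; rewrite lee_fin.
apply: eq_measure_integral.
by move=> A mA _; exact: lawX.
Qed.

Lemma normal_law_moments : sqintegrable P X /\ \int[P]_w X w ^+ 2 = s ^+ 2.
Proof.
have c2 : continuous (fun x : R => x ^+ 2) by exact: exprn_continuous.
have h := normal_law_integral c2 (fun x => sqr_ge0 x).
have E : (\int[N1]_x ((s * x) ^+ 2)%:E = (s ^+ 2)%:E)%E.
  have i2 := rintegrableZ (s ^+ 2) x2_int.
  under eq_integral do rewrite exprMn.
  by rewrite (Rint_fin i2) (RintZ _ x2_int) x2E mulr1.
split; last by rewrite /Rintegral h E.
split => //; apply: ge0_rintegrableP; first exact: measurable_funX.
  by move=> x; exact: sqr_ge0.
by rewrite h E ltry.
Qed.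

Lemma normal_law_cf z : \int[P]_w cos (z * X w) = normal_cf (z * s) /\ \int[P]_w sin (z * X w) = 0.
Proof.
have ic : rintegrable P (fun w => cos (z * X w)).
  apply: (@bounded_rintegrable _ _ _ P _ 1); last by move=> w; exact: norm_cos_le1.
  by apply: (measurableT_comp (@measurable_cos R setT)); exact: measurable_funM.
have is_ : rintegrable P (fun w => sin (z * X w)).
  apply: (@bounded_rintegrable _ _ _ P _ 1); last by move=> w; exact: norm_sin_le1.
  by apply: (measurableT_comp (@measurable_sin R setT)); exact: measurable_funM.
have hc := congr1 fine (normal_law_integral (@ccos z) (fun x => cos1_ge0 _)).
have hs := congr1 fine (normal_law_integral (@csin z) (fun x => sin1_ge0 _)).
have assoc x : z * (s * x) = z * s * x by rewrite mulrA.
have ac : (fun x => 1 + cos (z * (s * x))) = (fun x => 1 + cos (z * s * x)).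
  by apply/funext => x; rewrite assoc.
have as_ : (fun x => 1 + sin (z * (s * x))) = (fun x => 1 + sin (z * s * x)).
  by apply/funext => x; rewrite assoc.
have {}hc : \int[P]_w (1 + cos (z * X w)) = \int[N1]_x (1 + cos (z * s * x)).
  by apply: etrans hc _; rewrite -ac.
have {}hs : \int[P]_w (1 + sin (z * X w)) = \int[N1]_x (1 + sin (z * s * x)).
  by apply: etrans hs _; rewrite -as_.
move: hc hs.
rewrite (RintD (rintegrable_cst P 1) ic) (RintD (rintegrable_cst P 1) is_).
rewrite (RintD (rintegrable_cst N1 1) (icos _)) (RintD (rintegrable_cst N1 1) (isin _)).
by rewrite !Rint_cst normal_sin0 /normal_cf; split; lra.
Qed.

End law.

Let r (u : R) := \int[N1]_x (x ^+ 2 * Num.min 1 `|u * x|).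

Let mr (u : R) : measurable_fun setT (fun x : R => x ^+ 2 * Num.min 1 `|u * x|).
Proof.
apply: measurable_funM => //; apply: measurable_minr => //.
by apply: measurableT_comp => //; exact: measurable_funM.
Qed.

Let r_le (u x : R) : `|x ^+ 2 * Num.min 1 `|u * x| | <= x ^+ 2.
Proof.
have m0 : 0 <= Num.min 1 `|u * x| by rewrite le_min ler01 normr_ge0.
by rewrite normrM (ger0_norm m0) (ger0_norm (sqr_ge0 x)) ler_piMr ?sqr_ge0// ge_min lexx.
Qed.

Let ir (u : R) : rintegrable N1 (fun x : R => x ^+ 2 * Num.min 1 `|u * x|).
Proof. by apply: (le_rintegrable _ _ x2_int); [exact: mr|exact: r_le]. Qed.

Let cf_quad (u : R) : `|normal_cf u - 1 + u ^+ 2 / 2| <= u ^+ 2 * r u.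
Proof.
have -> : normal_cf u - 1 + u ^+ 2 / 2 =
    \int[N1]_x cos (u * x) - \int[N1]_x (1 + (- (u ^+ 2 / 2)) * x ^+ 2).
  by rewrite (RintD (rintegrable_cst N1 1) (rintegrableZ _ x2_int)) Rint_cst (RintZ _ x2_int) x2E /normal_cf; ring.
rewrite -(RintZ _ (ir u)); apply: ler_norm_RintB.
- exact: icos.
- by apply: rintegrableD; [exact: rintegrable_cst|exact: rintegrableZ].
- by apply: rintegrableZ; exact: ir.
- move=> x; have := cos_quad_bound (u * x); rewrite exprMn mulrA.
  by rewrite (_ : cos (u * x) - (1 + - (u ^+ 2 / 2) * x ^+ 2) = cos (u * x) - 1 + u ^+ 2 * x ^+ 2 / 2)//; ring.
Qed.

Let r_cvg (u : nat -> R) : u n @[n --> \oo] --> (0 : R) -> r (u n) @[n --> \oo] --> (0 : R).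
Proof.
move=> u0.
have [_] : rintegrable N1 (fun=> 0 : R) /\ r (u n) @[n --> \oo] --> \int[N1]_x (fun=> 0 : R) x.
  apply: (@cvg_RintD _ _ _ N1 (fun n x => x ^+ 2 * Num.min 1 `|u n * x|) (fun=> 0) (fun x => x ^+ 2)) => //.
  { by move=> n; exact: mr. }
  move=> x; apply/norm_cvg0P.
  have h : x ^+ 2 * `|u n * x| @[n --> \oo] --> (0 : R).
    rewrite [X in _ --> X](_ : _ = x ^+ 2 * `|0 * x|); last by rewrite mul0r normr0 mulr0.
    apply: cvgM; first exact: cvg_cst.
    by apply: cvg_norm; apply: cvgM => //; exact: cvg_cst.
  apply: (squeeze_cvgr _ (cvg_cst 0) h); apply: nearW => n; rewrite normr_ge0/=.
  have m0 : 0 <= Num.min 1 `|u n * x| by rewrite le_min ler01 normr_ge0.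
  rewrite normrM (ger0_norm m0) (ger0_norm (sqr_ge0 x)).
  by rewrite ler_wpM2l ?sqr_ge0// ge_min lexx orbT.
by rewrite Rint0.
Qed.

Lemma expr_sub_le (x y : R) n : `|x| <= 1 -> `|y| <= 1 -> `|x ^+ n - y ^+ n| <= n%:R * `|x - y|.
Proof.
move=> x1 y1; elim: n => [|n IH]; first by rewrite !expr0 subrr normr0 mul0r.
rewrite !exprS (_ : x * x ^+ n - y * y ^+ n = x * (x ^+ n - y ^+ n) + (x - y) * y ^+ n); last by ring.
apply: le_trans (ler_normD _ _) _; rewrite -[n.+1%:R]natr1 [leRHS]mulrDl mul1r.
apply: lerD; rewrite normrM.
  by apply: le_trans IH; rewrite ler_piMl.
by rewrite ler_piMr// normrX exprn_ile1.
Qed.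

Lemma expR_quad (v : R) : 0 <= v -> `|expR (- v) - 1 + v| <= v ^+ 2.
Proof.
move=> v0; rewrite ger0_norm; last by have := expR_ge1Dx (- v); lra.
have h1 := expR_ge1Dx v.
have e0 := expR_gt0 v.
have : expR (- v) <= (1 + v)^-1 by rewrite expRN lef_pV2 ?posrE ?ltr_wpDr.
have : (1 + v)^-1 <= 1 - v + v ^+ 2.
  rewrite -[X in X <= _]mul1r ler_pdivrMr ?ltr_wpDr//.
  rewrite (_ : (1 - v + v ^+ 2) * (1 + v) = 1 + v ^+ 3); last by ring.
  by rewrite lerDl exprn_ge0.
lra.
Qed.

Section brownian.
Context d (T : measurableType d) (P : probability T R) (B : R -> T -> R).
Hypothesis HB : brownian_motion P B.

Let mB t : 0 <= t -> measurable_fun setT (B t).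
Proof. exact: (bm_measurable HB). Qed.

Let mI s t : 0 <= s -> s <= t -> measurable_fun setT (B t \- B s).
Proof.
move=> s0 st; apply: measurable_funB; apply: mB => //; exact: le_trans st.
Qed.

Let tn n (k : nat) : R := k%:R / n.+1%:R.

Let tn_mono n : {homo tn n : i j / (i < j)%N >-> i < j}.
Proof. by move=> i j ij; rewrite /tn ltr_pM2r ?invr_gt0// ltr_nat. Qed.

Let tn_ge0 n k : 0 <= tn n k.
Proof. by rewrite divr_ge0. Qed.

Let Incr n (k : 'I_n.+1) := B (tn n k.+1) \- B (tn n k).

Let indI n : mutually_independent P (@Incr n).
Proof. by apply: (bm_increments HB) => //; exact: tn_mono. Qed.

Let mIncr n k : measurable_fun setT (@Incr n k).
Proof. by apply: mI => //; apply: ltW; exact: tn_mono. Qed.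

Let tn_diff n k : tn n k.+1 - tn n k = n.+1%:R^-1.
Proof. by rewrite /tn -mulrBl -natr1 addrAC subrr add0r mul1r. Qed.

Let law_incr n (k : 'I_n.+1) z : \int[P]_w cos (z * Incr k w) = normal_cf (z * Num.sqrt n.+1%:R^-1) /\
  \int[P]_w sin (z * Incr k w) = 0.
Proof.
apply: (normal_law_cf (mIncr k)); first by rewrite sqrtr_gt0 invr_gt0.
move=> A mA; have := bm_normal HB (tn_ge0 n k) (tn_mono n (ltnSn k)) mA.
by rewrite tn_diff.
Qed.

(** The increment of [B] over [[0, 1]] is standard normal and is the sum of [n + 1] independent
    increments of variance [1 / (n + 1)]. Positivity allows writing the factor as an exponential, as
    [cf_indep_sum] requires. *)
Let cf_pow n z : 0 < normal_cf (z * Num.sqrt n.+1%:R^-1) ->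
  normal_cf z = normal_cf (z * Num.sqrt n.+1%:R^-1) ^+ n.+1.
Proof.
set f := normal_cf _ => f0.
have h1 (k : 'I_n.+1) : \int[P]_w cos (z * Incr k w) = expR (ln f) * cos 0.
  by rewrite (law_incr k z).1 lnK ?posrE// cos0 mulr1.
have h2 (k : 'I_n.+1) : \int[P]_w sin (z * Incr k w) = expR (ln f) * sin 0.
  by rewrite (law_incr k z).2 sin0 mulr0.
have [hc _] := cf_indep_sum (@mIncr n) (@indI n) (th := fun=> z) (a := fun=> ln f) (b := fun=> 0) h1 h2.
move: hc; rewrite !sumr_const card_ord mul0rn cos0 mulr1 -mulr_natl expRM_natl.
rewrite lnK ?posrE// => <-.
have E w : \sum_(k < n.+1) z * Incr k w = z * (B (tn n n.+1) w - B (tn n 0) w).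
  rewrite -mulr_sumr; congr (_ * _).
  by rewrite -(big_mkord xpredT (fun k => B (tn n k.+1) w - B (tn n k) w)) telescope_sumr.
under eq_Rint do rewrite E.
rewrite (normal_law_cf (X := B (tn n n.+1) \- B (tn n 0)) (s := 1) _ ltr01 _ z).1 ?mulr1//.
- by apply: mI => //; apply: ltW; exact: tn_mono.
- have e1 : Num.sqrt (tn n n.+1 - tn n 0) = 1 by rewrite /tn mul0r subr0 divff ?sqrtr1// pnatr_eq0.
  by move=> A mA; have := bm_normal HB (tn_ge0 n 0) (tn_mono n (ltn0Sn n)) mA; rewrite e1.
Qed.

(** Infinite divisibility replaces any contour or differential argument: at [u = z / sqrt (n + 1)]
    both sides differ by [o (u ^+ 2)], and raising to the power [n + 1] multiplies that by at most
    [n + 1], leaving a quantity that tends to 0. *)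
Lemma normal_cfE z : normal_cf z = expR (- (z ^+ 2 / 2)).
Proof.
pose u n := z * Num.sqrt n.+1%:R^-1.
have u2 n : u n ^+ 2 = z ^+ 2 / n.+1%:R by rewrite exprMn sqr_sqrtr ?invr_ge0.
have u0 : u n @[n --> \oo] --> (0 : R).
  rewrite -[X in _ --> X](mulr0 z); apply: cvgM; first exact: cvg_cst.
  rewrite -(sqrtr0 R); apply: (@cvg_comp _ _ _ (fun n => n.+1%:R^-1) (@Num.sqrt R)).
    exact: cvg_harmonic.
  exact: sqrt_continuous.
have ru := r_cvg u0.
have uu : u n ^+ 2 @[n --> \oo] --> (0 ^+ 2 : R).
  exact: (cvgM u0 u0).
have err : z ^+ 2 * (r (u n) + u n ^+ 2) @[n --> \oo] --> (0 : R).
  rewrite [X in _ --> X](_ : _ = z ^+ 2 * (0 + 0 ^+ 2)); last by rewrite expr0n addr0 mulr0.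
  by apply: cvgM; [exact: cvg_cst|exact: cvgD].
have bnd n : `|normal_cf (u n) - expR (- (u n ^+ 2 / 2))| <= u n ^+ 2 * (r (u n) + u n ^+ 2).
  have h1 := cf_quad (u n).
  have v0 : 0 <= u n ^+ 2 / 2 by rewrite divr_ge0// sqr_ge0.
  have h2 := expR_quad v0.
  have h3 : (u n ^+ 2 / 2) ^+ 2 <= u n ^+ 2 * u n ^+ 2.
    by have := sqr_ge0 (u n ^+ 2); rewrite expr_div_n -expr2; lra.
  by move: h1 h2; rewrite mulrDr !ler_norml; lra.
have cvf : u n ^+ 2 * (r (u n) + u n ^+ 2) @[n --> \oo] --> (0 : R).
  rewrite [X in _ --> X](_ : _ = 0 ^+ 2 * (0 + 0 ^+ 2)); last by rewrite expr0n mul0r.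
  by apply: cvgM => //; exact: cvgD.
have cvu : normal_cf (u n) @[n --> \oo] --> (1 : R).
  have -> : (fun n => normal_cf (u n)) =
     (fun n => expR (- (u n ^+ 2 / 2)) + (normal_cf (u n) - expR (- (u n ^+ 2 / 2)))).
    by apply/funext => n; rewrite addrC subrK.
  rewrite [X in _ --> X](_ : _ = 1 + 0); last by rewrite addr0.
  apply: cvgD.
    rewrite [X in _ --> X](_ : _ = expR (- (0 ^+ 2 / 2))); last by rewrite expr0n mul0r oppr0 expR0.
    have h : - (u n ^+ 2 / 2) @[n --> \oo] --> - (0 ^+ 2 / 2 : R).
      by apply: cvgN; apply: cvgM => //; exact: cvg_cst.
    exact: (cvg_comp _ _ h (@continuous_expR R _)).
  apply/norm_cvg0P; apply: (squeeze_cvgr _ (cvg_cst 0) cvf).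
  by apply: nearW => n; rewrite normr_ge0/=; exact: bnd.
have pos : \forall n \near \oo, 0 < normal_cf (u n).
  have half : (0 : R) < 1 / 2 by lra.
  move/cvgrPdist_le : cvu => /(_ _ half); apply: filterS => n.
  by rewrite ler_norml => /andP[_]; lra.
apply/eqP; rewrite -subr_eq0 -normr_eq0; apply/eqP.
apply/eqP; rewrite eq_le normr_ge0 andbT; apply/ler_addgt0Pr => e e0; rewrite add0r.
move/cvgrPdist_le : err => /(_ _ e0) err.
have [n [p1 p2]] : exists n, 0 < normal_cf (u n) /\ `|0 - z ^+ 2 * (r (u n) + u n ^+ 2)| <= e.
  have [n _ hn] : \forall n \near \oo, 0 < normal_cf (u n) /\ `|0 - z ^+ 2 * (r (u n) + u n ^+ 2)| <= e.
    by near=> n; split; near: n.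
  by exists n; apply: hn => /=.
rewrite (cf_pow p1).
have -> : expR (- (z ^+ 2 / 2)) = expR (- (u n ^+ 2 / 2)) ^+ n.+1.
  rewrite -expRM_natl u2; congr expR.
  by have : (n.+1%:R : R) != 0 by [rewrite pnatr_eq0]; move: (n.+1%:R : R) => x x0; field.
apply: le_trans (expr_sub_le _ _ _) _.
{ rewrite /normal_cf; apply: le_trans (ler_norm_Rint (icos _)) _.
  rewrite -[leRHS](Rint_cst N1); apply: ler_Rint.
  - exact: rintegrable_norm (icos _).
  - exact: rintegrable_cst.
  - by move=> x; exact: norm_cos_le1. }
{ by rewrite ger0_norm ?expR_ge0// -[leRHS]expR0 ler_expR oppr_le0 divr_ge0// sqr_ge0. }
apply: (@le_trans _ _ (n.+1%:R * (u n ^+ 2 * (r (u n) + u n ^+ 2)))).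
  by rewrite ler_wpM2l ?ler0n//; exact: bnd.
move: p2; rewrite sub0r normrN => /(le_trans (ler_norm _)); apply: le_trans.
by rewrite u2 mulrA [_ * (z ^+ 2 / _)]mulrC divfK ?pnatr_eq0.
Unshelve. all: by end_near.
Qed.

Lemma bm_increment_moments s t : 0 <= s -> s <= t ->
  sqintegrable P (fun w => B t w - B s w) /\ \int[P]_w (B t w - B s w) ^+ 2 = t - s.
Proof.
move=> s0; rewrite le_eqVlt => /predU1P[->|st].
  split; last by rewrite subrr; under eq_Rint do rewrite subrr expr0n; exact: Rint_cst.
  have -> : (fun w => B t w - B t w) = fun=> 0 by apply/funext => w; rewrite subrr.
  exact: sqintegrable_cst.
have sd : 0 < Num.sqrt (t - s) by rewrite sqrtr_gt0 subr_gt0.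
have [h1 h2] := normal_law_moments (mI s0 (ltW st)) sd (fun A mA => bm_normal HB s0 st mA).
by split => //; rewrite [LHS]h2 sqr_sqrtr// subr_ge0 ltW.
Qed.

Lemma bm_moments t : 0 <= t -> sqintegrable P (B t) /\ \int[P]_w B t w ^+ 2 = t.
Proof.
move=> t0; have [h1 h2] := bm_increment_moments (lexx 0) t0.
have E : {ae P, forall w, B t w - B 0 w = B t w}.
  by move: (bm_start HB); apply: filterS => w ->; rewrite subr0.
split; first exact: (ae_sqintegrable (mB t0) E h1).
rewrite -[RHS]subr0 -h2; apply/esym/ae_eq_Rint.
- by apply: measurable_funX; exact: mI.
- by apply: measurable_funX; exact: mB.
- by move: E; apply: filterS => w ->.
Qed.

(** Independence is given for increments along increasing times, while the [t i] are unordered and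
    may coincide. Rounding them down to a grid of mesh [1 / (n + 1)] expresses everything in the
    same increments, at a mean cost of at most a constant times the square root of the mesh. *)
Lemma bm_cf k (t th : 'I_k -> R) : (forall i, 0 <= t i <= 1) ->
  \int[P]_w cos (\sum_i th i * B (t i) w) =
    expR (- ((\sum_i \sum_j th i * th j * Num.min (t i) (t j)) / 2)) /\
  \int[P]_w sin (\sum_i th i * B (t i) w) = 0.
Proof.
move=> t01.
pose p n i := Num.truncn (n.+1%:R * t i).
have t0 i : 0 <= t i by have /andP[] := t01 i.
have t1 i : t i <= 1 by have /andP[] := t01 i.
have pn n i : (p n i <= n.+1)%N.
  by rewrite -[leqRHS](@natrK R n.+1); apply: le_truncn; rewrite ler_piMr.
have pt n i : tn n (p n i) <= t i /\ t i - tn n (p n i) <= n.+1%:R^-1.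
  have /andP[h1 h2] := truncn_itv (mulr_ge0 (ler0n R n.+1) (t0 i)).
  rewrite /tn; split; first by rewrite ler_pdivrMr// mulrC.
  rewrite lerBlDr -[X in _ <= X + _]mul1r -mulrDl ler_pdivlMr// mulrC addrC natr1.
  exact: ltW.
pose chi n i (l : nat) : R := if (l < p n i)%N then 1 else 0.
pose be n (l : 'I_n.+1) := \sum_i th i * chi n i l.
pose W w := \sum_i th i * B (t i) w.
pose Wn n w := \sum_i th i * B (tn n (p n i)) w.
pose V := \sum_i \sum_j th i * th j * Num.min (t i) (t j).
pose Vn n := \sum_i \sum_j th i * th j * (minn (p n i) (p n j))%:R / n.+1%:R.
have mW : measurable_fun setT W.
  by apply: measurable_bigsum => i _; apply: measurable_funM => //; exact: mB.
have mWn n : measurable_fun setT (Wn n).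
  by apply: measurable_bigsum => i _; apply: measurable_funM => //; exact: mB.
have WnE n : {ae P, forall w, Wn n w = \sum_l be n l * Incr l w}.
  move: (bm_start HB); apply: filterS => w B0.
  under [RHS]eq_bigr do rewrite mulr_suml.
  rewrite exchange_big; apply: eq_bigr => i _ /=.
  transitivity (th i * \sum_(l < p n i) (B (tn n l.+1) w - B (tn n l) w)).
    congr (_ * _); rewrite -(big_mkord xpredT (fun l => B (tn n l.+1) w - B (tn n l) w)) telescope_sumr//.
    have -> : tn n 0 = 0 by rewrite /tn mul0r.
    by rewrite B0 subr0.
  rewrite (big_ord_wid (fun l => B (tn n l.+1) w - B (tn n l) w) (pn n i)) mulr_sumr.
  by apply: eq_bigr => l _; rewrite -mulrA.
have sumbe n : \sum_l be n l ^+ 2 / n.+1%:R = Vn n.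
  rewrite /Vn; under eq_bigr => l _.
    rewrite expr2 /be mulr_suml mulr_suml.
    under eq_bigr do rewrite mulr_sumr mulr_suml.
  over.
  rewrite exchange_big; apply: eq_bigr => i _ /=.
  rewrite exchange_big; apply: eq_bigr => j _ /=.
  transitivity (\sum_(l < n.+1) th i * th j / n.+1%:R * (chi n i l * chi n j l)).
    by apply: eq_bigr => l _; ring.
  rewrite -mulr_sumr mulrAC; congr (_ * _).
  have -> : (minn (p n i) (p n j))%:R = \sum_(l < minn (p n i) (p n j)) (1 : R).
    by rewrite sumr_const card_ord.
  have hm : (minn (p n i) (p n j) <= n.+1)%N by rewrite geq_min pn.
  rewrite (big_ord_wid (fun=> 1) hm); congr (_ * _); apply: eq_bigr => l _.
  by rewrite /chi ltn_min; case: (l < p n i)%N; case: (l < p n j)%N; rewrite ?mulr1 ?mulr0.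
have cfn n : \int[P]_w cos (Wn n w) = expR (- (Vn n / 2)) /\ \int[P]_w sin (Wn n w) = 0.
  have hc (l : 'I_n.+1) : \int[P]_w cos (be n l * Incr l w) = expR (- (be n l ^+ 2 / n.+1%:R / 2)) * cos 0.
    rewrite (law_incr l (be n l)).1 normal_cfE cos0 mulr1 exprMn sqr_sqrtr ?invr_ge0//.
  have hs (l : 'I_n.+1) : \int[P]_w sin (be n l * Incr l w) = expR (- (be n l ^+ 2 / n.+1%:R / 2)) * sin 0.
    by rewrite (law_incr l (be n l)).2 sin0 mulr0.
  have [h1 h2] := cf_indep_sum (@mIncr n) (@indI n) hc hs.
  have mS : measurable_fun setT (fun w => \sum_l be n l * Incr l w).
    by apply: measurable_bigsum => l _; exact: measurable_funM.
  rewrite sumrN -mulr_suml sumbe big1// cos0 sin0 mulr1 mulr0 in h1 h2.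
  { rewrite -h1 -[in X in _ /\ _ = X]h2; split; apply: ae_eq_Rint.
  - by apply: measurableT_comp => //; exact: measurable_cos.
  - by apply: measurableT_comp => //; exact: measurable_cos.
  - by move: (WnE n); apply: filterS => w ->.
  - by apply: measurableT_comp => //; exact: measurable_sin.
  - by apply: measurableT_comp => //; exact: measurable_sin.
  - by move: (WnE n); apply: filterS => w ->. }
pose C := \sum_i `|th i|.
have close (f : R -> R) n : measurable_fun setT f -> (forall x, `|f x| <= 1) ->
   (forall x y, `|f x - f y| <= `|x - y|) ->
   `|\int[P]_w f (W w) - \int[P]_w f (Wn n w)| <= C * Num.sqrt n.+1%:R^-1.
  move=> mf f1 flip.
  have sI i := (bm_increment_moments (tn_ge0 n (p n i)) (pt n i).1).
  have iI i := rintegrable_norm (sqintegrable_int (sI i).1).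
  have iZ i := rintegrableZ `|th i| (iI i).
  apply: (@le_trans _ _ (\int[P]_w \sum_i `|th i| * `|B (t i) w - B (tn n (p n i)) w|)).
  { apply: ler_norm_RintB.
    - by apply: (@bounded_rintegrable _ _ _ P _ 1) => //; exact: measurableT_comp.
    - by apply: (@bounded_rintegrable _ _ _ P _ 1) => //; exact: measurableT_comp.
    - by apply: rintegrable_sum => i _; exact: iZ.
    - move=> w; apply: le_trans (flip _ _) _; rewrite /W /Wn -sumrB.
      apply: le_trans (ler_norm_sum _ _ _) _; apply: ler_sum => i _.
      by rewrite -mulrBr normrM. }
  rewrite Rint_sum; last by move=> i _; exact: iZ.
  rewrite mulr_suml; apply: ler_sum => i _; rewrite (RintZ _ (iI i)) ler_wpM2l//.
  apply: le_trans (Rint_norm_sqrt (sI i).1) _; rewrite (sI i).2 ler_wsqrtr//.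
  exact: (pt n i).2.
have sq0 : C * Num.sqrt n.+1%:R^-1 @[n --> \oo] --> (0 : R).
  rewrite -[X in _ --> X](mulr0 C); apply: cvgM; first exact: cvg_cst.
  rewrite -(sqrtr0 R); apply: (@cvg_comp _ _ _ (fun n => n.+1%:R^-1) (@Num.sqrt R)).
    exact: cvg_harmonic.
  exact: sqrt_continuous.
have lim_eq (f : R -> R) (l : nat -> R) (l0 : R) : measurable_fun setT f -> (forall x, `|f x| <= 1) ->
   (forall x y, `|f x - f y| <= `|x - y|) -> (forall n, \int[P]_w f (Wn n w) = l n) ->
   l n @[n --> \oo] --> l0 -> \int[P]_w f (W w) = l0.
  move=> mf f1 flip fl ll0.
  have h : \int[P]_w f (Wn n w) @[n --> \oo] --> \int[P]_w f (W w).
    apply/cvgrPdist_le => e e0; move/cvgrPdist_le : sq0 => /(_ _ e0); apply: filterS => n.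
    rewrite sub0r normrN => /(le_trans (ler_norm _)); apply: le_trans; exact: close.
  have h2 : \int[P]_w f (Wn n w) @[n --> \oo] --> l0.
    by rewrite (_ : (fun n => _) = l)//; apply/funext => n; rewrite fl.
  exact: (cvg_unique (@norm_hausdorff _ _) h h2).
split.
- apply: (lim_eq (@cos R) (fun n => expR (- (Vn n / 2))) _ (@measurable_cos R setT) (@norm_cos_le1 R) (@cos_lip R)).
    by move=> n; have [] := cfn n.
  have h : - (Vn n / 2) @[n --> \oo] --> - (V / 2); last exact: (cvg_comp _ _ h (@continuous_expR R _)).
  apply: cvgN; apply: cvgM; last exact: cvg_cst.
  apply: cvg_sumr => i; apply: cvg_sumr => j.
  rewrite (_ : (fun n => _) = (fun n => th i * th j * Num.min (tn n (p n i)) (tn n (p n j)))).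
    apply: cvgM; first exact: cvg_cst.
    have ct l : tn n (p n l) @[n --> \oo] --> t l.
      apply/cvgrPdist_le => e e0.
      have /cvgrPdist_le /(_ _ e0) := @cvg_harmonic R; apply: filterS => n.
      rewrite /harmonic /= sub0r normrN => /(le_trans (ler_norm _)); apply: le_trans.
      by rewrite ger0_norm ?subr_ge0; [exact: (pt n l).2|exact: (pt n l).1].
    rewrite minr_absE; under eq_fun do rewrite minr_absE.
    apply: cvgM; last exact: cvg_cst.
    by apply: cvgB; [exact: cvgD|apply: cvg_norm; exact: cvgB].
  apply/funext => n; rewrite -mulrA; congr (_ * _).
  rewrite /tn; case: (leqP (p n i) (p n j)) => h.
    by rewrite min_l// ler_pM2r ?invr_gt0// ler_nat.
  by rewrite min_r// ler_pM2r ?invr_gt0// ler_nat ltnW.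
- apply: (lim_eq (@sin R) (fun=> 0) _ (@measurable_sin R setT) (@norm_sin_le1 R) (@sin_lip R)).
    by move=> n; have [] := cfn n.
  exact: cvg_cst.
Qed.

End brownian.
End normal_cf.

(** * Stable convergence of the finite-dimensional distributions *)

Section stable_fidis.
Context d (Om : measurableType d) (R : realType) (P : probability Om R).
Context (L : set (R * R) -> Om -> R) (gamma b : R) (nu : {measure set R -> \bar R}).
Hypothesis HL : levy_basis P L gamma b nu.
Context (m s2 : R) (eps : R -> R).
Hypothesis ce : cumulant_expansion (log_cf_re b nu) (log_cf_im gamma nu) m s2 eps.
Context (a : R -> R).
Hypothesis Ha : trawl_function a.
Hypothesis tG : tail_fun (tail_int a).
Context (Delta : nat -> R).
Hypothesis D0 : forall n, 0 < Delta n.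
Hypothesis Dcvg : Delta n @[n --> \oo] --> (0 : R).
Hypothesis nD : n%:R * Delta n @[n --> \oo] --> +oo.

Local Notation X := (trawl_process L a).

Definition scaled_sum n t w := Num.sqrt (Delta n / n%:R) * partial_sum P X Delta n t w.

(** The integral of the autocovariance over the line, by [integral_acov]. *)
Definition asymptotic_var := s2 * (2 * tail_int (tail_int a) 0).

Lemma asymptotic_var_ge0 : 0 <= asymptotic_var.
Proof. by rewrite mulr_ge0 ?(ce_s2_ge0 ce)// mulr_ge0// (tail_int_ge0 tG). Qed.

Let trawl_set_finite u : finite_borel (trawl_set_at a u).
Proof. by rewrite trawl_set_atE; exact: trawl_box_finite. Qed.

Let linear_comb1 n t w :
  linear_comb P L a Delta (fun _ : 'I_1 => t) (fun=> 1) n w = scaled_sum n t w.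
Proof. by rewrite /linear_comb big_ord1 mul1r. Qed.

Lemma scaled_sum_sqintegrable n t : 0 <= t <= 1 -> sqintegrable P (scaled_sum n t).
Proof.
move=> t01.
have [h _ _] := centered_sum_moments HL ce (fun k : 'I_n => trawl_set_finite (k%:R * Delta n))
  (fun k => Num.sqrt (Delta n / n%:R) * \sum_(i < 1) 1 * (if (k < Num.truncn (n%:R * t))%N then 1 else 0)).
rewrite (_ : scaled_sum n t = centered_sum L m (fun k : 'I_n => trawl_set_at a (k%:R * Delta n))
  (fun k => Num.sqrt (Delta n / n%:R) * \sum_(i < 1) 1 * (if (k < Num.truncn (n%:R * t))%N then 1 else 0)))//.
by apply/funext => w; rewrite -linear_comb1 (linear_combE HL ce Ha Delta (fun=> 1) (fun=> t01)).
Qed.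

Lemma scaled_sum_second_moment t : 0 <= t <= 1 ->
  \int[P]_w scaled_sum n t w ^+ 2 @[n --> \oo] --> t * asymptotic_var.
Proof.
move=> t01.
have -> : t * asymptotic_var = s2 * limit_var a (fun _ : 'I_1 => t) (fun=> 1).
  by rewrite /limit_var !big_ord1 minxx /asymptotic_var; ring.
have := quad_cvg Ha tG D0 Dcvg nD (th := fun=> 1) (fun _ : 'I_1 => t01).
move=> /(cvgM (cvg_cst s2)); apply: cvg_trans; apply: near_eq_cvg; apply: nearW => n.
have [_ _ h] := centered_sum_moments HL ce (fun k : 'I_n => trawl_set_finite (k%:R * Delta n))
  (fun k => Num.sqrt (Delta n / n%:R) * \sum_(i < 1) 1 * (if (k < Num.truncn (n%:R * t))%N then 1 else 0)).
apply: etrans (esym h) _.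
by apply: eq_Rint => w; rewrite -linear_comb1 (linear_combE HL ce Ha Delta (fun=> 1) (fun=> t01)).
Qed.

Context d' (Om' : measurableType d') (P' : probability Om' R) (pi : Om' -> Om) (B : R -> Om' -> R).
Hypothesis Hpi : prob_extension P P' pi.
Hypothesis HB : brownian_motion P' B.

Local Notation sig := (Num.sqrt asymptotic_var).

Let mB t : 0 <= t -> measurable_fun setT (B t).
Proof. exact: (bm_measurable HB). Qed.

Section fidi.
Hypothesis Hind : independent_of_field P' pi (sigma_field_X X Delta) B.
Context (k : nat) (t : 'I_k -> R).
Hypothesis t01 : forall i, 0 <= t i <= 1.

Let xi n w : 'rV[R]_k := \row_i scaled_sum n (t i) w.
Let xi' w : 'rV[R]_k := \row_i (sig * B (t i) w).

Let t0 i : 0 <= t i. Proof. by have /andP[] := t01 i. Qed.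

Let dot_xi th n w : dotv th (xi n w) = linear_comb P L a Delta t (fun i => th 0 i) n w.
Proof. by apply: eq_bigr => i _; rewrite mxE. Qed.

Let dot_xi' th w : dotv th (xi' w) = \sum_i (th 0 i * sig) * B (t i) w.
Proof. by apply: eq_bigr => i _; rewrite mxE mulrA. Qed.

Let adapted_xi' th : adapted (gen_of [set t | 0 <= t] B) (fun w => dotv th (xi' w)).
Proof.
rewrite (funext (dot_xi' th)); apply: adapted_sum => i _; apply: adaptedM; first exact: adapted_cst.
by apply: adapted_gen; rewrite /=; exact: t0.
Qed.

Let m_xi' th : measurable_fun setT (fun w => dotv th (xi' w)).
Proof.
rewrite (funext (dot_xi' th)); by apply: measurable_bigsum => i _; apply: measurable_funM => //; exact: mB.
Qed.

Let sxi n i : sqintegrable P (fun w => xi n w 0 i).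
Proof. by under eq_fun do rewrite mxE; exact: scaled_sum_sqintegrable. Qed.

Let Vxi : \forall n \near \oo, forall i, \int[P]_w xi n w 0 i ^+ 2 <= asymptotic_var + 1.
Proof.
apply: filter_forall => i.
have /cvgrPdist_le /(_ _ ltr01) := scaled_sum_second_moment (t01 i).
apply: filterS => n.
have -> : \int[P]_w xi n w 0 i ^+ 2 = \int[P]_w scaled_sum n (t i) w ^+ 2.
  by apply: eq_Rint => w; rewrite mxE.
have : t i * asymptotic_var <= asymptotic_var.
  by rewrite ler_piMl ?asymptotic_var_ge0//; have /andP[] := t01 i.
rewrite ler_norml; lra.
Qed.

Let sxi' i : sqintegrable P' (fun w => xi' w 0 i).
Proof.
by under eq_fun do rewrite mxE; apply: sqintegrableZ; exact: (bm_moments HB (t0 i)).1.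
Qed.

Let Vxi' i : \int[P']_w xi' w 0 i ^+ 2 <= asymptotic_var + 1.
Proof.
under eq_Rint do rewrite mxE exprMn.
have [h1 h2] := bm_moments HB (t0 i).
rewrite (RintZ _ h1.2) h2 sqr_sqrtr ?asymptotic_var_ge0//.
have : asymptotic_var * t i <= asymptotic_var.
  by rewrite ler_piMr ?asymptotic_var_ge0//; have /andP[] := t01 i.
lra.
Qed.

Context (E : set Om).
Hypothesis GE : sigma_field_X X Delta E.

Let mE : measurable E.
Proof. exact: (sigma_field_X_measurable HL Ha GE). Qed.

Let mE' : measurable (pi @^-1` E).
Proof. by rewrite -[X in measurable X]setTI; exact: Hpi.1. Qed.

Let ind_xi' th : indep_rv P' (\1_(pi @^-1` E)) (fun w => dotv th (xi' w)).
Proof.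
apply: indep_rv_indic => // A mA.
by rewrite setIC (Hind (adapted_xi' th mA) GE) muleC.
Qed.

Let var_xi' (th : 'rV[R]_k) : \sum_i \sum_j th 0 i * sig * (th 0 j * sig) * Num.min (t i) (t j) =
  s2 * limit_var a t (fun i => th (0 : 'I_1) i).
Proof.
rewrite /limit_var mulr_sumr; apply: eq_bigr => i _; rewrite mulr_sumr; apply: eq_bigr => j _.
rewrite (_ : th 0 i * sig * (th 0 j * sig) = th 0 i * th 0 j * sig ^+ 2); last by ring.
by rewrite sqr_sqrtr ?asymptotic_var_ge0// /asymptotic_var; ring.
Qed.

Let hcos th : \int[P]_w (\1_E w * cos (dotv th (xi n w))) @[n --> \oo] -->
  \int[P']_w (\1_(pi @^-1` E) w * cos (dotv th (xi' w))).
Proof.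
rewrite (indic_indep_mul mE' (m_xi' th) (@measurable_cos R setT) (@norm_cos_le1 R) (ind_xi' th)).
rewrite Hpi.2//; under [X in _ * X]eq_Rint do rewrite dot_xi'.
rewrite (bm_cf HB _ t01).1 var_xi'.
have := (linear_comb_stable HL ce Ha tG D0 Dcvg nD (fun i => th 0 i) t01 GE).1.
apply: cvg_trans; apply: near_eq_cvg; apply: nearW => n.
by apply: eq_Rint => w; rewrite dot_xi.
Qed.

Let hsin th : \int[P]_w (\1_E w * sin (dotv th (xi n w))) @[n --> \oo] -->
  \int[P']_w (\1_(pi @^-1` E) w * sin (dotv th (xi' w))).
Proof.
rewrite (indic_indep_mul mE' (m_xi' th) (@measurable_sin R setT) (@norm_sin_le1 R) (ind_xi' th)).
rewrite Hpi.2//; under [X in _ * X]eq_Rint do rewrite dot_xi'.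
rewrite (bm_cf HB _ t01).2.
have := (linear_comb_stable HL ce Ha tG D0 Dcvg nD (fun i => th 0 i) t01 GE).2.
apply: cvg_trans; apply: near_eq_cvg; apply: nearW => n.
by apply: eq_Rint => w; rewrite dot_xi.
Qed.

Lemma scaled_sum_stable_continuous (g : 'rV[R]_k -> R) M : continuous g ->
  (forall v, `|g v| <= M) ->
  \int[P]_w (\1_E w * g (\row_i scaled_sum n (t i) w)) @[n --> \oo] -->
  \int[P']_w (\1_(pi @^-1` E) w * g (\row_i (sig * B (t i) w))).
Proof. exact: (weak_continuous mE mE' sxi Vxi sxi' Vxi' hcos hsin). Qed.

Lemma scaled_sum_stable_lip (g : 'rV[R]_k -> R) Lam M : 0 <= Lam -> lip_sum Lam g ->
  (forall v, `|g v| <= M) ->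
  \int[P]_w (\1_E w * g (\row_i scaled_sum n (t i) w)) @[n --> \oo] -->
  \int[P']_w (\1_(pi @^-1` E) w * g (\row_i (sig * B (t i) w))).
Proof. exact: (weak_lip mE mE' sxi Vxi sxi' Vxi' hcos hsin). Qed.

End fidi.

Hypothesis Hind : independent_of_field P' pi (sigma_field_X X Delta) B.

Lemma scaled_sum_cvg_lip k (t : 'I_k -> R) (g : 'rV[R]_k -> R) Lam M :
  (forall i, 0 <= t i <= 1) -> 0 <= Lam -> lip_sum Lam g -> (forall v, `|g v| <= M) ->
  \int[P]_w g (\row_i scaled_sum n (t i) w) @[n --> \oo] -->
  \int[P']_w g (\row_i (sig * B (t i) w)).
Proof.
move=> t01 L0 gL gM.
have GT : sigma_field_X X Delta setT.
  have [h0 h _] := smallest_sigma_algebra [set: Om] (\bigcup_(k in [set k | (1 <= k)%N])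
    \bigcap_(N in [set N | (k <= N)%N]) sigma_of [set j | (j <= k)%N] (fun j : nat => X (j%:R * Delta N))).
  by have := h _ h0; rewrite setD0.
have := scaled_sum_stable_lip Hind t01 GT L0 gL gM; rewrite preimage_setT.
under eq_fun do under eq_Rint do rewrite indicT mul1r.
by under [X in _ --> X -> _]eq_Rint do rewrite indicT mul1r.
Qed.

Lemma scaled_sum_cvg_stably k (t : 'I_k -> R) : (forall i, 0 <= t i <= 1) ->
  cvg_stably P P' pi (sigma_field_X X Delta) (V := 'rV[R]_k)
    (fun n w => \row_i scaled_sum n (t i) w) (fun w => \row_i (sig * B (t i) w)).
Proof.
move=> t01 E GE PE g cg [M gM].
have mE := sigma_field_X_measurable HL Ha GE.
have mE' : measurable (pi @^-1` E) by rewrite -[X in measurable X]setTI; exact: Hpi.1.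
have RE d0 (T : measurableType d0) (Q : probability T R) (A : set T) (f : T -> R) :
    \int[Q]_(w in A) f w = \int[Q]_w (\1_A w * f w).
  rewrite Rintegral_mkcond; apply: eq_Rint => w; rewrite patchE indicE.
  by case: ifPn => _; rewrite ?mul1r ?mul0r.
rewrite /cond_expect Hpi.2// RE; under eq_fun do rewrite RE.
apply: cvgM; last exact: cvg_cst.
exact: (scaled_sum_stable_continuous Hind t01 GE cg gM).
Qed.

End stable_fidis.

(** * Tightness *)

Section running_max.
Context (R : realType).
Implicit Types y : nat -> R.

Fixpoint running_max y i := if i is i'.+1 then Num.max (running_max y i') (y i) else y 0%N.

Lemma running_max_ge y i k : (k <= i)%N -> y k <= running_max y i.
Proof.
elim: i => [|i IH]; first by rewrite leqn0 => /eqP ->.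
by rewrite leq_eqVlt => /predU1P[->|/IH h] /=; rewrite le_max ?lexx ?orbT// h.
Qed.

(** Discrete form of the rule that the integral of the running maximum [M] against [y] is at most
    [M * y - M ^+ 2 / 2]: the maximum moves only when it equals [y]. *)
Lemma doob_transform_le y n : 0 <= y 0%N ->
  \sum_(i < n) running_max y i * (y i.+1 - y i) <=
  running_max y n * y n - running_max y n ^+ 2 / 2.
Proof.
move=> y0; elim: n => [|n IH].
  by rewrite big_ord0 /= -expr2; have := sqr_ge0 (y 0%N); lra.
rewrite big_ord_recr /=; move: IH; set s := \sum_(i < n) _; set M := running_max y n => IH.
have [h|h] := leP M (y n.+1); last by nra.
have := sqr_ge0 (M - y n.+1); rewrite sqrrB -!expr2; nra.
Qed.

(** Pathwise form of Doob's inequality in mean square: combine the previous bound with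
    [(M - 2 * y) ^+ 2 >= 0]. The sum is a transform of the increments, whose expectation has a sign
    for a submartingale. *)
Lemma doob_path y n : 0 <= y 0%N ->
  running_max y n ^+ 2 <= 4 * y n ^+ 2 - 4 * \sum_(i < n) running_max y i * (y i.+1 - y i).
Proof.
move=> y0; have := doob_transform_le n y0; move: (\sum_(i < n) _) (running_max y n) (y n) => s M z.
have := sqr_ge0 (M - 2 * z); rewrite sqrrB; nra.
Qed.

End running_max.

Section doob.
Context d (T : measurableType d) (R : realType) (P : probability T R).
Context (n : nat) (Y : nat -> T -> R).
Hypothesis sY : forall i, sqintegrable P (Y i).
Hypothesis Y0 : forall i, \int[P]_w Y i w = 0.
Hypothesis indY : mutually_independent P (fun i : 'I_n => Y i).

Let mY i : measurable_fun setT (Y i). Proof. by have [] := sY i. Qed.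

Definition block_sum p i w := \sum_(l < i) Y (p + l)%N w.

Section positive_part.
Context (p : nat) (sg q : R).

Let S := block_sum p.

Definition excess i w := Num.max (sg * S i w - q) 0.

Definition max_excess i w := running_max (fun j => excess j w) i.

Let past i : set 'I_n := [set l | (l < p + i)%N].

Let adapted_S j i : (j <= i)%N -> (p + i <= n)%N -> adapted (gen_of (past i) (fun l : 'I_n => Y l)) (S j).
Proof.
move=> ji pin; apply: adapted_sum => l _.
have ln : (p + l < n)%N by apply: leq_trans pin; rewrite ltn_add2l; exact: leq_trans ji.
have pl : past i (Ordinal ln) by rewrite /past /= ltn_add2l; exact: leq_trans ji.
exact: (adapted_gen (Z := fun l : 'I_n => Y l) pl).
Qed.

Let adapted_excess j i : (j <= i)%N -> (p + i <= n)%N ->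
  adapted (gen_of (past i) (fun l : 'I_n => Y l)) (excess j).
Proof.
move=> ji pin; apply: adapted_max; last exact: adapted_cst.
apply: adaptedD; last exact: adapted_cst.
by apply: adaptedM; [exact: adapted_cst|exact: adapted_S].
Qed.

Let adapted_max_excess j i : (j <= i)%N -> (p + i <= n)%N ->
  adapted (gen_of (past i) (fun l : 'I_n => Y l)) (max_excess j).
Proof.
elim: j => [|j IH] ji pin; first exact: adapted_excess.
by apply: adapted_max; [apply: IH => //; exact: ltnW|exact: adapted_excess].
Qed.

Lemma sqintegrable_block_sum i : sqintegrable P (S i).
Proof. by apply: sqintegrable_sum => l _. Qed.

Lemma sqintegrable_excess i : sqintegrable P (excess i).
Proof.
have sq := sqintegrableB (sqintegrableZ sg (sqintegrable_block_sum i)) (sqintegrable_cst P q).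
apply: (le_sqintegrable _ _ sq).
  by apply: measurable_maxr; [case: sq|exact: measurable_cst].
move=> w; rewrite /excess; move: (sg * S i w - q) => x.
by have [h|h] := leP x 0; rewrite ?normr0.
Qed.

Let excess_ge0 i w : 0 <= excess i w.
Proof. by rewrite /excess le_max lexx orbT. Qed.

Lemma max_excess_ge0 i w : 0 <= max_excess i w.
Proof. exact: le_trans (excess_ge0 0 w) (running_max_ge (fun j => excess j w) (leq0n i)). Qed.

Lemma sqintegrable_max_excess i : sqintegrable P (max_excess i).
Proof.
elim: i => [|i IH]; first exact: sqintegrable_excess.
have sq := sqintegrableD IH (sqintegrable_excess i.+1).
apply: (le_sqintegrable _ _ sq).
  by apply: measurable_maxr; [case: IH|case: (sqintegrable_excess i.+1)].
move=> w; have := max_excess_ge0 i w; have := excess_ge0 i.+1 w.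
rewrite {2}/max_excess /= -/(max_excess i w); move: (max_excess i w) (excess i.+1 w) => x y h1 h2.
by rewrite !ger0_norm ?addr_ge0//; case: (leP x y); lra.
Qed.

(** A subgradient of the convex function [x |-> max (sg * x - q) 0]: the increment of the excess is
    at least [slope] times the increment of the walk. *)
Let slope (x : R) : R := \1_(`]q, +oo[%classic) (sg * x) * sg.

Let measurable_slope : measurable_fun setT slope.
Proof.
apply: measurable_funM; last exact: measurable_cst.
by apply: measurableT_comp; [exact: measurable_indic|exact: measurable_funM].
Qed.

Let slope_bound x : `|slope x| <= `|sg|.
Proof. by rewrite /slope indicE; case: (_ \in _); rewrite ?mul1r// mul0r normr0. Qed.

Let excess_convex i w : slope (S i w) * Y (p + i)%N w <= excess i.+1 w - excess i w.
Proof.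
have -> : excess i.+1 w = Num.max (sg * (S i w + Y (p + i)%N w) - q) 0.
  by rewrite /excess /S /block_sum big_ord_recr.
rewrite /excess /slope; move: (S i w) (Y _ w) => x z.
rewrite indicE mem_setE in_itv/= andbT; case: ltP => h.
  rewrite mul1r [X in _ - X]max_l; last lra.
  rewrite lerBrDr le_max; apply/orP; left; lra.
by rewrite !mul0r [X in _ - X]max_r ?subr0 ?le_max ?lexx ?orbT//; lra.
Qed.

(** In the pathwise inequality, the increments of the excess are bounded below by [slope * Y]. The
    weight [max_excess * slope] depends on the past only and [Y] is centered and independent of it,
    so the sum has expectation 0. *)
Lemma doob_excess N : (p + N <= n)%N ->
  \int[P]_w max_excess N w ^+ 2 <= 4 * \int[P]_w excess N w ^+ 2.
Proof.
move=> pN.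
pose g i w := max_excess i w * slope (S i w).
have sg_ i : sqintegrable P (g i).
  apply: (le_sqintegrable _ _ (sqintegrableZ `|sg| (sqintegrable_max_excess i))).
    apply: measurable_funM; first by case: (sqintegrable_max_excess i).
    by apply: measurableT_comp => //; case: (sqintegrable_block_sum i).
  move=> w; rewrite /g; move: (slope_bound (S i w)); move: (slope (S i w)) => s hs.
  by rewrite !normrM normr_id [X in X <= _]mulrC; apply: ler_wpM2r.
have igY i : (i < N)%N -> rintegrable P (fun w => g i w * Y (p + i)%N w) /\
    \int[P]_w (g i w * Y (p + i)%N w) = 0.
  move=> iN; have pin : (p + i < n)%N by apply: leq_trans pN; rewrite ltn_add2l.
  have ind : indep_rv P (g i) (Y (p + i)%N).
  { apply: (@indep_blocks_rv _ _ _ P n (fun l : 'I_n => Y l) (fun l => mY l) indY (past i) [set l | l = Ordinal pin]).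
    - by move=> l [] /[swap] ->; rewrite /past /= ltnn.
    - apply: adaptedM; first by apply: adapted_max_excess => //; exact: ltnW.
      by apply: (adapted_comp (f := slope)) => //; apply: adapted_S => //; exact: ltnW.
    - exact: (adapted_gen (Z := fun l : 'I_n => Y l) (i := Ordinal pin)). }
  have [h1 ->] := indep_rv_mul ind (sqintegrable_int (sg_ i)) (sqintegrable_int (sY _)).
  by rewrite Y0 mulr0.
have i1 := rintegrableZ 4 (sqintegrable_excess N).2.
have i2 : rintegrable P (fun w => \sum_(i < N) g i w * Y (p + i)%N w).
  by apply: rintegrable_sum => i _; have [] := igY i (ltn_ord i).
apply: (@le_trans _ _ (\int[P]_w (4 * excess N w ^+ 2 - 4 * \sum_(i < N) g i w * Y (p + i)%N w))).
  apply: ler_Rint; [exact: (sqintegrable_max_excess N).2|by apply: rintegrableB => //; exact: rintegrableZ|].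
  { move=> w; apply: le_trans (doob_path _ (excess_ge0 0 w)) _.
    rewrite lerD2l lerN2 ler_wpM2l//; apply: ler_sum => i _.
    by rewrite /g -mulrA ler_wpM2l ?max_excess_ge0// excess_convex. }
rewrite (RintB i1 (rintegrableZ 4 i2)) (RintZ _ (sqintegrable_excess N).2) (RintZ _ i2).
rewrite Rint_sum; last by move=> i _; have [] := igY i (ltn_ord i).
by rewrite big1 ?mulr0 ?subr0// => i _; have [] := igY i (ltn_ord i).
Qed.

End positive_part.

Definition sq_excess (q x : R) := Num.max (x - q) 0 ^+ 2 + Num.max (- x - q) 0 ^+ 2.

Context (M : nat) (pt : nat -> nat).
Hypothesis pt_mono : forall b, (pt b <= pt b.+1)%N.
Hypothesis pt_n : forall b, (b < M)%N -> (pt b.+1 <= n)%N.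

Let len b := (pt b.+1 - pt b)%N.

(** Inside a block the walk exceeds [q] in absolute value by at most the maximal excess of one of
    the two signs. Summing the squares over blocks and signs dominates the largest, and its root is
    controlled in mean by Doob's inequality and Cauchy-Schwarz. *)
Lemma block_oscillation q : 0 <= q -> exists2 O : T -> R,
  rintegrable P O /\ (forall w, 0 <= O w) /\ (forall w b k, (b < M)%N -> (pt b <= k <= pt b.+1)%N ->
    `|\sum_(pt b <= i < k) Y i w| <= O w) &
  \int[P]_w O w <= q + Num.sqrt (4 * \sum_(b < M) \int[P]_w sq_excess q (block_sum (pt b) (len b) w)).
Proof.
move=> q0.
pose ybar sg b w := max_excess (pt b) sg q (len b) w.
have sy sg b : sqintegrable P (ybar sg b) by exact: sqintegrable_max_excess.
pose Q w := \sum_(b < M) (ybar 1 b w ^+ 2 + ybar (-1) b w ^+ 2).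
have Q0 w : 0 <= Q w by apply: sumr_ge0 => b _; rewrite addr_ge0 ?sqr_ge0.
have iQ : rintegrable P Q.
  by apply: rintegrable_sum => b _; apply: rintegrableD; exact: (sy _ b).2.
have mQ : measurable_fun setT Q by exact: rintegrable_measurable iQ.
have sqQ : sqintegrable P (fun w => Num.sqrt (Q w)).
  split; first by apply: measurableT_comp => //; apply: continuous_measurable_fun; exact: sqrt_continuous.
  by apply: eq_rintegrable iQ => w; rewrite sqr_sqrtr.
exists (fun w => q + Num.sqrt (Q w)).
  split; first by apply: rintegrableD; [exact: rintegrable_cst|exact: sqintegrable_int].
  split; first by move=> w; rewrite addr_ge0 ?sqrtr_ge0.
  move=> w b k bM /andP[k1 k2].
  have -> : \sum_(pt b <= i < k) Y i w = block_sum (pt b) (k - pt b) w.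
    by rewrite /block_sum -{1}(add0n (pt b)) big_addn big_mkord; apply: eq_bigr => i _; rewrite addnC.
  have ksub : (k - pt b <= len b)%N by rewrite leq_sub2r.
  have hy sg : sg = 1 \/ sg = -1 -> sg * block_sum (pt b) (k - pt b) w - q <= Num.sqrt (Q w).
    move=> sgE; apply: (@le_trans _ _ (ybar sg b w)).
      apply: le_trans (running_max_ge (fun j => excess (pt b) sg q j w) ksub).
      by rewrite /excess le_max lexx.
    have yQ : ybar sg b w ^+ 2 <= Q w -> ybar sg b w <= Num.sqrt (Q w).
      by move=> h; rewrite -[leLHS]ger0_norm ?max_excess_ge0// -sqrtr_sqr ler_wsqrtr.
    apply: yQ; rewrite /Q (bigD1 (Ordinal bM))//=.
    have r0 : 0 <= \sum_(i < M | i != Ordinal bM) (ybar 1 i w ^+ 2 + ybar (-1) i w ^+ 2).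
      by apply: sumr_ge0 => i _; rewrite addr_ge0 ?sqr_ge0.
    move: r0 (sqr_ge0 (ybar 1 b w)) (sqr_ge0 (ybar (-1) b w)).
    by set r := \sum_(_ | _) _; case: sgE => ->; move: r (_ ^+ 2) (_ ^+ 2) => r x y; lra.
  have h1 := hy 1 (or_introl erefl); have h2 := hy (-1) (or_intror erefl).
  by rewrite ler_norml; apply/andP; split; lra.
have iyb sg b := (sy sg b).2.
have EQ : \int[P]_w Q w <= 4 * \sum_(b < M) \int[P]_w sq_excess q (block_sum (pt b) (len b) w).
  rewrite Rint_sum; last by move=> b _; apply: rintegrableD.
  rewrite mulr_sumr; apply: ler_sum => b _; rewrite (RintD (iyb _ _) (iyb _ _)).
  have pb : (pt b + len b <= n)%N by rewrite /len subnKC ?pt_n.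
  have h1 := doob_excess 1 q pb; have h2 := doob_excess (-1) q pb.
  have s1 := (sqintegrable_excess (pt b) 1 q (len b)).2.
  have s2 := (sqintegrable_excess (pt b) (-1) q (len b)).2.
  apply: le_trans (lerD h1 h2) _; rewrite -mulrDr ler_wpM2l// -(RintD s1 s2).
  by rewrite le_eqVlt; apply/orP; left; apply/eqP; apply: eq_Rint => w; rewrite /excess /sq_excess mul1r mulN1r.
rewrite (RintD (rintegrable_cst _ _) (sqintegrable_int sqQ)) Rint_cst lerD2l.
apply: (@le_trans _ _ (Num.sqrt (\int[P]_w Q w))); last exact: ler_wsqrtr.
apply: (@le_trans _ _ (\int[P]_w `|Num.sqrt (Q w)|)).
  apply: ler_Rint; [exact: sqintegrable_int|exact/rintegrable_norm/sqintegrable_int|by move=> w; exact: ler_norm].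
apply: le_trans (Rint_norm_sqrt sqQ) _.
by rewrite le_eqVlt; apply/orP; left; apply/eqP; congr Num.sqrt; apply: eq_Rint => w; rewrite sqr_sqrtr.
Qed.

End doob.

Section truncated_square.
Context (R : realType).
Implicit Types q x z : R.

Lemma sq_excess_ge0 q x : 0 <= sq_excess q x.
Proof. by rewrite addr_ge0 ?sqr_ge0. Qed.

Lemma sq_excess_le q x : 0 <= q -> sq_excess q x <= x ^+ 2.
Proof.
move=> q0; rewrite /sq_excess; have [h1|h1] := leP (x - q) 0; have [h2|h2] := leP (- x - q) 0.
- by rewrite expr0n addr0 sqr_ge0.
- by rewrite expr0n add0r; nra.
- by rewrite expr0n addr0; nra.
- lra.
Qed.

(* For [`|x| > q] the cosine term is at most [8 / z ^+ 2 = 8 / 9 * q ^+ 2]. *)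
Lemma sq_excess_cos q x z : 0 < q -> z * q = 3 ->
  sq_excess q x <= 2 * x ^+ 2 - 4 / z ^+ 2 * (1 - cos (z * x)).
Proof.
move=> q0 zq; have z0 : 0 < z by nra.
have z2 : 0 < z ^+ 2 by rewrite exprn_gt0.
have iz : 0 < 4 / z ^+ 2 by rewrite divr_gt0.
have [hx|hx] := leP `|x| q.
  have -> : sq_excess q x = 0.
    move: hx; rewrite ler_norml => /andP[h1 h2].
    by rewrite /sq_excess !max_r ?expr0n ?addr0//; lra.
  have := cos_ge_quad (z * x); rewrite subr_ge0 => h.
  have : 4 / z ^+ 2 * (1 - cos (z * x)) <= 4 / z ^+ 2 * ((z * x) ^+ 2 / 2).
    by rewrite ler_pM2l//; lra.
  move=> /le_trans; apply; rewrite le_eqVlt; apply/orP; left; apply/eqP.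
  by field; rewrite gt_eqF.
apply: le_trans (sq_excess_le x (ltW q0)) _.
have h : 4 / z ^+ 2 * (1 - cos (z * x)) <= 4 / z ^+ 2 * 2.
  by rewrite ler_pM2l//; have := cos_geN1 (z * x); lra.
have e : 4 / z ^+ 2 * 2 = 8 / 9 * q ^+ 2.
  have -> : q = 3 / z by rewrite -zq mulrAC divff ?mul1r// gt_eqF.
  by field; rewrite gt_eqF.
have : q ^+ 2 <= x ^+ 2 by rewrite -(real_normK (num_real x)); nra.
lra.
Qed.

End truncated_square.

Section blocks.
Context (R : realType) (n M : nat).
Hypothesis M0 : (0 < M)%N.

Definition block_point b := Num.truncn (n%:R * (b%:R / M%:R) : R).

Let MR : (0 : R) < M%:R. Proof. by rewrite ltr0n. Qed.

Lemma block_point_mono b b' : (b <= b')%N -> (block_point b <= block_point b')%N.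
Proof. by move=> bb; apply: le_truncn; rewrite ler_wpM2l// ler_pM2r ?invr_gt0// ler_nat. Qed.

Lemma block_pointM : block_point M = n.
Proof. by rewrite /block_point divff ?gt_eqF// mulr1 natrK. Qed.

Lemma block_point_le b : (b <= M)%N -> (block_point b <= n)%N.
Proof. by move=> bM; rewrite -[leqRHS]block_pointM block_point_mono. Qed.

Lemma block_length b : (block_point b.+1 - block_point b)%N%:R <= n%:R / M%:R + 1 :> R.
Proof.
rewrite natrB ?block_point_mono//.
have r0 k : 0 <= n%:R * (k%:R / M%:R) :> R by rewrite mulr_ge0// divr_ge0.
have /andP[h1 _] := truncn_itv (r0 b.+1); have /andP[_ h2] := truncn_itv (r0 b).
move: h1 h2; rewrite -/(block_point b.+1) -/(block_point b) -!natr1.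
rewrite (mulrDl b%:R) (mulrDr n%:R) mul1r; lra.
Qed.

Lemma sum_block_length : \sum_(b < M) (block_point b.+1 - block_point b)%N%:R = n%:R :> R.
Proof.
under eq_bigr do rewrite natrB ?block_point_mono//.
rewrite -(big_mkord xpredT (fun b => (block_point b.+1)%:R - (block_point b)%:R)) telescope_sumr//.
by rewrite block_pointM /block_point mul0r mulr0 truncn0 subr0.
Qed.

End blocks.

Definition oscillation_bound d (T : measurableType d) (R : realType) (P : probability T R)
    (n M : nat) (Y : nat -> T -> R) (c : R) :=
  exists2 O : T -> R, [/\ rintegrable P O, forall w, 0 <= O w &
    forall w b k, (b < M)%N -> (block_point R n M b <= k <= block_point R n M b.+1)%N ->
      `|\sum_(block_point R n M b <= i < k) Y i w| <= O w] & \int[P]_w O w <= c.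

(** * The random walk of a single lag *)

Section lag.
Context d (Om : measurableType d) (R : realType) (P : probability Om R).
Context (L : set (R * R) -> Om -> R) (gamma b : R) (nu : {measure set R -> \bar R}).
Hypothesis HL : levy_basis P L gamma b nu.
Context (m s2 : R) (eps : R -> R).
Hypothesis ce : cumulant_expansion (log_cf_re b nu) (log_cf_im gamma nu) m s2 eps.
Context (a : R -> R).
Hypothesis Ha : trawl_function a.
Context (D : R).
Hypothesis D0 : 0 < D.
Context (n M j : nat).
Hypothesis n0 : (0 < n)%N.
Hypothesis M0 : (0 < M)%N.

Definition lag_strip (i : nat) :=
  trawl_strip a (i%:R * D) ((i%:R - j.+1%:R) * D) ((i%:R - j%:R) * D).

Definition lag_mass := tail_int a (j%:R * D) - tail_int a (j.+1%:R * D).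

Let xy i : (i%:R - j.+1%:R) * D <= (i%:R - j%:R) * D :> R.
Proof. by rewrite ler_pM2r// lerD2l lerN2 ler_nat. Qed.

Let yM i : (i%:R - j%:R) * D <= i%:R * D :> R.
Proof. by rewrite ler_pM2r// gerBl. Qed.

Lemma lag_strip_finite i : finite_borel (lag_strip i).
Proof. exact: trawl_strip_finite. Qed.

Lemma lam_lag_strip i : lam (lag_strip i) = lag_mass.
Proof.
rewrite lam_trawl_strip// /lag_mass.
by congr (tail_int a _ - tail_int a _); ring.
Qed.

Lemma lag_mass_ge0 : 0 <= lag_mass.
Proof. by rewrite -(lam_lag_strip 0); exact: lam_ge0. Qed.

Lemma lag_strip_disjoint i k : i != k -> lag_strip i `&` lag_strip k = set0.
Proof.
wlog ik : i k / (i < k)%N => [hw|_].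
  by rewrite neq_ltn => /orP[h|h]; [|rewrite setIC]; apply: hw => //; rewrite neq_ltn h ?orbT.
apply/seteqP; split => // p [[[h1 _] _] [_ /= h2]].
have : (k%:R - j.+1%:R) * D < (i%:R - j%:R) * D :> R by apply: lt_le_trans h1.
rewrite ltr_pM2r//.
have : (i%:R + 1 <= k%:R :> R) by rewrite natr1 ler_nat.
rewrite -[j.+1%:R]natr1; lra.
Qed.

Let c := Num.sqrt (D / n%:R).

Definition lag_increment (i : nat) w := c * (L (lag_strip i) w - m * lam (lag_strip i)).

Let sY i : sqintegrable P (lag_increment i).
Proof. by apply: sqintegrableZ; have [] := centered_moments HL ce (lag_strip_finite i). Qed.

Let Y0 i : \int[P]_w lag_increment i w = 0.
Proof.
have [h1 h2 _] := centered_moments HL ce (lag_strip_finite i).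
by rewrite (RintZ _ (sqintegrable_int h1)) h2 mulr0.
Qed.

Let indY : mutually_independent P (fun i : 'I_n => lag_increment i).
Proof.
move=> B mB.
have tS : trivIset [set: 'I_n] (fun i : 'I_n => lag_strip i).
  by apply/trivIsetP => i k _ _ ik; exact: lag_strip_disjoint.
pose h (i : 'I_n) (x : R) := c * (x - m * lam (lag_strip i)).
have := levy_basis_independent HL (fun i : 'I_n => lag_strip_finite i) tS (B := fun i => h i @^-1` B i).
apply => i; rewrite -[X in measurable X]setTI.
have mh : measurable_fun setT (h i) by apply: measurable_funM => //; exact: measurable_funB.
exact: mh.
Qed.

Let Z p i := block_sum lag_increment p i.

Let A p i (l : 'I_i) := lag_strip (p + l)%N.

Let ZE p i w : Z p i w = centered_sum L m (@A p i) (fun=> c) w.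
Proof. by []. Qed.

Let quadA p i (t : R) : quad (@A p i) (fun=> t) = t ^+ 2 * (i%:R * lag_mass).
Proof.
rewrite /quad (_ : _ * (_ * _) = \sum_(k < i) t ^+ 2 * lag_mass); last first.
  by rewrite sumr_const card_ord -[RHS]mulr_natl mulrCA.
apply: eq_bigr => k _; rewrite (bigD1 k)//= big1 ?addr0.
  by rewrite setIid lam_lag_strip expr2.
have lam0 : lam (set0 : set (R * R)) = 0 by rewrite /lam /leb2 measure0.
move=> l lk; rewrite lag_strip_disjoint ?lam0 ?mulr0// eqn_add2l.
by apply: contra lk => /eqP h; apply/eqP/val_inj.
Qed.

Let Z2 p i : sqintegrable P (Z p i) /\ \int[P]_w Z p i w ^+ 2 = s2 * (c ^+ 2 * (i%:R * lag_mass)).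
Proof. by have [h1 _ h2] := centered_sum_moments HL ce (fun l : 'I_i => lag_strip_finite (p + l)) (fun=> c); rewrite -(quadA p i). Qed.

(** The strips of one lag are disjoint, so a point receives the coefficient [z * c] at most once;
    [clt_bound] applies with every index in [J] and its far term vanishes. *)
Let cosZ p i z : 0 <= z ->
  \int[P]_w cos (z * Z p i w) <= expR (- (s2 * (z ^+ 2 * (c ^+ 2 * (i%:R * lag_mass))) / 2)) +
    2 * (eps (2 * (z * c)) * (z ^+ 2 * (c ^+ 2 * (i%:R * lag_mass)))).
Proof.
move=> z0; have c0 : 0 <= z * c by rewrite mulr_ge0// sqrtr_ge0.
have [C _ hC] := ce_eps_bound ce.
have hr q : `|\sum_(l < i) z * c * \1_(A p l) q| <= z * c.
  have [[k Ak]|nA] := pselect (exists k : 'I_i, A p k q).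
    rewrite (bigD1 k)//= big1 ?addr0 ?indicE ?mem_set ?mulr1 ?ger0_norm// => l lk.
    rewrite indicE memNset ?mulr0// => Al.
    have : lag_strip (p + l) `&` lag_strip (p + k) = set0.
      by apply: lag_strip_disjoint; rewrite eqn_add2l.
    by move/seteqP => [/(_ q) h _]; apply: h.
  rewrite big1 ?normr0// => l _; rewrite indicE memNset ?mulr0// => Al.
  by apply: nA; exists l.
have [h _] := clt_bound HL ce (fun l : 'I_i => lag_strip_finite (p + l)) (th := fun _ : 'I_i => z * c) (J := xpredT) c0 hC hr.
move: h; rewrite quadA exprMn -[z ^+ 2 * c ^+ 2 * _]mulrA (_ : quad _ _ = 0); last first.
  by rewrite /quad big1// => k _; rewrite big1// => l _; rewrite mul0r mul0r.
rewrite mulr0 addr0 ler_norml => /andP[_].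
rewrite (_ : \int[P]_w _ = \int[P]_w cos (z * Z p i w)); first lra.
by apply: eq_Rint => w; rewrite ZE /centered_sum mulr_sumr; congr cos; apply: eq_bigr => k _; rewrite mulrA.
Qed.

(** In [sq_excess_cos] at [z = 3 / q], the contribution [2 * s2 * V] of the second moment cancels
    against the leading term of the cosine. There remain a term quadratic in [V], small over short
    blocks, and the Lindeberg error. *)
Let excessZ p i q : 0 < q ->
  \int[P]_w sq_excess q (Z p i w) <=
  9 * s2 ^+ 2 / q ^+ 2 * (c ^+ 2 * (i%:R * lag_mass)) ^+ 2 +
  8 * eps (6 * c / q) * (c ^+ 2 * (i%:R * lag_mass)).
Proof.
move=> q0; pose z := 3 / q.
have zq : z * q = 3 by rewrite divfK// gt_eqF.
have z0 : 0 < z by rewrite divr_gt0.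
have [sZ EZ] := Z2 p i; have mZ := sZ.1.
have icos : rintegrable P (fun w => cos (z * Z p i w)).
  apply: (@bounded_rintegrable _ _ _ P _ 1); last by move=> w; exact: norm_cos_le1.
  by apply: (measurableT_comp (@measurable_cos R setT)); exact: measurable_funM.
have iB := rintegrableB (rintegrable_cst P 1) icos.
have mE : measurable_fun setT (fun w => sq_excess q (Z p i w)).
  have mm (f : Om -> R) : measurable_fun setT f -> measurable_fun setT (fun w => Num.max (f w - q) 0 ^+ 2).
    by move=> mf; apply: measurable_funX; apply: measurable_maxr => //; exact: measurable_funB.
  by apply: measurable_funD; apply: mm => //; exact: measurableT_comp.
have iE : rintegrable P (fun w => sq_excess q (Z p i w)).
  apply: (le_rintegrable mE _ sZ.2) => w.
  by rewrite ger0_norm ?sq_excess_ge0// sq_excess_le// ltW.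
apply: (@le_trans _ _ (\int[P]_w (2 * Z p i w ^+ 2 - 4 / z ^+ 2 * (1 - cos (z * Z p i w))))).
  apply: ler_Rint => //; last by move=> w; exact: sq_excess_cos.
  by apply: rintegrableB; apply: rintegrableZ => //; exact: sZ.2.
rewrite (RintB (rintegrableZ _ sZ.2) (rintegrableZ _ iB)) (RintZ _ sZ.2) (RintZ _ iB) EZ.
rewrite (RintB (rintegrable_cst P 1) icos) Rint_cst.
have := cosZ p i (ltW z0).
set V := c ^+ 2 * (i%:R * lag_mass).
have -> : 2 * (z * c) = 6 * c / q by rewrite /z; field; rewrite gt_eqF.
have V0 : 0 <= V by rewrite mulr_ge0 ?sqr_ge0// mulr_ge0// lag_mass_ge0.
have x0 : 0 <= s2 * (z ^+ 2 * V) / 2.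
  by rewrite divr_ge0// mulr_ge0 ?(ce_s2_ge0 ce)// mulr_ge0// sqr_ge0.
have := expR_quad x0; rewrite ler_norml => /andP[_ h1] h2.
have : 1 - \int[P]_w cos (z * Z p i w) >=
   s2 * (z ^+ 2 * V) / 2 - (s2 * (z ^+ 2 * V) / 2) ^+ 2 - 2 * (eps (6 * c / q) * (z ^+ 2 * V)) by lra.
have z2 : 0 < 4 / z ^+ 2 by rewrite divr_gt0// exprn_gt0.
rewrite -(ler_pM2l z2); move: (1 - _) (eps _) => I e h3.
have -> : 9 * s2 ^+ 2 / q ^+ 2 * V ^+ 2 = s2 ^+ 2 * z ^+ 2 * V ^+ 2.
  by rewrite /z; field; rewrite gt_eqF.
have h4 : 4 / z ^+ 2 * (s2 * (z ^+ 2 * V) / 2 - (s2 * (z ^+ 2 * V) / 2) ^+ 2 - 2 * (e * (z ^+ 2 * V))) =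
   2 * s2 * V - s2 ^+ 2 * z ^+ 2 * V ^+ 2 - 8 * e * V.
  by field; rewrite gt_eqF.
move: h3; rewrite h4; lra.
Qed.

Let osc q : 0 <= q -> oscillation_bound P n M lag_increment
  (q + Num.sqrt (4 * \sum_(b < M) \int[P]_w sq_excess q
    (Z (block_point R n M b) (block_point R n M b.+1 - block_point R n M b)%N w))).
Proof.
move=> q0.
have [||U [h1 [h2 h3]] h4] := block_oscillation sY Y0 indY (M := M) (pt := block_point R n M) _ _ q0.
{ by move=> b'; exact: block_point_mono. }
{ by move=> b' bM; exact: block_point_le. }
by exists U.
Qed.

Let c2 : c ^+ 2 = D / n%:R.
Proof. by rewrite sqr_sqrtr// divr_ge0// ltW. Qed.

Let sumV : \sum_(b < M) c ^+ 2 * ((block_point R n M b.+1 - block_point R n M b)%N%:R * lag_mass) = D * lag_mass.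
Proof.
rewrite -mulr_sumr -mulr_suml sum_block_length// c2 mulrA divfK//.
by rewrite pnatr_eq0 -lt0n.
Qed.

(** The level [q = 0]: no gain from the blocks, but also no condition on the mass of the lag. *)
Lemma lag_crude : oscillation_bound P n M lag_increment (2 * Num.sqrt (s2 * (D * lag_mass))).
Proof.
have [U hU h4] := osc (lexx 0); exists U => //; apply: le_trans h4 _; rewrite add0r.
have -> : 2 * Num.sqrt (s2 * (D * lag_mass)) = Num.sqrt (4 * (s2 * (D * lag_mass))).
  rewrite -[X in X * _](ger0_norm (ler0n R 2)) -sqrtr_sqr -sqrtrM ?sqr_ge0//.
  by congr (Num.sqrt (_ * _)); ring.
apply: ler_wsqrtr; rewrite ler_pM2l// -sumV mulr_sumr; apply: ler_sum => k _.
have [sZ <-] := Z2 (block_point R n M k) (block_point R n M k.+1 - block_point R n M k).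
apply: ler_Rint; last by move=> w; exact: sq_excess_le.
- apply: (le_rintegrable _ _ sZ.2).
    have mm (f : Om -> R) : measurable_fun setT f -> measurable_fun setT (fun w => Num.max (f w - 0) 0 ^+ 2).
      by move=> mf; apply: measurable_funX; apply: measurable_maxr => //; exact: measurable_funB.
    by apply: measurable_funD; apply: mm; [exact: sZ.1|apply: measurableT_comp => //; exact: sZ.1].
  by move=> w; rewrite ger0_norm ?sq_excess_ge0// sq_excess_le.
- exact: sZ.2.
Qed.

(** The level is [delta] times [w], which is up to the factor [sqrt s2] the standard deviation of
    the whole walk, so the bound is [w] times a factor that is small for many blocks and a large
    mass [n * lag_mass]. *)
Lemma lag_fine delta : 0 < delta -> 0 < lag_mass ->
  oscillation_bound P n M lag_increment (Num.sqrt (D * lag_mass) *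
    (delta + Num.sqrt (36 * s2 ^+ 2 / delta ^+ 2 * (M%:R^-1 + n%:R^-1) +
                       32 * eps (6 / (delta * Num.sqrt (n%:R * lag_mass)))))).
Proof.
move=> d0 v0; set w := Num.sqrt (D * lag_mass).
have N0 : (0 : R) < n%:R by rewrite ltr0n.
have Dv0 : 0 < D * lag_mass by rewrite mulr_gt0.
have w0 : 0 < w by rewrite sqrtr_gt0.
have w2 : w ^+ 2 = D * lag_mass by rewrite sqr_sqrtr// ltW.
have q0 : 0 < w * delta by rewrite mulr_gt0.
have [U hU h4] := osc (ltW q0); exists U => //; apply: le_trans h4 _.
rewrite mulrDr lerD2l.
have e0 : 0 <= eps (6 / (delta * Num.sqrt (n%:R * lag_mass))).
  by apply: (ce_eps_ge0 ce); rewrite divr_ge0// mulr_ge0 ?sqrtr_ge0// ltW.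
set e := eps _ in e0 *.
have K0 : 0 <= 36 * s2 ^+ 2 / delta ^+ 2 * (M%:R^-1 + n%:R^-1) :> R.
  by rewrite mulr_ge0 ?addr_ge0 ?invr_ge0// divr_ge0 ?sqr_ge0// mulr_ge0// sqr_ge0.
have v0' := ltW v0.
have cw : 6 * c / (w * delta) = 6 / (delta * Num.sqrt (n%:R * lag_mass)).
  have -> : w = c * Num.sqrt (n%:R * lag_mass).
    rewrite -sqrtrM ?divr_ge0// ?(ltW D0)//; congr Num.sqrt.
    by rewrite mulrA divfK// gt_eqF.
  have : 0 < Num.sqrt (n%:R * lag_mass) by rewrite sqrtr_gt0 mulr_gt0.
  have : 0 < c by rewrite sqrtr_gt0 divr_gt0.
  by move: c (Num.sqrt _) => x y x0 y0; field; rewrite !gt_eqF.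
rewrite /w -sqrtrM ?(ltW Dv0)//; apply: ler_wsqrtr.
pose V k := c ^+ 2 * ((block_point R n M k.+1 - block_point R n M k)%N%:R * lag_mass).
have V0 k : 0 <= V k by rewrite mulr_ge0 ?sqr_ge0// mulr_ge0.
have Vm k : V k <= D * lag_mass * (M%:R^-1 + n%:R^-1).
  (* The variance of one block is at most a fraction [1 / M + 1 / n] of the total, so the sum of the
     squared block variances is at most this fraction times the square of the total. *)
  apply: (@le_trans _ _ (c ^+ 2 * ((n%:R / M%:R + 1) * lag_mass))).
    by rewrite ler_wpM2l ?sqr_ge0// ler_wpM2r// block_length.
  rewrite c2 le_eqVlt; apply/orP; left; apply/eqP; field.
  by rewrite !gt_eqF// ltr0n.
apply: (@le_trans _ _ (4 * \sum_(k < M) (9 * s2 ^+ 2 / (w * delta) ^+ 2 * (D * lag_mass * (M%:R^-1 + n%:R^-1)) + 8 * e) * V k)).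
  rewrite ler_pM2l//; apply: ler_sum => k _; apply: le_trans (excessZ _ _ q0) _.
  rewrite cw -/(V k) [leRHS]mulrDl; apply: lerD => //.
  have K1 : 0 <= 9 * s2 ^+ 2 / (w * delta) ^+ 2 by rewrite divr_ge0 ?sqr_ge0// mulr_ge0// sqr_ge0.
  move: (Vm k) (V0 k) K1; move: (V k) (9 * _ / _) (D * _ * _) => x K B h1 h2 h3.
  by rewrite -[leRHS]mulrA ler_wpM2l// expr2 ler_wpM2r.
rewrite -mulr_sumr sumV exprMn w2 le_eqVlt; apply/orP; left; apply/eqP.
move: e e0 Dv0 => e _ Dv0; field.
by rewrite !gt_eqF// ltr0n.
Qed.

End lag.

(** Each term is at most the integral of [f] over the preceding cell; cells that start before [x0]
    are clamped away and the rest telescopes. *)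
Lemma grid_tail_sum (R : realType) (f : R -> R) (D x0 : R) J : tail_fun f -> 0 < D -> 0 <= x0 ->
  \sum_(j < J) (if x0 + D <= j%:R * D then D * f (j%:R * D) else 0) <= tail_int f x0.
Proof.
move=> tf D0 x00.
pose u k := Num.max x0 (k%:R * D - D).
have ux k : x0 <= u k by rewrite le_max lexx.
suff h : \sum_(j < J) (if x0 + D <= j%:R * D then D * f (j%:R * D) else 0) <= tail_int f x0 - tail_int f (u J).
  by apply: le_trans h _; rewrite gerBl (tail_int_ge0 tf)// (le_trans x00).
elim: J => [|J IH].
  by rewrite big_ord0 /u mul0r sub0r max_l ?subrr// (le_trans _ x00)// oppr_le0 ltW.
rewrite big_ord_recr/=; apply: le_trans (lerD IH (lexx _)) _; rewrite -addrA lerD2l.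
have uJ : u J.+1 = Num.max x0 (J%:R * D) by rewrite /u -natr1 mulrDl mul1r addrK.
case: ifPn => h.
  have -> : u J.+1 = J%:R * D by rewrite uJ max_r//; lra.
  have -> : u J = J%:R * D - D by rewrite /u max_r//; lra.
  have h0 : 0 <= J%:R * D - D by lra.
  have := @tail_int_lb _ _ tf (J%:R * D - D) (J%:R * D) h0.
  have h1 : J%:R * D - D <= J%:R * D by rewrite gerBl ltW.
  move/(_ h1); rewrite (_ : J%:R * D - (J%:R * D - D) = D); last by ring.
  lra.
rewrite addr0 lerN2; apply: (tail_int_noninc tf); first exact: le_trans (ux J).
by rewrite uJ /u ge_max le_max lexx/= le_max; apply/orP; right; rewrite gerBl ltW.
Qed.

(** * Summation over the lags *)

Section tightness.
Context d (Om : measurableType d) (R : realType) (P : probability Om R).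
Context (L : set (R * R) -> Om -> R) (gamma b : R) (nu : {measure set R -> \bar R}).
Hypothesis HL : levy_basis P L gamma b nu.
Context (m s2 : R) (eps : R -> R).
Hypothesis ce : cumulant_expansion (log_cf_re b nu) (log_cf_im gamma nu) m s2 eps.
Context (a : R -> R).
Hypothesis Ha : trawl_function a.

Section fixed_step.
Context (D : R).
Hypothesis D0 : 0 < D.
Context (n M : nat).
Hypothesis n0 : (0 < n)%N.
Hypothesis M0 : (0 < M)%N.

Local Notation w j := (Num.sqrt (D * lag_mass a D j)).

(** When [n * lag_mass >= Lam], the argument of [eps] in the fine bound is at most
    [6 / (delta * sqrt Lam)] and the bound is [3 * delta * w j]. Below that level the crude bound is
    used instead. *)
Lemma lag_bound (delta Lam : R) (j : nat) : 0 < delta -> 0 < Lam ->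
  eps (6 / (delta * Num.sqrt Lam)) <= delta ^+ 2 / 32 ->
  36 * s2 ^+ 2 / delta ^+ 2 * (M%:R^-1 + n%:R^-1) <= delta ^+ 2 ->
  oscillation_bound P n M (lag_increment L m a D n j)
    (3 * delta * w j + if n%:R * lag_mass a D j < Lam then 2 * Num.sqrt s2 * w j else 0).
Proof.
move=> d0 L0 he hn.
have v0 := lag_mass_ge0 Ha D0 j.
have w0 : 0 <= w j by exact: sqrtr_ge0.
have s0 := ce_s2_ge0 ce.
case: ifPn => h.
  have [U hU hc] := lag_crude HL ce Ha D0 j n0 M0; exists U => //; apply: le_trans hc _.
  rewrite sqrtrM// mulrA lerDr mulr_ge0// mulr_ge0//; exact: ltW.
rewrite -leNgt in h; have N0 : (0 : R) < n%:R by rewrite ltr0n.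
have v1 : 0 < lag_mass a D j by rewrite -(pmulr_rgt0 _ N0); exact: lt_le_trans h.
have [U hU hc] := lag_fine HL ce Ha D0 n0 M0 d0 v1; exists U => //; apply: le_trans hc _.
rewrite addr0 mulrC ler_wpM2r//.
have -> : 3 * delta = delta + 2 * delta by ring.
rewrite lerD2l -[leRHS]ger0_norm; last by rewrite mulr_ge0// ltW.
rewrite -sqrtr_sqr ler_wsqrtr// exprMn.
have : eps (6 / (delta * Num.sqrt (n%:R * lag_mass a D j))) <= delta ^+ 2 / 32.
  apply: le_trans he; apply: (ce_eps_mono ce).
    by rewrite divr_ge0// mulr_ge0 ?sqrtr_ge0// ltW.
  have sL : 0 < Num.sqrt Lam by rewrite sqrtr_gt0.
  rewrite ler_pM2l// lef_pV2 ?posrE ?mulr_gt0//; last by rewrite sqrtr_gt0 mulr_gt0.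
  by rewrite ler_pM2l// ler_wsqrtr.
have := sqr_ge0 delta; lra.
Qed.

Let X i := trawl_process L a (i%:R * D).

Definition lag_rest J i w := L (trawl_box a (i%:R * D) ((i%:R - J%:R) * D)) w -
  m * lam (trawl_box a (i%:R * D) ((i%:R - J%:R) * D)).

Let iJ i J : (i%:R - J%:R) * D <= i%:R * D :> R.
Proof. by rewrite ler_pM2r// gerBl. Qed.

Lemma lag_split J i : {ae P, forall w, X i w - fine 'E_P[X i] =
  \sum_(j < J) (L (lag_strip a D j i) w - m * lam (lag_strip a D j i)) + lag_rest J i w}.
Proof.
elim: J => [|J IH].
  apply: nearW => w; rewrite big_ord0 add0r /X (trawl_mean HL ce Ha) /trawl_process /lag_rest.
  by rewrite trawl_set_atE subr0.
pose S : set (R * R) := [set p | (i%:R - J.+1%:R) * D < p.1].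
have mS : measurable S.
  have mf : measurable_fun setT (fst : R * R -> R) by exact: measurable_fst.
  have := measurable_fun_ltr (measurable_cst ((i%:R - J.+1%:R) * D)) mf measurableT (I : measurable [set true]).
  by rewrite setTI; congr measurable; apply/seteqP; split => p /=.
have fB := trawl_box_finite Ha (iJ i J).
have xy : (i%:R - J.+1%:R) * D <= (i%:R - J%:R) * D :> R by rewrite ler_pM2r// lerD2l lerN2 ler_nat.
have EC : trawl_box a (i%:R * D) ((i%:R - J%:R) * D) `&` ~` S = trawl_box a (i%:R * D) ((i%:R - J.+1%:R) * D).
  apply/seteqP; split => p; first by move=> [[_ h] /= /negP]; rewrite -leNgt => h2; split.
  by move=> [h1 h2]; split; [split => //; exact: le_trans xy|apply/negP; rewrite -leNgt].
have lamE := lam_splitI fB mS; rewrite EC in lamE.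
have := levy_splitI HL fB mS; rewrite EC; apply: filterS2 IH => w -> hw.
rewrite big_ord_recr/= -addrA; congr (_ + _).
by rewrite /lag_rest hw lamE /lag_strip /trawl_strip -/S; ring.
Qed.

Lemma lag_rest_small J i : rintegrable P (lag_rest J i) /\
  \int[P]_w `|lag_rest J i w| <= Num.sqrt (s2 * tail_int a (J%:R * D)).
Proof.
have [h1 h2 h3] := centered_moments HL ce (trawl_box_finite Ha (iJ i J)).
split; first exact: sqintegrable_int.
apply: le_trans (Rint_norm_sqrt h1) _; rewrite h3 lam_trawl_box//.
by rewrite mulrC (_ : i%:R * D - (i%:R - J%:R) * D = J%:R * D)//; ring.
Qed.

Local Notation c := (Num.sqrt (D / n%:R)).

(** The rest beyond lag [J] is estimated term by term, without cancellation over the [n] times; this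
    is affordable because [J] may be chosen after [n]. *)
Lemma oscillation_sum J (o : nat -> R) :
  (forall j, oscillation_bound P n M (lag_increment L m a D n j) (o j)) ->
  exists2 U : Om -> R, [/\ rintegrable P U, forall w, 0 <= U w &
    {ae P, forall w (t : R), 0 <= t <= 1 ->
      `|c * \sum_(0 <= k < Num.truncn (n%:R * t)) (X k w - fine 'E_P[X k]) -
        c * \sum_(0 <= k < Num.truncn (n%:R * ((Num.truncn (M%:R * t))%:R / M%:R) : R))
             (X k w - fine 'E_P[X k])| <= U w}] &
    \int[P]_w U w <= \sum_(j < J) o j + c * (n%:R * Num.sqrt (s2 * tail_int a (J%:R * D))).
Proof.
move=> ho.
have {ho} /choice[U hU] : forall j, exists U : Om -> R, [/\ rintegrable P U, forall w, 0 <= U w &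
    forall w b k, (b < M)%N -> (block_point R n M b <= k <= block_point R n M b.+1)%N ->
      `|\sum_(block_point R n M b <= i < k) lag_increment L m a D n j i w| <= U w] /\ \int[P]_w U w <= o j.
  by move=> j; have [V h1 h2] := ho j; exists V.
have c0 : 0 <= c by exact: sqrtr_ge0.
have iU (j : 'I_J) : rintegrable P (U j) by have [[]] := hU j.
have iR i := rintegrable_norm (lag_rest_small J i).1.
have iS1 : rintegrable P (fun w => \sum_(j < J) U j w) by apply: rintegrable_sum => j _.
have iS2 : rintegrable P (fun w => \sum_(i < n) `|lag_rest J i w|) by apply: rintegrable_sum => i _.
exists (fun w => \sum_(j < J) U j w + c * \sum_(i < n) `|lag_rest J i w|); last first.
  rewrite (RintD iS1 (rintegrableZ _ iS2)) (RintZ _ iS2) Rint_sum; last by move=> j _.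
  rewrite Rint_sum; last by move=> i _.
  apply: lerD; first by apply: ler_sum => j _; have [] := hU j.
  rewrite ler_wpM2l//.
  have -> : n%:R * Num.sqrt (s2 * tail_int a (J%:R * D)) = \sum_(i < n) Num.sqrt (s2 * tail_int a (J%:R * D)).
    by rewrite sumr_const card_ord mulr_natl.
  by apply: ler_sum => i _; have [] := lag_rest_small J i.
split.
{ by apply: rintegrableD => //; exact: rintegrableZ. }
{ by move=> w; rewrite addr_ge0 ?mulr_ge0 ?sumr_ge0// => j _; have [[]] := hU j. }
have : {ae P, forall w, forall i : 'I_n, X i w - fine 'E_P[X i] =
  \sum_(j < J) (L (lag_strip a D j i) w - m * lam (lag_strip a D j i)) + lag_rest J i w}.
  by apply: filter_forall => i; exact: lag_split.
apply: filterS => w hw t /andP[t0 t1].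
set k := Num.truncn (n%:R * t); set bt := Num.truncn (M%:R * t).
rewrite -/(block_point R n M bt).
have MR : (0 : R) < M%:R by rewrite ltr0n.
have /andP[b1 b2] := truncn_itv (mulr_ge0 (ler0n R M) t0).
have kn : (k <= n)%N by rewrite -[leqRHS](@natrK R n); apply: le_truncn; rewrite ler_piMr.
have bk : (block_point R n M bt <= k)%N.
  by apply: le_truncn; rewrite ler_wpM2l// ler_pdivrMr// mulrC.
have U0 : 0 <= \sum_(j < J) U j w + c * \sum_(i < n) `|lag_rest J i w|.
  by rewrite addr_ge0 ?mulr_ge0 ?sumr_ge0// => j _; have [[]] := hU j.
have btM : (bt <= M)%N by rewrite -[leqRHS](@natrK R M); apply: le_truncn; rewrite ler_piMr.
rewrite -mulrBr (@big_cat_nat _ _ _ (block_point R n M bt) 0 k)//= addrAC subrr add0r.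
have [bM|Mb] := ltnP bt M; last first.
  have -> : block_point R n M bt = n by rewrite (_ : bt = M) ?block_pointM//; apply/eqP; rewrite eqn_leq btM Mb.
  by rewrite big_geq// mulr0 normr0.
have kb : (k <= block_point R n M bt.+1)%N.
  by apply: le_truncn; rewrite ler_wpM2l// ler_pdivlMr// mulrC ltW.
rewrite mulr_sumr (_ : \sum_(_ <= i < k) _ =
   \sum_(j < J) \sum_(block_point R n M bt <= i < k) lag_increment L m a D n j i w +
   c * \sum_(block_point R n M bt <= i < k) lag_rest J i w); last first.
  rewrite exchange_big/= mulr_sumr -big_split/=; apply: eq_big_nat => i /andP[_ ik].
  have iln : (i < n)%N by exact: leq_trans kn.
  by rewrite (hw (Ordinal iln)) mulrDr mulr_sumr.
apply: le_trans (ler_normD _ _) _; apply: lerD.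
  apply: le_trans (ler_norm_sum _ _ _) _; apply: ler_sum => j _.
  have [[_ _ h] _] := hU j; apply: (h w bt k bM).
  by rewrite bk kb.
rewrite normrM (ger0_norm c0) ler_wpM2l//; apply: le_trans (ler_norm_sum _ _ _) _.
rewrite -(big_mkord xpredT (fun i => `|lag_rest J i w|)) (@big_cat_nat _ _ _ (block_point R n M bt) 0 n)//=; last exact: leq_trans kn.
rewrite (@big_cat_nat _ _ _ k (block_point R n M bt) n)//=.
by rewrite addrCA lerDl addr_ge0// sumr_ge0.
Qed.

End fixed_step.

Hypothesis tG : tail_fun (tail_int a).
Local Notation sa := (fun s => Num.sqrt (a s)).
Hypothesis tsa : tail_fun sa.

(** A strip of width [D] at lag [j] has area at most [D * a (j * D)]. Sums over lags thereby become
    Riemann sums of [sqrt a]. *)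
Lemma sqrt_lag_mass_le (D : R) j : 0 < D -> Num.sqrt (D * lag_mass a D j) <= D * sa (j%:R * D).
Proof.
move=> D0; rewrite -[X in X * sa _](ger0_norm (ltW D0)) -sqrtr_sqr -sqrtrM ?sqr_ge0// ler_wsqrtr//.
rewrite expr2 -mulrA ler_pM2l//.
have h0 : 0 <= j%:R * D by rewrite mulr_ge0// ltW.
have h1 : j%:R * D <= j.+1%:R * D by rewrite ler_pM2r// ler_nat.
apply: le_trans (tail_int_ub (trawl_tail_fun Ha) h0 h1) _.
by rewrite -mulrBl -natr1 addrAC subrr add0r mul1r.
Qed.

Lemma sum_lag_le (D : R) J : 0 < D -> D <= 1 ->
  \sum_(j < J) Num.sqrt (D * lag_mass a D j) <= sa 0 + tail_int sa 0.
Proof.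
move=> D0 D1; have t0 := tail_int_ge0 tsa (lexx 0).
apply: (@le_trans _ _ (\sum_(j < J) D * sa (j%:R * D))).
  by apply: ler_sum => j _; exact: sqrt_lag_mass_le.
case: J => [|J]; first by rewrite big_ord0 addr_ge0// sqrtr_ge0.
rewrite big_ord_recl/= mul0r; apply: lerD; first by rewrite ler_piMl// sqrtr_ge0.
have := grid_sum_le tsa D0 J (lexx 0); apply: le_trans.
by apply: ler_sum => j _; rewrite add0r.
Qed.

(** Before [x0 + D] there are at most [(x0 + D) / D + 1] lags, and a light one weighs at most
    [sqrt (D * Lam / n) = D * eta]. Later lags are bounded by the tail of [sqrt a], whatever their
    mass. *)
Lemma sum_small_lag_le (D Lam x0 : R) (n J : nat) : 0 < D -> D <= 1 -> (0 < n)%N -> 0 < Lam -> 0 <= x0 ->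
  \sum_(j < J) (if n%:R * lag_mass a D j < Lam then Num.sqrt (D * lag_mass a D j) else 0) <=
  Num.sqrt (Lam / (n%:R * D)) * (x0 + 2) + tail_int sa x0.
Proof.
move=> D0 D1 n0 L0 x00; have N0 : (0 : R) < n%:R by rewrite ltr0n.
set eta := Num.sqrt (Lam / _); have e0 : 0 <= eta by exact: sqrtr_ge0.
apply: (@le_trans _ _ (\sum_(j < J) (D * eta * (if 0 <= j%:R * D < 0 + (x0 + D) then 1 else 0) +
    (if x0 + D <= j%:R * D then D * sa (j%:R * D) else 0)))).
  apply: ler_sum => j _; have j0 : 0 <= j%:R * D by rewrite mulr_ge0// ltW.
  rewrite j0 add0r /=; have [hj|hj] := leP (x0 + D) (j%:R * D).
    rewrite mulr0 add0r; case: ifP => _; first exact: sqrt_lag_mass_le.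
    by rewrite mulr_ge0 ?sqrtr_ge0// ltW.
  rewrite addr0 mulr1; case: ifPn => h; last by rewrite mulr_ge0// ltW.
  rewrite -[X in X * eta](ger0_norm (ltW D0)) -sqrtr_sqr -sqrtrM ?sqr_ge0// ler_wsqrtr//.
  have -> : D ^+ 2 * (Lam / (n%:R * D)) = D * (Lam / n%:R) by field; rewrite !gt_eqF.
  by rewrite ler_pM2l// ler_pdivlMr// mulrC ltW.
rewrite big_split/=; apply: lerD; last exact: grid_tail_sum.
have K0 : 0 <= x0 + D by rewrite addr_ge0// ltW.
rewrite -mulr_sumr; apply: le_trans (_ : D * eta * ((x0 + D) / D + 1) <= _).
  by rewrite ler_wpM2l ?mulr_ge0 ?(ltW D0)//; exact: count_window.
have -> : D * eta * ((x0 + D) / D + 1) = eta * (x0 + 2 * D) by field; rewrite gt_eqF.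
by rewrite ler_wpM2l//; lra.
Qed.

Context (Delta : nat -> R).
Hypothesis D0 : forall n, 0 < Delta n.
Hypothesis Dcvg : Delta n @[n --> \oo] --> (0 : R).
Hypothesis nD : n%:R * Delta n @[n --> \oo] --> +oo.

(** Order of choices: [delta], then the mass level [Lam] and the lag cutoff [x0], then the number of
    blocks [M], then [n], and last [J], which depends on [n]. Heavy lags cost a quarter of [e],
    light lags two, the rest one. *)
Lemma scaled_sum_tight e : 0 < e -> exists m0, forall M, (m0 < M)%N ->
  \forall n \near \oo, exists2 U : Om -> R, [/\ rintegrable P U, forall w, 0 <= U w &
    {ae P, forall w (t : R), 0 <= t <= 1 ->
      `|scaled_sum P L a Delta n t w - scaled_sum P L a Delta n ((Num.truncn (M%:R * t))%:R / M%:R) w| <= U w}] &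
    \int[P]_w U w <= e.
Proof.
move=> e0; have s0 := ce_s2_ge0 ce.
set W := sa 0 + tail_int sa 0.
have W0 : 0 <= W by rewrite addr_ge0 ?sqrtr_ge0// (tail_int_ge0 tsa).
pose delta := e / (12 * (W + 1)).
have d0 : 0 < delta by rewrite divr_gt0// mulr_gt0// ltr_wpDl.
have dW : 3 * delta * W <= e / 4.
  have -> : 3 * delta * W = e / 4 * (W / (W + 1)).
    by rewrite /delta; field; rewrite gt_eqF// ltr_wpDl.
  by rewrite ler_piMr ?divr_ge0 ?(ltW e0)// ler_pdivrMr ?ltr_wpDl// mul1r lerDl.
have d2 : 0 < delta ^+ 2 by rewrite exprn_gt0.
have [x xp xe] := ce_eps_0 ce (divr_gt0 d2 (ltr0n R 32)).
(* The solution of [6 / (delta * sqrt Lam) = x], so that the Lindeberg error of a heavy lag is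
   [eps x]. *)
pose Lam := (6 / (delta * x)) ^+ 2.
have sLp : 0 < 6 / (delta * x) by rewrite divr_gt0// mulr_gt0.
have Lp : 0 < Lam by rewrite exprn_gt0.
have he : eps (6 / (delta * Num.sqrt Lam)) <= delta ^+ 2 / 32.
  rewrite sqrtr_sqr gtr0_norm// (_ : 6 / _ = x) ?ltW//.
  by field; rewrite !gt_eqF.
have ssp : 0 < 8 * (Num.sqrt s2 + 1) by rewrite mulr_gt0// ltr_wpDl ?sqrtr_ge0.
have [x0 x00 hx0] := tail_int_cvg0 tsa (divr_gt0 e0 ssp).
pose A := 36 * s2 ^+ 2 / delta ^+ 2.
have A0 : 0 <= A by rewrite divr_ge0 ?(ltW d2)// mulr_ge0// sqr_ge0.
exists (Num.truncn (2 * A / delta ^+ 2)) => M hM.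
have M0 : (0 < M)%N by apply: leq_trans hM.
have MR : (0 : R) < M%:R by rewrite ltr0n.
have hAM : A / M%:R <= delta ^+ 2 / 2.
  have : 2 * A / delta ^+ 2 < M%:R by move: hM; rewrite truncn_lt_nat// divr_ge0 ?(ltW d2)// mulr_ge0.
  rewrite ltr_pdivrMr// => h; rewrite ler_pdivrMr//; lra.
have c1 : A * n%:R^-1 @[n --> \oo] --> (0 : R).
  by rewrite -[X in _ --> X](mulr0 A); apply: cvgM; [exact: cvg_cst|exact: cvg_invn].
have c2 : 2 * Num.sqrt s2 * (Num.sqrt (Lam / (n%:R * Delta n)) * (x0 + 2)) @[n --> \oo] --> (0 : R).
  have h : Num.sqrt (Lam / (n%:R * Delta n)) @[n --> \oo] --> (0 : R).
    have h0 : Lam / (n%:R * Delta n) @[n --> \oo] --> (0 : R).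
      by rewrite -[X in _ --> X](mulr0 Lam); apply: cvgM; [exact: cvg_cst|exact: cvg_invnD].
    by have := cvg_comp _ _ h0 (@sqrt_continuous R 0); rewrite sqrtr0.
  rewrite [X in _ --> X](_ : _ = 2 * Num.sqrt s2 * (0 * (x0 + 2))); last by rewrite mul0r mulr0.
  by apply: cvgM; [exact: cvg_cst|apply: cvgM => //; exact: cvg_cst].
have e4 : 0 < e / 4 by rewrite divr_gt0.
have d22 : 0 < delta ^+ 2 / 2 by rewrite divr_gt0.
move/cvgrPdist_le : c1 => /(_ _ d22) c1; move/cvgrPdist_le : c2 => /(_ _ e4) c2.
have c3 : \forall n \near \oo, Delta n <= 1.
  move/cvgrPdist_le : Dcvg => /(_ _ ltr01); apply: filterS => n.
  by rewrite sub0r normrN gtr0_norm.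
near=> n.
have n0 : (0 < n)%N by rewrite -(ltr0n R); near: n; exact: natr_gt0_near.
have h1 : A / n%:R <= delta ^+ 2 / 2.
  have : `|0 - A * n%:R^-1| <= delta ^+ 2 / 2 by near: n.
  by rewrite sub0r normrN; apply: le_trans; exact: ler_norm.
have h2 : 2 * Num.sqrt s2 * (Num.sqrt (Lam / (n%:R * Delta n)) * (x0 + 2)) <= e / 4.
  have : `|0 - 2 * Num.sqrt s2 * (Num.sqrt (Lam / (n%:R * Delta n)) * (x0 + 2))| <= e / 4 by near: n.
  by rewrite sub0r normrN; apply: le_trans; exact: ler_norm.
have h3 : Delta n <= 1 by near: n.
set c := Num.sqrt (Delta n / n%:R); have c0 : 0 <= c by exact: sqrtr_ge0.
(* The mean size allowed for each of the [n] rest terms, so that together, with the weight [c], they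
   stay below [e / 4]. *)
pose q := e / 4 / (c * n%:R + 1).
have cn1 : 0 < c * n%:R + 1 by rewrite ltr_wpDl// mulr_ge0.
have q0 : 0 < q by rewrite divr_gt0.
have s21 : 0 < s2 + 1 by rewrite ltr_wpDl.
have [y y0 hy] := tail_int_cvg0 (trawl_tail_fun Ha) (divr_gt0 (exprn_gt0 2 q0) s21).
pose J := (Num.truncn (y / Delta n)).+1.
have hJ : c * (n%:R * Num.sqrt (s2 * tail_int a (J%:R * Delta n))) <= e / 4.
  have yJ : y <= J%:R * Delta n.
    have /andP[_ h] := truncn_itv (divr_ge0 y0 (ltW (D0 n))).
    by rewrite -ler_pdivrMr// ltW.
  have hq : Num.sqrt (s2 * tail_int a (J%:R * Delta n)) <= q.
    rewrite -[leRHS]gtr0_norm// -sqrtr_sqr ler_wsqrtr//.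
    have h := le_lt_trans (tail_int_noninc (trawl_tail_fun Ha) y0 yJ) hy.
    apply: (@le_trans _ _ (s2 * (q ^+ 2 / (s2 + 1)))); first by rewrite ler_wpM2l// ltW.
    by rewrite mulrCA ler_piMr ?sqr_ge0// ler_pdivrMr// mul1r lerDl.
  rewrite mulrA; apply: (@le_trans _ _ (c * n%:R * q)); first by rewrite ler_wpM2l ?mulr_ge0.
  rewrite /q mulrCA ler_piMr ?(ltW e4)// ler_pdivrMr// mul1r lerDl//.
have hn : 36 * s2 ^+ 2 / delta ^+ 2 * (M%:R^-1 + n%:R^-1) <= delta ^+ 2.
  by rewrite -/A mulrDr; move: hAM h1; lra.
have [U hU hc] := oscillation_sum (D0 n) M0 J
  (fun j => lag_bound (D0 n) n0 M0 j d0 Lp he hn).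
exists U; first exact: hU.
apply: le_trans hc _; rewrite -/c big_split/= -mulr_sumr.
have i1 : 3 * delta * \sum_(j < J) Num.sqrt (Delta n * lag_mass a (Delta n) j) <= e / 4.
  apply: le_trans dW; apply: ler_wpM2l; first by rewrite mulr_ge0// ltW.
  exact: (sum_lag_le J (D0 n) h3).
have i2 : \sum_(j < J) (if n%:R * lag_mass a (Delta n) j < Lam
    then 2 * Num.sqrt s2 * Num.sqrt (Delta n * lag_mass a (Delta n) j) else 0) <= e / 4 + e / 4.
  have -> : \sum_(j < J) (if n%:R * lag_mass a (Delta n) j < Lam
      then 2 * Num.sqrt s2 * Num.sqrt (Delta n * lag_mass a (Delta n) j) else 0) =
    2 * Num.sqrt s2 * \sum_(j < J) (if n%:R * lag_mass a (Delta n) j < Lam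
      then Num.sqrt (Delta n * lag_mass a (Delta n) j) else 0).
    by rewrite mulr_sumr; apply: eq_bigr => j _; case: ifP => _; rewrite ?mulr0.
  apply: (@le_trans _ _ (2 * Num.sqrt s2 * (Num.sqrt (Lam / (n%:R * Delta n)) * (x0 + 2) + tail_int sa x0))).
    by rewrite ler_wpM2l ?mulr_ge0 ?sqrtr_ge0//; exact: sum_small_lag_le.
  rewrite mulrDr; apply: lerD => //.
  apply: (@le_trans _ _ (2 * Num.sqrt s2 * (e / (8 * (Num.sqrt s2 + 1))))).
    by rewrite ler_wpM2l ?mulr_ge0 ?sqrtr_ge0// ltW.
  have ss : 0 <= Num.sqrt s2 by exact: sqrtr_ge0.
  have -> : 2 * Num.sqrt s2 * (e / (8 * (Num.sqrt s2 + 1))) = e / 4 * (Num.sqrt s2 / (Num.sqrt s2 + 1)).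
    by field; rewrite gt_eqF// ltr_wpDl.
  by rewrite ler_piMr ?(ltW e4)// ler_pdivrMr ?ltr_wpDl// mul1r lerDl.
move: i1 i2 hJ; lra.
Unshelve. all: by end_near.
Qed.

End tightness.

(** * Convergence in law in the Skorokhod space *)

Section nonmeasurable_integrand.
Import HBNNSimple.
Context d (T : measurableType d) (R : realType) (P : probability T R).

(* Only [g] has to be measurable: the integral of a nonnegative function is a supremum
   over the simple functions below it, hence does not see a null set. *)
Let ae_eq_ge0_integral (f g : T -> \bar R) : (forall x, 0 <= f x)%E -> (forall x, 0 <= g x)%E ->
  measurable_fun setT g -> {ae P, forall x, f x = g x} ->
  (\int[P]_x f x = \int[P]_x g x)%E.
Proof.
move=> f0 g0 mg [A [mA PA sub]].
have fg x : ~ A x -> f x = g x by move=> nA; apply: contrapT => h; apply: nA; exact: sub.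
have mAC : measurable (~` A) by exact: measurableC.
have aeA : {ae P, forall x, ~ A x} by exists A; split => // x /= /contrapT.
apply/eqP; rewrite eq_le; apply/andP; split.
  rewrite ge0_integralTE//; apply: ub_ereal_sup => _ [h /= hf <-].
  rewrite -integralT_nnsfun.
  have mh : measurable_fun setT (EFin \o h) by apply/measurable_EFinP.
  have mhA : measurable_fun setT (fun x => (h x * \1_(~` A) x)%:E).
    by apply/measurable_EFinP; apply: measurable_funM => //; exact: measurable_indic.
  rewrite (@ae_eq_integral _ _ _ P setT (fun x => (h x * \1_(~` A) x)%:E) (EFin \o h))//; last first.
    by apply: filterS aeA => x nA _ /=; rewrite indicE mem_set// mulr1.
  apply: ge0_le_integral => //.
    by move=> x _; rewrite lee_fin mulr_ge0.
  move=> x _; rewrite indicE; have [Ax|nA] := pselect (A x).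
    by rewrite memNset ?mulr0//; move=> /(_ Ax).
  by rewrite mem_set// mulr1 -fg// hf.
pose g' x := (g x * (\1_(~` A) x)%:E)%E.
have mg' : measurable_fun setT g'.
  by apply: emeasurable_funM => //; apply/measurable_EFinP; exact: measurable_indic.
have g'0 x : (0 <= g' x)%E by rewrite mule_ge0// lee_fin.
have g'f x : (g' x <= f x)%E.
  rewrite /g' indicE; have [Ax|nA] := pselect (A x).
    by rewrite memNset ?mule0//; move=> /(_ Ax).
  by rewrite mem_set// mule1 fg.
rewrite (@ae_eq_integral _ _ _ P setT g' g)//; last first.
  by apply: filterS aeA => x nA _ /=; rewrite /g' indicE mem_set// mule1.
rewrite !ge0_integralTE//; apply: le_ereal_sup => _ [h /= hf <-].
by exists h => // x; exact: le_trans (hf x) (g'f x).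
Qed.

(** A functional of the limit process need not be measurable on the null set where the path is not
    continuous; this allows replacing the process by a version with all paths continuous. *)
Lemma ae_eq_Rint_nonmeas (f g : T -> R) : measurable_fun setT g ->
  {ae P, forall x, f x = g x} -> \int[P]_x f x = \int[P]_x g x.
Proof.
move=> mg fg; rewrite /Rintegral; congr fine.
have mEg : measurable_fun setT (EFin \o g) by apply/measurable_EFinP.
rewrite integralE [RHS]integralE; congr (_ - _)%E; apply: ae_eq_ge0_integral => //.
- exact: measurable_funepos.
- by apply: filterS fg => x; rewrite !funeposE => ->.
- exact: measurable_funeneg.
- by apply: filterS fg => x; rewrite !funenegE => ->.
Qed.

End nonmeasurable_integrand.

(** * Paths, the uniform distance and Lipschitz envelopes of functionals *)

Section cadlag_paths.
Context (R : realType).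
Implicit Types x y : R -> R.

Lemma cadlag_step (g : nat -> R) M : cadlag 1 (fun t : R => g (Num.truncn (M%:R * t))).
Proof.
have [->|M0] := posnP M.
  have -> : (fun t : R => g (Num.truncn (0%:R * t))) = fun=> g 0%N.
    by apply/funext => t; rewrite mul0r truncn0.
  split=> [t _|t _]; first exact: cvg_cst.
  exact: is_cvg_cst.
have MR : (0 : R) < M%:R by rewrite ltr0n.
split=> [t /andP[t0 t1]|t /andP[t0 t1]].
  have /andP[h1 h2] := truncn_itv (mulr_ge0 (ler0n R M) t0).
  have tk : t < (Num.truncn (M%:R * t)).+1%:R / M%:R by rewrite ltr_pdivlMr// mulrC.
  apply: cvg_near_cst; near=> s; congr g; apply/truncn_def/andP; split.
    by apply: le_trans h1 _; rewrite ler_wpM2l//; near: s; exact: nbhs_right_ge.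
  by rewrite mulrC -ltr_pdivlMr//; near: s; exact: nbhs_right_lt.
have Mt : 0 < M%:R * t by rewrite mulr_gt0.
(* The cell just before [t]: its index is one less than that of [t] when [M * t] is an integer. *)
have [k kt tk] : exists2 k : nat, k%:R < M%:R * t & M%:R * t <= k.+1%:R.
  have /andP[h1 h2] := truncn_itv (ltW Mt).
  move: h1; rewrite le_eqVlt => /predU1P[h1|h1]; last by exists (Num.truncn (M%:R * t)) => //; exact: ltW.
  move: h1; case: (Num.truncn _) => [h|k h]; first by rewrite -h ltxx in Mt.
  by exists k; rewrite -h// ltr_nat.
apply/cvg_ex; exists (g k); apply: cvg_near_cst; near=> s; congr g; apply/truncn_def/andP; split.
  by rewrite mulrC -ler_pdivrMr//; near: s; apply: nbhs_left_ge; rewrite ltr_pdivrMr// mulrC.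
apply: lt_le_trans tk; rewrite ltr_pM2l//; near: s; exact: nbhs_left_lt.
Unshelve. all: by end_near.
Qed.

Definition half_line_continuous x := forall t e : R, 0 <= t -> 0 < e ->
  exists2 delta, 0 < delta & forall s, 0 <= s -> `|t - s| < delta -> `|x t - x s| < e.

Lemma within_half_line x : {within `[0, +oo[, continuous x} -> half_line_continuous x.
Proof.
move=> /subspace_continuousP cx t e t0 e0.
have t0' : `[0, +oo[%classic t by rewrite /= in_itv/= t0.
have /cvgrPdist_lt /(_ _ e0) [del /= d0 hd] := cx t t0'.
exists del => // s s0 ts; apply: hd => //.
by rewrite /= in_itv/= s0.
Qed.

Lemma cadlag_continuous x : half_line_continuous x -> cadlag 1 x.
Proof.
move=> cx; split=> [t /andP[t0 _]|t /andP[t0 _]].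
  apply/cvgrPdist_lt => e e0; have [del d0 hd] := cx t e t0 e0.
  by exists del => //= s ts ts'; apply: hd => //; exact: le_trans (ltW ts').
apply/cvg_ex; exists (x t); apply/cvgrPdist_lt => e e0; have [del d0 hd] := cx t e (ltW t0) e0.
near=> s; apply: hd.
  by near: s; exact: nbhs_left_ge.
have st : s < t by near: s; exact: nbhs_left_lt.
rewrite ger0_norm ?subr_ge0 ?(ltW st)// ltrBlDr -ltrBlDl.
by near: s; apply: nbhs_left_gt; rewrite gtrBl.
Unshelve. all: by end_near.
Qed.

(** Compactness of [[0, 1]] in the form of near coverings: around each [t] the bound holds for
    nearby times and all large [M], because the sampled time is within [1 / M] of the true one. *)
Lemma half_line_uniform x e : half_line_continuous x -> 0 < e ->
  \forall M \near \oo, forall t, 0 <= t <= 1 -> `|x t - x ((Num.truncn (M%:R * t))%:R / M%:R)| <= e.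
Proof.
move=> cx e0.
have /compact_near_coveringP cc : compact `[0 : R, 1]%classic by exact: segment_compact.
have := cc nat \oo (fun M t => 0 <= t -> `|x t - x ((Num.truncn (M%:R * t))%:R / M%:R)| <= e).
move=> H; have {}H : \forall M \near \oo, `[0 : R, 1]%classic `<=`
    (fun t => 0 <= t -> `|x t - x ((Num.truncn (M%:R * t))%:R / M%:R)| <= e).
  apply: H => t /=; rewrite in_itv/= => /andP[t0 _].
  have e2 : 0 < e / 2 by rewrite divr_gt0.
  have [del d0 hd] := cx t _ t0 e2.
  have d2 : 0 < del / 2 by rewrite divr_gt0.
  exists (ball t (del / 2), [set M | (0 < M)%N /\ (M%:R : R)^-1 < del / 2]).
    split; first exact: nbhsx_ballx.
    have /cvgrPdist_lt /(_ _ d2) h := @cvg_invn R.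
    near=> M; split; first by rewrite -(ltr0n R); near: M; exact: natr_gt0_near.
    have : `|0 - (M%:R : R)^-1| < del / 2 by near: M.
    by rewrite sub0r normrN; apply: le_lt_trans; exact: ler_norm.
  move=> [s M] /= [ts [M0 hM]] s0.
  have MR : (0 : R) < M%:R by rewrite ltr0n.
  have /andP[b1 b2] := truncn_itv (mulr_ge0 (ler0n R M) s0).
  set r := _ / _; have r0 : 0 <= r by rewrite divr_ge0.
  have rs : r <= s by rewrite ler_pdivrMr// [leRHS]mulrC.
  have sr : s < r + M%:R^-1 by rewrite /r -[X in _ + X]mul1r -mulrDl natr1 ltr_pdivlMr// mulrC.
  have h1 := hd s s0 (lt_trans ts _); have h2 := hd r r0 _.
  have {}h1 : `|x t - x s| < e / 2 by apply: h1; lra.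
  have {}h2 : `|x t - x r| < e / 2.
    apply: h2; apply: (@le_lt_trans _ _ (`|t - s| + `|s - r|)).
      by rewrite (_ : t - r = (t - s) + (s - r)) ?ler_normD//; ring.
    rewrite (ger0_norm (x := s - r)) ?subr_ge0//.
    move: (ts : `|t - s| < del / 2) sr hM; lra.
  rewrite (_ : x s - x r = (x t - x r) - (x t - x s)); last by ring.
  apply: le_trans (ler_normB _ _) _; lra.
apply: filterS H => M hM t t01; apply: hM; first by rewrite /= in_itv.
by have /andP[] := t01.
Unshelve. all: by end_near.
Qed.

Lemma skorokhod_dist_le x y e : 0 < e -> (forall t, 0 <= t <= 1 -> `|x t - y t| <= e) ->
  skorokhod_dist 1 x y <= e.
Proof.
move=> e0 xy; apply: ge_inf; first by exists 0 => z [/ltW].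
split => //; exists id; split; last by move=> t t01; rewrite subrr normr0 ltW// xy.
split; first by move=> s t _ _.
  by apply: continuous_subspaceT => t; exact: cvg_id.
by rewrite image_id.
Qed.

Section functional.
Context (F : (R -> R) -> R) (M : R).
Hypothesis cF : skorokhod_continuous 1 F.
Hypothesis FM : forall x, cadlag 1 x -> `|F x| <= M.

(* A path [x] that is not cadlag is unconstrained, so that some [y] is always near it. *)
Let near_path x y (e : R) := [/\ cadlag 1 y, 0 <= e &
  cadlag 1 x -> forall t, 0 <= t <= 1 -> `|x t - y t| <= e].

Let near_ge0 x y e : near_path x y e -> 0 <= e. Proof. by case. Qed.

Let cadlag0 : cadlag 1 (fun=> 0 : R). Proof. exact: (cadlag_step (fun=> 0) 0). Qed.

Let near_refl x : cadlag 1 x -> near_path x x 0.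
Proof. by move=> cx; split => // _ t _; rewrite subrr normr0. Qed.

Let near_ex x : exists y e, near_path x y e.
Proof.
have [cx|nx] := pselect (cadlag 1 x); first by exists x, 0; exact: near_refl.
by exists (fun=> 0), 0; split.
Qed.

Let near_bound x y e : near_path x y e -> `|F y| <= M. Proof. by case=> cy _ _; exact: FM. Qed.

Definition lip_approx (j : nat) x := inf_conv near_path F M j%:R x.

Lemma lip_approx_bound j x : `|lip_approx j x| <= M.
Proof. exact: (inf_conv_bound near_ge0 near_ex near_bound). Qed.

Lemma lip_approx_le j x : cadlag 1 x -> lip_approx j x <= F x.
Proof.
move=> cx; have := inf_conv_le near_ge0 near_bound (ler0n R j) (near_refl cx).
by rewrite mulr0 addr0.
Qed.

Lemma lip_approx_lip j x y c : cadlag 1 x -> cadlag 1 y -> 0 <= c ->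
  (forall t, 0 <= t <= 1 -> `|x t - y t| <= c) -> `|lip_approx j x - lip_approx j y| <= j%:R * c.
Proof.
move=> cx cy c0 xy.
have h u v : cadlag 1 u -> cadlag 1 v -> (forall t, 0 <= t <= 1 -> `|u t - v t| <= c) ->
    lip_approx j u <= lip_approx j v + j%:R * c.
  move=> cu cv uv; apply: (inf_conv_lip near_ge0 near_ex near_bound) => // z e [cz e0 vz].
  split => //; first exact: addr_ge0.
  move=> _ t t01; rewrite (_ : u t - z t = (u t - v t) + (v t - z t)); last by ring.
  by apply: le_trans (ler_normD _ _) _; rewrite addrC lerD ?uv ?vz.
have h1 := h x y cx cy xy; have h2 : lip_approx j y <= lip_approx j x + j%:R * c.
  by apply: h => // t t01; rewrite distrC xy.
move: h1 h2; move: (lip_approx j x) (lip_approx j y) (j%:R * c) => p q r h1 h2.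
by rewrite ler_norml; apply/andP; split; lra.
Qed.

Lemma lip_approx_cvg x : cadlag 1 x -> lip_approx j x @[j --> \oo] --> F x.
Proof.
move=> cx; apply: (inf_conv_cvg near_ge0 near_ex near_bound (near_refl cx)) => e e0.
have [del d0 hd] := cF cx e0; exists (del / 2); first by rewrite divr_gt0.
move=> y c [cy c0 xy] cd.
have : skorokhod_dist 1 x y < del.
  apply: (@le_lt_trans _ _ (del / 2)); last lra.
  apply: skorokhod_dist_le; first by rewrite divr_gt0.
  by move=> t t01; apply: le_trans (ltW cd); exact: xy.
by move=> /(hd y cy); rewrite ltr_norml => /andP[_]; lra.
Qed.

(** Rebuilds a path from [N + 1] samples; composing with it turns a functional of paths into a
    function of a vector, to which the finite-dimensional limit applies. *)
Definition step_path N (v : 'rV[R]_N.+1) (t : R) : R := v 0 (inord (Num.truncn (N%:R * t))).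

Lemma cadlag_step_path N (v : 'rV[R]_N.+1) : cadlag 1 (step_path v).
Proof. exact: (cadlag_step (fun k => v 0 (inord k))). Qed.

Lemma step_path_sample N x t : 0 <= t <= 1 ->
  step_path (\row_(i < N.+1) x (i%:R / N%:R)) t = x ((Num.truncn (N%:R * t))%:R / N%:R).
Proof.
move=> /andP[t0 t1]; rewrite /step_path mxE inordK// ltnS.
by rewrite -[leqRHS](@natrK R N); apply: le_truncn; rewrite ler_piMr.
Qed.

Lemma lip_step_path j N : lip_sum j%:R (fun v : 'rV[R]_N.+1 => lip_approx j (step_path v)).
Proof.
move=> u v; apply: lip_approx_lip; [exact: cadlag_step_path|exact: cadlag_step_path| |].
  by apply: sumr_ge0 => i _.
move=> t _; rewrite /step_path (bigD1 (inord (Num.truncn (N%:R * t))))//=.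
by rewrite lerDl sumr_ge0.
Qed.

End functional.
End cadlag_paths.

Section skorokhod_convergence.
Context d (Om : measurableType d) d' (Om' : measurableType d') (R : realType).
Context (P : probability Om R) (P' : probability Om' R).
Context (Xn : nat -> R -> Om -> R) (X : R -> Om' -> R).
Hypothesis mXn : forall n t, 0 <= t <= 1 -> measurable_fun setT (Xn n t).
Hypothesis mX : forall t, 0 <= t <= 1 -> measurable_fun setT (X t).
Hypothesis Xn_step : forall n w, exists g : nat -> R, forall t, Xn n t w = g (Num.truncn (n%:R * t)).
Hypothesis fdd : forall N (g : 'rV[R]_N.+1 -> R) Lam M, 0 <= Lam -> lip_sum Lam g ->
  (forall v, `|g v| <= M) ->
  \int[P]_w g (\row_i Xn n (i%:R / N%:R) w) @[n --> \oo] --> \int[P']_w g (\row_i X (i%:R / N%:R) w).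
Hypothesis tight : forall e : R, 0 < e -> exists m0, forall N, (m0 < N)%N ->
  \forall n \near \oo, exists2 U : Om -> R, [/\ rintegrable P U, forall w, 0 <= U w &
    {ae P, forall w (t : R), 0 <= t <= 1 ->
      `|Xn n t w - Xn n ((Num.truncn (N%:R * t))%:R / N%:R) w| <= U w}] &
    \int[P]_w U w <= e.
Hypothesis X_continuous : {ae P', forall w, half_line_continuous (fun t => X t w)}.

Section lower_bound.
Context (F : (R -> R) -> R) (M : R).
Hypothesis cF : skorokhod_continuous 1 F.
Hypothesis FM : forall x, cadlag 1 x -> `|F x| <= M.

Local Notation H := (lip_approx F M).
Local Notation sample N x := (\row_(i < N.+1) x (i%:R / N%:R)).

Let grid01 N (i : 'I_N.+1) : 0 <= (i%:R / N%:R : R) <= 1.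
Proof.
rewrite divr_ge0//=; have [N0|N0] := posnP N; last by rewrite ler_pdivrMr ?ltr0n// mul1r ler_nat -ltnS.
by rewrite [X in _ / X%:R]N0 invr0 mulr0.
Qed.

Let H_measurable d0 (T : measurableType d0) j N (Z : R -> T -> R) :
  (forall t, 0 <= t <= 1 -> measurable_fun setT (Z t)) ->
  measurable_fun setT (fun w => H j (step_path (\row_(i < N.+1) Z (i%:R / N%:R) w))).
Proof.
move=> mZ; apply: (lip_measurable _ (ler0n R j) (lip_step_path FM j (N := N))) => [i|v].
  rewrite (_ : (fun w => _) = Z (i%:R / N%:R)); first exact/mZ/grid01.
  by apply/funext => w; rewrite mxE.
exact: lip_approx_bound.
Qed.

Let H_rintegrable d0 (T : measurableType d0) (Q : probability T R) j N (Z : R -> T -> R) :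
  (forall t, 0 <= t <= 1 -> measurable_fun setT (Z t)) ->
  rintegrable Q (fun w => H j (step_path (\row_(i < N.+1) Z (i%:R / N%:R) w))).
Proof.
move=> mZ; apply: (@bounded_rintegrable _ _ _ Q _ M); first exact: H_measurable.
by move=> w; exact: lip_approx_bound.
Qed.

Let H_sample_close j N x (c : R) : cadlag 1 x -> 0 <= c ->
  (forall t, 0 <= t <= 1 -> `|x t - x ((Num.truncn (N%:R * t))%:R / N%:R)| <= c) ->
  `|H j x - H j (step_path (sample N x))| <= j%:R * c.
Proof.
move=> cx c0 hx; apply: (lip_approx_lip FM j cx (@cadlag_step_path _ _ _) c0) => t t01.
by rewrite step_path_sample// hx.
Qed.

Let cadlag_Xn n w : cadlag 1 (fun t => Xn n t w).
Proof. by have [g hg] := Xn_step n w; rewrite (funext hg); exact: cadlag_step. Qed.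

(** The path is constant on cells of length [1 / n], so sampling at that mesh loses nothing.
    Measurability of [H j] along [Xn n] reduces to finitely many coordinates. *)
Let H_Xn j n w : (0 < n)%N -> H j (fun t => Xn n t w) = H j (step_path (sample n (fun t => Xn n t w))).
Proof.
move=> n0; apply/eqP; rewrite -subr_eq0 -normr_le0 -(mulr0 j%:R).
apply: H_sample_close => // t /andP[t0 t1]; have [g hg] := Xn_step n w.
by rewrite !hg [n%:R * (_ / _)]mulrC divfK ?gt_eqF ?ltr0n// natrK subrr normr0.
Qed.

Let cst_bound d0 (T : measurableType d0) (Q : probability T R) (h : nat -> T -> R) (f : T -> R) :
  (forall n, measurable_fun setT (h n)) -> (forall n w, `|h n w| <= M) ->
  (forall w, h n w @[n --> \oo] --> f w) ->
  rintegrable Q f /\ \int[Q]_w h n w @[n --> \oo] --> \int[Q]_w f w.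
Proof.
by move=> mh hM hf; apply: (cvg_RintD mh (rintegrable_cst Q M) hM).
Qed.

Let H_Xn_rintegrable j n : (0 < n)%N -> rintegrable P (fun w => H j (fun t => Xn n t w)).
Proof.
move=> n0; under eq_fun do rewrite H_Xn//; apply: (@H_rintegrable _ _ P j n (Xn n)).
by move=> t; exact: mXn.
Qed.

Lemma F_Xn_rintegrable n : (0 < n)%N -> rintegrable P (fun w => F (fun t => Xn n t w)).
Proof.
move=> n0; apply: (@cst_bound _ _ P (fun j w => H j (fun t => Xn n t w)) _ _ _ _).1.
- by move=> j; exact: rintegrable_measurable (H_Xn_rintegrable j n0).
- by move=> j w; exact: lip_approx_bound.
- by move=> w; apply: lip_approx_cvg => //; exact: cadlag_Xn.
Qed.

(** The process is set to 0 on a null set that contains every discontinuous path. *)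
Lemma skorokhod_regular_version : exists X' : R -> Om' -> R,
  [/\ forall t, 0 <= t <= 1 -> measurable_fun setT (X' t),
      forall w, half_line_continuous (fun t => X' t w) &
      {ae P', forall w, forall t, X' t w = X t w}].
Proof.
have [A [mA PA sub]] := X_continuous.
exists (fun t w => X t w * \1_(~` A) w); split.
- move=> t t01; apply: measurable_funM; first exact: mX.
  by apply: measurable_indic; exact: measurableC.
- move=> w; have [Aw|nA] := pselect (A w).
    rewrite (_ : (fun t => _) = fun=> 0).
      by move=> t e _ e0; exists 1 => // s _ _; rewrite subrr normr0.
    by apply/funext => t; rewrite indicE memNset ?mulr0// => /(_ Aw).
  rewrite (_ : (fun t => _) = fun t => X t w).
    by apply: contrapT => h; apply: nA; exact: sub.
  by apply/funext => t; rewrite indicE mem_set// mulr1.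
- exists A; split => // w /= h; apply: contrapT => nA; apply: h => t.
  by rewrite indicE mem_set// mulr1.
Qed.

Lemma limit_functional X' : (forall t, 0 <= t <= 1 -> measurable_fun setT (X' t)) ->
  (forall w, half_line_continuous (fun t => X' t w)) ->
  (forall j, \int[P']_w H j (step_path (\row_(i < N.+1) X' (i%:R / N%:R) w)) @[N --> \oo]
      --> \int[P']_w H j (fun t => X' t w)) /\
  rintegrable P' (fun w => F (fun t => X' t w)) /\
  \int[P']_w H j (fun t => X' t w) @[j --> \oo] --> \int[P']_w F (fun t => X' t w).
Proof.
move=> mX' cX'; have cad w := cadlag_continuous (cX' w).
have hH j : rintegrable P' (fun w => H j (fun t => X' t w)) /\
    \int[P']_w H j (step_path (\row_(i < N.+1) X' (i%:R / N%:R) w)) @[N --> \oo]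
    --> \int[P']_w H j (fun t => X' t w).
{ apply: cst_bound => [N|N w|w].
  - exact: H_measurable.
  - exact: lip_approx_bound.
  - apply/cvgrPdist_le => r r0; have j1 : (0 : R) < j%:R + 1 by rewrite ltr_wpDl.
    have rj : 0 < r / (j%:R + 1) by rewrite divr_gt0.
    have := half_line_uniform (cX' w) rj; apply: filterS => N hN.
    apply: le_trans (H_sample_close j (cad w) (ltW rj) hN) _.
    by rewrite mulrCA ler_piMr ?(ltW r0)// ler_pdivrMr// mul1r lerDl. }
split; first by move=> j; have [] := hH j.
apply: cst_bound => [j|j w|w].
- by have [h _] := hH j; exact: rintegrable_measurable h.
- exact: lip_approx_bound.
- exact: lip_approx_cvg.
Qed.

(** Four errors of [e / 4]: the envelope index [j] is fixed first, then the mesh [N] by continuity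
    of the limit and tightness, then [n] by the finite-dimensional limit and tightness. The
    comparison [H j <= F] along [Xn] is one-sided, hence only a lower bound. *)
Lemma skorokhod_lower_bound e : 0 < e ->
  \forall n \near \oo, \int[P']_w F (fun t => X t w) - e <= \int[P]_w F (fun t => Xn n t w).
Proof.
move=> e0; have [X' [mX' cX' aeX]] := skorokhod_regular_version.
have [cH [iF cFX]] := limit_functional mX' cX'.
have -> : \int[P']_w F (fun t => X t w) = \int[P']_w F (fun t => X' t w).
  apply: ae_eq_Rint_nonmeas; first exact: rintegrable_measurable iF.
  by apply: filterS aeX => w h; congr F; apply/funext => t; rewrite h.
have e4 : 0 < e / 4 by rewrite divr_gt0.
have [j hj] : exists j, \int[P']_w F (fun t => X' t w) - e / 4 <= \int[P']_w H j (fun t => X' t w).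
  move/cvgrPdist_le : cFX => /(_ _ e4) [j _ hj]; exists j.
  by have := hj j (leqnn j); rewrite ler_norml => /andP[_]; lra.
have j1 : (0 : R) < j%:R + 1 by rewrite ltr_wpDl.
(* [H j] has Lipschitz constant [j], so a mean oscillation of this size costs at most [e / 4]. *)
have ej : 0 < e / 4 / (j%:R + 1) by rewrite divr_gt0.
have [m0 hm0] := tight ej.
have [N mN hN] : exists2 N, (m0 < N)%N & \int[P']_w H j (fun t => X' t w) - e / 4 <=
    \int[P']_w H j (step_path (\row_(i < N.+1) X (i%:R / N%:R) w)).
  move/cvgrPdist_le : (cH j) => /(_ _ e4) [N0 _ hN]; exists (maxn N0 m0.+1).
    exact: leq_maxr.
  rewrite (_ : \int[P']_w H j (step_path (\row_i X _ w)) =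
     \int[P']_w H j (step_path (\row_(i < (maxn N0 m0.+1).+1) X' (i%:R / (maxn N0 m0.+1)%:R) w))).
    by have := hN (maxn N0 m0.+1) (leq_maxl _ _); rewrite ler_norml lerBlDr -lerBlDl => /andP[].
  apply: ae_eq_Rint; [exact: H_measurable|exact: H_measurable|].
  by apply: filterS aeX => w h; congr (H j (step_path _)); apply/rowP => i; rewrite !mxE h.
have := fdd (ler0n R j) (lip_step_path FM j (N := N)) (fun v => lip_approx_bound FM j _).
move/cvgrPdist_le => /(_ _ e4) hfdd.
have htight := hm0 N mN.
near=> n.
have n0 : (0 < n)%N by rewrite -(ltr0n R); near: n; exact: natr_gt0_near.
have h1 : `|\int[P']_w H j (step_path (\row_(i < N.+1) X (i%:R / N%:R) w)) -
    \int[P]_w H j (step_path (\row_(i < N.+1) Xn n (i%:R / N%:R) w))| <= e / 4 by near: n.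
have [U [iU U0 [A [mA PA sub]]] hU] : exists2 U : Om -> R, [/\ rintegrable P U, forall w, 0 <= U w &
    {ae P, forall w (t : R), 0 <= t <= 1 ->
      `|Xn n t w - Xn n ((Num.truncn (N%:R * t))%:R / N%:R) w| <= U w}] &
    \int[P]_w U w <= e / 4 / (j%:R + 1) by near: n.
have iHn := H_Xn_rintegrable j n0.
have iA : rintegrable P (\1_A : Om -> R).
  by apply: (@bounded_rintegrable _ _ _ P _ 1) => [|w]; [exact: measurable_indic|rewrite indicE; case: (_ \in _); rewrite ?normr1 ?normr0].
have M0 : 0 <= M by apply: le_trans (FM (cadlag_Xn n point)).
have h2 : `|\int[P]_w H j (fun t => Xn n t w) -
    \int[P]_w H j (step_path (\row_(i < N.+1) Xn n (i%:R / N%:R) w))| <= e / 4.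
  apply: (@le_trans _ _ (\int[P]_w (j%:R * U w + 2 * M * \1_A w))).
    have iG : rintegrable P (fun w => H j (step_path (\row_(i < N.+1) Xn n (i%:R / N%:R) w))).
      exact: (@H_rintegrable _ _ P j N (Xn n) (mXn n)).
    apply: (ler_norm_RintB iHn iG); first by apply: rintegrableD; exact: rintegrableZ.
    move=> w; have [Aw|nA] := pselect (A w).
      rewrite indicE mem_set// mulr1; apply: le_trans (ler_normB _ _) _.
      have b1 := lip_approx_bound FM j (fun t => Xn n t w).
      have b2 := lip_approx_bound FM j (step_path (\row_(i < N.+1) Xn n (i%:R / N%:R) w)).
      apply: le_trans (lerD b1 b2) _.
      by rewrite -[M + M]mulr2n -[M *+ 2]mulr_natl lerDr mulr_ge0.
    rewrite indicE memNset// mulr0 addr0; apply: (H_sample_close j (cadlag_Xn n w) (U0 w)).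
    by apply: contrapT => h; apply: nA; apply: sub => /= h'; apply: h.
  rewrite (RintD (rintegrableZ _ iU) (rintegrableZ _ iA)) (RintZ _ iU) (RintZ _ iA).
  rewrite Rint_indic// PA mulr0 addr0.
  apply: (@le_trans _ _ (j%:R * (e / 4 / (j%:R + 1)))); first by rewrite ler_wpM2l.
  by rewrite mulrCA ler_piMr ?(ltW e4)// ler_pdivrMr// mul1r lerDl.
have h3 : \int[P]_w H j (fun t => Xn n t w) <= \int[P]_w F (fun t => Xn n t w).
  apply: ler_Rint => //; first exact: F_Xn_rintegrable.
  by move=> w; exact: lip_approx_le.
move: h1 h2 h3 hj hN; rewrite !ler_norml => /andP[_ h1] /andP[h2 _] h3 h4 h5.
move: (\int[P']_w F _) (\int[P]_w F _) (\int[P']_w H j (fun t => _)) (\int[P]_w H j (fun t => _)) h1 h2 h3 h4 h5 => a b c f.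
move: (\int[P']_w _) (\int[P]_w _) => g h; lra.
Unshelve. all: by end_near.
Qed.

End lower_bound.

Lemma cvg_law_skorokhod_of_tight : cvg_law_skorokhod P P' 1 Xn X.
Proof.
move=> F cF [M FM].
have cN : skorokhod_continuous 1 (fun x => - F x).
  move=> x cx e e0; have [del d0 hd] := cF x cx e e0; exists del => // y cy xy.
  by rewrite -opprD normrN; exact: hd.
have NM x : cadlag 1 x -> `|- F x| <= M by rewrite normrN; exact: FM.
have [X' [mX' cX' aeX]] := skorokhod_regular_version.
apply/cvgrPdist_le => e e0.
have h1 := skorokhod_lower_bound cF FM e0; have h2 := skorokhod_lower_bound cN NM e0.
near=> n.
have n0 : (0 < n)%N by rewrite -(ltr0n R); near: n; exact: natr_gt0_near.
have h3 : \int[P']_w F (fun t => X t w) - e <= \int[P]_w F (fun t => Xn n t w) by near: n.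
have h4 : \int[P']_w (- F (fun t => X t w)) - e <= \int[P]_w (- F (fun t => Xn n t w)) by near: n.
rewrite (RintN (F_Xn_rintegrable cF FM n0)) in h4.
have NX : \int[P']_w (- F (fun t => X t w)) = - \int[P']_w F (fun t => X t w).
  have [_ [iF _]] := limit_functional cF FM mX' cX'.
  have E : {ae P', forall w, F (fun t => X t w) = F (fun t => X' t w)}.
    by apply: filterS aeX => w h; congr F; apply/funext => t; rewrite h.
  rewrite (ae_eq_Rint_nonmeas (rintegrable_measurable iF) E) -(RintN iF).
  apply: ae_eq_Rint_nonmeas; first exact: rintegrable_measurable (rintegrableN iF).
  by apply: filterS E => w ->.
rewrite NX in h4; rewrite ler_norml; apply/andP; split; lra.
Unshelve. all: by end_near.
Qed.

End skorokhod_convergence.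

Theorem theorem2 (R : realType)
  (d : measure_display) (Om : measurableType d) (P : probability Om R)
  (HP : measure_is_complete P)
  (gamma b : R) (nu : {measure set R -> \bar R})
  (L : set (R * R) -> Om -> R) (HL : levy_basis P L gamma b nu)
  (L' : {RV P >-> R}) (HL' : levy_seed L' gamma b nu)
  (a : R -> R) (Ha : trawl_function a)
  (Delta : nat -> R)
  (HDelta_gt0 : forall n, 0 < Delta n)
  (HDelta_nonincr : nonincreasing_seq Delta)
  (HDelta_0 : Delta n @[n --> \oo] --> (0 : R))
  (HnDelta : n%:R * Delta n @[n --> \oo] --> +oo)
  (p0 : R) (Hp0 : 2 < p0)
  (HL'p0 : ('E_P[fun w => (`|L' w| `^ p0)%R] < +oo)%E)
  (Hap0 : exists C : R, \forall s \near +oo_R, `|a s| <= C * s `^ (- p0)) :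
  let X := trawl_process L a in
  let GX := sigma_field_X X Delta in
  let Gamma_X := trawl_acov L' a in
  let sigma_a := Num.sqrt (\int[@lebesgue_measure R]_s Gamma_X s) in
  (forall t h : R, covariance P (X t) (X (t + h)) = (Gamma_X h)%:E) /\
  forall (d' : measure_display) (Om' : measurableType d')
    (P' : probability Om' R) (pi : Om' -> Om) (B : R -> Om' -> R),
    prob_extension P P' pi ->
    brownian_motion P' B ->
    independent_of_field P' pi GX B ->
    cvg_stably_skorokhod P P' pi GX 1
      (fun n t w => Num.sqrt (Delta n / n%:R) * partial_sum P X Delta n t w)
      (fun t w => sigma_a * B t w).
Proof.
move=> X GX Gamma_X sigma_a.
have [m [s2 [eps [ce varL]]]] := seed_expansion (levy_basis_nu HL) HL' (seed_sqintegrable Hp0 HL'p0).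
have GammaE h : Gamma_X h = s2 * tail_int a `|h| by rewrite /Gamma_X /trawl_acov varL.
have [C hC] := Hap0.
have tG := tail_int_tail_fun Ha Hp0 hC.
have tsa := sqrt_tail_fun Ha Hp0 hC.
have sigmaE : sigma_a = Num.sqrt (asymptotic_var s2 a).
  congr Num.sqrt; rewrite (funext GammaE); exact: integral_acov.
split; first by move=> t h; rewrite GammaE (trawl_covariance HL ce Ha).
move=> d' Om' P' pi B Hpi HB Hind; rewrite sigmaE; split; last first.
  by move=> k ts ts01; exact: (scaled_sum_cvg_stably HL ce Ha tG HDelta_gt0 HDelta_0 HnDelta Hpi HB Hind).
apply: (@cvg_law_skorokhod_of_tight _ _ _ _ _ P P' (fun n => scaled_sum P L a Delta n)).
- by move=> n t t01; have [] := scaled_sum_sqintegrable HL ce Ha Delta n t01.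
- by move=> t /andP[t0 _]; apply: measurable_funM => //; exact: (bm_measurable HB).
- by move=> n w; exists (fun k => Num.sqrt (Delta n / n%:R) *
    \sum_(0 <= i < k) (X (i%:R * Delta n) w - fine 'E_P[X (i%:R * Delta n)%R]%E)).
- move=> N g Lam M L0 gL gM.
  apply: (scaled_sum_cvg_lip HL ce Ha tG HDelta_gt0 HDelta_0 HnDelta Hpi HB Hind _ L0 gL gM).
  (* For [N = 0] the quotient takes the default value 0, which still lies in [[0, 1]]. *)
  move=> i; rewrite divr_ge0//=; have [N0|N0] := posnP N; last by rewrite ler_pdivrMr ?ltr0n// mul1r ler_nat -ltnS.
  by rewrite [X in _ / X%:R]N0 invr0 mulr0.
- exact: (scaled_sum_tight HL ce Ha tsa HDelta_gt0 HDelta_0 HnDelta).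
- move: (bm_continuous HB); apply: filterS => w /within_half_line cB t e t0 e0.
  set s := Num.sqrt _; have s1 : 0 < s + 1 by rewrite ltr_wpDl// sqrtr_ge0.
  have [del d0 hd] := cB t (e / (s + 1)) t0 (divr_gt0 e0 s1).
  exists del => // r r0 tr; rewrite -mulrBr normrM ger0_norm ?sqrtr_ge0//.
  have := hd r r0 tr; rewrite ltr_pdivlMr// mulrDr mulr1 mulrC.
  by apply: le_lt_trans; rewrite [leRHS]addrC lerDr.
Qed.
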